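(* Let $U\subset\mathbb{C}^d$ be a non-empty connected open set, and let $\omega:U\to(0,\infty)$ be a Borel function such that $\operatorname{essinf}_{z\in B}\omega(z)>0$ for every relatively compact subset $B\subset U$ of positive Lebesgue measure, and such that the weighted Bergman space $A^2(U,\omega)$ is not $\{0\}$. Let $K_\omega$ be the reproducing kernel of $A^2(U,\omega)$ and let $\mathbb{P}_{K_\omega}$ be the determinantal point process on $U$ induced by $K_\omega$. If there exists a non-constant bounded holomorphic function on $U$, then for every integer $\ell\ge 1$ and every $\ell$-tuple $\mathfrak{p}=(p_1,\dots,p_\ell)$ of distinct points of $U$ for which the reduced Palm measure $\mathbb{P}_{K_\omega}^{\mathfrak{p}}$ is defined (that is, $\det[K_\omega(p_i,p_j)]_{1\le i,j\le \ell}\neq 0$), the measures $\mathbb{P}_{K_\omega}$ and $\mathbb{P}_{K_\omega}^{\mathfrak{p}}$ are equivalent, i.e. mutually absolutely continuous.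
   Context: $V$ is Lebesgue measure on $\mathbb{C}^d$, and $A^2(U,\omega)$ is the space of holomorphic $f:U\to\mathbb{C}$ with $\int_U|f|^2\omega\,dV<\infty$. Under the assumption on $\omega$ it is a closed subspace of $L^2(U,\omega\, dV)$ with continuous point evaluations; $K_\omega(z,w)$ is its reproducing kernel, and the same symbol denotes the orthogonal projection of $L^2(U,\omega\,dV)$ onto $A^2(U,\omega)$, which is locally of trace class. A configuration on $U$ is a locally finite collection of points of $U$; $\mathrm{Conf}(U)$ is the space of configurations with the smallest sigma-algebra making all maps $\mathfrak{X}\mapsto\#(\mathfrak{X}\cap B)$, $B$ relatively compact Borel, measurable. A point process on $U$ is a probability measure on $\mathrm{Conf}(U)$. The determinantal point process $\mathbb{P}_K$ induced by a locally trace class positive contraction $K$ on $L^2(U,\mu)$ is the unique simple (multiplicity-free) point process whose $l$-th correlation measure is $\det(K(x_i,x_j))_{1\le i,j\le l}\,\mu(dx_1)\cdots\mu(dx_l)$ for every $l\ge1$; here $\mu=\omega\, dV$. Reduced Palm measures: for distinct $p_1,\dots,p_\ell$ with $\det[K_\omega(p_i,p_j)]_{1\le i,j\le\ell}\ne0$, the reduced Palm measure $\mathbb{P}_{K_\omega}^{\mathfrak{p}}$ (of order $\ell$; informally the law of the configuration minus $\{p_1,\dots,p_\ell\}$, conditioned to contain $p_1,\dots,p_\ell$) is the determinantal point process induced by the kernel $$K_\omega^{\mathfrak{p}}(z,w)=\frac{\det[K_\omega(p_i,q_j)]_{0\le i,j\le\ell}}{\det[K_\omega(p_i,p_j)]_{1\le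 i,j\le\ell}},\qquad p_0=z,\ q_0=w,\ q_i=p_i\ (1\le i\le \ell),$$ which is the kernel of the orthogonal projection of $L^2(U,\omega\, dV)$ onto $\{\varphi\in A^2(U,\omega):\varphi(p_1)=\dots=\varphi(p_\ell)=0\}$. *)

(* Defs.v *)
From HB Require Import structures.
From mathcomp Require Import all_boot all_order all_algebra.
From mathcomp Require Import complex lra.
From mathcomp Require Import all_classical all_reals all_analysis.
From mathcomp Require Import measurable_realfun.

Set Implicit Arguments.
Unset Strict Implicit.
Unset Printing Implicit Defensive.

Import Order.TTheory GRing.Theory Num.Theory.
Import numFieldNormedType.Exports.
Import ComplexField.Normc.

Local Open Scope classical_set_scope.
Local Open Scope ring_scope.
Local Open Scope complex_scope.

HB.instance Definition _ (R : realType) := NormedModule.copy R[i] R[i]^o.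

(* Borel sigma-algebra of C^d *)
HB.instance Definition _ (R : realType) (d : nat) :=
  Measurable.copy 'rV[R[i]]_d (g_sigma_algebraType (@open 'rV[R[i]]_d)).

Lemma sigma_finite_pushforward d1 d2 (T1 : measurableType d1)
    (T2 : measurableType d2) (R : realType) (m : {measure set T1 -> \bar R})
    (f : T1 -> T2) (g : T2 -> T1) :
  sigma_finite setT m -> measurable_fun setT g -> cancel f g ->
  sigma_finite setT (pushforward m f).
Proof.
move=> [F TF mF] mg fK; exists (fun n => g @^-1` (F n)).
  by rewrite -preimage_bigcup -TF preimage_setT.
move=> n; have [mFn Fn] := mF n; split.
  by rewrite -[X in measurable X]setTI; exact: mg.
rewrite /pushforward -comp_preimage.
by have -> : g \o f = id by apply/funext => x /=; rewrite fK.
Qed.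

(* The library's sigma-finite structure on m1 \x m2 is not found by canonical
   inference, its instance for products of subprobabilities taking precedence. *)
Lemma sigma_finite_product d1 d2 (T1 : measurableType d1)
    (T2 : measurableType d2) (R : realType)
    (m1 : {sigma_finite_measure set T1 -> \bar R})
    (m2 : {sigma_finite_measure set T2 -> \bar R}) :
  sigma_finite setT (m1 \x m2)%E.
Proof.
have /sigma_finiteP[F [TF ndF Foo]] := sigma_finiteT m1.
have /sigma_finiteP[G [TG ndG Goo]] := sigma_finiteT m2.
exists (fun n => F n `*` G n).
  rewrite -setXTT TF TG predeqE => -[x y]; split.
    move=> [/= [n _ Fnx] [k _ Gky]]; exists (maxn n k) => //; split.
    - by move: x Fnx; exact/subsetPset/ndF/leq_maxl.
    - by move: y Gky; exact/subsetPset/ndG/leq_maxr.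
  by move=> [n _ []/= ? ?]; split; exists n.
move=> k; have [? ?] := Foo k; have [? ?] := Goo k.
split; first exact: measurableX.
by rewrite product_measure1E// lte_mul_pinfty// ge0_fin_numE.
Qed.

Section cons_measure.
Context d (T : measurableType d) (R : realType) (n : nat).
Variables (m : {sigma_finite_measure set T -> \bar R})
  (m' : {sigma_finite_measure set (n.-tuple T) -> \bar R}).

Definition cons_pair (x : T * n.-tuple T) : n.+1.-tuple T :=
  [tuple of x.1 :: x.2].

Lemma measurable_cons_pair : measurable_fun setT cons_pair.
Proof. exact: (measurable_cons measurable_fst measurable_snd). Qed.

Definition cons_measure : set (n.+1.-tuple T) -> \bar R :=
  pushforward (m \x m')%E cons_pair.

Let cons_measure0 : cons_measure set0 = 0%E.
Proof. by rewrite /cons_measure /pushforward preimage_set0 measure0. Qed.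

Let cons_measure_ge0 A : (0 <= cons_measure A)%E.
Proof. by rewrite /cons_measure /pushforward measure_ge0. Qed.

Let cons_measure_sigma_additive : semi_sigma_additive cons_measure.
Proof.
exact: (@measure_semi_sigma_additive _ _ _
  (measure_function_pushforward__canonical__measure_function_Measure
     (m \x m')%E measurable_cons_pair)).
Qed.

HB.instance Definition _ := isMeasure.Build _ _ _ cons_measure
  cons_measure0 cons_measure_ge0 cons_measure_sigma_additive.

Let cons_measure_sigma_finite : sigma_finite setT cons_measure.
Proof.
apply: (@sigma_finite_pushforward _ _ _ _ _ _ _
  (fun t : n.+1.-tuple T => (thead t, [tuple of behead t]))).
- exact: sigma_finite_product.
- apply: measurable_fun_pair; first exact: measurable_tnth.
  exact: measurable_behead.
- by move=> [x t]; rewrite theadE /cons_pair/=; congr pair; exact/val_inj.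
Qed.

HB.instance Definition _ := Measure_isSigmaFinite.Build _ _ _ cons_measure
  cons_measure_sigma_finite.

End cons_measure.

(* The n-fold product m x ... x m on n.-tuple T. *)
Fixpoint tuple_measure d (T : measurableType d) (R : realType)
    (m : {sigma_finite_measure set T -> \bar R}) (n : nat) :
    {sigma_finite_measure set (n.-tuple T) -> \bar R} :=
  match n with
  | 0 => dirac [tuple]
  | n'.+1 => cons_measure m (tuple_measure m n')
  end.

Section lebesgue_measure2.
Context (R : realType).

Local Notation RR := (measurableTypeR R * measurableTypeR R)%type.
Local Notation leb := (@lebesgue_measure R).

Definition lebesgue_measure2 : set RR -> \bar R := (leb \x leb)%E.

HB.instance Definition _ := Measure.copy lebesgue_measure2 (leb \x leb)%E.

Let lebesgue_measure2_sigma_finite : sigma_finite setT lebesgue_measure2.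
Proof. exact: sigma_finite_product. Qed.

HB.instance Definition _ := Measure_isSigmaFinite.Build _ _ _ lebesgue_measure2
  lebesgue_measure2_sigma_finite.

End lebesgue_measure2.

Section lebesgue_Cn.
Context (R : realType) (d : nat).
Local Notation RR := (measurableTypeR R * measurableTypeR R)%type.

Definition Cn_of_tuple (t : d.-tuple RR) : 'rV[R[i]]_d :=
  \row_j ((tnth t j).1 +i* (tnth t j).2).

Definition tuple_of_Cn (z : 'rV[R[i]]_d) : d.-tuple RR :=
  [tuple (complex.Re (z ord0 j), complex.Im (z ord0 j)) | j < d].

Lemma Cn_of_tupleK : cancel Cn_of_tuple tuple_of_Cn.
Proof.
move=> t; apply: eq_from_tnth => j.
by rewrite tnth_mktuple mxE /=; case: (tnth t j).
Qed.

Let cball (q : d.-tuple (rat * rat) * nat) : set 'rV[R[i]]_d :=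
  ball (\row_j (ratr (tnth q.1 j).1 +i* ratr (tnth q.1 j).2))
    ((q.2.+1%:R^-1 : R)%:C).

Let measurable_cball q : measurable (Cn_of_tuple @^-1` cball q).
Proof.
set c := (\row_j (ratr (tnth q.1 j).1 +i* ratr (tnth q.1 j).2)) : 'rV[R[i]]_d.
set e : R := q.2.+1%:R^-1.
have -> : Cn_of_tuple @^-1` cball q = \bigcap_(j in [set: 'I_d])
   [set t | Num.sqrt ((complex.Re (c ord0 j) - (tnth t j).1) ^+ 2 +
                      (complex.Im (c ord0 j) - (tnth t j).2) ^+ 2) < e].
  have e0 : 0 < e%:C by rewrite ltcR invr_gt0.
  have E t j : ball (c ord0 j) e%:C (Cn_of_tuple t ord0 j) =
     (Num.sqrt ((complex.Re (c ord0 j) - (tnth t j).1) ^+ 2 +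
                      (complex.Im (c ord0 j) - (tnth t j).2) ^+ 2) < e) :> Prop.
    rewrite /ball /= normc_def ltcR; congr (is_true (Num.sqrt (_ ^+ 2 + _ ^+ 2) < _)).
      by rewrite !mxE /=.
    by rewrite !mxE /=.
  apply/seteqP; split => t /=.
    by move=> [_ tb] j _ /=; rewrite -E; exact: tb.
  move=> tb; split => // i j; rewrite ord1; have := tb j I; rewrite /= -E; exact.
apply: fin_bigcap_measurable => // j _.
have mcoord (p : RR -> R) (a : R) : measurable_fun setT p ->
    measurable_fun setT (fun t : d.-tuple RR => (a - p (tnth t j)) ^+ 2).
  move=> mp; apply: measurable_funX; apply: measurable_funB; first by [].
  by apply: measurableT_comp => //; exact: measurable_tnth.
set h := fun t : d.-tuple RR =>
  Num.sqrt ((complex.Re (c ord0 j) - (tnth t j).1) ^+ 2 +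
            (complex.Im (c ord0 j) - (tnth t j).2) ^+ 2).
have mh : measurable_fun setT h.
  apply: measurableT_comp.
    by apply: continuous_measurable_fun; exact: sqrt_continuous.
  apply: measurable_funD; first exact: (mcoord fst).
  exact: (mcoord snd).
have -> : [set t | h t < e] = setT `&` h @^-1` `]-oo, e[.
  by rewrite setTI; apply/seteqP; split => t /=; rewrite in_itv.
by apply: mh => //; exact: measurable_itv.
Qed.

Lemma measurable_Cn_of_tuple : measurable_fun setT Cn_of_tuple.
Proof.
apply: (measurability (@open 'rV[R[i]]_d)) => //.
move=> _ [D oD <-]; rewrite setTI.
have -> : D = \bigcup_q (if `[< cball q `<=` D >] then cball q else set0).
  apply/seteqP; split; last first.
    by move=> z [q _]; case: asboolP => // + zq; exact.
  move=> z Dz.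
  have [e e0 zeD] : exists2 e : R[i], 0 < e & ball z e `<=` D.
    by apply/nbhs_ballP; exact: open_nbhs_nbhs.
  have [r r0 re] : exists2 r : R, 0 < r & e = r%:C.
    move: e0; case: e {zeD} => a b; rewrite ltcE /= => /andP[/eqP -> a0].
    by exists a.
  have [n nr] : exists n, n.+1%:R^-1 < r / 2.
    exists (Num.bound (r / 2)^-1).
    rewrite -[ltRHS]invrK ltf_pV2 ?posrE ?invr_gt0 ?divr_gt0 //.
    apply: (lt_le_trans (archi_boundP _)); last by rewrite ler_nat.
    by rewrite invr_ge0 divr_ge0 // ltW.
  set s : R := n.+1%:R^-1 / 2.
  have s0 : 0 < s by rewrite divr_gt0 // invr_gt0.
  have rat_near (x : R) : exists q : rat, `|ratr q - x| < s.
    have [q] := @rat_in_itvoo R (x - s) (x + s) ltac:(lra).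
    by rewrite in_itv /= => /andP[? ?]; exists q; rewrite ltr_distlC; apply/andP; split; lra.
  pose near_rat x := projT1 (cid (rat_near x)).
  pose q := ([tuple (near_rat (complex.Re (z ord0 j)),
                     near_rat (complex.Im (z ord0 j))) | j < d], n).
  have qz j : `|(ratr (tnth q.1 j).1 +i* ratr (tnth q.1 j).2) - z ord0 j| <
      (n.+1%:R^-1 : R)%:C.
    have n0 : 0 < n.+1%:R^-1 :> R by rewrite invr_gt0.
    rewrite tnth_mktuple /= normc_def ltcR -[ltRHS](ger0_norm (ltW n0)).
    rewrite -sqrtr_sqr ltr_sqrt ?exprn_gt0//.
    have sq x : (ratr (near_rat x) - x) ^+ 2 < s ^+ 2.
      rewrite -real_normK ?num_real// ltr_pXn2r ?nnegrE ?(ltW s0)//.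
      exact: (projT2 (cid (rat_near x))).
    case: (z ord0 j) => x y /=.
    apply: (lt_trans (ltrD (sq x) (sq y))).
    rewrite /s expr_div_n -mulr2n -[ltLHS]mulr_natr -mulrA gtr_pMr ?exprn_gt0//.
    by lra.
  exists q => //; case: asboolP => [_|not_sub].
    split; first by rewrite ltcR invr_gt0.
    by move=> i j; rewrite ord1 !mxE; exact: qz.
  exfalso; apply: not_sub => w [_ qw]; apply: zeD.
  split; first by [].
  move=> i j; rewrite ord1 -ball_normE /=.
  have := ler_distD (ratr (tnth q.1 j).1 +i* ratr (tnth q.1 j).2)
    (z ord0 j) (w ord0 j).
  move=> /le_lt_trans; apply; rewrite distrC.
  apply: (@lt_trans _ _ ((n.+1%:R^-1 : R)%:C + (n.+1%:R^-1 : R)%:C)).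
    apply: ltrD; first exact: qz.
    by have := qw ord0 j; rewrite !mxE.
  by rewrite re -rmorphD /= ltcR [ltRHS]splitr ltrD.
rewrite preimage_bigcup; apply: countable_bigcupT_measurable => // q.
case: asboolP => _; last by rewrite preimage_set0.
exact: measurable_cball.
Qed.

Lemma measurable_tuple_of_Cn : measurable_fun setT tuple_of_Cn.
Proof.
apply/measurable_fun_tnthP => j.
have contC (p : R[i] -> R) :
    (forall x y, `|p x - p y|%:C <= `|x - y|) ->
    measurable_fun setT (fun z : 'rV[R[i]]_d => p (z ord0 j)).
  move=> pl; apply: (measurability _ (RGenOpens.measurableE R)).
  move=> _ [_ [a [b ->] <-]]; rewrite setTI; apply: sub_sigma_algebra.
  suff : open [set z : 'rV[R[i]]_d | `]a, b[%classic (p (z ord0 j))] by [].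
  rewrite openE => z /= pz.
  have /nbhs_ballP[e /= e0 eab] : nbhs (p (z ord0 j)) `]a, b[%classic.
    by apply: open_nbhs_nbhs; split => //; exact: interval_open.
  apply/nbhs_ballP; exists e%:C => /=; first by rewrite ltcR.
  move=> w [_ zw]; apply: eab; rewrite -ball_normE /= -ltcR.
  exact: le_lt_trans (pl _ _) (zw ord0 j).
have -> : (fun t => tnth t j) \o tuple_of_Cn =
    (fun z : 'rV[R[i]]_d => (complex.Re (z ord0 j), complex.Im (z ord0 j))).
  by apply/funext => z /=; rewrite tnth_mktuple.
apply: measurable_fun_pair; apply: contC => -[a b] [a' b'].
  by rewrite normc_def lecR /= -sqrtr_sqr ler_wsqrtr// lerDl sqr_ge0.
by rewrite normc_def lecR /= -sqrtr_sqr ler_wsqrtr// lerDr sqr_ge0.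
Qed.

Definition lebesgue_Cn : set 'rV[R[i]]_d -> \bar R :=
  pushforward (tuple_measure (@lebesgue_measure2 R) d) Cn_of_tuple.

Let lebesgue_Cn0 : lebesgue_Cn set0 = 0%E.
Proof. by rewrite /lebesgue_Cn /pushforward preimage_set0 measure0. Qed.

Let lebesgue_Cn_ge0 A : (0 <= lebesgue_Cn A)%E.
Proof. by rewrite /lebesgue_Cn /pushforward measure_ge0. Qed.

Let lebesgue_Cn_sigma_additive : semi_sigma_additive lebesgue_Cn.
Proof.
exact: (@measure_semi_sigma_additive _ _ _
  (measure_function_pushforward__canonical__measure_function_Measure
     (tuple_measure (@lebesgue_measure2 R) d) measurable_Cn_of_tuple)).
Qed.

HB.instance Definition _ := isMeasure.Build _ _ _ lebesgue_Cn
  lebesgue_Cn0 lebesgue_Cn_ge0 lebesgue_Cn_sigma_additive.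

Let lebesgue_Cn_sigma_finite : sigma_finite setT lebesgue_Cn.
Proof.
exact: (sigma_finite_pushforward (sigma_finiteT _) measurable_tuple_of_Cn
  Cn_of_tupleK).
Qed.

HB.instance Definition _ := Measure_isSigmaFinite.Build _ _ _ lebesgue_Cn
  lebesgue_Cn_sigma_finite.

End lebesgue_Cn.

Section bergman_space.
Context (R : realType) (d : nat).
Local Notation Cd := 'rV[R[i]]_d.
Local Notation V := (@lebesgue_Cn R d).
Implicit Types (U : set Cd) (omega : Cd -> R) (f g : Cd -> R[i]).

(* Functions on U are represented by total functions on C^d, of which only the
   values on U matter; differentiability is over the field R[i]. *)
Definition holomorphic_on U f := forall z, U z -> differentiable f z.

Definition bergman_space U omega : set (Cd -> R[i]) :=
  [set f | holomorphic_on U f /\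
    (\int[V]_(z in U) (normc (f z) ^+ 2 * omega z)%:E < +oo)%E].

Definition bergman_dot U omega f g : R[i] :=
  (\int[V]_(z in U) (complex.Re (f z * (g z)^*) * omega z))%R +i*
  (\int[V]_(z in U) (complex.Im (f z * (g z)^*) * omega z))%R.

Definition reproducing_kernel U omega (K : Cd -> Cd -> R[i]) :=
  (forall w, U w -> bergman_space U omega (K^~ w)) /\
  (forall f w, bergman_space U omega f -> U w ->
    f w = bergman_dot U omega f (K^~ w)).

(* Kernel of the reduced Palm process at p; the indices 0, ..., l of the bordered
   determinant run over (z, p_1, ..., p_l) and (w, p_1, ..., p_l). *)
Definition palm_kernel (K : Cd -> Cd -> R[i]) l (p : l.-tuple Cd) :
    Cd -> Cd -> R[i] := fun z w =>
  \det (\matrix_(i < l.+1, j < l.+1)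
           K (tnth [tuple of z :: p] i) (tnth [tuple of w :: p] j)) /
  \det (\matrix_(i < l, j < l) K (tnth p i) (tnth p j)).

End bergman_space.

Definition relatively_compact (T : topologicalType) (U B : set T) :=
  compact (closure B) /\ closure B `<=` U.

Section configurations.
Context (R : realType) (d : nat).
Local Notation Cd := 'rV[R[i]]_d.

(* A configuration is given by the multiplicity of each point. *)
Record configuration (U : set Cd) := Configuration {
  mult :> Cd -> nat;
  mult_out : forall z, ~ U z -> mult z = 0%N;
  mult_locally_finite : forall B, relatively_compact U B ->
    finite_set (B `&` [set z | mult z != 0%N]) }.

Variable U : set Cd.

HB.instance Definition _ := gen_eqMixin (configuration U).
HB.instance Definition _ := gen_choiceMixin (configuration U).

Program Definition configuration0 : configuration U :=
  @Configuration U (fun=> 0%N) _ _.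
Next Obligation. by []. Qed.
Next Obligation.
move=> B _; rewrite (_ : _ `&` _ = set0)//.
by apply/seteqP; split => [z [_ /negP]|//]; apply.
Qed.

HB.instance Definition _ := isPointed.Build (configuration U) configuration0.

Definition npoints (X : configuration U) (B : set Cd) : nat :=
  (\sum_(z \in B) X z)%R.

Definition configuration_events : set (set (configuration U)) :=
  [set E | exists B (n : nat), [/\ measurable B, relatively_compact U B &
    E = [set X | npoints X B = n]]].

HB.instance Definition _ := Measurable.copy (configuration U)
  (g_sigma_algebraType configuration_events).

(* The number of ways of choosing the points t_0, ..., t_(l-1) successively and
   without replacement in X. *)
Definition factorial_mult (X : configuration U) l (t : l.-tuple Cd) : nat :=
  (\prod_(i < l)
     (X (tnth t i) - #|[pred j : 'I_l | (j < i) && (tnth t j == tnth t i)]|))%N.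

(* Expected number of l-tuples of points of X, taken without replacement, that
   lie in A: the l-th factorial moment measure. *)
Definition correlation_measure (P : probability (configuration U) R) l
    (A : set (l.-tuple Cd)) : \bar R :=
  (\int[P]_X \esum_(t in A) (factorial_mult X t)%:R%:E)%E.

Definition simple_process (P : probability (configuration U) R) :=
  {ae P, forall X : configuration U, forall z, (X z <= 1)%N}.

(* The l-th correlation measure is det(K(t_i, t_j)) mu^l with mu = omega dV. For
   a positive kernel these determinants are nonnegative reals, so taking real
   parts loses nothing. *)
Definition determinantal_process (omega : Cd -> R) (K : Cd -> Cd -> R[i])
    (P : probability (configuration U) R) :=
  simple_process P /\
  forall l, (0 < l)%N -> forall A : set (l.-tuple Cd), measurable A ->
    A `<=` [set t | forall i, U (tnth t i)] ->
    correlation_measure P A =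
    (\int[tuple_measure (@lebesgue_Cn R d) l]_(t in A)
      (complex.Re (\det (\matrix_(i < l, j < l) K (tnth t i) (tnth t j))) *
       \prod_(i < l) omega (tnth t i))%:E)%E.

End configurations.

(* Main.v *)
(** On a set of finite volume on which the weight and the diagonal of the kernel
  are bounded, the process and its reduced Palm process at [p] have the explicit
  Janossy densities [jan w v] and [jan w (p ++ v) / rho p], alternating series of
  integrals of the correlation functions [rho], and it suffices to compare these
  with constants that do not depend on the set.  The bounded function [g] enters
  through the multipliers [(g z - g x) / (2 * M)], which are contractions of the
  Bergman space vanishing at [x].  The Palm law is dominated by the law: a point
  [q] of [p] can be traded for points [x] near [q] by the submean value
  inequality, because the multiplier at [x] does not vanish at [q].  The law is
  dominated by the Palm law: up to a small probability the configuration has at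
  most [n0] points in a large compact set, none of them with a value of [g] close
  to some [g p_i]; the product of the multipliers at these points is bounded below
  at every [p_i], while outside the compact set conditioning on [p] has almost no
  effect, since the extremal problem for evaluation at [p_i] is localized. *)
Require Import Defs.
From HB Require Import structures.
From mathcomp Require Import all_boot all_order all_algebra.
From mathcomp Require Import fingroup perm complex ring lra.
From mathcomp Require Import all_classical all_reals all_analysis.
From mathcomp Require Import ess_sup_inf measurable_realfun.
Set Implicit Arguments.
Unset Strict Implicit.
Unset Printing Implicit Defensive.

Import Order.TTheory GRing.Theory Num.Theory.
Import numFieldNormedType.Exports.
Import ComplexField.Normc.

Local Open Scope classical_set_scope.
Local Open Scope ring_scope.
Local Open Scope complex_scope.

Local Notation Re := complex.Re.
Local Notation Im := complex.Im.
Local Notation measT := (measurable_fun setT).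
Local Notation sfmeas T R := {sigma_finite_measure set T -> \bar R}.
Local Notation mfM := measurable_funM.
Local Notation mfcomp := measurableT_comp.
Local Notation mfpair := measurable_fun_pair.
Local Notation mEFinP := measurable_EFinP.
Local Notation mfubF := measurable_fun_fubini_tonelli_F.
Local Notation mindic := measurable_indic.
Local Notation rcpt := relatively_compact.
Local Notation lebm2 := lebesgue_measure2.

(** The quotient [jan w (q :: s) / jan w s] is the value at [q], on the diagonal, of the reproducing
    kernel of the functions vanishing on [s] for the weight [W0 - w], that is, the largest |f(q)|^2
    at norm one. Comparing Janossy densities thus means comparing extremal problems, and a
    multiplier carries competitors of one problem to another. No operator theory enters: the
    extremal property follows from expanding bordered determinants along a row and integrating term
    by term. The sign of the alternating series is the obstacle. For the empty configuration it is
    taken from the process itself, since [jan (t w) [::]] is the expectation of (1 - t)^N, N being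
    the number of points in the window. For t < 1 the weight [W0 - t w] remains comparable to [W0],
    so points can be added one at a time without losing positivity; then t tends to 1. The constants
    may depend on an error e but not on the window: P(D) <= lam Q(D) + e for the events D of all
    windows is enough for absolute continuity, because these events approximate all others. *)

Lemma eq_ler d (T : porderType d) (x y : T) : x = y -> (x <= y)%O.
by move->. Qed.

Lemma mpre d1 d2 d3 (T1 : measurableType d1) (T2 : measurableType d2)
  (T3 : measurableType d3) (f : T2 -> T3) (h : T1 -> T2) :
 measT f -> measT h ->
 measT (fun x => f (h x)).
by exact: mfcomp. Qed.

(** * The measurable space of finite sequences *)

Definition seq_display : measure_display -> measure_display.
exact. Qed.

Section seq_measurable_type.
Context d (T : measurableType d).

(** The sigma-algebra of the disjoint union of the powers of [T]. On it a series over n of integrals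
    over n-tuples becomes a single integral, to which Fubini and dominated convergence apply
    directly. *)
Definition seq_measurable (A : set (seq T)) : Prop :=
 forall n, measurable [set t : n.-tuple T | A (tval t)].

Let seq_measurable0 : seq_measurable set0.
by move=> n; rewrite (_ : [set _ | _] = set0). Qed.

Let seq_measurableC A : seq_measurable A -> seq_measurable (~` A).
by move=> mA n; exact: measurableC (mA n).
Qed.

Let seq_measurable_bigcup (F : (set (seq T))^nat) :
 (forall i, seq_measurable (F i)) -> seq_measurable (\bigcup_i F i).
by move=> mF n; apply: (@bigcup_measurable) => i _; exact: mF.
Qed.

HB.instance Definition _ := isPointed.Build (seq T) [::].

HB.instance Definition _ := @isMeasurable.Build (seq_display d) (seq T)
 seq_measurable seq_measurable0 seq_measurableC seq_measurable_bigcup.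

Lemma m_tval n : measT (@tval n T).
by move=> _ A mA; rewrite setTI; exact: mA. Qed.

Lemma m_size_eq n : measurable [set s : seq T | size s = n].
move=> k; have [->|kn] := eqVneq k n.
 by rewrite (_ : [set _ | _] = setT)//; apply/seteqP; split => // t _ /=;
  rewrite size_tuple.
rewrite (_ : [set _ | _] = set0)//; apply/seteqP; split => // t /=.
by rewrite size_tuple => /eqP; rewrite (negbTE kn).
Qed.

(** Sequences of another length go to one fixed tuple, so that this left inverse of [tval] is total
    and measurable. *)
Definition tuple_of_seq n (s : seq T) : n.-tuple T :=
 insubd [tuple of nseq n point] s.

Lemma tuple_of_seqK n s : size s = n -> tval (tuple_of_seq n s) = s.
by move=> sn; rewrite val_insubd sn eqxx. Qed.

Lemma tval_tuple_of_seq n (t : n.-tuple T) : tuple_of_seq n t = t.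
by apply: val_inj; rewrite /= tuple_of_seqK// size_tuple. Qed.

Lemma m_tuple_of_seq n : measT (@tuple_of_seq n).
move=> _ A mA; rewrite setTI.
suff : seq_measurable (tuple_of_seq n @^-1` A) by [].
move=> k; have [->|kn] := eqVneq k n.
 rewrite (_ : [set _ | _] = A)//; apply/seteqP; split => t;
  by rewrite /preimage/= tval_tuple_of_seq.
have E (t : k.-tuple T) : tuple_of_seq n t = [tuple of nseq n point].
 by apply: val_inj; rewrite val_insubd size_tuple (negbTE kn).
have [Ap|nAp] := pselect (A [tuple of nseq n point]).
 by rewrite (_ : [set _ | _] = setT)//; apply/seteqP; split => // t _ /=; rewrite E.
by rewrite (_ : [set _ | _] = set0)//; apply/seteqP; split => t /=; rewrite E.
Qed.

Context d' (T' : measurableType d').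

Lemma m_fun_seqP (f : seq T -> T') :
 (forall n, measT (fun t : n.-tuple T => f t)) <->
 measT f.
split=> [mf _ A mA|mf n]; last first.
 by apply: (mfcomp mf); exact: m_tval.
rewrite setTI; suff : seq_measurable (f @^-1` A) by [].
move=> n.
by have := mf n measurableT A mA; rewrite setTI.
Qed.

Context d2 (X : measurableType d2).

(** The product sigma-algebra on [X * seq T] is not by definition a disjoint union over the lengths.
    The slices of a given length are measurable rectangles, and on each of them the preimage is
    pulled back along [tuple_of_seq]. *)
Lemma m_fun_seq2 (f : X -> seq T -> T') :
 (forall n, measT (fun p : X * n.-tuple T => f p.1 p.2)) ->
 measT (fun p : X * seq T => f p.1 p.2).
move=> mf _ A mA; rewrite setTI.
rewrite (_ : _ _ = \bigcup_n ((setT `*` [set s | size s = n]) `&`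
  (fun p => (p.1, tuple_of_seq n p.2)) @^-1`
   ((fun p : X * n.-tuple T => f p.1 p.2) @^-1` A))).
 apply: bigcup_measurable => n _; apply: measurableI.
  by apply: measurableX => //; exact: m_size_eq.
 rewrite -[X in measurable X]setTI.
 have m1 : measT (fun p : X * seq T => (p.1, tuple_of_seq n p.2)).
  apply: mfpair => //.
  by apply: mfcomp => //; exact: m_tuple_of_seq.
 apply: m1 => //.
 by have := mf n measurableT A mA; rewrite setTI.
apply/seteqP; split => [[x s] Af|[x s] [n _ [[_ /= sn]]]]; last first.
 by rewrite tuple_of_seqK.
by exists (size s) => //; rewrite /preimage/= tuple_of_seqK.
Qed.

End seq_measurable_type.

Section seq_measurable_ops.
Context d (T : measurableType d).

Lemma m_seq_cons :
 measT (fun p : T * seq T => p.1 :: p.2).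
apply: (@m_fun_seq2) => n.
rewrite (_ : (fun _ => _) = @tval _ _ \o
 (fun p : T * n.-tuple T => [tuple of p.1 :: p.2]))//.
apply: mfcomp; first exact: m_tval.
exact: (measurable_cons).
Qed.

Lemma m_cat_tuple k n : measT
 (fun p : k.-tuple T * n.-tuple T => [tuple of p.1 ++ p.2]).
apply/measurable_fun_tnthP => i; case: (@split_ordP k n i) => j ->.
 rewrite (_ : _ _ = (fun t => tnth t j) \o fst); last first.
  by apply/funext => -[x y] /=; rewrite (tnth_lshift).
 by apply: mfcomp => //; exact: measurable_tnth.
rewrite (_ : _ _ = (fun t => tnth t j) \o snd); last first.
 by apply/funext => -[x y] /=; rewrite (tnth_rshift).
by apply: mfcomp => //; exact: measurable_tnth.
Qed.

Lemma m_seq_cat :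
 measT (fun p : seq T * seq T => p.1 ++ p.2).
apply: (@m_fun_seq2) => n.
rewrite (_ : (fun _ => _) = (fun p : n.-tuple T * seq T => p.2 ++ p.1) \o
 (fun p => (p.2, p.1)))//.
apply: mfcomp; last first.
 exact: mfpair.
apply: (@m_fun_seq2 _ _ _ _ _ _ (fun (t : n.-tuple T) s => s ++ t)) => k.
rewrite (_ : (fun _ => _) = @tval _ _ \o
 (fun p : n.-tuple T * k.-tuple T => [tuple of p.2 ++ p.1]))//.
apply: mfcomp; first exact: m_tval.
rewrite (_ : (fun _ => _) =
 (fun p : k.-tuple T * n.-tuple T => [tuple of p.1 ++ p.2]) \o
 (fun p => (p.2, p.1)))//.
apply: mfcomp; first exact: m_cat_tuple.
exact: mfpair.
Qed.

End seq_measurable_ops.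

(** * The Lebesgue-Poisson measure *)

Section lebesgue_poisson.
Context d (T : measurableType d) (R : realType).
Variable V : sfmeas T R.

Definition tuple_push n : set (seq T) -> \bar R :=
 pushforward (tuple_measure V n) (@tval n T).

Let tuple_push0 n : tuple_push n set0 = 0%E.
by rewrite /tuple_push /pushforward measure0. Qed.

Let tuple_push_ge0 n A : (0 <= tuple_push n A)%E.
by rewrite /tuple_push /pushforward. Qed.

Let tuple_push_sigma_additive n : semi_sigma_additive (tuple_push n).
exact: (@measure_semi_sigma_additive _ _ _
 (measure_function_pushforward__canonical__measure_function_Measure
   (tuple_measure V n) (@m_tval _ _ n))).
Qed.

HB.instance Definition _ n := isMeasure.Build _ _ _ (tuple_push n)
 (tuple_push0 n) (@tuple_push_ge0 n) (@tuple_push_sigma_additive n).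

Definition lp_piece n : {measure set (seq T) -> \bar R} :=
 mscale ((n`!%:R : R)^-1)%:nng (tuple_push n).

(** The factor 1 / n! of each piece compensates for the orderings of n points, so that integrals of
    symmetric functions are integrals over finite configurations. *)
Definition lp : set (seq T) -> \bar R := mseries lp_piece 0.

HB.instance Definition _ := Measure.copy lp (mseries lp_piece 0).

Local Open Scope ereal_scope.

Lemma ge0_integral_tuple_push n (f : seq T -> \bar R) :
 measT f -> (forall s, 0 <= f s) ->
 \int[tuple_push n]_s f s = \int[tuple_measure V n]_t f (tval t).
move=> mf f0.
rewrite (ge0_integral_pushforward (@m_tval _ _ n) _)//.
Qed.

Lemma ge0_integral_lp_piece n (f : seq T -> \bar R) :
 measT f -> (forall s, 0 <= f s) ->
 \int[lp_piece n]_s f s = (n`!%:R^-1)%:E * \int[tuple_measure V n]_t f (tval t).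
move=> mf f0; rewrite /lp_piece.
by rewrite ge0_integral_mscale// ge0_integral_tuple_push.
Qed.

Lemma ge0_integral_lp (f : seq T -> \bar R) :
 measT f -> (forall s, 0 <= f s) ->
 \int[lp]_s f s =
 \sum_(n <oo) (n`!%:R^-1)%:E * \int[tuple_measure V n]_t f (tval t).
move=> mf f0; rewrite ge0_integral_measure_series//.
by apply: eq_eseriesr => n _; exact: ge0_integral_lp_piece.
Qed.

Lemma int_tupleS n (f : n.+1.-tuple T -> \bar R) :
 measT f -> (forall t, 0 <= f t) ->
 \int[tuple_measure V n.+1]_t f t =
 \int[V]_x \int[tuple_measure V n]_t f [tuple of x :: t].
move=> mf f0 /=.
rewrite (ge0_integral_pushforward (@measurable_cons_pair _ _ n) _ measurableT)//.
rewrite fubini_tonelli1//.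
 by apply: mfcomp => //; exact: measurable_cons_pair.
by move=> x; exact: f0.
Qed.

(** Fubini on pairs of sequences asks for this. A covering set fixes a length and a piece of finite
    measure among the tuples of that length; on it the series defining [lp] has a single nonzero
    term. *)
Lemma lp_sigma_finite : sigma_finite setT lp.
have H n := cid2 (sigma_finiteT (tuple_measure V n)).
pose F n := sval (cid2 (sigma_finiteT (tuple_measure V n))).
have FT n : setT = \bigcup_k F n k by rewrite /F; case: cid2.
have mF n k : measurable (F n k) /\ tuple_measure V n (F n k) < +oo.
 by rewrite /F; case: cid2.
pose G (p : nat * nat) := [set s : seq T | size s = p.1 /\
  F p.1 p.2 (tuple_of_seq p.1 s)].
have mG p : measurable (G p).
 apply: measurableI; first exact: m_size_eq.
 rewrite -[X in measurable X]setTI; apply: m_tuple_of_seq => //.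
 exact: (mF _ _).1.
have Goo p : lp (G p) < +oo.
 rewrite -[X in lp X]setIT -integral_indic//.
 rewrite ge0_integral_lp//; last by apply/mEFinP.
 rewrite (@nneseriesD1 _ _ p.1)//; last first.
  move=> n _; apply: mule_ge0 => //; apply: integral_ge0 => t _; rewrite lee_fin //.
 rewrite eseries0 ?adde0; last first.
  move=> n _ /= pn; rewrite integral0_eq ?mule0// => t _; rewrite indicE.
  rewrite memNset// /G/= size_tuple => -[np _].
  by move: pn; rewrite np eqxx.
 rewrite lte_mul_pinfty//.
 apply: le_lt_trans (mF p.1 p.2).2.
 rewrite -[X in tuple_measure V _ X]setIT -integral_indic//; last exact: (mF _ _).1.
 apply: ge0_le_integral => //.
 - apply/mEFinP.
  exact: (mfcomp (mindic (mG p)) (m_tval (n:=p.1))).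
 - by apply/mEFinP; exact: mindic (mF _ _).1.
 - move=> t _; rewrite lee_fin !indicE.
  case: (boolP (tval t \in G p)) => [Gt|_]//.
  have [_] := set_mem Gt; rewrite tval_tuple_of_seq => Ft.
  by rewrite (mem_set).
pose u n := if unpickle n is Some p then G p else set0.
exists u.
 apply/seteqP; split => // s _.
 have : (\bigcup_k F (size s) k) (tuple_of_seq (size s) s) by rewrite -FT.
 move=> [k _ Fk]; exists (pickle (size s, k)) => //.
 by rewrite /u pickleK.
move=> n; rewrite /u; case: unpickle => []//.
by rewrite measure0.
Qed.

HB.instance Definition _ := Measure_isSigmaFinite.Build _ _ _ lp
 lp_sigma_finite.

End lebesgue_poisson.

(** * Sums over the splittings of a sequence *)

(** One term for each of the 2^n ways of dealing the entries of [s] into two subsequences. For [g]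
    symmetric in each argument these are the splittings of a finite configuration into two parts. *)
Fixpoint ssum (T : Type) (Z : nmodType) (g : seq T -> seq T -> Z)
  (s : seq T) : Z :=
 match s with
 | [::] => g [::] [::]
 | a :: s' => ssum (fun x y => g (a :: x) y) s' +
        ssum (fun x y => g x (a :: y)) s'
 end.

Section splitsum_theory.
Variables (T : Type) (Z : nmodType).
Implicit Types g h : seq T -> seq T -> Z.

Lemma eq_ssum g h s :
 (forall x y, g x y = h x y) -> ssum g s = ssum h s.
elim: s g h => [|a s IH] g h gh /=//.
by congr (_ + _); apply: IH .
Qed.

Lemma ssum_add g h s :
 ssum (fun x y => g x y + h x y) s = ssum g s + ssum h s.
elim: s g h => [|a s IH] g h //=.
by rewrite IH IH addrACA.
Qed.

Lemma ssum_morph (Z' : nmodType) (phi : Z -> Z') g s :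
 {morph phi : x y / x + y} ->
 phi (ssum g s) = ssum (fun x y => phi (g x y)) s.
by move=> phiD; elim: s g => [|a s IH] g //; rewrite phiD !IH. Qed.

End splitsum_theory.

Lemma ssum_le (R : numDomainType) (T : Type) (g h : seq T -> seq T -> R) s :
 (forall x y, g x y <= h x y) -> ssum g s <= ssum h s.
by elim: s g h => [|a s IH] g h gh //=; apply: lerD; exact: IH. Qed.

Lemma ssumZ (R : pzRingType) (T : Type) (g : seq T -> seq T -> R) s c :
 ssum (fun x y => c * g x y) s = c * ssum g s.
by rewrite ssum_morph// => x y; rewrite mulrDr. Qed.

Section splitsum_integral.
Context d (T : measurableType d) (R : realType).
Variable V : sfmeas T R.
Local Open Scope ereal_scope.

(** The parameter space [X] serves the induction, which moves the first entry of the tuple into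
    it. *)
Lemma m_ssum_tuple d' (X : measurableType d')
  (g : X -> seq T -> seq T -> \bar R) n :
 measT (fun p : X * (seq T * seq T) => g p.1 p.2.1 p.2.2) ->
 measT (fun p : X * n.-tuple T => ssum (g p.1) p.2).
elim: n => [|n IH] in d' X g * => mg.
 rewrite (_ : (fun _ => _) = (fun p : X * (seq T * seq T) => g p.1 p.2.1 p.2.2) \o
   (fun p : X * 0.-tuple T => (p.1, ([::], [::])))); last first.
  by apply/funext => -[x t] /=; rewrite tuple0.
 apply: mfcomp => //; apply: mfpair => //.
have [g1 g2] : measT (fun p : (X * T) * (seq T * seq T) =>
   g p.1.1 (p.1.2 :: p.2.1) p.2.2) /\
  measT (fun p : (X * T) * (seq T * seq T) =>
   g p.1.1 p.2.1 (p.1.2 :: p.2.2)).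
 have m11 : measT (fun p : (X * T) * (seq T * seq T) => p.1.1).
  by apply: mfcomp => //; exact: measurable_fst.
 have m21 : measT (fun p : (X * T) * (seq T * seq T) => p.2.1).
  by apply: mfcomp => //; exact: measurable_snd.
 have m22 : measT (fun p : (X * T) * (seq T * seq T) => p.2.2).
  by apply: mfcomp => //; exact: measurable_snd.
 have mc (h : (X * T) * (seq T * seq T) -> seq T) : measT h ->
   measT (fun p : (X * T) * (seq T * seq T) => p.1.2 :: h p).
  move=> mh; rewrite (_ : (fun _ => _) = (fun p : T * seq T => p.1 :: p.2) \o
   (fun p : (X * T) * (seq T * seq T) => (p.1.2, h p)))//.
  apply: mfcomp; first exact: m_seq_cons.
  by apply: mfpair => //; apply: mfcomp => //; exact: measurable_fst.
 split.
  rewrite (_ : (fun _ => _) = (fun p : X * (seq T * seq T) => g p.1 p.2.1 p.2.2) \o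
   (fun p : (X * T) * (seq T * seq T) => (p.1.1, (p.1.2 :: p.2.1, p.2.2))))//.
  apply: mfcomp => //; apply: mfpair => //.
  by apply: mfpair => //; exact: mc.
 rewrite (_ : (fun _ => _) = (fun p : X * (seq T * seq T) => g p.1 p.2.1 p.2.2) \o
  (fun p : (X * T) * (seq T * seq T) => (p.1.1, (p.2.1, p.1.2 :: p.2.2))))//.
 apply: mfcomp => //; apply: mfpair => //.
 by apply: mfpair => //; exact: mc.
have dec : measT (fun p : X * n.+1.-tuple T =>
  ((p.1, thead p.2), [tuple of behead p.2])).
 apply: mfpair; first apply: mfpair.
 - exact: measurable_fst.
 - by apply: mfcomp => //; exact: measurable_tnth.
 - by apply: (mfcomp (@measurable_behead _ _ _)).
have := mfcomp (emeasurable_funD (IH _ _ (fun (q : X * T) x y => g q.1 (q.2 :: x) y) g1)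
 (IH _ _ (fun (q : X * T) x y => g q.1 x (q.2 :: y)) g2)) dec.
apply: eq_measurable_fun => -[x t] _ /=.
by rewrite [in RHS](tuple_eta t).
Qed.

Variable g : seq T -> seq T -> \bar R.
Hypotheses (g0 : forall x y, 0 <= g x y)
 (mg : measT (fun p : seq T * seq T => g p.1 p.2)).

Lemma ssum_ge0 s : 0 <= ssum g s.
by elim: s g g0 => [|a s IH] h h0 //=; rewrite adde_ge0// IH. Qed.

Lemma m_ssum : measT (ssum g).
apply/m_fun_seqP => n.
have : measT (fun p : unit * n.-tuple T => ssum ((fun=> g) p.1) p.2).
 apply: m_ssum_tuple.
 rewrite (_ : (fun _ => _) = (fun p => g p.1 p.2) \o (@snd unit (seq T * seq T)))//.
 exact: mfcomp.
move=> /(mpre (h := (fun t => (tt, t)))); apply.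
exact: mfpair.
Qed.

End splitsum_integral.

(** Pascal's rule, for the induction in [integral_ssum_tuple]: the first entry of the tuple goes to
    one part or to the other. *)
Lemma pascal_sum (R : realType) (f : nat -> nat -> \bar R) n :
 (forall k m, 0 <= f k m)%E ->
 (\sum_(k < n.+1) ('C(n, k)%:R)%:E * (f k.+1 (n - k)%N + f k (n - k).+1) =
  \sum_(k < n.+2) ('C(n.+1, k)%:R)%:E * f k (n.+1 - k)%N)%E.
move=> f0; rewrite [RHS]big_ord_recl bin0 subn0/=.
under [X in (_ + X)%E]eq_bigr => i _.
 rewrite /bump add1n binS subSS natrD EFinD ge0_muleDl ?lee_fin//.
 over.
rewrite big_split/= addeA [X in (X + _)%E](_ : _ =
 \sum_(k < n.+1) ('C(n, k)%:R)%:E * f k (n - k).+1)%E; last first.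
 rewrite big_ord_recr/= bin_small// mul0e adde0 big_ord_recl bin0 subn0.
 congr (_ + _)%E; apply: eq_bigr => i _.
 by rewrite subnSK.
rewrite -big_split/=; apply: eq_bigr => k _.
by rewrite ge0_muleDr// addeC.
Qed.

Section splitsum_lp.
Context d (T : measurableType d) (R : realType).
Variable V : sfmeas T R.
Local Open Scope ereal_scope.
Local Notation tm := (tuple_measure V).

Let B k m (g : seq T -> seq T -> \bar R) :=
 \int[tm k]_x \int[tm m]_y g x y.

Let meas2 (g : seq T -> seq T -> \bar R) :=
 measT (fun p : seq T * seq T => g p.1 p.2).

Let m_tt k m g : meas2 g ->
 measT (fun p : k.-tuple T * m.-tuple T => g p.1 p.2).
move=> mg; rewrite (_ : (fun _ => _) = (fun p => g p.1 p.2) \o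
 (fun p => (tval p.1, tval p.2)))//.
apply: mfcomp => //; apply: mfpair;
 by apply: mfcomp => //; exact: m_tval.
Qed.

Let m_consl (g : seq T -> seq T -> \bar R) : meas2 g ->
 measT (fun p : T * (seq T * seq T) => g (p.1 :: p.2.1) p.2.2).
move=> mg; rewrite (_ : (fun _ => _) = (fun p => g p.1 p.2) \o
 (fun p => (p.1 :: p.2.1, p.2.2)))//.
apply: mfcomp => //; apply: mfpair; last first.
 exact: mfcomp .
rewrite (_ : (fun _ => _) = (fun p => p.1 :: p.2) \o
 (fun p : T * (seq T * seq T) => (p.1, p.2.1)))//.
apply: mfcomp; first exact: m_seq_cons.
apply: mfpair => //.
exact: mfcomp .
Qed.

Let m_swap (g : seq T -> seq T -> \bar R) : meas2 g -> meas2 (fun x y => g y x).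
move=> mg; rewrite /meas2 (_ : (fun _ => _) = (fun p => g p.1 p.2) \o
 (fun p => (p.2, p.1)))//.
by apply: mfcomp => //; apply: mfpair.
Qed.

Let m_consr (g : seq T -> seq T -> \bar R) : meas2 g ->
 measT (fun p : T * (seq T * seq T) => g p.2.1 (p.1 :: p.2.2)).
move=> /m_swap /m_consl mg.
rewrite (_ : (fun _ => _) = (fun p => g p.2.2 (p.1 :: p.2.1))
 \o (fun p => (p.1, (p.2.2, p.2.1))))//.
apply: (@mfcomp _ _ _ _ _ _) => //.
apply: mfpair => //; apply: mfpair;
 exact: mfcomp .
Qed.

Let m_sect (h : T -> seq T -> seq T -> \bar R) a :
 measT (fun p : T * (seq T * seq T) => h p.1 p.2.1 p.2.2) ->
 meas2 (h a).
move=> mh; rewrite /meas2 (_ : (fun _ => _) =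
 (fun p => h p.1 p.2.1 p.2.2) \o (fun p => (a, p)))//.
by apply: mfcomp => //; apply: mfpair.
Qed.

Let m_B k m (h : T -> seq T -> seq T -> \bar R) :
 (forall a x y, 0 <= h a x y) ->
 measT (fun p : T * (seq T * seq T) => h p.1 p.2.1 p.2.2) ->
 measT (fun p : T * k.-tuple T => \int[tm m]_y h p.1 p.2 y).
move=> h0 mh; pose f (q : (T * k.-tuple T) * m.-tuple T) := h q.1.1 q.1.2 q.2.
apply: (@mfubF _ _ _ _ _ (tm m) f); last first.
 by move=> q; exact: h0.
rewrite (_ : f = (fun p => h p.1 p.2.1 p.2.2) \o
 (fun q => (q.1.1, (tval q.1.2, tval q.2))))//.
apply: mfcomp => //; apply: mfpair.
 exact: mfcomp .
apply: mfpair; (apply: mfcomp; first exact: m_tval) => //.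
exact: mfcomp .
Qed.

Let B_consl k m g : (forall x y, 0 <= g x y) -> meas2 g ->
 B k.+1 m g = \int[V]_a B k m (fun x y => g (a :: x) y).
move=> g0 mg; rewrite /B int_tupleS//.
- apply: (@mfubF _ _ _ _ _ (tm m)
  (fun p : k.+1.-tuple T * m.-tuple T => g p.1 p.2)) => //.
 exact: m_tt.
- by move=> t; exact: integral_ge0.
Qed.

Let B_consr k m g : (forall x y, 0 <= g x y) -> meas2 g ->
 B k m.+1 g = \int[V]_a B k m (fun x y => g x (a :: y)).
move=> g0 mg; rewrite /B.
under eq_integral => x _.
 rewrite int_tupleS//; last first.
  have := m_tt (m := m.+1) (k := k) mg.
  by move=> /(mpre (h := (pair x))); apply.
 over.
rewrite (@fubini_tonelli _ _ _ _ _ V (tm k)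
 (fun p : T * k.-tuple T => \int[tm m]_y g p.2 (p.1 :: y)))//.
- exact: (@m_B k m (fun a x y => g x (a :: y)) _ (m_consr mg)).
- by move=> p; apply: integral_ge0.
Qed.

Let B_ge0 k m g : (forall x y, 0 <= g x y) -> 0 <= B k m g.
by move=> g0; apply: integral_ge0 => x _; exact: integral_ge0. Qed.

Let m_BB k m (h : T -> seq T -> seq T -> \bar R) :
 (forall a x y, 0 <= h a x y) ->
 measT (fun p : T * (seq T * seq T) => h p.1 p.2.1 p.2.2) ->
 measT (fun a => B k m (h a)).
move=> h0 mh; apply: (@mfubF _ _ _ _ _ (tm k)
 (fun p : T * k.-tuple T => \int[tm m]_y h p.1 p.2 y)).
 exact: m_B.
by move=> p; exact: integral_ge0.
Qed.

(** Binomial formula: C(n, k) splittings give k entries to the first part, and all of these have the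
    same integral because the entries are integrated against a product measure. *)
Lemma integral_ssum_tuple n g : (forall x y, 0 <= g x y) -> meas2 g ->
 \int[tm n]_t ssum g t = \sum_(k < n.+1) ('C(n, k)%:R)%:E * B k (n - k) g.
elim: n g => [|n IH] g g0 mg.
 rewrite big_ord_recl big_ord0 adde0 mul1e /B /=.
 have mgx x : measT (fun y : 0.-tuple T => g x y).
  by have /(mpre (h := fun y => (x, y))) : meas2 g := mg;
   move=> /(_ (mfpair (measurable_cst _) (@measurable_id _ _ setT))) /mpre;
   apply; exact: m_tval.
 rewrite integral_dirac//; last exact: mpre (m_ssum mg) (m_tval (n:=0)).
 rewrite integral_dirac//; last first.
  apply: (@mfubF _ _ _ _ _ (tm 0)
   (fun p : 0.-tuple T * 0.-tuple T => g p.1 p.2)) => //; exact: m_tt.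
 by rewrite integral_dirac// !diracE !in_setT !mul1e.
have ml := m_consl mg; have mr := m_consr mg.
rewrite -(@pascal_sum _ (fun k m => B k m g)); last by move=> k m; exact: B_ge0.
under eq_bigr => k _ do rewrite B_consl// B_consr//.
rewrite int_tupleS; last 2 first.
- have := m_ssum mg.
 by move=> /(mpre); apply; exact: m_tval.
- by exact: ssum_ge0.
under eq_integral => a _.
 rewrite /= ge0_integralD//; last 4 first.
 - by move=> t _; exact: ssum_ge0.
 - have := m_ssum (m_sect (h := fun a x y => g (a :: x) y) a ml).
  by move=> /(mpre); apply; exact: m_tval.
 - by move=> t _; exact: ssum_ge0.
 - have := m_ssum (m_sect (h := fun a x y => g x (a :: y)) a mr).
  by move=> /(mpre); apply; exact: m_tval.
 rewrite ?(IH)//; last 2 first.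
 - exact: (m_sect (h := fun a x y => g x (a :: y))).
 - exact: (m_sect (h := fun a x y => g (a :: x) y)).
 rewrite -big_split/=.
 under eq_bigr => k _.
  rewrite -ge0_muleDr; last 2 first.
  - exact: B_ge0.
  - exact: B_ge0.
  over.
 over.
have mBl k := @m_BB k (n - k) (fun a x y => g (a :: x) y) (fun _ _ _ => g0 _ _) ml.
have mBr k := @m_BB k (n - k) (fun a x y => g x (a :: y)) (fun _ _ _ => g0 _ _) mr.
rewrite ge0_integral_sum//; last 2 first.
- move=> k; apply: emeasurable_funM => //; exact: emeasurable_funD.
- by move=> k a _; rewrite mule_ge0// adde_ge0//; exact: B_ge0.
apply: eq_bigr => k _; rewrite ge0_integralZl//; last 2 first.
- exact: emeasurable_funD.
- by move=> a _; rewrite adde_ge0//; exact: B_ge0.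
rewrite ge0_integralD//.
- by move=> a _; exact: B_ge0.
- by move=> a _; exact: B_ge0.
Qed.

(** The identity C(n, k) / n! = 1 / (k! (n - k)!) separates the two parts, which then range
    independently over all finite sequences. Mecke's formula and the superposition rule [EW_add] are
    special cases. *)
Lemma ge0_integral_ssum g : (forall x y, 0 <= g x y) -> meas2 g ->
 \int[lp V]_s ssum g s = \int[lp V]_x \int[lp V]_y g x y.
move=> g0 mg.
have mgx x : measT (g x).
 by move: mg => /(mpre (h := (pair x))); apply.
rewrite ge0_integral_lp; last 2 first.
- exact: m_ssum.
- by exact: ssum_ge0.
rewrite (@ge0_integral_lp _ _ _ V (fun x => \int[lp V]_y g x y)); last 2 first.
- exact: (@mfubF _ _ _ _ _ (lp V) (fun p => g p.1 p.2)).
- by move=> s; apply: integral_ge0.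
pose a k m := (k`!%:R^-1)%:E * ((m`!%:R^-1)%:E * B k m g).
have a0 k m : 0 <= a k m by rewrite !mule_ge0 ?invr_ge0// B_ge0.
transitivity (\sum_(k <oo) \sum_(m <oo) a k m); last first.
 apply: eq_eseriesr => k _.
 rewrite nneseriesZl; last first.
  by move=> m _; rewrite mule_ge0 ?invr_ge0// B_ge0.
 congr (_ * _).
 under eq_integral => x _ do rewrite (ge0_integral_lp V (mgx x) (g0 x)).
 rewrite integral_nneseries//.
 - apply: eq_eseriesr => m _; rewrite ge0_integralZl//.
  + apply: (@mfubF _ _ _ _ _ (tm m)
    (fun p : k.-tuple T * m.-tuple T => g p.1 p.2)) => //; exact: m_tt.
  + by move=> x _; exact: integral_ge0.
 - move=> m; apply: emeasurable_funM => //.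
  apply: (@mfubF _ _ _ _ _ (tm m)
   (fun p : k.-tuple T * m.-tuple T => g p.1 p.2)) => //; exact: m_tt.
 - move=> m x _; rewrite mule_ge0 ?invr_ge0//.
  exact: integral_ge0.
(* The double series of the [a k m] is summed along the antidiagonals k + m = n; the value 0 fills
   the places where n < k. *)
pose b k n := if (k <= n)%N then a k (n - k)%N else 0.
have b0 k n : 0 <= b k n by rewrite /b; case: ifP.
transitivity (\sum_(n <oo) \sum_(k <oo) b k n); last first.
 rewrite nneseries_interchange//; apply: eq_eseriesr => k _.
 rewrite (nneseries_split 0 k)// add0n big1_seq ?add0e; last first.
  by move=> n; rewrite mem_index_iota /b => /andP[_ /andP[_ nk]]; rewrite leqNgt nk.
 rewrite -nneseries_addn//; apply: eq_eseriesr => n _.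
 by rewrite /b leq_addl addnK.
apply: eq_eseriesr => n _.
rewrite integral_ssum_tuple// (nneseries_split 0 n.+1)// add0n.
rewrite eseries0 ?adde0; last first.
 by move=> k nk _; rewrite /b leqNgt nk.
rewrite big_mkord ge0_sume_distrr; last first.
 by move=> k _; rewrite mule_ge0 ?lee_fin// B_ge0.
apply: eq_bigr => k _; have kn : (k <= n)%N by rewrite -ltnS.
rewrite /b kn /a !muleA; congr (_%:E * _).
rewrite -[in LHS](bin_fact kn); field.
by rewrite !pnatr_eq0 -!lt0n !fact_gt0 bin_gt0.
Qed.

End splitsum_lp.

(** * Integrable real functions *)

Section real_integral.
Context d (T : measurableType d) (R : realType).
Variable m : {measure set T -> \bar R}.
Implicit Types f g : T -> R.

Definition L1 f := m.-integrable setT (EFin \o f).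

Lemma EFin_Rint f : L1 f ->
 ((\int[m]_x f x)%R)%:E = (\int[m]_x (f x)%:E)%E.
by move=> fi; rewrite fineK//; exact: integrable_fin_num. Qed.

Lemma L1_measurable f : L1 f -> measT f.
by move=> /measurable_int/mEFinP. Qed.

Lemma le_L1 f g : measT f ->
 (forall x, `|f x| <= g x) -> L1 g -> L1 f.
move=> mf fg gi; apply: (le_integrable _ _ _ gi) => //.
 exact/mEFinP.
by move=> x _; rewrite lee_fin (le_trans (fg x))// ler_norm.
Qed.

Lemma L1D f g : L1 f -> L1 g ->
 L1 (fun x => f x + g x).
by move=> fi gi; have := integrableD measurableT fi gi. Qed.

Lemma L1B f g : L1 f -> L1 g ->
 L1 (fun x => f x - g x).
by move=> fi gi; have := integrableB measurableT fi gi. Qed.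

Lemma L1Z c f : L1 f -> L1 (fun x => c * f x).
by move=> fi; have := integrableZl measurableT c fi. Qed.

Lemma L1N f : L1 f -> L1 (fun x => - f x).
by move=> /(L1Z (-1)); apply: eq_integrable => // x _ /=; rewrite mulN1r.
Qed.

Lemma eq_L1 f g : (forall x, f x = g x) -> L1 f -> L1 g.
by move=> fg; apply: eq_integrable => // x _ /=; rewrite fg. Qed.

Lemma L1_norm f : L1 f -> L1 (fun x => `|f x|).
by move=> /integrable_norm. Qed.

Lemma eq_rint f g : (forall x, f x = g x) ->
 (\int[m]_x f x = \int[m]_x g x)%R.
by move=> fg; apply: eq_Rintegral => x _. Qed.

Lemma RintD f g : L1 f -> L1 g ->
 (\int[m]_x (f x + g x) = \int[m]_x f x + \int[m]_x g x)%R.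
by move=> fi gi; rewrite RintegralD. Qed.

Lemma RintB f g : L1 f -> L1 g ->
 (\int[m]_x (f x - g x) = \int[m]_x f x - \int[m]_x g x)%R.
by move=> fi gi; rewrite RintegralB. Qed.

Lemma RintZ c f : L1 f ->
 (\int[m]_x (c * f x) = c * \int[m]_x f x)%R.
by move=> fi; rewrite RintegralZl. Qed.

Lemma Rint0 : (\int[m]_x (0 : R) = 0)%R.
by rewrite /Rintegral integral0. Qed.

Lemma RintN f : L1 f -> (\int[m]_x (- f x) = - \int[m]_x f x)%R.
move=> fi; rewrite -mulN1r -RintZ//; apply: eq_rint => x; by rewrite mulN1r.
Qed.

Lemma Rint_ge0 f : (forall x, 0 <= f x) -> 0 <= (\int[m]_x f x)%R.
by move=> f0; apply: Rintegral_ge0. Qed.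

Lemma le_Rint f g : L1 f -> L1 g -> (forall x, f x <= g x) ->
 (\int[m]_x f x <= \int[m]_x g x)%R.
by move=> fi gi fg; apply: le_Rintegral. Qed.

Lemma norm_Rint f : L1 f ->
 `|(\int[m]_x f x)%R| <= (\int[m]_x `|f x|)%R.
exact: le_normr_Rintegral. Qed.

Lemma ge0_L1P f : measT f -> (forall x, 0 <= f x) ->
 (\int[m]_x (f x)%:E < +oo)%E -> L1 f.
move=> mf f0 foo; apply/integrableP; split; first exact/mEFinP.
by under eq_integral => x _ do rewrite /= ger0_norm//.
Qed.

Lemma L1_lty f : L1 f -> (forall x, 0 <= f x) ->
 (\int[m]_x (f x)%:E < +oo)%E.
move=> /integrableP[_] foo f0; apply: le_lt_trans foo.
by under [leRHS]eq_integral => x _ do rewrite /= ger0_norm//.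
Qed.

Lemma Rint_cvg (f_ : nat -> T -> R) f g : (forall n, measT (f_ n)) ->
 measT f -> (forall x, f_ n x @[n --> \oo] --> f x) ->
 L1 g -> (forall n x, `|f_ n x| <= g x) ->
 (\int[m]_x f_ n x)%R @[n --> \oo] --> (\int[m]_x f x)%R.
move=> mf_ mf cf gi fg.
have fi n : L1 (f_ n) by exact: le_L1.
have [] := @dominated_convergence _ _ _ m setT measurableT
  (fun n x => (f_ n x)%:E) (EFin \o f) (EFin \o g).
- by move=> n; exact/mEFinP.
- exact/mEFinP.
- by apply/aeW => x _; apply: cvg_EFin; [exact: nearW|exact: cf].
- by [].
- by apply/aeW => x n _; rewrite lee_fin.
move=> fi' _; rewrite -(EFin_Rint fi').
under [X in X @ _ --> _]eq_fun => n do rewrite -(EFin_Rint (fi n)).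
by move=> /fine_cvg.
Qed.

End real_integral.

Lemma m_Rint_param d1 d2 (X : measurableType d1) (Y : measurableType d2)
  (R : realType) (m : {sigma_finite_measure set Y -> \bar R}) (g : X -> Y -> R) :
 measT (fun p : X * Y => g p.1 p.2) ->
 measT (fun x => (\int[m]_y g x y)%R).
move=> mg; apply: mfcomp => //.

under eq_fun do rewrite integralE.
have mG : measT (fun p : X * Y => (g p.1 p.2)%:E).
 exact/mEFinP.
apply: emeasurable_funB.
- have := @mfubF _ _ X Y R m _ (measurable_funepos mG)
  (funepos_ge0 _).
 by apply: eq_measurable_fun => x _; apply: eq_integral => y _; rewrite ?funeposE ?funenegE.
- have := @mfubF _ _ X Y R m _ (measurable_funeneg mG)
  (funeneg_ge0 _).
 by apply: eq_measurable_fun => x _; apply: eq_integral => y _; rewrite ?funeposE ?funenegE.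
Qed.

Lemma m_section d1 d2 d3 (X : measurableType d1) (Y : measurableType d2)
  (Z : measurableType d3) (g : X -> Y -> Z) :
 measT (fun p : X * Y => g p.1 p.2) ->
 forall x, measT (g x).
move=> mg x; apply: (mpre (h := pair x) mg).
by [].
Qed.

Section real_splitsum.
Context d (T : measurableType d) (R : realType).
Variable V : sfmeas T R.
Variables (g : seq T -> seq T -> R) (h1 h2 : seq T -> R).
Hypotheses (mg : measT (fun p : seq T * seq T => g p.1 p.2))
 (h1i : L1 (lp V) h1) (h2i : L1 (lp V) h2)
 (h10 : forall x, 0 <= h1 x) (h20 : forall x, 0 <= h2 x)
 (gh : forall x y, `|g x y| <= h1 x * h2 y).

Lemma L1_section x : L1 (lp V) (g x).
apply: le_L1 (L1Z (h1 x) h2i).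
 exact: m_section.
by [].
Qed.

Lemma L1_iter : L1 (lp V) (fun x => (\int[lp V]_y g x y)%R).
apply: (@le_L1 _ _ _ _ _ (fun x => (\int[lp V]_y h2 y)%R * h1 x)).
- exact: m_Rint_param.
- move=> x; apply: le_trans (norm_Rint (L1_section x)) _.
 rewrite mulrC -RintZ//; apply: le_Rint.
 + exact/L1_norm/L1_section.
 + exact: L1Z.
 + by [].
- exact: L1Z.
Qed.

End real_splitsum.

Section real_splitsum2.
Context d (T : measurableType d) (R : realType).
Variable V : sfmeas T R.
Variables (h1 h2 : seq T -> R).
Hypotheses (h1i : L1 (lp V) h1) (h2i : L1 (lp V) h2)
 (h10 : forall x, 0 <= h1 x) (h20 : forall x, 0 <= h2 x).

Let ssum_EFin (g : seq T -> seq T -> R) s :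
 (ssum g s)%:E = ssum (fun x y => (g x y)%:E) s.
by rewrite ssum_morph. Qed.

Let mEF (g : seq T -> seq T -> R) :
 measT (fun p : seq T * seq T => g p.1 p.2) ->
 measT (fun p : seq T * seq T => (g p.1 p.2)%:E).
by move=> mg; exact/mEFinP. Qed.

Lemma m_real_ssum (g : seq T -> seq T -> R) :
 measT (fun p : seq T * seq T => g p.1 p.2) ->
 measT (ssum g).
move=> mg0; have mg := m_ssum (g := fun x y => (g x y)%:E) (mEF mg0).
apply/mEFinP.
by apply: eq_measurable_fun mg => s _; rewrite /=.
Qed.

Let ge0_ssum (g : seq T -> seq T -> R) :
 measT (fun p : seq T * seq T => g p.1 p.2) ->
 (forall x y, 0 <= g x y) -> (forall x y, `|g x y| <= h1 x * h2 y) ->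
 L1 (lp V) (ssum g) /\
 (\int[lp V]_s ssum g s = \int[lp V]_x \int[lp V]_y g x y)%R.
move=> mg g0 gh.
have E : (\int[lp V]_s (ssum g s)%:E =
  (\int[lp V]_x \int[lp V]_y g x y)%R%:E)%E.
 under eq_integral do rewrite ssum_EFin.
 rewrite ge0_integral_ssum//; last exact: mEF.
 rewrite (EFin_Rint (L1_iter mg h1i h2i gh)).
 apply: eq_integral => x _.
 by rewrite (EFin_Rint (L1_section mg h2i gh x)).
split; last by rewrite {}/Rintegral E.
apply: ge0_L1P.
- exact: m_real_ssum.
- move=> s; rewrite -lee_fin ssum_EFin; exact: ssum_ge0.
- by rewrite E ltry.
Qed.

Variable g : seq T -> seq T -> R.
Hypotheses (mg : measT (fun p : seq T * seq T => g p.1 p.2))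
 (gh : forall x y, `|g x y| <= h1 x * h2 y).

Let gp x y := Num.max (g x y) 0.
Let gn x y := Num.max (- g x y) 0.

Let gE x y : g x y = gp x y - gn x y.
by rewrite /gp /gn; case: leP; case: (leP 0); lra. Qed.

Let mgp : measT (fun p : seq T * seq T => gp p.1 p.2).
exact: measurable_maxr. Qed.

Let mgn : measT (fun p : seq T * seq T => gn p.1 p.2).
by apply: measurable_maxr => //; exact: mfcomp. Qed.

Let gph x y : `|gp x y| <= h1 x * h2 y.
rewrite ger0_norm ?le_max ?lexx ?orbT// ge_max mulr_ge0// andbT.
by rewrite (le_trans _ (gh x y))// ler_norm.
Qed.

Let gnh x y : `|gn x y| <= h1 x * h2 y.
rewrite ger0_norm ?le_max ?lexx ?orbT// ge_max mulr_ge0// andbT.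
by rewrite (le_trans _ (gh x y))// -normrN ler_norm.
Qed.

(** Positive and negative parts of [g] obey the same product bound, so all the integrals in the
    nonnegative formula are finite and may be subtracted. *)
Lemma integral_real_ssum :
 L1 (lp V) (ssum g) /\
 (\int[lp V]_s ssum g s = \int[lp V]_x \int[lp V]_y g x y)%R.
have [pi pE] := ge0_ssum mgp (fun x y => ltac:(by rewrite le_max lexx orbT)) gph.
have [ni nE] := ge0_ssum mgn (fun x y => ltac:(by rewrite le_max lexx orbT)) gnh.
have sE s : ssum g s = ssum gp s - ssum gn s.
 rewrite [- _](ssum_morph); last by move=> x y; rewrite opprD.
 by rewrite -ssum_add; apply: eq_ssum .
split.
 exact: eq_L1 (L1B pi ni) .
rewrite (eq_rint _ sE) RintB// pE nE -RintB; last 2 first.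
- exact: (L1_iter mgp h1i h2i).
- exact: (L1_iter mgn h1i h2i).
apply: eq_rint => x; rewrite -RintB.
- exact: eq_rint .
- exact: (L1_section mgp h2i).
- exact: (L1_section mgn h2i).
Qed.

End real_splitsum2.

(** * Sums over the removal of one entry *)

Fixpoint remsum (T : Type) (Z : nmodType) (g : T -> seq T -> Z) (s : seq T) : Z :=
 match s with
 | [::] => 0
 | a :: s' => g a s' + remsum (fun z r => g z (a :: r)) s'
 end.

Definition only_one (T : Type) (Z : nmodType) (h : T -> Z) (s : seq T) : Z :=
 if s is [:: a] then h a else 0.

Section remsum_theory.
Variables (T : Type) (Z : nmodType).
Implicit Types g h : T -> seq T -> Z.

Lemma eq_remsum g h s : (forall z r, g z r = h z r) -> remsum g s = remsum h s.
by elim: s g h => [|a s IH] g h gh //=; rewrite gh (IH _ (fun z r => h z (a :: r))).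
Qed.

Lemma remsum_morph (Z' : nmodType) (phi : Z -> Z') g s : phi 0 = 0 ->
 {morph phi : x y / x + y} -> phi (remsum g s) = remsum (fun z r => phi (g z r)) s.
by move=> p0 pD; elim: s g => [|a s IH] g //; rewrite pD IH. Qed.

Lemma ssum_none (g : seq T -> Z) s :
 ssum (fun x y => if x is [::] then g y else 0) s = g s.
elim: s g => [|a s IH] g //=; rewrite IH.
suff -> : ssum (fun _ _ : seq T => 0 : Z) s = 0 by rewrite add0r.
by elim: s {IH} => //= ? s ->; rewrite addr0.
Qed.

(** Removing an entry is a splitting whose first part has length one; this reduces Mecke's formula
    to the splitting formula. *)
Lemma remsum_ssum g s :
 remsum g s = ssum (fun x y => only_one (g^~ y) x) s.
elim: s g => [|a s IH] g //=; rewrite IH; congr (_ + _).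
by rewrite - ssum_none.
Qed.

Lemma remsum_cat g s t :
 remsum g (s ++ t) = remsum (fun z r => g z (r ++ t)) s + remsum (fun z r => g z (s ++ r)) t.
by elim: s g => [|a s IH] g /=; rewrite ?add0r// IH addrA.
Qed.

End remsum_theory.

Lemma remsumZ (R : pzRingType) (T : Type) (g : T -> seq T -> R) s c :
 remsum (fun z r => c * g z r) s = c * remsum g s.
by rewrite [RHS](remsum_morph) ?mulr0// => x y; rewrite mulrDr. Qed.

(** * Weighted integrals over configurations and Mecke's formula *)

Section weights.
Context d (T : measurableType d) (R : realType).
Implicit Types W : T -> R.

Definition wprod W (s : seq T) : R := \prod_(x <- s) W x.

Lemma wprod_nil W : wprod W [::] = 1. Proof. by rewrite /wprod big_nil. Qed.

Lemma wprod_cons W a s : wprod W (a :: s) = W a * wprod W s.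
by rewrite /wprod big_cons. Qed.

Lemma wprod_cat W s t : wprod W (s ++ t) = wprod W s * wprod W t.
by rewrite /wprod big_cat. Qed.

Lemma wprodM W1 W2 s : wprod (fun x => W1 x * W2 x) s = wprod W1 s * wprod W2 s.
by rewrite /wprod big_split. Qed.

Lemma norm_wprod W s : `|wprod W s| = wprod (fun x => `|W x|) s.
by rewrite normr_prod. Qed.

Lemma wprod_ge0 W s : (forall x, 0 <= W x) -> 0 <= wprod W s.
by move=> W0; rewrite prodr_ge0. Qed.

Lemma m_wprod W : measT W -> measT (wprod W).
move=> mW; apply/m_fun_seqP => n.
rewrite (_ : (fun _ => _) = fun t => \prod_(i < n) W (tnth t i)).
 by apply: measurable_prod => i _; apply: mfcomp => //; exact: measurable_tnth.
by apply/funext => t; rewrite /wprod big_tuple.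
Qed.

Variable V : sfmeas T R.

Lemma integral_wprod_tuple W n : measT W -> (forall x, 0 <= W x) ->
 L1 V W ->
 (\int[tuple_measure V n]_t (wprod W t)%:E = ((\int[V]_x W x)%R ^+ n)%:E)%E.
move=> mW W0 iW; elim: n => [|n IH].
 rewrite /= integral_dirac//; last first.
  by apply/mEFinP; apply: (mpre (m_wprod mW));
   exact: m_tval.
 by rewrite diracE in_setT mul1e wprod_nil.
rewrite int_tupleS; last 2 first.
- by apply/mEFinP; apply: (mpre (m_wprod mW));
  exact: m_tval.
- by move=> t; rewrite lee_fin wprod_ge0.
rewrite exprS EFinM EFin_Rint//.
rewrite -(integralZr measurableT iW); apply: eq_integral => x _.
rewrite -IH -ge0_integralZl//; last 3 first.
- by apply/mEFinP; apply: (mpre (m_wprod mW));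
  exact: m_tval.
- by move=> t _; rewrite lee_fin wprod_ge0.
- by rewrite lee_fin.
by apply: eq_integral => t _; rewrite wprod_cons.
Qed.

(** The integral is the exponential series at the integral of [W], the term of order n being its
    n-th power over n!. *)
Lemma L1_wprod W : measT W -> (forall x, 0 <= W x) ->
 L1 V W -> L1 (lp V) (wprod W).
move=> mW W0 iW; apply: ge0_L1P.
- exact: m_wprod.
- by move=> s; exact: wprod_ge0.
rewrite ge0_integral_lp; last 2 first.
- by apply/mEFinP; exact: m_wprod.
- by move=> s; rewrite lee_fin wprod_ge0.
under eq_eseriesr => n _ do rewrite integral_wprod_tuple// -EFinM.
set x := (\int[V]_x W x)%R; have x0 : 0 <= x by exact: Rint_ge0.
have cx := is_cvg_series_exp_coeff x.
rewrite (_ : (fun n => \sum_(0 <= k < n) _)%E = EFin \o series (exp_coeff x)).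
 by rewrite EFin_lim// ltry.
apply/funext => n; rewrite /series/= -sumEFin; apply: eq_bigr => i _.
by rewrite mulrC.
Qed.

(** Later [kap] is the diagonal of the kernel. Hadamard's inequality puts the correlation functions
    into this class, which ensures absolute convergence against every weight that makes [kap]
    integrable. *)
Definition kdom (kap : T -> R) (f : seq T -> R) :=
 exists2 C, 0 <= C & forall s, `|f s| <= C * wprod kap s.

(** The weight may be negative: with -w it is an alternating series, with w an integral over the
    configurations of a window. *)
Definition EW W (f : seq T -> R) : R := (\int[lp V]_s (f s * wprod W s))%R.

Variable kap : T -> R.
Hypotheses (mkap : measT kap) (kap0 : forall x, 0 <= kap x).

Definition gweight W :=
 measT W /\ L1 V (fun x => kap x * W x).

Lemma L1_kap W C : gweight W ->
 L1 (lp V) (fun s => C * wprod (fun x => kap x * `|W x|) s).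
move=> [mW iW]; apply: L1Z; apply: L1_wprod.
- by apply: mfM ; exact: mfcomp.
- by move=> x; rewrite mulr_ge0.
- apply: eq_L1 (L1_norm iW) => x.
 by rewrite normrM ger0_norm.
Qed.

Lemma kdom_le W f C s : (forall s, `|f s| <= C * wprod kap s) ->
 `|f s * wprod W s| <= C * wprod (fun x => kap x * `|W x|) s.
by move=> fC; rewrite normrM norm_wprod wprodM mulrA ler_wpM2r// wprod_ge0.
Qed.

Lemma L1_kdom W f : gweight W -> measT f -> kdom kap f ->
 L1 (lp V) (fun s => f s * wprod W s).
move=> gW mf [C C0 fC]; apply: le_L1 (L1_kap C gW).
- by apply: mfM => //; apply: m_wprod; exact: gW.1.
- by move=> s; exact: kdom_le.
Qed.

Lemma EWD W f g : gweight W -> measT f -> kdom kap f ->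
 measT g -> kdom kap g ->
 EW W (fun s => f s + g s) = EW W f + EW W g.
move=> gW mf fk mg gk; rewrite /EW -RintD; last 2 first.
- exact: L1_kdom.
- exact: L1_kdom.
by apply: eq_rint => s; rewrite mulrDl.
Qed.

Lemma EWZ W f c : gweight W -> measT f -> kdom kap f ->
 EW W (fun s => c * f s) = c * EW W f.
move=> gW mf fk; rewrite /EW -RintZ; last exact: L1_kdom.
by apply: eq_rint => s; rewrite mulrA.
Qed.

Lemma EW_ext W f g : (forall s, f s = g s) -> EW W f = EW W g.
by move=> fg; apply: eq_rint => s; rewrite fg. Qed.

Lemma EW_ge0 W f : (forall x, 0 <= W x) -> (forall s, 0 <= f s) -> 0 <= EW W f.
by move=> W0 f0; apply: Rint_ge0 => s; rewrite mulr_ge0// wprod_ge0. Qed.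

Lemma le_EW W f g : (forall x, 0 <= W x) -> gweight W ->
 measT f -> kdom kap f ->
 measT g -> kdom kap g -> (forall s, f s <= g s) -> EW W f <= EW W g.
move=> W0 gW mf fk mg gk fg; apply: le_Rint; try exact: L1_kdom.
by move=> s; rewrite ler_wpM2r// wprod_ge0.
Qed.

Definition EWbound W := (\int[lp V]_s wprod (fun x => kap x * `|W x|)%R s)%R.

Lemma EWbound_ge0 W : 0 <= EWbound W.
by apply: Rint_ge0 => s; apply: wprod_ge0 => x; rewrite mulr_ge0. Qed.

Lemma norm_EW W (f : seq T -> R) C : gweight W -> measT f -> 0 <= C ->
 (forall s, `|f s| <= C * wprod kap s) -> `|EW W f| <= C * EWbound W.
move=> gW mf C0 fC; have fk : kdom kap f by exists C.
apply: le_trans (norm_Rint (L1_kdom gW mf fk)) _.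
rewrite -RintZ; last first.
 by apply: eq_L1 (L1_kap 1 gW) => s; rewrite mul1r.
apply: le_Rint.
- exact/L1_norm/L1_kdom.
- exact: L1_kap.
- by move=> s; exact: kdom_le.
Qed.

Definition kdom2 (f : seq T -> seq T -> R) :=
 exists2 C, 0 <= C & forall x y, `|f x y| <= C * (wprod kap x * wprod kap y).

Lemma m_EW (d' : measure_display) (X : measurableType d') W (f : X -> seq T -> R) :
 measT W -> measT (fun p : X * seq T => f p.1 p.2) ->
 measT (fun x => EW W (f x)).
move=> mW mf; apply: (@m_Rint_param _); apply: mfM => //.
exact: (mpre (m_wprod mW)).
Qed.

Lemma kdom_EW W (f : seq T -> seq T -> R) : gweight W ->
 measT (fun p : seq T * seq T => f p.1 p.2) -> kdom2 f ->
 kdom kap (fun x => EW W (f x)).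
move=> gW mf [C C0 fC]; exists (C * EWbound W); first by rewrite mulr_ge0 ?EWbound_ge0.
move=> x; rewrite -mulrA [_ * wprod _ _]mulrC mulrA; apply: norm_EW => //.
- exact: m_section.
- by rewrite mulr_ge0// wprod_ge0.
- by move=> s; rewrite -mulrA.
Qed.

Lemma EW_ssum W1 W2 (f : seq T -> seq T -> R) :
 gweight W1 -> gweight W2 ->
 measT (fun p : seq T * seq T => f p.1 p.2) -> kdom2 f ->
 L1 (lp V) (ssum (fun x y => f x y * (wprod W1 x * wprod W2 y))) /\
 (\int[lp V]_s ssum (fun x y => f x y * (wprod W1 x * wprod W2 y))%R s)%R =
 EW W1 (fun x => EW W2 (f x)).
move=> g1 g2 mf [C C0 fC].
have mw1 : measT (fun p : seq T * seq T => wprod W1 p.1).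
 exact: (mpre (m_wprod g1.1)).
have mw2 : measT (fun p : seq T * seq T => wprod W2 p.2).
 exact: (mpre (m_wprod g2.1)).
have h10 x : 0 <= C * wprod (fun z => kap z * `|W1 z|) x.
 by rewrite mulr_ge0// wprod_ge0// => z; rewrite mulr_ge0.
have h20 x : 0 <= 1 * wprod (fun z => kap z * `|W2 z|) x.
 by rewrite mulr_ge0// wprod_ge0// => z; rewrite mulr_ge0.
have dom x y : `|f x y * (wprod W1 x * wprod W2 y)| <=
  (C * wprod (fun z => kap z * `|W1 z|) x) * (1 * wprod (fun z => kap z * `|W2 z|) y).
 rewrite mul1r !wprodM !normrM !norm_wprod.
 apply: (@le_trans _ _ ((C * (wprod kap x * wprod kap y)) *
  (wprod (fun x0 => `|W1 x0|) x * wprod (fun x0 => `|W2 x0|) y))).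
  by rewrite ler_wpM2r// mulr_ge0// wprod_ge0.
 by apply: eq_ler; ring.
have mg : measT (fun p : seq T * seq T =>
  f p.1 p.2 * (wprod W1 p.1 * wprod W2 p.2)).
 by apply: mfM => //; exact: mfM.
have [i ->] := @integral_real_ssum _ _ _ V _ _ (L1_kap C g1) (L1_kap 1 g2)
 h10 h20 (fun x y => f x y * (wprod W1 x * wprod W2 y)) mg dom.
split=> //; apply: eq_rint => x; rewrite mulrC -RintZ; last first.
 apply: L1_kdom => //; first exact: m_section.
 exists (C * wprod kap x); first by rewrite mulr_ge0 ?wprod_ge0.
 by move=> s; rewrite -mulrA.
by apply: eq_rint => y; ring.
Qed.

Definition symf (f : seq T -> R) := forall s t, perm_eq s t -> f s = f t.

(** In the expanded product of the sums [W1 x + W2 x] every entry chooses one of the two weights;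
    symmetry of [f] lets the chosen entries be gathered. *)
Lemma ssum_wprod W1 W2 (f : seq T -> R) s : symf f ->
 ssum (fun x y => f (x ++ y) * (wprod W1 x * wprod W2 y)) s =
 f s * wprod (fun x => W1 x + W2 x) s.
elim: s f => [|a s IH] f fs; first by rewrite /= !wprod_nil !mulr1.
have fas : symf (fun s => f (a :: s)) by move=> u v uv; apply: fs; rewrite perm_cons.
rewrite /= wprod_cons mulrDl mulrDr mulrCA [in X in _ = _ + X]mulrCA -!(IH _ fas) -!ssumZ.
congr (_ + _); apply: eq_ssum => x y; rewrite wprod_cons; first by ring.
rewrite (@fs (x ++ a :: y) (a :: x ++ y)); first by ring.
by rewrite -cat1s perm_catCA.
Qed.

(** Superposition of independent parts. With opposite weights the sum is 0 and by [EW0] only the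
    empty sequence survives, which is inclusion-exclusion. *)
Lemma EW_add W1 W2 (f : seq T -> R) : symf f -> gweight W1 -> gweight W2 ->
 measT f -> kdom kap f ->
 EW (fun x => W1 x + W2 x) f = EW W1 (fun x => EW W2 (fun y => f (x ++ y))).
move=> fs g1 g2 mf [C C0 fC].
have mg : measT (fun p : seq T * seq T => f (p.1 ++ p.2)).
 by apply: (mpre mf); exact: m_seq_cat.
have dom : kdom2 (fun x y => f (x ++ y)).
 by exists C => // x y; rewrite -wprod_cat.
have [_ <-] := EW_ssum g1 g2 mg dom.
by apply: eq_rint => s; rewrite ssum_wprod.
Qed.

Lemma integral_lp_size k (f : seq T -> \bar R) : measT f ->
 (forall s, 0 <= f s)%E -> (forall s, size s != k -> f s = 0%E) ->
 (\int[lp V]_s f s = (k`!%:R^-1)%:E * \int[tuple_measure V k]_t f (tval t))%E.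
move=> mf f0 fk; rewrite ge0_integral_lp//.
have t0 n : (0 <= (n`!%:R^-1)%:E * \int[tuple_measure V n]_t f (tval t))%E.
 by rewrite mule_ge0//; apply: integral_ge0.
rewrite (@nneseriesD1 _ _ k)//.
rewrite eseries0 ?adde0// => n _ /= nk.
rewrite integral0_eq ?mule0// => t _; apply: fk.
by rewrite size_tuple.
Qed.

(** The empty product is 1 and every other product vanishes, so the integrand is [f [::]] times the
    indicator of the empty sequence, a set of mass 1. *)
Lemma EW0 (f : seq T -> R) : EW (fun=> 0) f = f [::].
have mn : measT (fun s : seq T => (nilp s)%:R : R).
 apply/m_fun_seqP => -[|n].
  rewrite (_ : (fun _ => _) = cst 1)//.
  by apply/funext => t; rewrite tuple0.
 rewrite (_ : (fun _ => _) = cst 0)//.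
 by apply/funext => t; rewrite (tuple_eta t).
have I : (\int[lp V]_s ((nilp s)%:R)%:E = 1 :> \bar R)%E.
 rewrite (@integral_lp_size 0%N)//.
 - rewrite /= integral_dirac//.
   by rewrite diracE in_setT mul1e invr1 mul1e.
  apply/mEFinP; apply: (mpre mn); exact: m_tval.
 - exact/mEFinP.
 - by case.
have ni : L1 (lp V) (fun s => (nilp s)%:R).
 apply: ge0_L1P => //; by rewrite I ltry.
transitivity (\int[lp V]_s (f [::] * (nilp s)%:R))%R.
 apply: eq_rint => -[|a s]; first by rewrite wprod_nil.
 by rewrite wprod_cons mul0r mulr0 mulr0.
by rewrite RintZ// /Rintegral I mulr1.
Qed.

Lemma m_only_one d' (X : measurableType d') (h : X -> T -> R) :
 measT (fun p : X * T => h p.1 p.2) ->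
 measT (fun p : X * seq T => only_one (h p.1) p.2).
move=> mh; apply: (@m_fun_seq2 _ _ _ _ _ _ (fun x s => only_one (h x) s)).
move=> [|[|n]].
- by rewrite (_ : (fun _ => _) = cst 0)//; apply/funext => -[x t]; rewrite tuple0.
- rewrite (_ : (fun _ => _) = (fun p => h p.1 (thead p.2))).
  apply: (mpre (h := fun p : X * 1.-tuple T => (p.1, thead p.2)) mh).
  apply: mfpair; first by [].
  by apply: mfcomp => //; exact: measurable_tnth.
 by apply/funext => -[x t]; case/tupleP: t => a t; rewrite tuple0.
- rewrite (_ : (fun _ => _) = cst 0)//; apply/funext => -[x t] /=.
 rewrite (tuple_eta t) /=; case: behead (size_behead t) => //=.
 by rewrite size_tuple.
Qed.

Lemma integral_only_one (h : T -> R) : L1 V h ->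
 L1 (lp V) (only_one h) /\
 (\int[lp V]_s only_one h s = \int[V]_x h x)%R.
have ge0 (p : T -> R) : L1 V p -> (forall x, 0 <= p x) ->
  L1 (lp V) (only_one p) /\
  (\int[lp V]_s only_one p s = \int[V]_x p x)%R.
 move=> pi p0; have mp := L1_measurable pi.
 have mo : measT (only_one p).
  have := @m_only_one _ unit (fun=> p).
  move=> /(_ (mpre mp measurable_snd)).
  move=> mo; exact: (@m_section _ _ _ _ _ _ (fun (_ : unit) s => only_one p s) mo).
 have o0 s : 0 <= only_one p s by case: s => [|a []] //=.
 have I : (\int[lp V]_s (only_one p s)%:E = (\int[V]_x p x)%R%:E)%E.
  rewrite (@integral_lp_size 1%N)//; last 2 first.
  - exact/mEFinP.
  - by case=> [|a []].
  rewrite factS invr1 mul1e int_tupleS; last 2 first.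
  - apply/mEFinP; apply: (mpre mo); exact: m_tval.
  - by move=> t; rewrite lee_fin.
  rewrite EFin_Rint//; apply: eq_integral => x _.
  rewrite /= integral_dirac//; first by rewrite diracE in_setT mul1e.
  apply/mEFinP.
  apply: (mpre (h := fun t : 0.-tuple T => x :: t) mo).
  apply: (mpre (h := fun t : 0.-tuple T => (x, tval t)) (@m_seq_cons _ T)).
  by apply: mfpair => //; exact: m_tval.
 split; last by rewrite {}/Rintegral I.
 by apply: ge0_L1P => //; rewrite I ltry.
move=> hi; have mh := L1_measurable hi.
have pi : L1 V (fun x => Num.max (h x) 0).
 apply: le_L1 (L1_norm hi); first exact: measurable_maxr.
 move=> x; rewrite ger0_norm ?le_max ?lexx ?orbT// ge_max normr_ge0 andbT.
 exact: ler_norm.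
have ni : L1 V (fun x => Num.max (- h x) 0).
 apply: le_L1 (L1_norm hi).
  by apply: measurable_maxr => //; exact: mfcomp.
 move=> x; rewrite ger0_norm ?le_max ?lexx ?orbT// ge_max normr_ge0 andbT.
 by rewrite -normrN ler_norm.
have [i1 e1] := ge0 _ pi (fun => ltac:(by rewrite le_max lexx orbT)).
have [i2 e2] := ge0 _ ni (fun => ltac:(by rewrite le_max lexx orbT)).
have hE x : h x = Num.max (h x) 0 - Num.max (- h x) 0.
 by case: (leP); case: (leP 0); lra.
have oE s : only_one (fun x => Num.max (h x) 0) s -
  only_one (fun x => Num.max (- h x) 0) s = only_one h s.
 by case: s => [|a []] /=; rewrite ?subr0//.
split; first exact: eq_L1 (L1B i1 i2).
rewrite -(eq_rint _ oE) RintB// e1 e2 -RintB//.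
exact: eq_rint .
Qed.

Lemma ssum_wprod_same W (f : seq T -> seq T -> R) s :
 ssum (fun x y => f x y * (wprod W x * wprod W y)) s =
 ssum f s * wprod W s.
elim: s f => [|a s IH] f; first by rewrite /= !wprod_nil !mulr1.
rewrite /= wprod_cons mulrCA mulrDl -!IH mulrDr -!ssumZ.
by congr (_ + _); apply: eq_ssum => x y; rewrite wprod_cons; ring.
Qed.

(** Splitting formula for splittings with a one-point first part: the removed point becomes an
    independent variable, integrated with its own weight. *)
Lemma mecke W (g : T -> seq T -> R) C : gweight W ->
 measT (fun p : T * seq T => g p.1 p.2) -> 0 <= C ->
 (forall z r, `|g z r| <= C * (kap z * wprod kap r)) ->
 [/\ L1 (lp V) (fun s => remsum g s * wprod W s),
   L1 V (fun x => W x * EW W (g x)) &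
   EW W (remsum g) = (\int[V]_x (W x * EW W (g x)))%R].
move=> gW mg C0 gC.
pose f x y := only_one (g^~ y) x.
have mf : measT (fun p : seq T * seq T => f p.1 p.2).
 apply: (mpre (h := fun p : seq T * seq T => (p.2, p.1))
  (@m_only_one _ (seq T) (fun y a => g a y) _)).
  apply: (mpre (h := fun p : seq T * T => (p.2, p.1)) mg).
  exact: mfpair.
 exact: mfpair.
have fC : kdom2 f.
 exists C => // -[|a [|b x]] y; rewrite /= ?normr0 ?mulr_ge0 ?wprod_ge0//.
 by rewrite wprod_cons wprod_nil mulr1.
have E s : ssum (fun x y => f x y * (wprod W x * wprod W y)) s =
  remsum g s * wprod W s.
 by rewrite ssum_wprod_same remsum_ssum.
have [i I] := EW_ssum gW gW mf fC.
have gk x : kdom kap (g x).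
 exists (C * kap x); first exact: mulr_ge0.
 by move=> s; rewrite -mulrA.
have iW : L1 V (fun x => W x * EW W (g x)).
 apply: (@le_L1 _ _ _ _ _ (fun x => C * EWbound W * `|kap x * W x|)).
 - apply: mfM; first exact: gW.1.
  by apply: m_EW => //; exact: gW.1.
 - move=> x; rewrite !normrM (ger0_norm (kap0 x)).
  rewrite [leRHS](_ : _ = `|W x| * ((C * kap x) * EWbound W)); last by ring.
  apply: ler_wpM2l => //; apply: norm_EW => //.
  + exact: m_section.
  + exact: mulr_ge0.
  + by move=> s; rewrite -mulrA.
 - apply: L1Z; exact: L1_norm gW.2.
split=> //; first exact: eq_L1.
rewrite /EW -(eq_rint _ E) I.
have [_ <-] := integral_only_one iW.
apply: eq_rint => -[|a [|b x]].
- by rewrite /EW (eq_rint _ (g := 0)) ?Rint0 ?mul0r// => s; rewrite mul0r.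
- by rewrite wprod_cons wprod_nil mulr1 mulrC.
- by rewrite /EW (eq_rint _ (g := 0)) ?Rint0 ?mul0r// => s; rewrite mul0r.
Qed.

End weights.

(** * Minors of a kernel *)

Section minors.
Variables (F : comPzRingType) (T : Type) (K : T -> T -> F).

Definition minor_mx n (t : n.-tuple (T * T)) : 'M[F]_n :=
 \matrix_(i, j) K (tnth t i).1 (tnth t j).2.

(** Rows carry the first components and columns the second ones; pairs are needed because the row
    and the column that border a principal minor belong to different points. *)
Definition minor (ps : seq (T * T)) : F := \det (minor_mx (in_tuple ps)).

Definition dup (s : seq T) : seq (T * T) := [seq (x, x) | x <- s].

Lemma minorE n (t : n.-tuple (T * T)) : minor t = \det (minor_mx t).
have H (s : seq (T * T)) n' (en : size s = n') (e : size s == n') :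
  minor s = \det (minor_mx (Tuple e)).
 case: n' / en e => e; congr (\det (minor_mx _)); exact: val_inj.
by case: t => s e; apply: H; exact/eqP.
Qed.

Definition drop_nth n (t : n.+1.-tuple (T * T)) (k : 'I_n.+1) :
 n.-tuple (T * T) := [tuple tnth t (lift k i) | i < n].

(** Expansion along the row of [z]. Deleting the column of entry k leaves its row unmatched; moving
    that row to the top has the sign (-1)^k, against (-1)^(k + 1) for the cofactor, so that every
    term gets the same sign and is again a bordered minor. *)
Lemma minor_expand_tuple n z q (t : n.+1.-tuple (T * T)) :
 minor ((z, q) :: t) = K z q * minor t -
  \sum_(k < n.+1) K z (tnth t k).2 * minor (((tnth t k).1, q) :: drop_nth t k).
have E k : cofactor (minor_mx [tuple of (z, q) :: t]) ord0 (lift ord0 k) =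
  - minor (((tnth t k).1, q) :: drop_nth t k).
 rewrite /cofactor; set M := row' _ _.
 have -> : minor (((tnth t k).1, q) :: drop_nth t k) =
   \det (row_perm (lift_perm ord0 k 1) M).
  rewrite (minorE [tuple of ((tnth t k).1, q) :: drop_nth t k]); congr (\det _).
  apply/matrixP => i j; rewrite !mxE.
  have -> : (tnth [tuple of ((tnth t k).1, q) :: drop_nth t k] i).1 =
    (tnth t (lift_perm ord0 k 1 i)).1.
   case: (unliftP ord0 i) => [i' ->|->].
    by rewrite tnthS tnth_mktuple lift_perm_lift perm1.
   by rewrite lift_perm_id.
  rewrite tnthS; congr (_ _).
  case: (unliftP ord0 j) => [j' ->|->].
   rewrite tnthS tnth_mktuple.
   have -> : lift (lift ord0 k) (lift ord0 j') = lift ord0 (lift k j').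
    by apply: val_inj; rewrite /= /bump ltnS; case: leqP.
   by rewrite tnthS.
  have -> : lift (lift ord0 k) ord0 = ord0 by exact: val_inj.
  by [].
 rewrite -[in LHS](mul1r (\det M)) row_permE det_mulmx det_perm.
 have -> : (-1) ^+ lift_perm ord0 k 1 = (-1) ^+ k :> F.
  by rewrite odd_lift_perm odd_perm1 addbF signr_odd.
 by rewrite mul1r exprS mulN1r mulNr.
rewrite (minorE [tuple of (z, q) :: t]) (expand_det_row _ ord0) big_ord_recl.
congr (_ + _).
 rewrite mxE minorE /cofactor mul1r; congr (_ * \det _).
 by apply/matrixP => i j; rewrite !mxE !tnthS.
rewrite -sumrN; apply: eq_bigr => k _; rewrite E mxE tnthS/= mulrN.
by [].
Qed.

Lemma remsum_tuple n (Z : nmodType) (g : T * T -> seq (T * T) -> Z)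
  (t : n.+1.-tuple (T * T)) :
 remsum g t = \sum_(k < n.+1) g (tnth t k) (drop_nth t k).
elim: n g t => [|n IH] g t.
 case/tupleP: t => a t; rewrite big_ord_recl big_ord0 tuple0 /=.
 rewrite tnth0; congr (g _ _ + _); apply/esym/size0nil.
 by rewrite size_map size_enum_ord.
case/tupleP: t => a t; rewrite [LHS]/= big_ord_recl IH; congr (_ + _).
 have E0 : drop_nth [tuple of a :: t] ord0 = t.
  by apply: eq_from_tnth => i; rewrite tnth_mktuple tnthS.
 by rewrite E0.
apply: eq_bigr => k _; rewrite tnthS.
suff -> : drop_nth [tuple of a :: t] (lift ord0 k) = [tuple of a :: drop_nth t k] by [].
apply: eq_from_tnth => i; rewrite tnth_mktuple.
case: (unliftP ord0 i) => [j ->|->].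
 have -> : lift (lift ord0 k) (lift ord0 j) = lift ord0 (lift k j).
  by apply: val_inj; rewrite /= /bump ltnS; case: leqP.
 by rewrite !tnthS tnth_mktuple.
have -> : lift (lift ord0 k) ord0 = ord0 by exact: val_inj.
by [].
Qed.

Lemma minor_expand z q (s : seq (T * T)) :
 minor ((z, q) :: s) =
 K z q * minor s - remsum (fun x r => K z x.2 * minor ((x.1, q) :: r)) s.
case: s => [|a s].
 rewrite subr0 minorE det_mx11 mxE /=.
 by rewrite minorE det_mx00 mulr1.
rewrite -[a :: s]/(tval [tuple of a :: in_tuple s]).
by rewrite minor_expand_tuple remsum_tuple.
Qed.

Lemma minor_nil : minor [::] = 1.
by rewrite minorE det_mx00. Qed.

Lemma minor_dup n (t : n.-tuple T) :
 minor (dup t) = \det (\matrix_(i < n, j < n) K (tnth t i) (tnth t j)).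
rewrite (minorE [tuple of dup t]); congr (\det _).
by apply/matrixP => i j; rewrite !mxE !tnth_map.
Qed.

Lemma remsum_dup (Z : nmodType) (g : T * T -> seq (T * T) -> Z) s :
 remsum g (dup s) = remsum (fun x r => g (x, x) (dup r)) s.
by elim: s g => [|a s IH] g //=; rewrite IH. Qed.

End minors.

Section minors_eq.
Variables (F : comPzRingType) (T : eqType) (K : T -> T -> F).

(** Rows and columns undergo the same permutation, whose sign appears twice. *)
Lemma minor_perm (s t : seq (T * T)) : perm_eq s t -> minor K s = minor K t.
move=> st; have e : size s == size t by rewrite (perm_size st).
rewrite -[s]/(tval (Tuple e)) -[t]/(tval (in_tuple t)) !minorE.
have /tuple_permP[p pE] : perm_eq (Tuple e) (in_tuple t) by [].
have -> : Tuple e = [tuple tnth (in_tuple t) (p i) | i < size t].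
 exact/val_inj.
have -> : minor_mx K [tuple tnth (in_tuple t) (p i) | i < size t] =
  row_perm p (col_perm p (minor_mx K (in_tuple t))).
 by apply/matrixP => i j; rewrite !mxE !tnth_mktuple.
rewrite row_permE col_permE !det_mulmx !det_perm odd_permV mulrCA -signr_addb addbb.
by rewrite mulr1.
Qed.

Lemma minor_repeat x q y (s : seq (T * T)) : minor K ((x, q) :: (x, y) :: s) = 0.
rewrite (minorE K [tuple of (x, q) :: (x, y) :: in_tuple s]).
apply: (determinant_alternate (i1 := ord0) (i2 := lift ord0 ord0)) => //.
by move=> j; rewrite !mxE.
Qed.

Lemma minor_mem x q (s : seq T) : x \in s -> minor K ((x, q) :: dup s) = 0.
move=> xs; rewrite (minor_perm (t := (x, q) :: (x, x) :: dup (rem x s))).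
 exact: minor_repeat.
rewrite perm_cons; apply: (perm_map (fun x => (x, x)) (t := x :: rem x s)).
exact: perm_to_rem.
Qed.

End minors_eq.

(** * Schur complements and the Palm kernel *)

Section schur.
Variable F : fieldType.

Lemma det_schur m n (A : 'M[F]_m) (B : 'M[F]_(m, n)) (C : 'M[F]_(n, m)) (G : 'M[F]_n) :
 G \in unitmx ->
 \det (block_mx A B C G) = \det (A - B *m invmx G *m C) * \det G.
move=> uG.
have -> : block_mx A B C G = block_mx 1%:M (B *m invmx G) 0 1%:M *m
  block_mx (A - B *m invmx G *m C) 0 C G.
 by rewrite mulmx_block !mul1mx !mul0mx !add0r subrK mulmxKV.
by rewrite det_mulmx det_ublock det_lblock !det1 !mul1r.
Qed.

Variables (T : Type) (K : T -> T -> F).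

(** For a single point the quotient of the bordered determinant by the minor of [p] is a Schur
    complement. The matrix of these quotients over [t] is then the Schur complement of the block of
    [p] in the matrix of [t ++ p]. Hence the correlation functions of the Palm process are those of
    the process at [t ++ p], divided by the one at [p]. *)
Lemma minor_palm n l (t : n.-tuple T) (p : l.-tuple T) :
 minor K (dup p) != 0 ->
 \det (\matrix_(i < n, j < n)
  (\det (\matrix_(a < l.+1, b < l.+1)
    K (tnth [tuple of tnth t i :: p] a) (tnth [tuple of tnth t j :: p] b)) /
   minor K (dup p))) = minor K (dup (t ++ p)) / minor K (dup p).
rewrite minor_dup => G0; set G := \matrix_(i, j) _ in G0 *.
have uG : G \in unitmx by rewrite unitmxE unitfE.
pose row_p z : 'rV[F]_l := \row_b K z (tnth p b).
pose col_p w : 'cV[F]_l := \col_a K (tnth p a) w.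
have E z w : \det (\matrix_(a < l.+1, b < l.+1)
  K (tnth [tuple of z :: p] a) (tnth [tuple of w :: p] b)) / \det G =
  K z w - (row_p z *m invmx G *m col_p w) ord0 ord0.
 have ME : (\matrix_(a < l.+1, b < l.+1)
   K (tnth [tuple of z :: p] a) (tnth [tuple of w :: p] b)) =
   block_mx ((K z w)%:M : 'M[F]_1) (row_p z) (col_p w) G :> 'M[F]_(1 + l).
  have el (i : 'I_1) : lshift l i = ord0 :> 'I_l.+1 by apply: val_inj; rewrite ord1.
  have er (i : 'I_l) : rshift 1 i = lift ord0 i :> 'I_l.+1 by exact: val_inj.
  apply/matrixP => i j; case: (@split_ordP 1 l i) => i' ->;
   case: (@split_ordP 1 l j) => j' ->.
  - by rewrite block_mxEul !mxE !ord1.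
  - by rewrite block_mxEur !mxE el er tnthS.
  - by rewrite block_mxEdl !mxE el er tnthS.
  - by rewrite block_mxEdr !mxE !er !tnthS.
 transitivity (\det (block_mx ((K z w)%:M : 'M[F]_1) (row_p z) (col_p w) G) / \det G).
  by rewrite -ME.
 rewrite (det_schur _ _ _ uG) mulfK// det_mx11 !mxE mulr1n.
 by [].
apply: (canRL (mulfK G0)).
rewrite (minor_dup K [tuple of t ++ p]).
pose Bt : 'M[F]_(n, l) := \matrix_(i, b) K (tnth t i) (tnth p b).
pose Ct : 'M[F]_(l, n) := \matrix_(a, j) K (tnth p a) (tnth t j).
have -> : (\matrix_(i < n + l, j < n + l)
  K (tnth [tuple of t ++ p] i) (tnth [tuple of t ++ p] j)) =
  block_mx (\matrix_(i < n, j < n) K (tnth t i) (tnth t j)) Bt Ct G.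
 apply/matrixP => i j; case: (@split_ordP n l i) => i' ->;
  case: (@split_ordP n l j) => j' ->.
 - by rewrite block_mxEul !mxE !tnth_lshift.
 - by rewrite block_mxEur !mxE tnth_lshift tnth_rshift.
 - by rewrite block_mxEdl !mxE tnth_lshift tnth_rshift.
 - by rewrite block_mxEdr !mxE !tnth_rshift.
rewrite (det_schur _ _ _ uG); congr (\det _ * _).
apply/matrixP => i j; rewrite !mxE E mxE; congr (_ - _).
apply: eq_bigr => b _; rewrite !mxE; congr (_ * _).
by apply: eq_bigr => c _; rewrite !mxE.
Qed.

End schur.

(** * Complex numbers by real and imaginary parts *)

Section complex_facts.
Variable R : realType.
Implicit Types x y : R[i].

Lemma normc_sq x : normc x ^+ 2 = Re x ^+ 2 + Im x ^+ 2.
by case: x => a b; rewrite sqr_sqrtr// addr_ge0// sqr_ge0. Qed.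

Lemma nc_ge0 x : 0 <= normc x.
by case: x => /=. Qed.

Lemma normc_conj x : normc (conjc x) = normc x.
by case: x => a b /=; rewrite sqrrN. Qed.

Lemma normcR (a : R) : normc a%:C = `|a|.
by rewrite /= expr0n addr0 sqrtr_sqr. Qed.

Lemma normc_Re x : `|Re x| <= normc x.
by case: x => a b; rewrite -sqrtr_sqr ler_wsqrtr// lerDl sqr_ge0. Qed.

Lemma normc_Im x : `|Im x| <= normc x.
by case: x => a b; rewrite -sqrtr_sqr ler_wsqrtr// lerDr sqr_ge0. Qed.

Lemma Re_le_normc x : Re x <= normc x.
exact: le_trans (ler_norm _) (normc_Re x). Qed.


Lemma normcD_le x y : normc (x + y) <= normc x + normc y.
by have := ler_normD x y; rewrite -rmorphD lecR. Qed.

Lemma normcN_eq x : normc (- x) = normc x.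
by case: x => a b /=; rewrite !sqrrN. Qed.

Lemma normcB_le x y : normc (x - y) <= normc x + normc y.
by rewrite -[normc y]normcN_eq normcD_le. Qed.

Lemma normcB_sym x y : normc (x - y) = normc (y - x).
by rewrite -normcN_eq opprB. Qed.

Lemma normc_eq0 x : (normc x == 0) = (x == 0).
by apply/eqP/eqP => [/eq0_normc//|->]; rewrite normc0.
Qed.

Lemma normc_gt0 x : (0 < normc x) = (x != 0).
by rewrite lt_neqAle nc_ge0 andbT eq_sym normc_eq0. Qed.

Lemma mulc_conj x : x * (conjc x) = (normc x ^+ 2)%:C.
rewrite normc_sq; case: x => a b; apply/eqP; rewrite eq_complex /=.
by apply/andP; split; apply/eqP; ring.
Qed.

Lemma normcX x n : normc (x ^+ n) = normc x ^+ n.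
by elim: n => [|n IH]; rewrite ?normc1// !exprS normcM IH. Qed.

Lemma cReD x y : Re (x + y) = Re x + Re y.
by case: x y => a b []. Qed.

Lemma cImD x y : Im (x + y) = Im x + Im y.
by case: x y => a b []. Qed.

Lemma cReN x : Re (- x) = - Re x. Proof. by case: x. Qed.
Lemma cImN x : Im (- x) = - Im x. Proof. by case: x. Qed.

Lemma cReM x y : Re (x * y) =
 Re x * Re y - Im x * Im y.
by case: x y => a b []. Qed.

Lemma cImM x y : Im (x * y) =
 Re x * Im y + Im x * Re y.
by case: x y => a b []. Qed.

Lemma cReMr x (a : R) : Re (x * a%:C) = Re x * a.
by rewrite cReM mulr0 subr0. Qed.

Lemma cImMr x (a : R) : Im (x * a%:C) = Im x * a.
by rewrite cImM mulr0 add0r. Qed.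

Lemma cRe_conj x : Re (conjc x) = Re x. Proof. by case: x. Qed.
Lemma cIm_conj x : Im (conjc x) = - Im x. Proof. by case: x. Qed.

Lemma cext x y : Re x = Re y -> Im x = Im y ->
 x = y.
by case: x y => a b [c e] /= -> ->. Qed.

Lemma cjK x : conjc (conjc x) = x.
by apply: cext; rewrite ?cRe_conj ?cIm_conj ?opprK. Qed.
Lemma cjD x y : conjc (x + y) = conjc x + conjc y.
by apply: cext; rewrite ?cReD ?cImD ?cRe_conj ?cIm_conj ?cReD ?cImD ?opprD.
Qed.
Lemma cjN x : conjc (- x) = - conjc x.
by apply: cext; rewrite ?cReN ?cImN ?cRe_conj ?cIm_conj ?cReN ?cImN. Qed.
Lemma cjM x y : conjc (x * y) = conjc x * conjc y.
apply: cext; rewrite ?(cReM, cImM, cRe_conj, cIm_conj); first by ring.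
by ring.
Qed.
Lemma cj_real (a : R) : conjc a%:C = a%:C.
by apply: cext => /=; rewrite ?oppr0. Qed.
Lemma cj0 : conjc 0 = 0 :> R[i].
exact: cj_real. Qed.
Lemma cj1 : conjc 1 = 1 :> R[i].
exact: cj_real. Qed.

End complex_facts.

(** * Measurable and integrable complex functions *)

Section cmeasurable.
Context d (T : measurableType d) (R : realType).
Implicit Types f g : T -> R[i].

Definition cmeas f := measT (fun x => Re (f x)) /\
 measT (fun x => Im (f x)).

Lemma eq_cmeas f g : (forall x, f x = g x) -> cmeas f -> cmeas g.
by move=> fg; rewrite (_ : g = f)//; apply/funext . Qed.

Lemma cmeas_cst c : cmeas (fun=> c).
by []. Qed.

Lemma cmeasD f g : cmeas f -> cmeas g -> cmeas (fun x => f x + g x).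
move=> [f1 f2] [g1 g2]; split.
- by under eq_fun do rewrite cReD; exact: measurable_funD.
- by under eq_fun do rewrite cImD; exact: measurable_funD.
Qed.

Lemma cmeasN f : cmeas f -> cmeas (fun x => - f x).
move=> [f1 f2]; split.
- by under eq_fun do rewrite cReN; exact: mfcomp.
- by under eq_fun do rewrite cImN; exact: mfcomp.
Qed.

Lemma cmeasB f g : cmeas f -> cmeas g -> cmeas (fun x => f x - g x).
by move=> mf mg; apply: cmeasD => //; exact: cmeasN. Qed.

Lemma cmeasM f g : cmeas f -> cmeas g -> cmeas (fun x => f x * g x).
move=> [f1 f2] [g1 g2]; split.
- by under eq_fun do rewrite cReM; apply: measurable_funB; exact: mfM.
- by under eq_fun do rewrite cImM; apply: measurable_funD; exact: mfM.
Qed.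

Lemma cmeas_conj f : cmeas f -> cmeas (fun x => (conjc (f x))).
move=> [f1 f2]; split.
- by under eq_fun do rewrite cRe_conj.
- by under eq_fun do rewrite cIm_conj; exact: mfcomp.
Qed.

Lemma cmeas_real (f : T -> R) : measT f -> cmeas (fun x => (f x)%:C).
by []. Qed.

Lemma cmeas_sum (I : Type) (r : seq I) (f : I -> T -> R[i]) :
 (forall i, cmeas (f i)) -> cmeas (fun x => \sum_(i <- r) f i x).
move=> mf; elim: r => [|i r IH].
 by apply: eq_cmeas (cmeas_cst 0) => x; rewrite big_nil.
by apply: eq_cmeas (cmeasD (mf i) IH) => x; rewrite big_cons.
Qed.

Lemma cmeas_prod (I : Type) (r : seq I) (f : I -> T -> R[i]) :
 (forall i, cmeas (f i)) -> cmeas (fun x => \prod_(i <- r) f i x).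
move=> mf; elim: r => [|i r IH].
 by apply: eq_cmeas (cmeas_cst 1) => x; rewrite big_nil.
by apply: eq_cmeas (cmeasM (mf i) IH) => x; rewrite big_cons.
Qed.

Lemma m_normc f : cmeas f -> measT (fun x => normc (f x)).
move=> [f1 f2].
have -> : (fun x => normc (f x)) =
  (fun x => Num.sqrt (Re (f x) ^+ 2 + Im (f x) ^+ 2)).
 by apply/funext => x; case: (f).
apply: (mpre); last by apply: measurable_funD; exact: measurable_funX.
by apply: continuous_measurable_fun; exact: sqrt_continuous.
Qed.

Lemma m_normc2 f : cmeas f -> measT (fun x => normc (f x) ^+ 2).
by move=> mf; apply: measurable_funX; exact: m_normc. Qed.

End cmeasurable.

Lemma cmpre d d' (X : measurableType d') (T : measurableType d) (R : realType)
  (f : T -> R[i]) (h : X -> T) : measT h -> cmeas f ->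
 cmeas (fun x => f (h x)).
by move=> mh [f1 f2]; split; [exact: mpre f1 mh|exact: mpre f2 mh]. Qed.

Section cintegral.
Context d (T : measurableType d) (R : realType).
Variable m : {measure set T -> \bar R}.
Implicit Types f g : T -> R[i].

Definition cL1 f := L1 m (fun x => Re (f x)) /\
 L1 m (fun x => Im (f x)).

Definition cint f : R[i] :=
 ((\int[m]_x Re (f x))%R +i* (\int[m]_x Im (f x))%R).

Lemma eq_cint f g : (forall x, f x = g x) -> cint f = cint g.
by move=> fg; rewrite (_ : f = g)//; apply/funext. Qed.

Lemma eq_cL1 f g : (forall x, f x = g x) -> cL1 f -> cL1 g.
by move=> fg; rewrite (_ : g = f)//; apply/funext. Qed.

Lemma cL1_dom f (h : T -> R) : cmeas f -> (forall x, normc (f x) <= h x) ->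
 L1 m h -> cL1 f.
move=> [f1 f2] fh hi; split; apply: le_L1 hi => // x.
- exact: le_trans (normc_Re _) (fh x).
- exact: le_trans (normc_Im _) (fh x).
Qed.

Lemma cL1_cmeas f : cL1 f -> cmeas f.
by move=> [/L1_measurable f1 /L1_measurable]. Qed.

Lemma cL1_normc f : cL1 f -> L1 m (fun x => normc (f x)).
move=> fi; have [f1 f2] := fi.
apply: le_L1 (L1D (L1_norm f1) (L1_norm f2)).
 exact/m_normc/cL1_cmeas.
move=> x; rewrite ger0_norm ?nc_ge0// -(@ler_pXn2r _ 2) ?nnegrE ?nc_ge0 ?addr_ge0//.
rewrite normc_sq sqrrD !real_normK ?num_real// lerD2r lerDl mulrn_wge0//.
Qed.

Lemma cL1D f g : cL1 f -> cL1 g ->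
 cL1 (fun x => f x + g x).
move=> [f1 f2] [g1 g2]; split.
- by apply: eq_L1 (L1D f1 g1) => x; rewrite cReD.
- by apply: eq_L1 (L1D f2 g2) => x; rewrite cImD.
Qed.

Lemma cintD f g : cL1 f -> cL1 g ->
 cint (fun x => f x + g x) = cint f + cint g.
move=> [f1 f2] [g1 g2]; apply: cext => /=; rewrite -RintD//.
- by apply: eq_rint => x; rewrite cReD.
- by apply: eq_rint => x; rewrite cImD.
Qed.

Lemma cL1Z c f : cL1 f -> cL1 (fun x => c * f x).
move=> [f1 f2]; split.
- apply: eq_L1 (L1B (L1Z (Re c) f1)
  (L1Z (Im c) f2)) => x; by rewrite cReM.
- apply: eq_L1 (L1D (L1Z (Re c) f2)
  (L1Z (Im c) f1)) => x; by rewrite cImM.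
Qed.

Lemma cintZ c f : cL1 f -> cint (fun x => c * f x) = c * cint f.
move=> [f1 f2]; apply: cext.
- rewrite cReM /= -!RintZ// -RintB; [|exact: L1Z|exact: L1Z].
 by apply: eq_rint => x; rewrite cReM.
- rewrite cImM /= -!RintZ// -RintD; [|exact: L1Z|exact: L1Z].
 by apply: eq_rint => x; rewrite cImM.
Qed.

Lemma cL1N f : cL1 f -> cL1 (fun x => - f x).
by move=> /(cL1Z (-1)); apply: eq_cL1 => x; rewrite mulN1r.
Qed.

Lemma cintN f : cL1 f -> cint (fun x => - f x) = - cint f.
by move=> fi; rewrite -mulN1r -cintZ//; apply: eq_cint => x; rewrite mulN1r.
Qed.

Lemma cintB f g : cL1 f -> cL1 g ->
 cint (fun x => f x - g x) = cint f - cint g.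
by move=> fi gi; rewrite cintD//; [rewrite cintN|exact: cL1N].
Qed.

Lemma cint_conj f : cL1 f -> cint (fun x => (conjc (f x))) = (conjc (cint f)).
move=> [f1 f2]; apply: cext => /=.
- by apply: eq_rint => x; rewrite cRe_conj.
- by rewrite -RintN//; apply: eq_rint => x; rewrite cIm_conj.
Qed.

Lemma cint0 : cint (fun=> 0) = 0.
by apply: cext; exact: Rint0. Qed.

Lemma cint_real (f : T -> R) : cint (fun x => (f x)%:C) = (\int[m]_x f x)%R%:C.
by apply: cext => //; exact: Rint0. Qed.

(** A unimodular factor [u] turns the integral into its own modulus; real parts are then compared
    under the integral. *)
Lemma normc_cint f : cL1 f -> normc (cint f) <= (\int[m]_x normc (f x))%R.
move=> fi; have [->|c0] := eqVneq (cint f) 0.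
 by rewrite normc0; apply: Rint_ge0 => x; exact: nc_ge0.
set c := cint f in c0 *; have n0 : 0 < normc c by rewrite normc_gt0.
pose u := (conjc c) * ((normc c)^-1)%:C.
have uc : u * c = (normc c)%:C.
 rewrite mulrAC [(conjc _) * _]mulrC mulc_conj -rmorphM /=; congr (_%:C).
 by rewrite mulfK// gt_eqF.
have u1 : normc u = 1.
 by rewrite normcM normc_conj normcR ger0_norm ?invr_ge0 ?nc_ge0// divff// gt_eqF.
have -> : normc c = Re (cint (fun x => u * f x)) by rewrite cintZ// uc.
apply: le_Rint.
- by have [] := cL1Z u fi.
- exact: cL1_normc.
- by move=> x; apply: le_trans (Re_le_normc _) _; rewrite normcM u1 mul1r.
Qed.

End cintegral.

(** * Fatou's lemma and weighted L2 spaces *)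

Section fatou.
Context d (T : measurableType d) (R : realType).
Variable m : {measure set T -> \bar R}.

(** The bound is required only eventually and up to [e], the form in which near-minimisers of an
    extremal problem satisfy it. *)
Lemma Rint_fatou (f_ : nat -> T -> R) f c : (forall n, measT (f_ n)) ->
 (forall n x, 0 <= f_ n x) -> (forall x, f_ n x @[n --> \oo] --> f x) ->
 (forall n, L1 m (f_ n)) -> (forall e, 0 < e -> \forall n \near \oo, (\int[m]_x f_ n x)%R <= c + e) ->
 L1 m f /\ (\int[m]_x f x <= c)%R.
move=> mf f0 cf fi fc.
have mf' : measT f.
 exact: measurable_fun_cvg => _.
have f0' x : 0 <= f x.
 rewrite -(cvg_lim (@Rhausdorff R) (cf x)); apply: limr_ge.
  by apply/cvg_ex; exists (f x).
 exact: nearW.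
have le : (\int[m]_x (f x)%:E <= c%:E)%E.
 apply/lee_addgt0Pr => e e0.
 have := @fatou _ _ _ m setT measurableT (fun n x => (f_ n x)%:E).
 move=> /(_ (fun => ltac:(exact/mEFinP)) (fun x _ => ltac:(by rewrite lee_fin))).
 have -> : (fun x => limn_einf (fun n => (f_ n x)%:E)) = EFin \o f.
  apply/funext => x /=.
  have ce : (f_ n x)%:E @[n --> \oo] --> (f x)%:E.
   by apply: cvg_EFin; [exact: nearW|exact: cf].
  rewrite is_cvg_limn_einfE; last by apply/cvg_ex; exists (f x)%:E.
  exact/cvg_lim.
 move=> /le_trans; apply.
 have [N _ NP] := fc e e0.
 rewrite limn_einf_lim; apply: lime_le; first exact: is_cvg_einfs.
 near=> n; apply: (@le_trans _ _ (\int[m]_x (f_ (maxn n N) x)%:E)%E).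
  by apply: ereal_inf_lbound; exists (maxn n N) => //=; rewrite leq_maxl.
 by rewrite -(EFin_Rint (fi _)); apply: NP; rewrite /= leq_maxr.
have fi' : L1 m f.
 by apply: ge0_L1P => //; apply: le_lt_trans le _; exact: ltry.
by split=> //; rewrite -lee_fin EFin_Rint.
Unshelve. by end_near. Qed.

End fatou.

Section L2_space.
Context d (T : measurableType d) (R : realType).
Variable V : {measure set T -> \bar R}.
Implicit Types (w : T -> R) (f g h : T -> R[i]).

Definition L2 w f := cmeas f /\ L1 V (fun z => normc (f z) ^+ 2 * w z).

Definition nrm2 w f : R := (\int[V]_z (normc (f z) ^+ 2 * w z))%R.

Definition dotw w f g : R[i] := cint V (fun z => f z * (conjc (g z)) * (w z)%:C).

Variable w : T -> R.
Hypotheses (mw : measT w) (w0 : forall z, 0 <= w z).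

Lemma nrm2_ge0 f : 0 <= nrm2 w f.
by apply: Rint_ge0 => z; rewrite mulr_ge0 ?sqr_ge0. Qed.

Lemma L2Z c f : L2 w f -> L2 w (fun z => c * f z).
move=> [mf fi]; split; first exact: cmeasM .
by apply: eq_L1 (L1Z (normc c ^+ 2) fi) => z; rewrite normcM exprMn mulrA.
Qed.

Lemma nrm2Z c f : L2 w f -> nrm2 w (fun z => c * f z) = normc c ^+ 2 * nrm2 w f.
by move=> [mf fi]; rewrite -RintZ//; apply: eq_rint => z; rewrite normcM exprMn !mulrA.
Qed.

Lemma L2D f g : L2 w f -> L2 w g -> L2 w (fun z => f z + g z).
move=> [mf fi] [mg gi]; split; first exact: cmeasD.
apply: le_L1 (L1D (L1Z 2 fi) (L1Z 2 gi)).
 by apply: mfM => //; apply: m_normc2; exact: cmeasD.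
move=> z; rewrite ger0_norm; last by rewrite mulr_ge0 ?sqr_ge0.
rewrite !mulrA -mulrDl ler_wpM2r//.
have fg : normc (f z + g z) ^+ 2 <= (normc (f z) + normc (g z)) ^+ 2.
 by rewrite ler_pXn2r ?nnegrE ?addr_ge0 ?nc_ge0 ?normcD_le.
apply: _; have := sqr_ge0 (normc (f z) - normc (g z)); nra.
Qed.

Lemma L2N f : L2 w f -> L2 w (fun z => - f z).
move=> [mf fi]; split; first exact: cmeasN.
by apply: eq_L1 fi => z; rewrite normcN_eq.
Qed.

Lemma L2B f g : L2 w f -> L2 w g -> L2 w (fun z => f z - g z).
by move=> fi gi; apply: L2D => //; exact: L2N. Qed.

Lemma dotw_integrable f g : L2 w f -> L2 w g ->
 cL1 V (fun z => f z * (conjc (g z)) * (w z)%:C).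
move=> [mf fi] [mg gi]; apply: cL1_dom (L1D fi gi).
 by apply: cmeasM (cmeas_real mw); apply: cmeasM => //; exact: cmeas_conj.
move=> z; rewrite !normcM normc_conj normcR ger0_norm// -mulrDl ler_wpM2r//.
have := sqr_ge0 (normc (f z) - normc (g z)).
have := nc_ge0; nra.
Qed.

Lemma dotwDl f g h : L2 w f -> L2 w g -> L2 w h ->
 dotw w (fun z => f z + g z) h = dotw w f h + dotw w g h.
move=> fi gi hi; rewrite /dotw -cintD; try exact: dotw_integrable.
by apply: eq_cint => z; rewrite !mulrDl.
Qed.

Lemma dotwZl c f h : L2 w f -> L2 w h ->
 dotw w (fun z => c * f z) h = c * dotw w f h.
move=> fi hi; rewrite /dotw -cintZ; last exact: dotw_integrable.
by apply: eq_cint => z; rewrite !mulrA.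
Qed.

Lemma dotwC f g : L2 w f -> L2 w g -> dotw w g f = (conjc (dotw w f g)).
move=> fi gi; rewrite /dotw -cint_conj; last exact: dotw_integrable.
by apply: eq_cint => z; rewrite !cjM cjK cj_real; ring.
Qed.

Lemma dotwff f : dotw w f f = (nrm2 w f)%:C.
rewrite -cint_real; apply: eq_cint => z.
by rewrite mulc_conj -rmorphM.
Qed.

Lemma dotwDr f g h : L2 w f -> L2 w g -> L2 w h ->
 dotw w h (fun z => f z + g z) = dotw w h f + dotw w h g.
move=> fi gi hi; rewrite (dotwC (L2D fi gi) hi) dotwDl// cjD.
by rewrite -!dotwC.
Qed.

Lemma dotwZr c f h : L2 w f -> L2 w h ->
 dotw w h (fun z => c * f z) = (conjc c) * dotw w h f.
by move=> fi hi; rewrite (dotwC (L2Z c fi) hi) dotwZl// cjM -dotwC.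
Qed.

Lemma dotwNr f h : L2 w f -> L2 w h ->
 dotw w h (fun z => - f z) = - dotw w h f.
move=> fi hi; rewrite (_ : (fun z => - f z) = (fun z => (-1) * f z)); last first.
 by apply/funext => z; rewrite mulN1r.
by rewrite dotwZr// cjN cj1 mulN1r.
Qed.

Lemma dotwBr f g h : L2 w f -> L2 w g -> L2 w h ->
 dotw w h (fun z => f z - g z) = dotw w h f - dotw w h g.
by move=> fi gi hi; rewrite dotwDr ?dotwNr//; exact: L2N. Qed.

Lemma nrm2D f g : L2 w f -> L2 w g ->
 nrm2 w (fun z => f z + g z) = nrm2 w f + nrm2 w g + 2 * Re (dotw w f g).
move=> fi gi; have E := dotwff (fun z => f z + g z).
have fg := L2D fi gi.
rewrite dotwDl// !dotwDr// (dotwC fi gi) !dotwff in E.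
have : Re ((nrm2 w f)%:C + dotw w f g + (conjc (dotw w f g) + (nrm2 w g)%:C)) =
 Re ((nrm2 w (fun z => f z + g z))%:C) by rewrite E.
by case: (dotw w) => a b /=; lra.
Qed.

Lemma nrm2DZ c f g : L2 w f -> L2 w g -> nrm2 w (fun z => f z + c * g z) =
 nrm2 w f + normc c ^+ 2 * nrm2 w g + 2 * Re ((conjc c) * dotw w f g).
by move=> fi gi; rewrite nrm2D ?nrm2Z ?dotwZr//; exact: L2Z.
Qed.

Lemma nrm2N f : nrm2 w (fun z => - f z) = nrm2 w f.
by apply: eq_rint => z; rewrite normcN_eq. Qed.

Lemma nrm2B f g : L2 w f -> L2 w g ->
 nrm2 w (fun z => f z - g z) = nrm2 w f + nrm2 w g - 2 * Re (dotw w f g).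
by move=> fi gi; rewrite nrm2D ?nrm2N ?dotwNr ?mulrN//; exact: L2N.
Qed.

Lemma cauchy_schwarz f g : L2 w f -> L2 w g ->
 normc (dotw w f g) ^+ 2 <= nrm2 w f * nrm2 w g.
move=> fi gi; set c := dotw w f g; set a := nrm2 w f; set b := nrm2 w g.
have P s : 0 <= a + normc s ^+ 2 * b - 2 * Re ((conjc s) * c).
 have := nrm2_ge0 (fun z => f z + (- s) * g z).
 rewrite nrm2DZ// normcN_eq cjN mulNr -/a -/b; lra.
have Q (t : R) : 0 <= a + t ^+ 2 * normc c ^+ 2 * b - 2 * (t * normc c ^+ 2).
 have := P (t%:C * c); have -> : conjc (t%:C * c) * c = (t * normc c ^+ 2)%:C.
  by rewrite cjM cj_real -mulrA [conjc c * c]mulrC mulc_conj -rmorphM.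
 by rewrite normcM normcR exprMn real_normK ?num_real.
have a0 : 0 <= a := nrm2_ge0 f; have b0 : 0 <= b := nrm2_ge0 g.
have n0 : 0 <= normc c ^+ 2 by exact: sqr_ge0.
(* When [b] vanishes the quadratic is affine in [t], and a large [t] would make it negative unless
   the product is 0. Otherwise its minimum is at [t = b^-1]. *)
have [bE|bn] := eqVneq b 0.
 rewrite bE mulr0 leNgt; apply/negP => n1.
 have := Q ((a + 1) / normc c ^+ 2); rewrite bE mulr0 divfK; lra.
have bp : 0 < b by rewrite lt_neqAle eq_sym bn.
have := Q b^-1; rewrite (_ : _ + _ _ = a - normc c ^+ 2 / b); last by field.
by rewrite subr_ge0 ler_pdivrMr.
Qed.

End L2_space.

Section L2_weights.
Context d (T : measurableType d) (R : realType).
Variable V : {measure set T -> \bar R}.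
Variables v w : T -> R.
Hypotheses (mv : measT v) (mw : measT w)
 (vw : forall z, 0 <= v z <= w z).

Let v0 z : 0 <= v z. Proof. by have /andP[] := vw z. Qed.
Let v_w z : v z <= w z. Proof. by have /andP[] := vw z. Qed.
Let w0 z : 0 <= w z. Proof. exact: le_trans. Qed.

Lemma L2_le (f : T -> R[i]) : L2 V w f -> L2 V v f.
move=> [mf fi]; split=> //; apply: le_L1 fi.
 by apply: mfM => //; exact: m_normc2.
move=> z; rewrite ger0_norm; last by rewrite mulr_ge0 ?sqr_ge0.
by rewrite ler_wpM2l// sqr_ge0.
Qed.

Lemma nrm2_le f : L2 V w f -> nrm2 V v f <= nrm2 V w f.
move=> fi; apply: le_Rint; [exact: (L2_le fi).2|exact: fi.2|].
by move=> z; rewrite ler_wpM2l// sqr_ge0.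
Qed.

Lemma L2_sub f : L2 V w f -> L2 V (fun z => w z - v z) f.
move=> fi; split; first exact: fi.1.
by apply: eq_L1 (L1B fi.2 (L2_le fi).2) => z; rewrite mulrBr.
Qed.

Lemma dotw_sub f g : L2 V w f -> L2 V w g ->
 dotw V (fun z => w z - v z) f g = dotw V w f g - dotw V v f g.
move=> fi gi; rewrite /dotw -cintB; last 2 first.
- exact: dotw_integrable.
- by apply: dotw_integrable => //; exact: L2_le.
by apply: eq_cint => z; rewrite rmorphB mulrBr.
Qed.

End L2_weights.

Lemma le_harmonic_bound (R : realType) (x c : R) :
 (forall n, x <= c * n.+1%:R^-1) -> x <= 0.
move=> xc; rewrite leNgt; apply/negP => x0.
have c0 : 0 < c.
 by have := lt_le_trans x0 (xc 0%N); rewrite invr1 mulr1.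
have [n nx] : exists n, c / x < n.+1%:R.
 exists (Num.bound (c / x)); apply: (lt_le_trans (archi_boundP _)).
  by rewrite divr_ge0// ltW.
 by rewrite ler_nat.
have := xc n; rewrite leNgt => /negP; apply.
rewrite ltr_pdivrMr -?ltr_pdivlMl//.
by move: nx; rewrite ltr_pdivrMr// mulrC.
Qed.

Lemma harmonic_small (R : realType) (c e : R) : 0 < e ->
 exists N : nat, c * N.+1%:R^-1 <= e.
move=> e0; apply: contrapT => H; suff : e <= 0 by rewrite leNgt e0.
apply: (@le_harmonic_bound _ e c) => n; rewrite leNgt; apply/negP => lt.
by apply: H; exists n; exact: ltW.
Qed.

Section normc_cvg.
Context d (T : measurableType d) (R : realType).
Variable V : {measure set T -> \bar R}.

Lemma cvg_normc2 (u : nat -> R[i]) (l : R[i]) :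
 normc (u n - l) @[n --> \oo] --> (0 : R) ->
 normc (u n) ^+ 2 @[n --> \oo] --> normc l ^+ 2.
move=> ul; apply: (@cvg_comp _ _ _ (fun n => normc (u n)) (fun x => x ^+ 2)).
 2: exact: exprn_continuous.
apply/cvgrPdist_lt => e e0; move/cvgrPdist_lt : ul => /(_ e e0).
apply: filterS => n; rewrite sub0r normrN ger0_norm ?nc_ge0//.
apply: le_lt_trans; rewrite ler_norml; apply/andP; split.
 have := normcD_le (u n - l) l; rewrite subrK; lra.
have := normcD_le (l - u n) (u n); rewrite subrK normcB_sym; lra.
Qed.

Lemma nrm2_fatou (w : T -> R) (f_ : nat -> T -> R[i]) (f : T -> R[i]) (c : R) : measT w ->
 (forall z, 0 <= w z) -> cmeas f -> (forall n, L2 V w (f_ n)) ->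
 (forall z, normc (f_ n z - f z) @[n --> \oo] --> (0 : R)) ->
 (forall e, 0 < e -> \forall n \near \oo, nrm2 V w (f_ n) <= c + e) ->
 L2 V w f /\ nrm2 V w f <= c.
move=> mw w0 mf fi cf fc.
have [] := @Rint_fatou _ _ _ V (fun n z => normc (f_ n z) ^+ 2 * w z)
 (fun z => normc (f z) ^+ 2 * w z) c.
- by move=> n; apply: mfM => //; apply: m_normc2; exact: (fi n).1.
- by move=> n z; rewrite mulr_ge0 ?sqr_ge0.
- by move=> z; apply: cvgM (cvg_cst _); exact: cvg_normc2.
- by move=> n; exact: (fi n).2.
- by [].
by [].
Qed.

End normc_cvg.

(** * Abstract weighted Bergman spaces *)

Section rkhs_data.
Context d (T : measurableType d) (R : realType).
Variable V : sfmeas T R.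

(* A weighted Bergman space, reduced to the properties used below: [Hol] stands
  for the holomorphic functions, [B] for an exhaustion by compact sets. *)
Record rkhs (W0 : T -> R) (Hol : set (T -> R[i])) (B : nat -> set T)
  (K : T -> T -> R[i]) : Prop := Rkhs {
 rkhs_mW : measT W0;
 rkhs_W0 : forall z, 0 <= W0 z;
 rkhs_cmeas : forall f, Hol f -> cmeas f;
 rkhs_lin : forall c f g, Hol f -> Hol g -> Hol (fun z => c * f z + g z);
 rkhs_zero : Hol (fun=> 0);
 rkhs_mB : forall n, measurable (B n);
 rkhs_ndB : forall n m, (n <= m)%N -> B n `<=` B m;
 rkhs_covB : forall z, W0 z != 0 -> exists n, B n z;
 rkhs_complete : forall f_ : nat -> T -> R[i],
  (forall n, Hol (f_ n) /\ L2 V W0 (f_ n)) ->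
  (forall M e, 0 < e -> exists N, forall n m, (N <= n)%N -> (N <= m)%N ->
    nrm2 V (fun z => W0 z * \1_(B M) z) (fun z => f_ n z - f_ m z) <= e) ->
  exists2 f, Hol f & forall z, normc (f_ n z - f z) @[n --> \oo] --> (0 : R);
 rkhs_mK : cmeas (fun p : T * T => K p.1 p.2);
 rkhs_HK : forall w, Hol (K^~ w) /\ L2 V W0 (K^~ w);
 rkhs_rep : forall f w, Hol f -> L2 V W0 f -> f w = dotw V W0 f (K^~ w) }.

End rkhs_data.

Section rkhs_basic.
Context d (T : measurableType d) (R : realType).
Variable V : sfmeas T R.
Variables (W0 : T -> R) (Hol : set (T -> R[i])) (B : nat -> set T)
 (K : T -> T -> R[i]).
Hypothesis rk : rkhs V W0 Hol B K.

Definition inH f := Hol f /\ L2 V W0 f.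
Let mW0 := rkhs_mW rk.
Let W00 := rkhs_W0 rk.

Lemma inH_lin c f g : inH f -> inH g -> inH (fun z => c * f z + g z).
move=> [hf fi] [hg gi]; split; first exact: (rkhs_lin rk).
by apply: L2D => //; exact: L2Z.
Qed.

Lemma inH0 : inH (fun=> 0).
split; first exact: (rkhs_zero rk); split; first by [].
have -> : (fun z => normc (0) ^+ 2 * W0 z) = (fun=> 0).
 by apply/funext => z; rewrite normc0 expr0n mul0r.
exact: integrable0.
Qed.

Lemma inHZ c f : inH f -> inH (fun z => c * f z).
move=> hf; have := inH_lin c hf inH0.
by congr inH; apply/funext => z; rewrite addr0.
Qed.

Lemma inHD f g : inH f -> inH g -> inH (fun z => f z + g z).
move=> hf hg; have := inH_lin 1 hf hg.
by congr inH; apply/funext => z; rewrite mul1r.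
Qed.

Lemma inHN f : inH f -> inH (fun z => - f z).
move=> hf; have := inHZ (-1) hf.
by congr inH; apply/funext => z; rewrite mulN1r.
Qed.

Lemma inHB f g : inH f -> inH g -> inH (fun z => f z - g z).
by move=> hf hg; apply: inHD => //; exact: inHN. Qed.

Lemma inHK w : inH (K^~ w). Proof. exact: (rkhs_HK rk). Qed.

Lemma repK f w : inH f -> f w = dotw V W0 f (K^~ w).
by move=> []; apply: (rkhs_rep rk). Qed.

Definition kap x : R := Re (K x x).

Lemma kap_nrm2 w : kap w = nrm2 V W0 (K^~ w).
by rewrite /kap (repK w (inHK w)) dotwff. Qed.

Lemma kap_ge0 w : 0 <= kap w. Proof. by rewrite kap_nrm2 nrm2_ge0. Qed.

Lemma K_conj x y : K y x = conjc (K x y).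
by rewrite (repK y (inHK x)) (repK x (inHK y)) -dotwC//; [exact: (inHK y).2|exact: (inHK x).2].
Qed.

Lemma K_diag x : K x x = (kap x)%:C.
apply: cext => //=; have := congr1 (@Im R) (K_conj x x).
case: K => a b /=; lra.
Qed.

Lemma eval_bound f q : inH f -> normc (f q) ^+ 2 <= kap q * nrm2 V W0 f.
move=> hf; rewrite (repK q hf) kap_nrm2 mulrC; apply: cauchy_schwarz => //.
- exact: hf.2.
- exact: (inHK q).2.
Qed.

Lemma normcK x y : normc (K x y) ^+ 2 <= kap x * kap y.
by rewrite [X in _ * X]kap_nrm2; exact: (eval_bound x (inHK y)). Qed.

Lemma m_kap : measT kap.
have [m1 _] := rkhs_mK rk.
apply: (mpre (h := fun x => (x, x)) m1).
exact: mfpair.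
Qed.

(** Local completeness provides a pointwise limit; Fatou's lemma for [f_ n - f_ m], as m tends to
    infinity, turns it into a limit in norm. *)
Lemma complete_nrm2 (f_ : nat -> T -> R[i]) : (forall n, inH (f_ n)) ->
 (forall e, 0 < e -> exists N, forall n m, (N <= n)%N -> (N <= m)%N ->
  nrm2 V W0 (fun z => f_ n z - f_ m z) <= e) ->
 exists f, inH f /\ forall e, 0 < e -> exists N, forall n, (N <= n)%N ->
  nrm2 V W0 (fun z => f_ n z - f z) <= e.
move=> hf cf.
have [f hol_f cvf] : exists2 f, Hol f &
  forall z, normc (f_ n z - f z) @[n --> \oo] --> (0).
 apply: (rkhs_complete rk) => // M e e0; have [N NP] := cf e e0.
 exists N => n m Nn Nm; apply: le_trans (NP n m Nn Nm).
 apply: nrm2_le .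
 - by apply: mfM => //; exact: mindic (rkhs_mB rk M).
 - move=> z; have i1 : \1_(B M) z <= 1 :> R by [].
  by rewrite mulr_ge0 ?W00// ler_piMr.
 - by apply: L2B => //; [exact: (hf n).2|exact: (hf m).2].
have key e : 0 < e -> exists N, forall n, (N <= n)%N ->
  L2 V W0 (fun z => f_ n z - f z) /\ nrm2 V W0 (fun z => f_ n z - f z) <= e.
 move=> e0; have [N NP] := cf e e0; exists N => n Nn.
 apply: (@nrm2_fatou _ _ _ _ _ (fun m z => f_ n z - f_ m z)) => //.
 - by apply: cmeasB; [exact: (hf n).2.1|exact: (rkhs_cmeas rk)].
 - by move=> m; apply: L2B => //; [exact: (hf n).2|exact: (hf m).2].
 - move=> z; suff -> : (fun m => normc (f_ n z - f_ m z - (f_ n z - f z))) =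
   (fun m => normc (f_ m z - f z)) by [].
  by apply/funext => m; rewrite -normcN_eq; congr (normc _); ring.
 - move=> e' e'0; exists N => // m /= Nm; apply: le_trans (NP n m Nn Nm) _.
  by rewrite lerDl ltW.
exists f; split.
 split=> //; have [N /(_ N (leqnn N))[Nf _]] := key 1 ltr01.
 have -> : f = (fun z => f_ N z - (f_ N z - f z)) by apply/funext => z; ring.
 by apply: L2B => //; exact: (hf N).2.
by move=> e /key[N NP]; exists N => n /NP[].
Qed.

Lemma inf_bound (I : Type) (P : set I) (J : I -> R) (m0 : R) :
 P !=set0 -> (forall i, P i -> m0 <= J i) ->
 exists m, (forall i, P i -> m <= J i) /\
  forall e, 0 < e -> exists2 i, P i & J i <= m + e.
move=> [i0 Pi0] Jm.
have hi : has_inf [set J i | i in P].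
 by split; [exists (J i0), i0|exists m0 => _ [i Pi <-]; exact: Jm].
exists (inf [set J i | i in P]); split.
 by move=> i Pi; apply: ge_inf; [exact: hi.2|exists i].
move=> e e0; have [_ [i Pi <-] ie] := inf_adherent e0 hi.
by exists i => //; exact: ltW.
Qed.

Lemma parallelogram (w : T -> R) (f g : T -> R[i]) : measT w -> (forall z, 0 <= w z) ->
 L2 V w f -> L2 V w g ->
 nrm2 V w (fun z => f z - g z) = 2 * nrm2 V w f + 2 * nrm2 V w g -
  4 * nrm2 V w (fun z => (2^-1)%:C * (f z + g z)).
move=> mw w0 fi gi; rewrite nrm2Z; last exact: L2D.
rewrite normcR ger0_norm// nrm2B// nrm2D//; lra.
Qed.

(** The inequality is read at t = - D / (N + 1), near the minimum; the added 1 avoids a case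
    distinction on N = 0. *)
Lemma quadratic_bound (N D e : R) : 0 <= N ->
 (forall t, - e <= t ^+ 2 * N + 2 * (t * D)) -> D ^+ 2 <= e * (N + 1).
move=> N0 /(_ (- D / (N + 1))) H; have N1 : 0 < N + 1 by lra.
have E : (- D / (N + 1)) ^+ 2 * N + 2 * (- D / (N + 1) * D) =
  (D ^+ 2 * (N / (N + 1)) - 2 * D ^+ 2) / (N + 1).
 by field; rewrite gt_eqF.
have q1 : N / (N + 1) <= 1 by rewrite ler_pdivrMr//; lra.
move: H; rewrite E ler_pdivlMr// => H.
have := sqr_ge0; nra.
Qed.

(** * Riesz representation for a smaller weight *)

Section riesz.
Variables (w : T -> R) (G : T -> R[i]).
Hypotheses (mw : measT w) (wW : forall z, 0 <= w z <= W0 z)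
 (Gi : L2 V w G).

Let w0 z : 0 <= w z. Proof. by have /andP[] := wW z. Qed.

(** A functional whose minimiser represents [G]: its derivative at [f] in the direction [h] is twice
    the real part of [dotw V W0 h f - dotw V w h G], as [J_var] shows. *)
Let J f := nrm2 V W0 f - 2 * Re (dotw V w f G).

Let H_L2w f : inH f -> L2 V w f.
by move=> [_]; exact: (L2_le mw). Qed.

Let J_lb f : inH f -> - nrm2 V w G <= J f.
move=> hf; have := nrm2_ge0 V w0 (fun z => f z - G z).
rewrite nrm2B//; last exact: H_L2w.
have := nrm2_le mw wW hf.2; rewrite /J; lra.
Qed.

Let J_half f g : inH f -> inH g ->
 nrm2 V W0 (fun z => f z - g z) =
 2 * J f + 2 * J g - 4 * J (fun z => (2^-1)%:C * (f z + g z)).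
move=> hf hg; rewrite (parallelogram mW0 W00 hf.2 hg.2) /J dotwZl//; last first.
 by apply: L2D => //; exact: H_L2w.
rewrite dotwDl//; try exact: H_L2w.
by case: (dotw) (dotw V w g) => a b [c e] /=; lra.
Qed.

Let J_var f h (t : R) : inH f -> inH h ->
 J (fun z => f z + t%:C * h z) = J f + t ^+ 2 * nrm2 V W0 h +
  2 * (t * Re (dotw V W0 h f - dotw V w h G)).
move=> hf hh; rewrite /J nrm2DZ//; [|exact: hf.2|exact: hh.2].
rewrite dotwDl//; [|exact: H_L2w|by apply: L2Z ; exact: H_L2w].
rewrite dotwZl//; last exact: H_L2w.
rewrite (dotwC _ _ hh.2 hf.2)// cj_real normcR real_normK ?num_real//.
by case: (dotw) (dotw V w h) (dotw V W0) => a b [c e] [g l] /=; lra.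
Qed.

(** Direct method: the parallelogram identity [J_half] makes near-minimisers a Cauchy sequence, and
    near-minimality bounds the derivative of [J] by [quadratic_bound]. *)
Lemma riesz_re : exists f, inH f /\ forall h, inH h ->
 Re (dotw V W0 h f) = Re (dotw V w h G).
have [m [mJ Jm]] := @inf_bound _ (inH) J _ (ex_intro _ _ inH0) J_lb.
have dl0 n : 0 < n.+1%:R^-1 :> R by [].
have /choice[f_ f_P] : forall n : nat, exists f, inH f /\ J f <= m + n.+1%:R^-1.
 by move=> n; have [f] := Jm _ (dl0 n); exists f.
have dle n k : (n <= k)%N -> k.+1%:R^-1 <= n.+1%:R^-1 :> R.
 by rewrite lef_pV2 ?posrE// ler_nat.
have cau n k : nrm2 V W0 (fun z => f_ n z - f_ k z) <= 2 * n.+1%:R^-1 + 2 * k.+1%:R^-1.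
 have [hn Jn] := f_P n; have [hk Jk] := f_P k.
 rewrite J_half//; move: (mJ _ (inHZ (2^-1)%:C (inHD hn hk))) Jn Jk.
 move: (J _) (J _) (n.+1%:R^-1) (k.+1%:R^-1) => b c e1 e2; lra.
have [f [hf cf]] : exists f, inH f /\ forall e, 0 < e -> exists N, forall n, (N <= n)%N ->
  nrm2 V W0 (fun z => f_ n z - f z) <= e.
 apply: complete_nrm2 => [n|e e0]; first exact: (f_P n).1.
 have [N Ne] : exists N : nat, 4 * N.+1%:R^-1 <= e.
  exact: harmonic_small.
 exists N => n k Nn Nk; apply: le_trans (cau n k) _.
 move: (dle _ _ Nn) (dle _ _ Nk) Ne; move: (n.+1%:R^-1) (k.+1%:R^-1) (N.+1%:R^-1) => a b c; lra.
exists f; split=> // h hh.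
set D := Re (dotw V W0 h f - dotw V w h G).
set N := nrm2 V W0 h; have N0 : 0 <= N by exact: nrm2_ge0.
have Dn n : Re (dotw V W0 h (f_ n) - dotw V w h G) ^+ 2 <= n.+1%:R^-1 * (N + 1).
 apply: quadratic_bound => // t; have [hn Jn] := f_P n.
 have := mJ _ (inHD hn (inHZ t%:C hh)); rewrite J_var// -/N; move: Jn; move: (n.+1%:R^-1) => b; lra.
(* The derivative at [f] differs from the one at [f_ n] by a product with [f_ n - f], controlled by
   Cauchy-Schwarz. Both squares are at most (N + 1) / (k + 1), and the square of a sum is at most
   twice the sum of the squares. *)
have D0 : D ^+ 2 <= 0.
 apply: (@le_harmonic_bound _ _ (4 * (N + 1))) => k.
 have [M MP] := cf _ (dl0 k); pose n := maxn M k.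
 have h1 := MP n (leq_maxl _ _); have h2 := Dn n.
 have h3 := dle k n (leq_maxr _ _).
 have hn := (f_P n).1.
 have dd : (Re (dotw V W0 h (fun z => f_ n z - f z))) ^+ 2 <= N * k.+1%:R^-1.
  apply: (@le_trans _ _ (normc (dotw V W0 h (fun z => f_ n z - f z)) ^+ 2)).
   by rewrite normc_sq lerDl sqr_ge0.
  apply: le_trans (cauchy_schwarz _ _ _ _) _ => //; first exact: hh.2.
   by apply: L2B => //; [exact: hn.2|exact: hf.2].
  by rewrite ler_wpM2l.
 rewrite dotwBr// in dd.
 - move: dd h2; rewrite /D.
  case: (dotw V W0) (dotw V W0 h f) (dotw V w h G) => a b [c e] [g l] /=.
  move=> dd h2; have h4 : n.+1%:R^-1 * (N + 1) <= k.+1%:R^-1 * (N + 1).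
   by rewrite ler_wpM2r//; lra.
  have := sqr_ge0 ((a - g) + (a - c)); have := dl0 k.
  move: h4 h2 dd; move: (n.+1%:R^-1) (k.+1%:R^-1) => e1 e2; nra.
 - exact: hn.2.
 - exact: hf.2.
 - exact: hh.2.
have : D = 0 by apply/eqP; rewrite -sqrf_eq0 eq_le D0 sqr_ge0.
by rewrite /D; case: (dotw V W0 h) (dotw V w h) => a b [c e] /=; lra.
Qed.

(** Imaginary parts are recovered from the real parts of the same identity for ['i * h]. *)
Lemma riesz : exists f, inH f /\ forall h, inH h ->
 dotw V W0 h f = dotw V w h G.
have [f [hf fP]] := riesz_re; exists f; split=> // h hh.
have h1 := fP h hh; have h2 := fP _ (inHZ 'i hh).
apply: cext => //.
move: h2; rewrite !dotwZl//; try exact: H_L2w.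
- by case: (dotw) (dotw V w) => a b [c e] /=; lra.
- exact: hh.2.
- exact: hf.2.
Qed.

End riesz.

End rkhs_basic.

(** * Bordered determinants of the reproducing kernel *)

Section kernel_minors.
Context d (T : measurableType d) (R : realType).
Variable V : sfmeas T R.
Variables (W0 : T -> R) (Hol : set (T -> R[i])) (B : nat -> set T)
 (K : T -> T -> R[i]).
Hypothesis rk : rkhs V W0 Hol B K.
Local Notation inH := (inH V W0 Hol).
Local Notation kap := (kap K).
Let mW0 := rkhs_mW rk.
Let W00 := rkhs_W0 rk.

(** As a function of [z] this is, up to the factor [rho s], the reproducing kernel at [q] of the
    subspace of functions vanishing on [s]. *)
Definition bdet z q (s : seq T) : R[i] := minor K ((z, q) :: dup s).
Definition rho (s : seq T) : R := Re (minor K (dup s)).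

Lemma bdet_expand z q s : bdet z q s =
 K z q * minor K (dup s) - remsum (fun x r => K z x * bdet x q r) s.
by rewrite /bdet minor_expand remsum_dup. Qed.

Lemma minor_real s : minor K (dup s) = (rho s)%:C.
apply: cext => //=.
have E : minor K (dup s) = conjc (minor K (dup s)).
 rewrite (minor_dup K (in_tuple s)).
 rewrite -[X in _ = X]/((Num.conj _) : R[i]) -det_map_mx -det_tr.
 congr (\det _); apply/matrixP => i j; rewrite !mxE.
 exact: (K_conj rk).
have := congr1 (@Im R) E.
by case: (minor K) => a b /=; lra.
Qed.

Lemma rho_nil : rho [::] = 1. Proof. by rewrite /rho minor_nil. Qed.

Lemma rho_perm s t : perm_eq s t -> rho s = rho t.
by move=> st; rewrite /rho (minor_perm K (perm_map _ st)). Qed.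

Lemma bdet_mem x q s : x \in s -> bdet x q s = 0.
exact: minor_mem. Qed.

Lemma bdet_diag q s : bdet q q s = (rho (q :: s))%:C.
exact: (minor_real (q :: s)). Qed.

Lemma inH_remsum (c : T -> seq T -> R[i]) s :
 inH (fun z => remsum (fun x r => K z x * c x r) s).
elim: s c => [|a s IH] c /=; first exact: (inH0 rk).
apply: (inHD rk); last by [].
have := inHZ rk (c a s) (inHK rk a).
by congr inH; apply/funext => z; rewrite mulrC.
Qed.

Lemma dot_remsum (f : T -> R[i]) (c : T -> seq T -> R[i]) s :
 inH f -> (forall x, x \in s -> f x = 0) ->
 dotw V W0 f (fun z => remsum (fun x r => K z x * c x r) s) = 0.
move=> hf; elim: s c => [|a s IH] c fs /=.
 by rewrite -[RHS](cint0 V); apply: eq_cint => z; rewrite cj0 mulr0 mul0r.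
rewrite dotwDr//; last 3 first.
- have := inHZ rk (c a s) (inHK rk a) => -[_].
 by congr L2; apply/funext => z; rewrite mulrC.
- exact: (inH_remsum (fun x r => c x (a :: r)) s).2.
- exact: hf.2.
rewrite IH ?addr0; last first.
 by move=> x xs; apply: fs; rewrite inE xs orbT.
rewrite (_ : (fun z => K z a * c a s) = (fun z => c a s * K z a)); last first.
 by apply/funext => z; rewrite mulrC.
rewrite dotwZr//; [|exact: (inHK rk a).2|exact: hf.2].
by rewrite -(repK rk a hf) fs ?mulr0// inE eqxx.
Qed.

(** * Elements representing an evaluation on functions vanishing on [s] *)

Section kernel_element.
Variables (v : T -> R) (s : seq T) (F : T -> R[i]) (q : T) (a b : R).
Hypotheses (mv : measT v) (vW : forall z, 0 <= v z <= W0 z)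
 (HF : inH F)
 (rep : forall f, inH f -> (forall x, x \in s -> f x = 0) ->
   dotw V v f F = f q * a%:C)
 (Fs : forall x, x \in s -> F x = 0) (Fq : F q = b%:C).

Let v0 z : 0 <= v z. Proof. by have /andP[] := vW z. Qed.

(** [F] itself vanishes on [s], hence is an admissible test function for its own representing
    property. For [bdet] the weight is [W0], for the series [Fw] below it is [W0 - w]; when [a] is
    positive, [b / a] is the extremal value of |f(q)|^2. The lemmas avoid the quotient because [a]
    may vanish. *)
Lemma nrm2_kel : nrm2 V v F = b * a.
have := dotwff V v F; rewrite rep// Fq -rmorphM => E.
by have := congr1 (@Re R) E.
Qed.

Lemma kel_eval f : inH f -> (forall x, x \in s -> f x = 0) ->
 normc (f q) ^+ 2 * a ^+ 2 <= nrm2 V v f * (b * a).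
move=> hf fs; rewrite -nrm2_kel.
apply: le_trans (cauchy_schwarz mv v0 (L2_le mv vW hf.2) (L2_le mv vW HF.2)).
by rewrite rep// normcM exprMn normcR real_normK ?num_real.
Qed.

Lemma kel_ge0 : 0 < a -> 0 <= b.
move=> a0; have := nrm2_ge0 V v0 F.
by rewrite nrm2_kel pmulr_lge0.
Qed.

Lemma kel_le f : 0 <= a -> 0 <= b -> inH f ->
 (forall x, x \in s -> f x = 0) -> normc (f q) ^+ 2 * a <= b * nrm2 V v f.
move=> a0 b0 hf fs; have [->|an] := eqVneq a 0.
 by rewrite mulr0 mulr_ge0// nrm2_ge0.
have ap : 0 < a by rewrite lt_neqAle eq_sym an.
have := kel_eval hf fs.
move=> H; rewrite -(ler_pM2r ap) -mulrA (le_trans H)// le_eqVlt.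
by apply/orP; left; apply/eqP; ring.
Qed.

Lemma kel_bound C : 0 <= a -> 0 <= b -> 0 <= C ->
 (forall f, inH f -> (forall x, x \in s -> f x = 0) ->
   normc (f q) ^+ 2 <= C * nrm2 V v f) -> b <= C * a.
move=> a0 b0 C0 fC; have [->|bn] := eqVneq b 0; first exact: mulr_ge0.
have bp : 0 < b by rewrite lt_neqAle eq_sym bn.
have := fC _ HF Fs; rewrite Fq nrm2_kel normcR real_normK ?num_real//.
move=> H; rewrite -(ler_pM2l bp) (le_trans H)// le_eqVlt.
by apply/orP; left; apply/eqP; ring.
Qed.

End kernel_element.

(** In the expansion along the row of [z], all terms but the first are combinations of kernels at
    points of [s], orthogonal to the functions vanishing there; the first term evaluates at [q]. *)
Lemma rep_bdet q s : let F := fun z => bdet z q s in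
 [/\ inH F, forall f, inH f -> (forall x, x \in s -> f x = 0) ->
    dotw V W0 f F = f q * (rho s)%:C & forall x, x \in s -> F x = 0].
move=> F; have FE : F = (fun z => (rho s)%:C * K z q -
  remsum (fun x r => K z x * bdet x q r) s).
 by apply/funext => z; rewrite /F bdet_expand minor_real mulrC.
have h1 := inHZ rk (rho s)%:C (inHK rk q).
have h2 := inH_remsum (fun x r => bdet x q r) s.
split.
- by rewrite FE; apply: (inHB rk).
- move=> f hf fs; rewrite FE dotwBr//; [|exact: h1.2|exact: h2.2|exact: hf.2].
 rewrite dot_remsum// subr0 dotwZr//; [|exact: (inHK rk q).2|exact: hf.2].
 by rewrite -(repK rk q hf) cj_real mulrC.
- by move=> xs; exact: bdet_mem.
Qed.

Let W0W z : 0 <= W0 z <= W0 z. Proof. by rewrite W00 lexx. Qed.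

(** Both parts come from the evaluation bound for F = [bdet] at [q], where F(q) = [rho (q :: s)] and
    the squared norm is [rho (q :: s) * rho s]. In particular a zero of [rho s] forces a zero of
    [rho (q :: s)]. *)
Lemma rho_ge0_hadamard s : 0 <= rho s /\ forall q, 0 <= rho (q :: s) <= kap q * rho s.
have step s' : 0 <= rho s' -> forall q, 0 <= rho (q :: s') <= kap q * rho s'.
 move=> s0 q; have [HF rep Fs] := rep_bdet q s'.
 have Fq := bdet_diag q s'.
 have nF := nrm2_kel HF rep Fs Fq.
 have ev := eval_bound rk q HF; rewrite Fq normcR real_normK ?num_real// nF in ev.
 have b0 : 0 <= rho (q :: s').
  have [s'0|s'n] := eqVneq (rho s') 0.
   move: ev; rewrite s'0 !mulr0 => ev.
   suff -> : rho (q :: s') = 0 by [].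
   by apply/eqP; rewrite -sqrf_eq0 eq_le ev sqr_ge0.
  by apply: (kel_ge0 W0W HF rep Fs Fq); rewrite lt_neqAle eq_sym s'n.
 rewrite b0/=; have [->|bn] := eqVneq (rho (q :: s')) 0.
  by rewrite mulr_ge0// (kap_ge0 rk).
 have bp : 0 < rho (q :: s') by rewrite lt_neqAle eq_sym bn.
 by move: ev; rewrite mulrCA ler_pM2l.
have s0 : 0 <= rho s.
 by elim: s => [|a s IH]; rewrite ?rho_nil//; have /andP[] := step s IH a.
by split=> //; exact: step.
Qed.

Lemma rho_ge0 s : 0 <= rho s. Proof. by have [] := rho_ge0_hadamard s. Qed.

Lemma rho_cons_le q s : rho (q :: s) <= kap q * rho s.
by have [_ /(_ q)/andP[]] := rho_ge0_hadamard s. Qed.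

Lemma rho_le s : rho s <= wprod kap s.
elim: s => [|a s IH]; first by rewrite rho_nil wprod_nil.
rewrite wprod_cons; apply: le_trans (rho_cons_le a s) _.
by rewrite ler_wpM2l// (kap_ge0 rk).
Qed.

Lemma rho_dom s y : `|rho (s ++ y)| <= wprod kap s * wprod kap y.
by rewrite ger0_norm ?rho_ge0// -wprod_cat rho_le. Qed.

Definition skap x := Num.sqrt (kap x).

Lemma skap_ge0 x : 0 <= skap x. Proof. exact: sqrtr_ge0. Qed.

Lemma skap_sq x : skap x * skap x = kap x.
by rewrite -expr2 sqr_sqrtr// (kap_ge0 rk). Qed.

Let sqr_le (x y : R) : 0 <= y -> x ^+ 2 <= y ^+ 2 -> x <= y.
move=> y0 xy; have [x0|x0] := leP 0 x; last exact: ltW (lt_le_trans x0 y0).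
by rewrite -(@ler_pXn2r _ 2).
Qed.

Lemma normcK_skap x y : normc (K x y) <= skap x * skap y.
apply: sqr_le; first by rewrite mulr_ge0 ?skap_ge0.
rewrite exprMn !expr2 !skap_sq; exact: (normcK rk).
Qed.

Lemma bdet_sq_le z q s : normc (bdet z q s) ^+ 2 <= kap z * (rho (q :: s) * rho s).
have [HF rep Fs] := rep_bdet q s; have Fq := bdet_diag q s.
by rewrite -(nrm2_kel HF rep Fs Fq); exact: (eval_bound rk).
Qed.

Lemma bdet_le z q s : normc (bdet z q s) <= skap z * skap q * wprod kap s.
have w0 : 0 <= wprod kap s by apply: wprod_ge0 ; exact: (kap_ge0 rk).
apply: sqr_le; first by rewrite !mulr_ge0 ?skap_ge0.
apply: le_trans (bdet_sq_le z q s) _; rewrite !exprMn !expr2 !skap_sq -mulrA.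
rewrite ler_wpM2l ?(kap_ge0 rk)//.
apply: le_trans _; last by rewrite mulrA.
apply: ler_pM; rewrite ?rho_ge0 ?rho_le//.
by apply: le_trans (rho_cons_le q s) _; rewrite ler_wpM2l ?rho_le// (kap_ge0 rk).
Qed.

Lemma cmeas_minor_tuple d' (X : measurableType d') n (f g : X -> 'I_n -> T)
  (ps : X -> n.-tuple (T * T)) :
 (forall x i, tnth (ps x) i = (f x i, g x i)) ->
 (forall i, measT (fun x => f x i)) ->
 (forall i, measT (fun x => g x i)) ->
 cmeas (fun x => minor K (ps x)).
move=> psE mf mg; apply: (@eq_cmeas _ _ _ (fun x =>
 \sum_(p : 'S_n) ((-1) ^+ p * \prod_i K (f x i) (g x (p i))))).
 move=> x; rewrite minorE; apply: eq_bigr => p _; congr (_ * _).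
 by apply: eq_bigr => i _; rewrite mxE !psE.
apply: cmeas_sum => p; apply: cmeasM; first by [].
apply: cmeas_prod => i.
apply: (cmpre (h := fun x => (f x i, g x (p i))) _ (rkhs_mK rk)).
exact: mfpair.
Qed.

Lemma m_rho : measT rho.
apply/m_fun_seqP => n.
have [] := @cmeas_minor_tuple _ (n.-tuple T) n (fun t i => tnth t i) (fun t i => tnth t i)
 (fun t => [tuple of dup t]) => //.
- by move=> t i; rewrite tnth_map.
- by exact: measurable_tnth.
- by exact: measurable_tnth.
Qed.

Lemma cmeas_bdet : cmeas (fun p : (T * T) * seq T => bdet p.1.1 p.1.2 p.2).
have H n : cmeas (fun p : (T * T) * n.-tuple T => bdet p.1.1 p.1.2 p.2).
 pose fi (k : bool) (p : (T * T) * n.-tuple T) (i : 'I_n.+1) : T :=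
  if unlift ord0 i is Some j then tnth p.2 j else if k then p.1.1 else p.1.2.
 have mfi k i : measT (fun p => fi k p i).
  rewrite /fi; case: unliftP => [j _|_].
   by apply: (mpre (f := fun t : n.-tuple T => tnth t j));
    [exact: measurable_tnth|by []].
  case: k.
   exact: mpre.
  exact: mpre.
 apply: (@cmeas_minor_tuple _ _ n.+1 (fi true) (fi false)
  (fun p => [tuple of (p.1.1, p.1.2) :: dup p.2])) => // p i.
 rewrite /fi; case: unliftP => [j ->|->]//.
 by rewrite tnthS tnth_map.
split.
- apply: (@m_fun_seq2 _ _ _ _ _ _ (fun (p : T * T) s => Re (bdet p.1 p.2 s))).
 by move=> n; exact: (H n).1.
- apply: (@m_fun_seq2 _ _ _ _ _ _ (fun (p : T * T) s => Im (bdet p.1 p.2 s))).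
 by move=> n; exact: (H n).2.
Qed.

End kernel_minors.

(** * Mecke's formula for complex integrands *)

Section complex_mecke.
Context d (T : measurableType d) (R : realType).
Variable V : sfmeas T R.
Variable kap : T -> R.
Hypotheses (kap0 : forall x, 0 <= kap x).

Lemma cint_remsum (G : T -> seq T -> seq T -> R[i]) s :
 (forall x r, cL1 (lp V) (G x r)) ->
 cL1 (lp V) (fun y => remsum (fun x r => G x r y) s) /\
 cint (lp V) (fun y => remsum (fun x r => G x r y) s) =
  remsum (fun x r => cint (lp V) (G x r)) s.
elim: s G => [|a s IH] G Gi /=.
 rewrite cint0; split; split; exact: integrable0.
have [i <-] := IH (fun x r => G x (a :: r)) (fun x r => Gi x _).
by split; [exact: cL1D|rewrite cintD].
Qed.

Lemma complex_mecke W (g : T -> seq T -> R[i]) C : gweight V kap W ->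
 measT kap ->
 cmeas (fun p : T * seq T => g p.1 p.2) -> 0 <= C ->
 (forall z r, normc (g z r) <= C * (kap z * wprod kap r)) ->
 [/\ cL1 (lp V) (fun s => remsum g s * (wprod W s)%:C),
   cL1 V (fun x => (W x)%:C * cint (lp V) (fun s => g x s * (wprod W s)%:C)) &
   cint (lp V) (fun s => remsum g s * (wprod W s)%:C) =
   cint V (fun x => (W x)%:C * cint (lp V) (fun s => g x s * (wprod W s)%:C))].
move=> gW mk [mg1 mg2] C0 gC.
have [i1 j1 e1] := @mecke _ _ _ V kap mk kap0 W (fun z r => Re (g z r)) C gW mg1 C0
 (fun z r => le_trans (normc_Re _) (gC z r)).
have [i2 j2 e2] := @mecke _ _ _ V kap mk kap0 W (fun z r => Im (g z r)) C gW mg2 C0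
 (fun z r => le_trans (normc_Im _) (gC z r)).
have rR s : Re (remsum g s * (wprod W s)%:C) =
  remsum (fun z r => Re (g z r)) s * wprod W s.
 rewrite -(remsum_morph g s erefl (@cReD R)).
 by move: (remsum g) => [a b] /=; rewrite mulr0 ?subr0.
have rI s : Im (remsum g s * (wprod W s)%:C) =
  remsum (fun z r => Im (g z r)) s * wprod W s.
 rewrite -(remsum_morph g s erefl (@cImD R)).
 by move: (remsum g) => [a b] /=; rewrite mulr0 ?add0r.
have cR x : Re ((W x)%:C * cint (lp V) (fun s => g x s * (wprod W s)%:C)) =
  W x * EW V W (fun r => Re (g x r)).
 by rewrite mulrC cReMr mulrC; congr (_ * _); apply: eq_rint => s; rewrite cReMr.
have cI x : Im ((W x)%:C * cint (lp V) (fun s => g x s * (wprod W s)%:C)) =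
  W x * EW V W (fun r => Im (g x r)).
 by rewrite mulrC cImMr mulrC; congr (_ * _); apply: eq_rint => s; rewrite cImMr.
split.
- split; first exact: eq_L1 i1 .
 exact: eq_L1 i2 .
- split; first exact: eq_L1 j1 .
 exact: eq_L1 j2 .
- apply: cext => /=.
 + by rewrite (eq_rint _ rR) (eq_rint _ cR) -e1.
 + by rewrite (eq_rint _ rI) (eq_rint _ cI).
Qed.

End complex_mecke.

(** * Fredholm series and Janossy densities *)

Section fredholm.
Context d (T : measurableType d) (R : realType).
Variable V : sfmeas T R.
Variables (W0 : T -> R) (Hol : set (T -> R[i])) (B : nat -> set T)
 (K : T -> T -> R[i]).
Hypothesis rk : rkhs V W0 Hol B K.
Local Notation inH := (inH V W0 Hol).
Local Notation kap := (kap K).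
Local Notation skap := (skap K).
Local Notation bdet := (bdet K).
Local Notation rho := (rho K).
Let mW0 := rkhs_mW rk.
Let W00 := rkhs_W0 rk.
Let kap0 := kap_ge0 rk.
Let mkap := m_kap rk.

(** For [s] empty this is the Fredholm determinant of 1 - K with respect to the weight [w]. *)
Definition jan w s := EW V (fun x => - w x) (fun y => rho (s ++ y)).

(** The Fredholm minor: the series of [jan] with the bordered determinant in place of [rho]. It is
    for the weight [W0 - w] what [bdet] is for [W0]. *)
Definition Fw w q s z := cint (lp V)
 (fun y => bdet z q (s ++ y) * (wprod (fun x => - w x) y)%:C).

Lemma m_cat_section (s : seq T) : measT (fun y : seq T => s ++ y).
apply: (mpre (h := fun y : seq T => (s, y)) (@m_seq_cat _ T)).
exact: mfpair.
Qed.

Lemma kdom_rho_cat s : kdom kap (fun y => rho (s ++ y)).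
by exists (wprod kap s); [exact: wprod_ge0|exact: (rho_dom rk)].
Qed.

Lemma m_rho_cat s : measT (fun y => rho (s ++ y)).
exact: mpre (m_rho rk) (m_cat_section s). Qed.

Lemma m_rho_cat2 : measT (fun p : seq T * seq T => rho (p.1 ++ p.2)).
exact: mpre (m_rho rk) (@m_seq_cat _ T). Qed.

Lemma jan_perm w s t : perm_eq s t -> jan w s = jan w t.
by move=> st; apply: EW_ext => y; apply: rho_perm; rewrite perm_cat2r.
Qed.

Variable w : T -> R.
Hypotheses (mw : measT w) (wW : forall z, 0 <= w z <= W0 z)
 (iw : L1 V (fun x => kap x * w x)).

Let w0 z : 0 <= w z. Proof. by have /andP[] := wW z. Qed.
Local Notation mwt := (fun x => - w x).
Local Notation e y := ((wprod mwt y)%:C).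

Lemma gweight_opp : gweight V kap mwt.
split; first exact: mfcomp.
by apply: eq_L1 (L1N iw) => x; rewrite mulrN.
Qed.

Let gw := gweight_opp.

Lemma m_jan : measT (jan w).
by apply: m_EW; [exact: gw.1|exact: m_rho_cat2]. Qed.

Lemma jan_le s : `|jan w s| <= EWbound V kap mwt * wprod kap s.
rewrite mulrC; apply: (norm_EW mkap kap0 gw).
- exact: m_rho_cat.
- exact: wprod_ge0.
- exact: (rho_dom rk).
Qed.

Lemma bdet_cat_le z q s y : normc (bdet z q (s ++ y) * e y) <=
 (skap z * skap q * wprod kap s) * wprod (fun x => kap x * `|mwt x|) y.
rewrite normcM normcR norm_wprod wprodM.
apply: (@le_trans _ _ (skap z * skap q * wprod kap (s ++ y) * wprod (fun x => `|mwt x|) y)).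
 by rewrite ler_wpM2r ?wprod_ge0//; exact: (bdet_le rk).
by rewrite wprod_cat !mulrA.
Qed.

Lemma cmeas_bdet_cat q s :
 cmeas (fun p : T * seq T => bdet p.1 q (s ++ p.2) * e p.2).
apply: cmeasM.
 apply: (cmpre (h := fun p : T * seq T => ((p.1, q), s ++ p.2)) _ (cmeas_bdet rk)).
 apply: mfpair; first exact: mfpair.
 exact: mpre (m_cat_section s) measurable_snd.
apply: cmeas_real; apply: mpre measurable_snd.
exact: m_wprod gw.1.
Qed.

Lemma cL1_bdet_cat z q s :
 cL1 (lp V) (fun y => bdet z q (s ++ y) * e y).
apply: cL1_dom (bdet_cat_le z q s) _.
 have [m1 m2] := cmeas_bdet_cat q s.
 by split; [exact: (@m_section _ _ _ _ _ _ (fun x y => Re (bdet x q (s ++ y) * e y)))|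
  exact: (@m_section _ _ _ _ _ _ (fun x y => Im (bdet x q (s ++ y) * e y)))].
exact: (L1_kap mkap _).
Qed.

Lemma Fw_le z q s : normc (Fw w q s z) <=
 skap z * (skap q * wprod kap s * EWbound V kap mwt).
apply: le_trans (normc_cint (cL1_bdet_cat z q s)) _.
rewrite !mulrA -RintZ; last first.
 by apply: eq_L1 (L1_kap mkap kap0 1 gw) => y; rewrite mul1r.
apply: le_Rint.
- exact: cL1_normc (cL1_bdet_cat z q s).
- exact: (L1_kap mkap _).
- exact: bdet_cat_le.
Qed.

Lemma cmeas_Fw q s : cmeas (Fw w q s).
have [m1 m2] := cmeas_bdet_cat q s.
by split; [exact: (@m_Rint_param _ _ _ _ _ _ (fun x y => Re (bdet x q (s ++ y) * e y)))|
  exact: (@m_Rint_param _ _ _ _ _ _ (fun x y => Im (bdet x q (s ++ y) * e y)))].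
Qed.

Lemma L2_Fw q s : L2 V w (Fw w q s).
split; first exact: cmeas_Fw.
set C := skap q * wprod kap s * EWbound V kap mwt.
have C0 : 0 <= C.
 by rewrite !mulr_ge0 ?(skap_ge0) ?wprod_ge0 ?EWbound_ge0.
apply: le_L1 (L1Z (C ^+ 2) iw).
 by apply: mfM => //; apply: m_normc2; exact: cmeas_Fw.
move=> z; rewrite ger0_norm; last by rewrite mulr_ge0 ?sqr_ge0.
rewrite mulrA ler_wpM2r// -(skap_sq rk) -exprMn mulrC.
have h := Fw_le z q s; rewrite -/C in h.
by apply: lerXn2r => //; rewrite nnegrE ?nc_ge0// mulr_ge0// skap_ge0.
Qed.

(** Expansion along the row of [z], integrated term by term. The columns of [s] give the sum over
    removals. For the columns of the integrated points, Mecke's formula extracts one point; its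
    weight -w changes the sign and leaves a product of [Fw] with the kernel at [z]. *)
Lemma Fw_expand q s z : Fw w q s z = K z q * (jan w s)%:C -
 remsum (fun x r => K z x * Fw w q r x) s +
 dotw V w (Fw w q s) (K^~ z).
pose g x r := K z x * bdet x q (s ++ r).
have mg : cmeas (fun p : T * seq T => g p.1 p.2).
 apply: cmeasM.
  apply: (cmpre (h := fun p : T * seq T => (z, p.1)) _ (rkhs_mK rk)).
  exact: mfpair.
 apply: (cmpre (h := fun p : T * seq T => ((p.1, q), s ++ p.2)) _ (cmeas_bdet rk)).
 apply: mfpair; first exact: mfpair.
 exact: mpre (m_cat_section s) measurable_snd.
have C0 : 0 <= skap z * skap q * wprod kap s.
 by rewrite !mulr_ge0 ?(skap_ge0) ?wprod_ge0.
have gC x r : normc (g x r) <= (skap z * skap q * wprod kap s) * (kap x * wprod kap r).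
 rewrite normcM; apply: (@le_trans _ _ ((skap z * skap x) * (skap x * skap q * wprod kap (s ++ r)))).
  by apply: ler_pM; rewrite ?nc_ge0 ?(normcK_skap rk) ?(bdet_le rk).
 by rewrite wprod_cat -(skap_sq rk); apply: eq_ler; ring.
have [i3 i3' e3] := complex_mecke kap0 gw mkap mg C0 gC.
have Gi x r : cL1 (lp V) (fun y => K z x * (bdet x q (r ++ y) * e y)).
 by apply: cL1Z; exact: cL1_bdet_cat.
have [i2 e2] := cint_remsum s Gi.
have i1 : cL1 (lp V) (fun y => (rho (s ++ y) * wprod mwt y)%:C).
 split => /=; last exact: integrable0.
 exact: (L1_kdom mkap kap0 gw (m_rho_cat s) (kdom_rho_cat s)).
have E y : bdet z q (s ++ y) * e y = K z q * (rho (s ++ y) * wprod mwt y)%:C -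
  (remsum (fun x r => K z x * (bdet x q (r ++ y) * e y)) s + remsum g y * e y).
 rewrite bdet_expand (minor_real rk) remsum_cat mulrBl mulrDl rmorphM mulrA; congr (_ - (_ + _)).
 rewrite mulrC -remsumZ; apply: eq_remsum => x r; ring.
rewrite /Fw (eq_cint _ E) cintB; [|exact: cL1Z|exact: cL1D].
rewrite cintZ// cint_real cintD// e2 e3 opprD addrA; congr (_ - _ + _).
 apply: eq_remsum => x r; rewrite cintZ//; exact: cL1_bdet_cat.
rewrite -cintN//; apply: eq_cint => x.
rewrite -mulNr -rmorphN /= opprK -(K_conj rk) mulrC; congr (_ * _).
rewrite [RHS]mulrC -cintZ; last exact: cL1_bdet_cat.
by apply: eq_cint => y; rewrite mulrA.
Qed.

(** The last term of [Fw_expand] is the Riesz representative [P] of [Fw] for the weight [w]. Moved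
    to the other side, it replaces [W0] by [W0 - w] in products with functions of the space; what
    remains is treated as in [rep_bdet]. *)
Lemma Fw_rep q s : [/\ inH (Fw w q s),
 forall f, inH f -> (forall x, x \in s -> f x = 0) ->
  dotw V (fun z => W0 z - w z) f (Fw w q s) = f q * (jan w s)%:C,
 forall x, x \in s -> Fw w q s x = 0 & Fw w q s q = (jan w (q :: s))%:C].
have [P [HP PE]] := riesz rk mw wW (L2_Fw q s).
have PK z : P z = dotw V w (Fw w q s) (K^~ z).
 have h1 := (inHK rk z).2; have h2 := L2_le mw wW h1.
 rewrite (repK rk z HP) (dotwC mW0 W00 h1 HP.2) (PE _ (inHK rk z)).
 by rewrite -(dotwC mw w0 h2 (L2_Fw q s)).
have FE : Fw w q s = (fun z => ((jan w s)%:C * K z q -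
  remsum (fun x r => K z x * Fw w q r x) s) + P z).
 by apply/funext => z; rewrite Fw_expand PK [K z q * _]mulrC.
have h1 := inHZ rk (jan w s)%:C (inHK rk q).
have h2 := inH_remsum rk (fun x r => Fw w q r x) s.
have HF : inH (Fw w q s) by rewrite FE; apply: (inHD rk) => //; exact: (inHB rk).
split=> //.
- move=> f hf fs; rewrite dotw_sub//; [|exact: hf.2|exact: HF.2].
 rewrite -(PE _ hf) {1}FE dotwDr//; [|exact: (inHB rk h1 h2).2|exact: HP.2|exact: hf.2].
 rewrite addrK dotwBr//; [|exact: h1.2|exact: h2.2|exact: hf.2].
 rewrite (dot_remsum rk)// subr0 dotwZr//; [|exact: (inHK rk q).2|exact: hf.2].
 by rewrite -(repK rk q hf) cj_real mulrC.
- move=> x xs; rewrite /Fw (eq_cint _ (g := fun=> 0)) ?cint0// => y.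
 by rewrite bdet_mem ?mul0r// mem_cat xs.
- rewrite -cint_real; apply: eq_cint => y.
 by rewrite (bdet_diag rk) -rmorphM.
Qed.

End fredholm.

Section limits.
Variable R : realType.

Lemma le_cvg (u v : nat -> R) (a b : R) : u n @[n --> \oo] --> a -> v n @[n --> \oo] --> b ->
 (forall n, u n <= v n) -> a <= b.
move=> ua vb uv; rewrite -(cvg_lim (@Rhausdorff R) ua) -(cvg_lim (@Rhausdorff R) vb).
apply: ler_lim; [by apply/cvg_ex; exists a|by apply/cvg_ex; exists b|exact: nearW].
Qed.

Lemma cvg_pow (u : nat -> R) (a : R) k : u n @[n --> \oo] --> a ->
 u n ^+ k @[n --> \oo] --> a ^+ k.
move=> ua; elim: k => [|k IH]; first by rewrite expr0; exact: cvg_cst.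
by under eq_fun do rewrite exprS; rewrite exprS; exact: cvgM.
Qed.

Definition tseq (n : nat) : R := 1 - n.+1%:R^-1.

Lemma tseq_ge0 n : 0 <= tseq n.
by rewrite subr_ge0 invf_le1// ler1n. Qed.

Lemma tseq_lt1 n : tseq n < 1.
by rewrite ltrBlDr ltrDl. Qed.

Lemma tseq_cvg k : tseq n ^+ k @[n --> \oo] --> (1 : R).
have t1 : tseq n @[n --> \oo] --> (1 : R).
 rewrite -[X in _ --> X]subr0; apply: cvgB; first exact: cvg_cst.
 exact: @cvg_harmonic.
by rewrite -(expr1n R k); exact: cvg_pow.
Qed.

End limits.

(** * Positivity and extremal property of the Janossy densities *)

Section consequences.
Context d (T : measurableType d) (R : realType).
Variable V : sfmeas T R.
Variables (W0 : T -> R) (Hol : set (T -> R[i])) (B : nat -> set T)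
 (K : T -> T -> R[i]).
Hypothesis rk : rkhs V W0 Hol B K.
Local Notation inH := (inH V W0 Hol).
Local Notation kap := (kap K).
Local Notation rho := (rho K).
Local Notation jan := (jan V K).
Local Notation Fw := (Fw V K).
Let mW0 := rkhs_mW rk.
Let W00 := rkhs_W0 rk.
Let kap0 := kap_ge0 rk.
Let mkap := m_kap rk.

Lemma wprod_scale (c : R) W (s : seq T) :
 wprod (fun x => c * W x) s = c ^+ size s * wprod W s.
by elim: s => [|a s IH]; rewrite ?wprod_nil ?mul1r// !wprod_cons IH exprS; ring. Qed.

(** Scaling the weight by t multiplies the integrand at a sequence of length n by t^n, so the
    unscaled integrand dominates. *)
Lemma EW_tseq W f : gweight V kap W -> measT f -> kdom kap f ->
 EW V (fun x => tseq R n * W x) f @[n --> \oo] --> EW V W f.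
move=> gW mf [C C0 fC]; have mw := m_wprod gW.1.
apply: (@Rint_cvg _ _ _ _ _ _ (fun s => C * wprod (fun x => kap x * `|W x|) s)).
- move=> n; apply: mfM => //; apply: m_wprod.
 by apply: mfM => //; exact: gW.1.
- exact: mfM.
- move=> s; under eq_fun do rewrite wprod_scale.
 have -> : f s * wprod W s = f s * (1 * wprod W s) by rewrite mul1r.
 apply: cvgM; first exact: cvg_cst.
 by apply: cvgM; [exact: tseq_cvg|exact: cvg_cst].
- exact: (L1_kap).
- move=> n s; rewrite wprod_scale.
 apply: (@le_trans _ _ `|f s * wprod W s|); last exact: kdom_le.
 rewrite !normrM ler_wpM2l//.
 rewrite ler_piMl// normrX exprn_ile1// ger0_norm ?tseq_ge0//.
 exact: ltW (tseq_lt1 _ _).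
Qed.

Lemma EW_weight_ext W1 W2 f : (forall x, W1 x = W2 x) -> EW V W1 f = EW V W2 f.
by move=> W12; congr (EW V _ f); apply/funext. Qed.

Section one_weight.
Variable w : T -> R.
Hypotheses (mw : measT w) (wW : forall z, 0 <= w z <= W0 z)
 (iw : L1 V (fun x => kap x * w x))
 (j0 : forall t, 0 <= t < 1 -> 0 <= jan (fun x => t * w x) [::]).

Let w0 z : 0 <= w z. Proof. by have /andP[] := wW z. Qed.

Section thinned.
Variable t : R.
Hypothesis t01 : 0 <= t < 1.
Let t0 : 0 <= t. Proof. by have /andP[] := t01. Qed.
Let t1 : t < 1. Proof. by have /andP[] := t01. Qed.
Let tw x := t * w x.
Let v z := W0 z - tw z.

Let mtw : measT tw. Proof. exact: mfM. Qed.

Let tw_le z : tw z <= t * W0 z.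
by rewrite ler_wpM2l; have /andP[] := wW z. Qed.

Let twW z : 0 <= tw z <= W0 z.
rewrite mulr_ge0//; apply: le_trans (tw_le z) _.
by rewrite ler_piMl// ltW.
Qed.

Let itw : L1 V (fun x => kap x * tw x).
by apply: eq_L1 (L1Z t iw) => x; rewrite mulrCA. Qed.

Let mv : measT v. Proof. exact: measurable_funB. Qed.
Let vW z : 0 <= v z <= W0 z.
by rewrite /v; have := twW z; lra. Qed.

(** Here t < 1 enters: [v] is at least (1 - t) [W0], so a null norm for [v] is a null norm of the
    space. For t = 1 the weight may vanish on a large set. *)
Let nrm2_v0 f q : inH f -> nrm2 V v f = 0 -> f q = 0.
move=> hf nf; have : (1 - t) * nrm2 V W0 f <= 0.
 rewrite -nf; have -> : (1 - t) * nrm2 V W0 f = nrm2 V (fun z => (1 - t) * W0 z) f.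
  rewrite /nrm2 -RintZ; last exact: hf.2.2.
  by apply: eq_rint => z; rewrite mulrCA.
 apply: nrm2_le.
 - exact: mfM.
 - by move=> z; rewrite mulr_ge0 ?subr_ge0 ?(ltW t1)// /v; have := tw_le z; lra.
 - exact: (L2_le mv vW hf.2).
rewrite pmulr_rle0 ?subr_gt0// => n0.
have := eval_bound rk q hf; have : kap q * nrm2 V W0 f <= 0 by rewrite mulr_ge0_le0.
move=> h1 h2; apply/eqP; rewrite -normc_eq0 -sqrf_eq0 eq_le sqr_ge0 andbT.
exact: le_trans h1.
Qed.

(** If [jan tw s] is 0, then [Fw] has norm 0 and hence value 0 at [q], which is [jan tw (q :: s)];
    if it is positive, the representing property gives the sign. *)
Let jan_ge0_step s : 0 <= jan tw s -> forall q, 0 <= jan tw (q :: s).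
move=> s0 q; have [HF rep Fs Fq] := Fw_rep rk mtw twW itw q s.
have [s'0|s'n] := eqVneq (jan tw s) 0.
 have := nrm2_kel HF rep Fs Fq; rewrite s'0 mulr0 => /(nrm2_v0 q HF).
 rewrite Fq => /(congr1 (@Re R)) /= ->; by [].
by apply: (kel_ge0 vW HF rep Fs Fq); rewrite lt_neqAle eq_sym s'n.
Qed.

Lemma jan_thinned_ge0 s : 0 <= jan tw s.
by elim: s => [|a s IH]; [exact: j0|exact: jan_ge0_step]. Qed.

(** The Cauchy-Schwarz inequality of a positive kernel: the extremal property at [z] is applied to
    the element at [q]. The common factor [jan tw s] is cancelled, its zeros being harmless because
    of [nrm2_v0]; the case t = 1 follows by a limit in [Fw_sq_le]. *)
Lemma Fw_thinned_le q s z :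
 normc (Fw tw q s z) ^+ 2 <= jan tw (z :: s) * jan tw (q :: s).
have [HF rep Fs Fq] := Fw_rep rk mtw twW itw q s.
have [HG repG Gs Gz] := Fw_rep rk mtw twW itw z s.
have nF := nrm2_kel HF rep Fs Fq.
have [s'0|s'n] := eqVneq (jan tw s) 0.
 have -> : Fw tw q s z = 0 by apply: nrm2_v0 HF _; rewrite nF s'0 mulr0.
 by rewrite normc0 expr0n mulr_ge0 ?jan_thinned_ge0.
have s'p : 0 < jan tw s by rewrite lt_neqAle eq_sym s'n jan_thinned_ge0.
have := kel_le mv vW HG repG Gs Gz (ltW s'p) (jan_thinned_ge0 _) HF Fs.
by rewrite nF mulrA ler_pM2r.
Qed.

End thinned.

Let gw := gweight_opp mw iw.

Lemma jan_cvg s : jan (fun x => tseq R n * w x) s @[n --> \oo] --> jan w s.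
have -> : (fun n => jan (fun x => tseq R n * w x) s) =
  (fun n => EW V (fun x => tseq R n * - w x) (fun y => rho (s ++ y))).
 by apply/funext => n; apply: EW_weight_ext => x; rewrite mulrN.
exact: EW_tseq (m_rho_cat rk s) (kdom_rho_cat rk s).
Qed.

Lemma jan_ge0 s : 0 <= jan w s.
apply: (@le_cvg _ (fun=> 0) (fun n => jan (fun x => tseq R n * w x) s)) => [||n];
 [exact: cvg_cst|exact: jan_cvg|].
by apply: jan_thinned_ge0; rewrite tseq_ge0 tseq_lt1.
Qed.

Lemma Fw_cvg q s z :
 normc (Fw (fun x => tseq R n * w x) q s z) ^+ 2 @[n --> \oo] --> normc (Fw w q s z) ^+ 2.
have H (p : R[i] -> R) : (forall x (a : R), p (x * a%:C) = p x * a) ->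
  measT (fun y => p (bdet K z q (s ++ y))) ->
  (forall x, `|p x| <= normc x) ->
  (\int[lp V]_y p (bdet K z q (s ++ y) *
    (wprod (fun x => - (tseq R n * w x)) y)%:C))%R @[n --> \oo] -->
  (\int[lp V]_y p (bdet K z q (s ++ y) * (wprod (fun x => - w x) y)%:C))%R.
 move=> pM mp pl; have := EW_tseq gw mp.
 have -> : (\int[lp V]_y p (bdet K z q (s ++ y) * (wprod (fun x => - w x) y)%:C))%R =
   EW V (fun x => - w x) (fun y => p (bdet K z q (s ++ y))).
  exact: eq_rint .
 have -> : (fun n => (\int[lp V]_y p (bdet K z q (s ++ y) *
    (wprod (fun x => - (tseq R n * w x)) y)%:C))%R) =
   (fun n => EW V (fun x => tseq R n * - w x) (fun y => p (bdet K z q (s ++ y)))).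
  apply/funext => n; apply: eq_rint => y; rewrite pM; congr (_ * wprod _ y).
  by apply/funext => x; rewrite mulrN.
 apply; exists (skap K z * skap K q * wprod kap s).
  by rewrite !mulr_ge0 ?(skap_ge0) ?wprod_ge0.
 move=> y; apply: le_trans (pl _) _; apply: le_trans (bdet_le rk z q _) _.
 by rewrite wprod_cat !mulrA.
have [m1 m2] : cmeas (fun y => bdet K z q (s ++ y)).
 apply: (cmpre (h := fun y : seq T => ((z, q), s ++ y)) _ (cmeas_bdet rk)).
 by apply: mfpair => //; exact: m_cat_section.
under eq_fun do rewrite normc_sq; rewrite normc_sq.
apply: cvgD.
- exact: cvg_pow (H _ (@cReMr R) m1 (@normc_Re R)).
- exact: cvg_pow (H _ (@cImMr R) m2 (@normc_Im R)).
Qed.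

Lemma Fw_sq_le q s z : normc (Fw w q s z) ^+ 2 <= jan w (z :: s) * jan w (q :: s).
apply: (@le_cvg _ (fun n => normc (Fw (fun x => tseq R n * w x) q s z) ^+ 2)
 (fun n => jan (fun x => tseq R n * w x) (z :: s) * jan (fun x => tseq R n * w x) (q :: s)))
 => [||n]; [exact: Fw_cvg|by apply: cvgM; exact: jan_cvg|].
by apply: Fw_thinned_le; rewrite tseq_ge0 tseq_lt1.
Qed.

Let v z := W0 z - w z.
Let mv : measT v. Proof. exact: measurable_funB. Qed.
Let vW z : 0 <= v z <= W0 z.
by rewrite /v; have := wW z; lra. Qed.

Lemma jan_eval f q s : inH f -> (forall x, x \in s -> f x = 0) ->
 normc (f q) ^+ 2 * jan w s <= jan w (q :: s) * nrm2 V v f.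
move=> hf fs; have [HF rep Fs Fq] := Fw_rep rk mw wW iw q s.
exact: (kel_le mv vW HF rep Fs Fq (jan_ge0 _) (jan_ge0 _)).
Qed.

Lemma jan_cons_le q s C : 0 <= C -> (forall f, inH f -> (forall x, x \in s -> f x = 0) ->
   normc (f q) ^+ 2 <= C * nrm2 V v f) -> jan w (q :: s) <= C * jan w s.
move=> C0 fC; have [HF rep Fs Fq] := Fw_rep rk mw wW iw q s.
exact: (kel_bound HF rep Fs Fq (jan_ge0 _) (jan_ge0 _)).
Qed.

Lemma nrm2_Fw q s : nrm2 V v (Fw w q s) = jan w (q :: s) * jan w s.
have [HF rep Fs Fq] := Fw_rep rk mw wW iw q s.
exact: nrm2_kel rep Fs Fq.
Qed.

End one_weight.

(** The product of [b] with the element F of [w'], [q], [y] competes in the problem of [w], [q],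
    [x ++ y]: it vanishes on [x] through [b] and on [y] through F, and its norm for [W0 - w] is at
    most that of F for the larger weight [W0 - w']. *)
Lemma jan_insert (w w' : T -> R) (b : T -> R[i]) q x y :
 measT w -> (forall z, 0 <= w z <= W0 z) ->
 L1 V (fun x => kap x * w x) ->
 (forall t, 0 <= t < 1 -> 0 <= jan (fun x => t * w x) [::]) ->
 measT w' -> (forall z, 0 <= w' z <= w z) ->
 (forall t, 0 <= t < 1 -> 0 <= jan (fun x => t * w' x) [::]) ->
 (forall f, inH f -> inH (fun z => b z * f z)) ->
 (forall z, normc (b z) <= 1) -> (forall z, z \in x -> b z = 0) ->
 normc (b q) ^+ 2 * (jan w' (q :: y) * jan w (x ++ y)) <=
 jan w (q :: x ++ y) * jan w' y.
move=> mw wW iw j0 mw' ww' j0' bH b1 bx.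
have wW' z : 0 <= w' z <= W0 z.
 have := ww' z; have := wW z; lra.
have iw' : L1 V (fun x => kap x * w' x).
 apply: le_L1 iw; first exact: mfM.
 move=> z; have /andP[h1 h2] := ww' z; rewrite ger0_norm ?mulr_ge0//.
 by rewrite ler_wpM2l.
have [HF rep Fs Fq] := Fw_rep rk mw' wW' iw' q y.
have nF := nrm2_Fw mw' wW' iw' q y.
have a0 := jan_ge0 mw' wW' iw' j0' y.
have b0 := jan_ge0 mw' wW' iw' j0' (q :: y).
have [E|bn] := eqVneq (jan w' (q :: y)) 0.
 by rewrite E mul0r mulr0 mulr_ge0//; exact: jan_ge0.
have bp : 0 < jan w' (q :: y) by rewrite lt_neqAle eq_sym bn.
have := @jan_eval w mw wW iw j0 (fun z => b z * Fw w' q y z) q (x ++ y) (bH _ HF).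
have vanish : forall z, z \in x ++ y -> b z * Fw w' q y z = 0.
 by move=> z; rewrite mem_cat => /orP[/bx ->|/Fs ->]; rewrite ?mul0r ?mulr0.
move=> /(_ vanish); rewrite Fq normcM exprMn normcR real_normK ?num_real// => H.
have vle : nrm2 V (fun z => W0 z - w z) (fun z => b z * Fw w' q y z) <=
  jan w' (q :: y) * jan w' y.
 rewrite -nF; apply: le_Rint.
 - have := L2_sub mw wW (bH _ HF).2 => -[_].
  exact.
 - by have [_] := L2_sub mw' wW' HF.2.
 - move=> z; rewrite normcM exprMn.
  have /andP[h1 h2] := ww' z; have /andP[h3 h4] := wW z.
  apply: (@le_trans _ _ (normc (Fw w' q y z) ^+ 2 * (W0 z - w z))).
   rewrite ler_wpM2r ?subr_ge0// ler_piMl ?sqr_ge0// exprn_ile1 ?nc_ge0//.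
  by rewrite ler_wpM2l ?sqr_ge0// lerB.
rewrite -(ler_pM2l bp).
have -> : jan w' (q :: y) * (normc (b q) ^+ 2 * (jan w' (q :: y) * jan w (x ++ y))) =
  normc (b q) ^+ 2 * jan w' (q :: y) ^+ 2 * jan w (x ++ y) by ring.
apply: le_trans H _; rewrite mulrCA; apply: ler_wpM2l => //.
exact: jan_ge0.
Qed.

End consequences.

(** * Localization of the evaluation problem *)

Section local_evaluation.
Context d (T : measurableType d) (R : realType).
Variable V : sfmeas T R.
Variables (W0 : T -> R) (Hol : set (T -> R[i])) (B : nat -> set T)
 (K : T -> T -> R[i]).
Hypothesis rk : rkhs V W0 Hol B K.
Local Notation inH := (inH V W0 Hol).
Local Notation rho := (rho K).
Let mW0 := rkhs_mW rk.
Let W00 := rkhs_W0 rk.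
Let wB M z := W0 z * \1_(B M) z.

Let mwB M : measT (wB M).
by apply: mfM => //; exact: mindic (rkhs_mB rk M). Qed.

Let wB_mono M N z : (M <= N)%N -> 0 <= wB M z <= wB N z.
move=> MN; rewrite mulr_ge0 ?W00// ler_wpM2l ?W00// !indicE.
case: (boolP (z \in B M)) => [/set_mem BM|_]//.
by rewrite (mem_set (rkhs_ndB rk MN BM)).
Qed.

Let wBW M z : 0 <= wB M z <= W0 z.
rewrite mulr_ge0 ?W00// ler_piMr ?W00//.
Qed.

Let wB0 M z : 0 <= wB M z. Proof. by have /andP[] := wBW M z. Qed.

Lemma wB_cvg z : wB M z @[M --> \oo] --> W0 z.
have [E|n0] := eqVneq (W0 z) 0.
 by under eq_fun do rewrite /wB E mul0r; rewrite E; exact: cvg_cst.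
have [N BN] := rkhs_covB rk n0.
apply: cvg_near_cst; exists N => // M /= NM.
by rewrite /wB indicE (mem_set (rkhs_ndB rk NM BN)) mulr1.
Qed.

(* The extremal problem for evaluation at [q] on [B M] decreases to the one for
  the whole space: near-minimisers form a Cauchy sequence on every [B M]. *)
Lemma eval_localized s q C : 0 < rho s -> rho (q :: s) < C * rho s ->
 exists M, forall f, inH f -> (forall x, x \in s -> f x = 0) ->
  normc (f q) ^+ 2 <= C * nrm2 V (wB M) f.
move=> rs rC; apply: contrapT => noM.
have C0 : 0 < C.
 have := rho_ge0 rk (q :: s) => r0; rewrite -(pmulr_lgt0 _ rs).
 exact: le_lt_trans rC.
pose A f := [/\ inH f, forall x, x \in s -> f x = 0 & f q = 1].
have L2w M f : inH f -> L2 V (wB M) f by move=> hf; exact: (L2_le (mwB M) (wBW M) hf.2).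
(* Failure of the claim on [B M] yields a function with too large a value at [q]; it is rescaled to
   take the value 1 there. *)
have ex M : exists2 f, A f & nrm2 V (wB M) f <= C^-1.
 apply: contrapT => nof; apply: noM; exists M => f hf fs; rewrite leNgt; apply/negP => lt.
 have fq0 : f q != 0.
  apply/eqP => fq; move: lt; rewrite fq normc0 expr0n /= ltNge.
  by rewrite mulr_ge0 ?(ltW C0)// nrm2_ge0.
 apply: nof; exists (fun z => (f q)^-1 * f z).
  split; [exact: (inHZ rk _ hf)|by move=> x xs; rewrite (fs x xs) mulr0|exact: mulVf].
 rewrite nrm2Z; last exact: L2w.
 rewrite normcV exprVn; have np : 0 < normc (f q) ^+ 2 by rewrite exprn_gt0 ?normc_gt0.
 by rewrite ler_pdivrMl// mulrC ler_pdivlMl//; apply: ltW.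
have /choice[m mP] : forall M, exists m, (forall f, A f -> m <= nrm2 V (wB M) f) /\
  forall e, 0 < e -> exists2 f, A f & nrm2 V (wB M) f <= m + e.
 move=> M; apply: (@inf_bound _ _ A (fun f => nrm2 V (wB M) f) 0).
  by have [f Af _] := ex M; exists f.
 by move=> f _; exact: nrm2_ge0.
have nrmM M N f : (M <= N)%N -> inH f -> nrm2 V (wB M) f <= nrm2 V (wB N) f.
 by move=> MN hf; apply: nrm2_le; [by []|move=> z; exact: wB_mono|exact: L2w].
have dl0 n : 0 < n.+1%:R^-1 :> R by [].
have dle n k : (n <= k)%N -> k.+1%:R^-1 <= n.+1%:R^-1 :> R.
 by rewrite lef_pV2 ?posrE// ler_nat.
have /choice[f_ f_P] : forall M, exists f, A f /\ nrm2 V (wB M) f <= m M + M.+1%:R^-1.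
 by move=> M; have [f] := (mP M).2 _ (dl0 M); exists f.
have m_mono M N : (M <= N)%N -> m M <= m N.
 move=> MN; apply/ler_addgt0Pr => e e0; have [f Af fm] := (mP N).2 e e0.
 apply: le_trans ((mP M).1 f Af) _; apply: le_trans fm; apply: nrmM => //.
 by case: Af.
have mC M : m M <= C^-1.
 by have [f Af fC] := ex M; exact: le_trans ((mP M).1 f Af) fC.
(* The local minima [m M] increase and stay below [C^-1]. Their increments, which by the
   parallelogram identity control the distance of near-minimisers on a fixed [B M], therefore tend
   to 0. *)
pose ms := sup (range m).
have hs : has_sup (range m).
 by split; [exists (m 0%N), 0%N|exists C^-1 => _ [M _ <-]].
have ms_ub M : m M <= ms by apply: ub_le_sup; [exact: hs.2|exists M].
have msC : ms <= C^-1 by apply: ge_sup => [|_ [M _ <-]//]; exact: hs.1.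
have cau M N N' : (M <= N)%N -> (N <= N')%N ->
  nrm2 V (wB M) (fun z => f_ N z - f_ N' z) <= 2 * (ms - m N) + 4 * N.+1%:R^-1.
 move=> MN NN'; have [[h1 s1 q1] J1] := f_P N; have [[h2 s2 q2] J2] := f_P N'.
 apply: le_trans (nrmM M N _ MN (inHB rk h1 h2)) _.
 rewrite (parallelogram (mwB N) (wB0 N) (L2w N _ h1) (L2w N _ h2)).
 have Ah : A (fun z => (2^-1)%:C * (f_ N z + f_ N' z)).
  split; first exact: (inHZ rk _ (inHD rk h1 h2)).
  - by move=> x xs; rewrite s1 ?s2 ?addr0 ?mulr0.
  - by rewrite q1 q2; apply: cext => /=; lra.
 move: ((mP N).1 _ Ah) J1 J2 (nrmM _ _ _ NN' h2) (ms_ub N') (dle _ _ NN').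
 move: (N.+1%:R^-1) (N'.+1%:R^-1) => b c; lra.
have cau2 e : 0 < e -> exists N, forall M N1 N2, (M <= N1)%N -> (M <= N2)%N ->
  (N <= N1)%N -> (N <= N2)%N ->
  nrm2 V (wB M) (fun z => f_ N1 z - f_ N2 z) <= e.
 move=> e0; have [_ [N0 _ <-] N0e] : exists2 x, range m x & ms - e / 4 < x.
  by apply: sup_adherent => //; rewrite divr_gt0.
 have [k ke] := @harmonic_small R 8 e e0.
 exists (maxn N0 k) => M N1 N2 MN1 MN2 NN1 NN2.
 wlog le12 : N1 N2 MN1 MN2 NN1 NN2 / (N1 <= N2)%N.
  move=> H; have /orP[|le21] := leq_total N1 N2; first exact: H.
  have := H _ _ MN2 MN1 NN2 NN1 le21; congr (_ <= _); apply: eq_rint => z.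
  by rewrite normcB_sym.
 apply: le_trans (cau M N1 N2 MN1 le12) _.
 have h1 : m N0 <= m N1 by apply: m_mono; apply: leq_trans NN1; exact: leq_maxl.
 have h2 := dle k N1 (leq_trans (leq_maxr _ _) NN1).
 move: ke h2; move: (k.+1%:R^-1) (N1.+1%:R^-1) => a b; lra.
have [f Hf cvf] : exists2 f, Hol f & forall z, normc (f_ n z - f z) @[n --> \oo] --> (0 : R).
 apply: (rkhs_complete rk) => [n|M e e0]; first by have [[]] := f_P n.
 have [N NP] := cau2 e e0; exists (maxn N M) => n k.
 by rewrite !geq_max => /andP[h1 h2] /andP[h3 h4]; exact: NP.
have const z c : (forall n, f_ n z = c) -> f z = c.
 move=> fc; apply/esym/eqP; rewrite -subr_eq0 -normc_eq0; apply/eqP.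
 have := cvf z; under eq_fun do rewrite fc.
 by move=> /(cvg_lim (@Rhausdorff R)); rewrite lim_cst.
have fq : f q = 1 by apply: const => n; have [[]] := f_P n.
have fs x : x \in s -> f x = 0.
 by move=> xs; apply: const => n; have [[_ s0 _] _] := f_P n; exact: s0.
have fM M : L2 V (wB M) f /\ nrm2 V (wB M) f <= ms.
 apply: (nrm2_fatou (mwB M) (wB0 M) (rkhs_cmeas rk Hf) _ cvf).
  by move=> n; apply: L2w; have [[]] := f_P n.
 move=> e e0; have [k ke] := @harmonic_small R 1 e e0.
 exists (maxn k M) => // n /=; rewrite geq_max => /andP[kn Mn].
 have [[hn _ _] Jn] := f_P n.
 move: (nrmM _ _ _ Mn hn) Jn (ms_ub n) (dle _ _ kn) ke.
 move: (n.+1%:R^-1) (k.+1%:R^-1) => a b; lra.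
have [fi fms] : L1 V (fun z => normc (f z) ^+ 2 * W0 z) /\
  (\int[V]_z (normc (f z) ^+ 2 * W0 z) <= ms)%R.
 apply: (@Rint_fatou _ _ _ V (fun M z => normc (f z) ^+ 2 * wB M z)).
 - by move=> M; apply: L1_measurable (fM M).1.2.
 - by move=> M z; rewrite mulr_ge0 ?sqr_ge0.
 - by move=> z; apply: cvgM; [exact: cvg_cst|exact: wB_cvg].
 - by move=> M; exact: (fM M).1.2.
 - move=> e e0; exists 0%N => // M _; apply: le_trans (fM M).2 _.
  by rewrite lerDl ltW.
have hf : inH f by split=> //; split=> //; exact: (rkhs_cmeas rk).
have [HF rep Fs] := rep_bdet rk q s.
have W0W z : 0 <= W0 z <= W0 z by rewrite W00 lexx.
(* The limit [f] contradicts the global problem: with f(q) = 1 and norm at most [C^-1], [rho s]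
   would be at most [rho (q :: s) / C], which is smaller than [rho s]. *)
have := kel_le mW0 W0W HF rep Fs (bdet_diag rk q s) (ltW rs)
 (rho_ge0 rk (q :: s)) hf fs.
rewrite fq normc1 expr1n mul1r => H.
have : rho (q :: s) * nrm2 V W0 f <= rho (q :: s) * C^-1.
 by rewrite ler_wpM2l ?(rho_ge0 rk)//; exact: le_trans msC.
have : rho (q :: s) * C^-1 < rho s by rewrite ltr_pdivrMr// mulrC.
lra.
Qed.

End local_evaluation.

(** * Insertion of points: domination of the law by the Palm law *)

Lemma scaled_difference_le (R : realDomainType) (a b k : R) :
 k * a + (-1) * b <= k * 1 + (-1) * 1 -> k * a <= b + (k - 1).
lra. Qed.

Lemma le_unscaled (R : realDomainType) (a b e k : R) : 1 <= k -> a <= b ->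
 k * e <= a + (k - 1) -> 0 <= e -> e <= b + (k - 1).
nra. Qed.

Section comparison.
Context d (T : measurableType d) (R : realType).
Variable V : sfmeas T R.
Variables (W0 : T -> R) (Hol : set (T -> R[i])) (B : nat -> set T)
 (K : T -> T -> R[i]).
Hypothesis rk : rkhs V W0 Hol B K.
Local Notation inH := (inH V W0 Hol).
Local Notation kap := (kap K).
Local Notation rho := (rho K).
Local Notation jan := (jan V K).
Local Notation EW := (EW V).
Let mW0 := rkhs_mW rk.
Let W00 := rkhs_W0 rk.
Let kap0 := kap_ge0 rk.
Let mkap := m_kap rk.

(** The weights of windows. The last clause is the positivity that the series does not show and that
    [law_subw] derives from the process. *)
Definition subw (w : T -> R) := [/\ measT w, forall z, 0 <= w z <= W0 z,
 L1 V (fun x => kap x * w x) &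
 forall t, 0 <= t < 1 -> 0 <= jan (fun x => t * w x) [::]].

Definition multiplier (b : T -> R[i]) :=
 (forall f, inH f -> inH (fun z => b z * f z)) /\ forall z, normc (b z) <= 1.

Lemma subw_good w : subw w -> gweight V kap w.
by case. Qed.

Lemma subw_ge0 w z : subw w -> 0 <= w z.
by case=> _ /(_ z)/andP[]. Qed.

Lemma subw_opp w : subw w -> gweight V kap (fun x => - w x).
by case=> mw _ iw _; exact: gweight_opp. Qed.

Lemma sub_jan_ge0 w s : subw w -> 0 <= jan w s.
by case=> mw wW iw j0; exact: (jan_ge0 rk). Qed.

Lemma le_EW_supp w f g : (forall x, 0 <= w x) -> gweight V kap w ->
 measT f -> kdom kap f -> measT g -> kdom kap g ->
 (forall s, (forall x, x \in s -> w x != 0) -> f s <= g s) -> EW w f <= EW w g.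
move=> w0 gw mf fk mg gk fg; apply: le_Rint; [exact: (L1_kdom mkap)|exact: (L1_kdom mkap kap0 gw)|].
move=> s; case: (boolP (all (fun x => w x != 0) s)) => [/allP ws|/allPn[x xs]].
 by rewrite ler_wpM2r ?wprod_ge0//; exact: fg.
rewrite negbK => /eqP wx; suff -> : wprod w s = 0 by rewrite !mulr0.
by rewrite /wprod (big_rem x)//= wx mul0r.
Qed.

Lemma m_jan_cat w p : subw w -> measT (fun v => jan w (p ++ v)).
case=> mw wW iw _; apply: mpre (m_jan rk mw iw) _.
exact: m_cat_section.
Qed.

Lemma jan_cat_bound w p v : subw w ->
 `|jan w (p ++ v)| <= EWbound V kap (fun x => - w x) * wprod kap p * wprod kap v.
by case=> mw wW iw _; rewrite -mulrA -wprod_cat; exact: (jan_le rk).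
Qed.

Lemma kdom_jan_cat w p : subw w -> kdom kap (fun v => jan w (p ++ v)).
move=> sw; exists (EWbound V kap (fun x => - w x) * wprod kap p).
 by rewrite mulr_ge0 ?EWbound_ge0 ?wprod_ge0.
by move=> v; exact: jan_cat_bound.
Qed.

Lemma symf_rho_cat s : symf (fun v => rho (s ++ v)).
by move=> u v uv; apply: rho_perm; rewrite perm_cat2l. Qed.

(** The density carries the weight -w; integrating over the points of weight [w1] adds [w1] to it
    and leaves -w2, the density of the remaining part of the window. *)
Lemma jan_marginal w w1 w2 p : subw w -> subw w1 ->
 (forall x, w x = w1 x + w2 x) ->
 EW w1 (fun x => jan w (p ++ x)) = jan w2 p.
move=> sw s1 ww; rewrite [RHS](_ : _ = EW (fun x => w1 x + - w x) (fun v => rho (p ++ v))).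
 rewrite (EW_add mkap kap0 (@symf_rho_cat p) (subw_good s1) (subw_opp sw)
  (m_rho_cat rk p) (kdom_rho_cat rk p)).
 by apply: EW_ext => x; apply: EW_ext => y; rewrite catA.
apply: EW_weight_ext => x; rewrite ww; ring.
Qed.

Lemma jan_total w p : subw w -> EW w (fun v => jan w (p ++ v)) = rho p.
move=> sw; rewrite (jan_marginal (w2 := fun=> 0) p sw sw) => [|x]; last by rewrite addr0.
rewrite /jan (EW_weight_ext V (W2 := fun=> 0)) ; last by rewrite oppr0.
by rewrite EW0 cats0.
Qed.

Section insertion.
Variables (w w1 w2 : T -> R) (BB : set T) (p : seq T) (bet kp : R) (phi : seq T -> R).
Hypotheses (sw : subw w) (sw1 : subw w1) (sw2 : subw w2)
 (wE : forall x, w x = w1 x + w2 x) (w1B : forall x, w1 x != 0 -> BB x)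
 (rp : 0 < rho p).

Fixpoint chain (P : T -> seq T -> Prop) (s : seq T) : Prop :=
 if s is q :: s' then P q s' /\ chain P s' else True.

(** The points of [p] are inserted one by one with [jan_insert], each at the cost of a factor [bet],
    and the intermediate densities [jan w2 (s ++ y)] cancel. The chain condition serves where such a
    density is 0: the next one is then 0 too. *)
Lemma insertion_chain b x y : multiplier b -> (forall z, z \in x -> b z = 0) ->
 0 <= bet -> (forall q, q \in p -> bet <= normc (b q) ^+ 2) ->
 chain (fun q s => exists2 C, 0 <= C &
  forall y, jan w2 (q :: s ++ y) <= C * jan w2 (s ++ y)) p ->
 bet ^+ size p * (jan w2 (p ++ y) * jan w (y ++ x)) <= jan w (p ++ y ++ x) * jan w2 y.
move=> [bH b1] bx bet0; elim: p => [|q s IH] bq /=.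
 by rewrite mul1r mulrC.
move=> [[C C0 jC] ch]; have {}IH := IH (fun z zs => bq z (mem_behead (s := q :: s) zs)) ch.
have [mw wW iw j0] := sw; have [mw2 wW2 iw2 j02] := sw2.
have w2w z : 0 <= w2 z <= w z.
 by have /andP[-> _] := wW2 z; rewrite wE lerDr (subw_ge0).
have := jan_insert rk q (s ++ y) mw wW iw j0 mw2 w2w j02 bH b1 bx.
have perm1' : perm_eq (x ++ s ++ y) (s ++ y ++ x) by rewrite perm_catC -catA.
rewrite (jan_perm V K w perm1') (@jan_perm _ _ _ V K w (q :: x ++ s ++ y) (q :: s ++ y ++ x)).
 2: by rewrite perm_cons.
move=> I.
have a0 := sub_jan_ge0 (s ++ y) sw2; have A0 := sub_jan_ge0 (s ++ y ++ x) sw.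
have [E|n0] := eqVneq (jan w2 (s ++ y)) 0.
 have -> : jan w2 (q :: s ++ y) = 0.
  apply/eqP; rewrite eq_le sub_jan_ge0// andbT.
  by have := jC y; rewrite E mulr0.
 by rewrite mul0r mulr0 mulr_ge0//; exact: sub_jan_ge0.
have ap : 0 < jan w2 (s ++ y) by rewrite lt_neqAle eq_sym n0.
rewrite -(ler_pM2l ap).
set j1 := jan w2 (q :: s ++ y) in I *; set j2 := jan w (q :: s ++ y ++ x) in I *.
have j10 : 0 <= j1 by exact: sub_jan_ge0.
have y0 := sub_jan_ge0 y sw2.
apply: (@le_trans _ _ (bet * j1 * (jan w (s ++ y ++ x) * jan w2 y))).
 rewrite [leLHS](_ : _ = (bet * j1) * (bet ^+ size s * (jan w2 (s ++ y) * jan w (y ++ x))));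
  last by rewrite exprS; ring.
 by rewrite ler_wpM2l// mulr_ge0.
apply: (@le_trans _ _ (j2 * jan w2 (s ++ y) * jan w2 y)); last first.
 by apply: eq_ler; ring.
rewrite mulrA ler_wpM2r//; apply: le_trans I; rewrite -mulrA ler_wpM2r ?mulr_ge0//.
by apply: bq; rewrite inE eqxx.
Qed.

Hypotheses (bet0 : 0 < bet) (kp1 : 1 <= kp)
 (ch : chain (fun q s => exists2 C, 0 <= C &
   forall y, jan w2 (q :: s ++ y) <= C * jan w2 (s ++ y)) p)
 (jkp : forall y, jan w2 (p ++ y) <= kp * rho p * jan w2 y)
 (mphi : measT phi) (phi01 : forall s, 0 <= phi s <= 1) (sphi : symf phi)
 (mult : forall y x, phi (y ++ x) != 0 -> (forall z, z \in x -> BB z) ->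
   exists b, [/\ multiplier b, forall z, z \in x -> b z = 0 &
    forall q, q \in p -> bet <= normc (b q) ^+ 2]).

(** The density ratio, for the outer configuration [y], of the law conditioned on [p] and the law
    itself. Where [jan w2 y] is 0 the quotient is 0, in agreement with [theta_jan]. *)
Let theta y := jan w2 (p ++ y) / (rho p * jan w2 y).

Let theta_ge0 y : 0 <= theta y.
by rewrite divr_ge0 ?mulr_ge0 ?sub_jan_ge0// ltW. Qed.

Let theta_jan y : theta y * jan w2 y = jan w2 (p ++ y) / rho p.
rewrite /theta; have [E|n0] := eqVneq (jan w2 y) 0; last first.
 by field; rewrite gt_eqF.
rewrite E mulr0; have -> : jan w2 (p ++ y) = 0; last by rewrite mul0r.
apply/eqP; rewrite eq_le sub_jan_ge0// andbT.
by have := jkp y; rewrite E mulr0.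
Qed.

Let theta_le y : theta y <= kp.
have [E|n0] := eqVneq (jan w2 y) 0.
 by rewrite /theta E mulr0 invr0 mulr0 (le_trans ler01).
have jp : 0 < jan w2 y by rewrite lt_neqAle eq_sym n0 sub_jan_ge0.
by rewrite ler_pdivrMr ?mulr_gt0// mulrA.
Qed.

Let mtheta : measT theta.
have -> : theta = (fun y => jan w2 (p ++ y) * (rho p * jan w2 y) `^ (-1)).
 apply/funext => y; rewrite powR_inv1// mulr_ge0 ?sub_jan_ge0//; exact: ltW.
apply: mfM; first exact: m_jan_cat.
apply: (mpre (f := fun y => y `^ (-1)) (h := fun y => rho p * jan w2 y)).
 by [].
apply: mfM; first by [].
exact: (m_jan_cat [::]).
Qed.

Let m_cat2 (f : seq T -> R) : measT f ->
 measT (fun q : seq T * seq T => f (q.1 ++ q.2)).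
by move=> mf; apply: mpre (@m_seq_cat _ T). Qed.

Let EE (f : seq T -> seq T -> R) := EW w2 (fun y => EW w1 (f y)).

Let good2 (f : seq T -> seq T -> R) :=
 measT (fun q : seq T * seq T => f q.1 q.2) /\ kdom2 kap f.

Let EE_le f g : good2 f -> good2 g ->
 (forall y x, (forall z, z \in x -> BB z) -> f y x <= g y x) -> EE f <= EE g.
move=> [mf fk] [mg gk] fg; have g1 := subw_good sw1; have g2 := subw_good sw2.
apply: (le_EW mkap kap0 (fun x => subw_ge0 x sw2) g2
 (m_EW V g1.1 mf) (kdom_EW mkap kap0 g1 mf fk)
 (m_EW V g1.1 mg) (kdom_EW mkap kap0 g1 mg gk)).
have sec h : kdom2 kap h -> forall y, kdom kap (h y).
 move=> [C C0 hC] y; exists (C * wprod kap y); first by rewrite mulr_ge0 ?wprod_ge0.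
 by move=> s; rewrite -mulrA.
move=> y; apply: le_EW_supp => //; try exact: m_section; try exact: sec.
- by move=> x; exact: subw_ge0.
- by move=> x xw; apply: fg => z /xw/w1B.
Qed.

Let EEZ c f : good2 f -> EE (fun y x => c * f y x) = c * EE f.
move=> [mf fk]; have g1 := subw_good sw1; have g2 := subw_good sw2.
have sec y : kdom kap (f y).
 have [C C0 hC] := fk; exists (C * wprod kap y); first by rewrite mulr_ge0 ?wprod_ge0.
 by move=> s; rewrite -mulrA.
rewrite /EE -(EWZ mkap)//.
- by apply: EW_ext => y; rewrite (EWZ mkap)//; exact: m_section.
- by apply: m_EW => //; exact: g1.1.
- exact: (kdom_EW).
Qed.

Let EED f g : good2 f -> good2 g -> EE (fun y x => f y x + g y x) = EE f + EE g.
move=> [mf fk] [mg gk]; have g1 := subw_good sw1; have g2 := subw_good sw2.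
have sec h : kdom2 kap h -> forall y, kdom kap (h y).
 move=> [C C0 hC] y; exists (C * wprod kap y); first by rewrite mulr_ge0 ?wprod_ge0.
 by move=> s; rewrite -mulrA.
rewrite /EE -(EWD mkap)//.
- by apply: EW_ext => y; rewrite (EWD mkap)//; [exact: m_section|exact: sec|
  exact: m_section|exact: sec].
- by apply: m_EW => //; exact: g1.1.
- exact: (kdom_EW).
- by apply: m_EW => //; exact: g1.1.
- exact: (kdom_EW).
Qed.

Let EE_cat f : measT f -> kdom kap f -> symf f ->
 EW w f = EE (fun y x => f (y ++ x)).
move=> mf fk fs; have g1 := subw_good sw1; have g2 := subw_good sw2.
rewrite /EE -(EW_add mkap)//; apply: EW_weight_ext => x; by rewrite addrC.
Qed.

Let good_cat f : measT f -> kdom kap f -> good2 (fun y x => f (y ++ x)).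
move=> mf [C C0 fC]; split; first exact: m_cat2.
by exists C => // y x; rewrite -wprod_cat.
Qed.

Let good_mul f (h : seq T -> seq T -> R) M : good2 f ->
 measT (fun q : seq T * seq T => h q.1 q.2) -> 0 <= M ->
 (forall y x, `|h y x| <= M) -> good2 (fun y x => h y x * f y x).
move=> [mf [C C0 fC]] mh M0 hM; split; first exact: mfM.
exists (M * C); first exact: mulr_ge0.
by move=> y x; rewrite normrM -mulrA ler_pM.
Qed.

Let mphi2 : measT (fun q : seq T * seq T => phi (q.1 ++ q.2)).
exact: m_cat2. Qed.

Let phi_norm s : `|phi s| <= 1.
by have /andP[ h2] := phi01 s; rewrite ger0_norm. Qed.

Let symf_jan q : symf (fun v => jan w (q ++ v)).
by move=> u v uv; apply: jan_perm; rewrite perm_cat2l. Qed.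

Let kdom_phi f : measT f -> kdom kap f -> kdom kap (fun v => phi v * f v).
move=> mf [C C0 fC]; exists C => // s; rewrite normrM -[leRHS]mul1r.
exact: ler_pM.
Qed.

(** Configurations are split into an inner part [x], where the multiplier vanishes, and an outer
    part [y]. The insertion chain compares the densities with the factor [theta y]; removing this
    factor produces the error [kp - 1]. *)
Lemma insertion_bound : EW w (fun v => phi v * jan w v) <=
 (bet ^+ size p * rho p)^-1 * EW w (fun v => phi v * jan w (p ++ v)) + (kp - 1).
have mj := m_jan_cat [::] sw; have kj := kdom_jan_cat [::] sw.
have mjp := m_jan_cat p sw; have kjp := kdom_jan_cat p sw.
have gj := good_cat mj kj; have gjp := good_cat mjp kjp.
have mphij := mfM mphi mj; have mphijp := mfM mphi mjp.
have E1 := EE_cat mphij (kdom_phi mj kj)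
 (fun u v uv => f_equal2 *%R (sphi uv) (symf_jan [::] uv)).
have E2 := EE_cat mphijp (kdom_phi mjp kjp)
 (fun u v uv => f_equal2 *%R (sphi uv) (symf_jan p uv)).
rewrite E1 E2.
have kp0 : 0 <= kp by exact: le_trans kp1.
have mth2 : measT (fun q : seq T * seq T => theta q.1).
 exact: mpre.
have th_norm y : `|theta y| <= kp by rewrite ger0_norm.
have gphij : good2 (fun y x => phi (y ++ x) * jan w (y ++ x)).
 exact: (good_mul gj mphi2 ler01).
have gphijp : good2 (fun y x => phi (y ++ x) * jan w (p ++ (y ++ x))).
 exact: (good_mul gjp mphi2 ler01).
have gthj : good2 (fun y x => theta y * jan w (y ++ x)) by exact: (good_mul gj mth2 kp0).
have gthphij : good2 (fun y x => theta y * (phi (y ++ x) * jan w (y ++ x))).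
 exact: (good_mul gphij mth2 kp0).
pose c := (bet ^+ size p * rho p)^-1.
have bp : 0 < bet ^+ size p by rewrite exprn_gt0.
have c0 : 0 < c by rewrite invr_gt0 mulr_gt0.
have S1 : EE (fun y x => theta y * (phi (y ++ x) * jan w (y ++ x))) <=
  c * EE (fun y x => phi (y ++ x) * jan w (p ++ (y ++ x))).
 have gc : good2 (fun y x => c * (phi (y ++ x) * jan w (p ++ (y ++ x)))).
  apply: (good_mul (M := `|c|)) => //.
 rewrite -(EEZ c gphijp); apply: (EE_le gthphij gc) => y x xB.
 have [E|n0] := eqVneq (phi (y ++ x)) 0; first by rewrite E !mul0r !mulr0.
 have [b [bm bx bq]] := mult n0 xB.
 have H := insertion_chain y bm bx (ltW bet0) bq ch.
 have phi0 : 0 <= phi (y ++ x) by have /andP[] := phi01 (y ++ x).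
 rewrite mulrCA [leRHS]mulrCA ler_wpM2l// /theta /c.
 have [jE|jn] := eqVneq (jan w2 y) 0.
  rewrite jE mulr0 invr0 mulr0 mul0r; apply: mulr_ge0; first exact: ltW.
  exact: sub_jan_ge0.
 have jp : 0 < jan w2 y by rewrite lt_neqAle eq_sym jn sub_jan_ge0.
 rewrite mulrAC ler_pdivrMr ?mulr_gt0// invfM -!mulrA ler_pdivlMl//.
 rewrite [leRHS](_ : _ = jan w (p ++ y ++ x) * jan w2 y); last by field; rewrite gt_eqF.
 by [].
(* [theta] has mean 1 and is at most [kp]. Hence [kp - theta] is nonnegative with mean [kp - 1], and
   the factor [phi], at most 1, can only lower this mean. *)
have S2 : kp * EE (fun y x => phi (y ++ x) * jan w (y ++ x)) <=
  EE (fun y x => theta y * (phi (y ++ x) * jan w (y ++ x))) + (kp - 1).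
 have gk h : good2 h -> good2 (fun y x => kp * h y x).
  by move=> gh; apply: (good_mul (M := `|kp|)) => //.
 have gN h : good2 h -> good2 (fun y x => (-1) * h y x).
  by move=> gh; apply: (good_mul (M := `|-1|)) => //.
 have T1 : EE (fun y x => jan w (y ++ x)) = 1.
  by rewrite -(EE_cat mj kj (symf_jan [::])) (jan_total [::] sw) rho_nil.
 have T2 : EE (fun y x => theta y * jan w (y ++ x)) = 1.
  have -> : EE (fun y x => theta y * jan w (y ++ x)) =
    EW w2 (fun y => (rho p)^-1 * jan w2 (p ++ y)).
   apply: EW_ext => y; rewrite (EWZ mkap kap0).
   - by rewrite (jan_marginal y sw sw1 wE) theta_jan mulrC.
   - exact: subw_good.
   - exact: m_jan_cat.
   - exact: kdom_jan_cat.
  rewrite (EWZ mkap kap0); [|exact: subw_good|exact: m_jan_cat|exact: kdom_jan_cat].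
  by rewrite (jan_total p sw2) mulVf// gt_eqF.
 have : EE (fun y x => kp * (phi (y ++ x) * jan w (y ++ x)) +
    (-1) * (theta y * (phi (y ++ x) * jan w (y ++ x)))) <=
   EE (fun y x => kp * jan w (y ++ x) + (-1) * (theta y * jan w (y ++ x))).
  have gD h1 h2 : good2 h1 -> good2 h2 -> good2 (fun y x => h1 y x + h2 y x).
   move=> [m1 [C1 C10 hC1]] [m2 [C2 C20 hC2]]; split; first exact: measurable_funD.
   exists (C1 + C2); first exact: addr_ge0.
   by move=> y x; rewrite mulrDl (le_trans (ler_normD _ _))// lerD.
  apply: EE_le; [by apply: gD; [exact: gk|exact: gN]|by apply: gD; [exact: gk|exact: gN]|].
  move=> y x _; have /andP[h1 h2] := phi01 (y ++ x).
  have := theta_le y; have := sub_jan_ge0 (y ++ x) sw => j0 tk.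
  rewrite [leLHS](_ : _ = phi (y ++ x) * ((kp - theta y) * jan w (y ++ x))); last by ring.
  rewrite [leRHS](_ : _ = (kp - theta y) * jan w (y ++ x)); last by ring.
  by rewrite ler_piMl// mulr_ge0// subr_ge0.
 rewrite (EED (gk _ gphij) (gN _ gthphij)) (EED (gk _ gj) (gN _ gthj)) (EEZ kp gphij) (EEZ (-1) gthphij) (EEZ kp gj) (EEZ (-1) gthj) T1 T2.

 exact: scaled_difference_le.
have P0 : 0 <= EE (fun y x => phi (y ++ x) * jan w (y ++ x)).
 rewrite -E1; apply: EW_ge0; first by move=> x; exact: subw_ge0.
 by move=> s; rewrite mulr_ge0 ?sub_jan_ge0; have /andP[] := phi01 s.
exact: le_unscaled S2 P0.
Qed.

End insertion.

End comparison.

(** * Interchange of iterated integrals *)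

Section iterated_integrals.
Context d1 d2 (X : measurableType d1) (Y : measurableType d2) (R : realType).
Variables (m1 : {sigma_finite_measure set X -> \bar R})
 (m2 : {sigma_finite_measure set Y -> \bar R}) (f : X -> Y -> R) (a : X -> R) (b : Y -> R).
Hypotheses (mf : measT (fun p : X * Y => f p.1 p.2))
 (f0 : forall x y, 0 <= f x y) (ai : L1 m1 a) (bi : L1 m2 b)
 (fab : forall x y, f x y <= a x * b y).

Lemma L1_inner x : L1 m2 (f x).
apply: le_L1 (L1Z (a x) bi); first exact: m_section.
by move=> y; rewrite ger0_norm.
Qed.

Lemma L1_outer : L1 m1 (fun x => \int[m2]_y f x y)%R.
apply: le_L1 (L1Z (\int[m2]_y b y)%R ai); first exact: m_Rint_param.
move=> x; rewrite ger0_norm; last exact: Rint_ge0.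
rewrite mulrC -RintZ//; apply: le_Rint => //; first exact: L1_inner.
exact: L1Z.
Qed.

Lemma EFin_iterated : ((\int[m1]_x \int[m2]_y f x y)%R)%:E =
 (\int[m1]_x \int[m2]_y (f x y)%:E)%E.
rewrite EFin_Rint; last exact: L1_outer.
by apply: eq_integral => x _; rewrite EFin_Rint//; exact: L1_inner.
Qed.

End iterated_integrals.

Lemma Rint_swap d1 d2 (X : measurableType d1) (Y : measurableType d2) (R : realType)
  (m1 : {sigma_finite_measure set X -> \bar R})
  (m2 : {sigma_finite_measure set Y -> \bar R}) (f : X -> Y -> R) (a : X -> R) (b : Y -> R) :
 measT (fun p : X * Y => f p.1 p.2) ->
 (forall x y, 0 <= f x y) -> L1 m1 a -> L1 m2 b ->
 (forall x y, f x y <= a x * b y) ->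
 (\int[m1]_x \int[m2]_y f x y = \int[m2]_y \int[m1]_x f x y)%R.
move=> mf f0 ai bi fab; apply: EFin_inj.
rewrite (EFin_iterated mf f0 ai bi fab) (@EFin_iterated _ _ _ _ _ _ _ (fun y x => f x y) b a)//.
- apply: (@fubini_tonelli _ _ _ _ _ m1 m2 (fun p => (f p.1 p.2)%:E)).
  exact/mEFinP.
 by move=> p; rewrite lee_fin.
- exact: (mpre mf (@measurable_swap _ _ Y X)).
- by move=> y x; rewrite mulrC.
Qed.

Lemma m_seq_consf d1 d2 (X : measurableType d1) (T : measurableType d2) (f : X -> T)
  (g : X -> seq T) : measT f -> measT g ->
 measT (fun x => f x :: g x).
move=> mf mg; apply: (mpre (h := fun x => (f x, g x)) (@m_seq_cons _ T)).
exact: mfpair.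
Qed.

(** The arithmetic-geometric mean inequality with a free parameter: taking [lam] large makes the
    second term a small error. *)
Lemma am_gm_le (R : realFieldType) (x j h D lam : R) : 0 < lam -> 0 <= j -> 0 <= h -> 0 <= D ->
 x ^+ 2 <= D * j * h -> x <= lam * j + D / (4 * lam) * h.
move=> l0 j0 h0 D0 xle; set k := D / (4 * lam) * h.
have k0 : 0 <= k by rewrite mulr_ge0// divr_ge0// mulr_ge0// ltW.
have e : D * j * h = 4 * (lam * j) * k by rewrite /k; field; rewrite gt_eqF.
have lj : 0 <= lam * j by rewrite mulr_ge0// ltW.
rewrite {}e in xle; rewrite leNgt; apply/negP.
move: (lam * j) k lj k0 xle => A b A0 b0 xle lt.
have : (A + b) ^+ 2 < x ^+ 2 by rewrite ltr_pXn2r// nnegrE ?addr_ge0// ltW// (le_lt_trans _ lt)// addr_ge0.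
have := sqr_ge0 (A - b); nra.
Qed.

(** * Deletion of points: domination of the Palm law by the law *)

Section deletion.
Context d (T : measurableType d) (R : realType).
Variable V : sfmeas T R.
Variables (W0 : T -> R) (Hol : set (T -> R[i])) (B : nat -> set T)
 (K : T -> T -> R[i]).
Hypothesis rk : rkhs V W0 Hol B K.
Local Notation inH := (inH V W0 Hol).
Local Notation kap := (kap K).
Local Notation rho := (rho K).
Local Notation jan := (jan V K).
Local Notation EW := (EW V).
Local Notation subw := (subw V W0 K).
Let mW0 := rkhs_mW rk.
Let W00 := rkhs_W0 rk.
Let kap0 := kap_ge0 rk.
Let mkap := m_kap rk.

Context d' (X : measurableType d') (nu : {sigma_finite_measure set X -> \bar R}).
Variables (a : X -> R) (h : X -> T) (q : T) (C c M : R).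
Hypotheses (a0 : forall x, 0 <= a x) (ai : L1 nu a) (mh : measT h)
 (C0 : 0 <= C) (c0 : 0 < c) (M0 : 0 <= M) (ma : measT a)
 (kapM : forall x, a x != 0 -> kap (h x) <= M)
 (fq : forall f, inH f ->
   normc (f q) ^+ 2 <= C * (\int[nu]_x (a x * normc (f (h x)) ^+ 2))%R)
 (mult : forall x, a x != 0 -> exists b, [/\ multiplier V W0 Hol b, b (h x) = 0 &
   c <= normc (b q) ^+ 2]).

Variable w : T -> R.
Hypothesis sw : subw w.

Let akap x : a x * kap (h x) <= M * a x.
have [->|n0] := eqVneq (a x) 0; first by rewrite mul0r mulr0.
by rewrite mulrC ler_wpM2r// kapM.
Qed.

Let mjan s t : measT (fun p : seq T * X => jan w (s ++ h p.2 :: t ++ p.1)).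
case: sw => mw wW iw _; apply: (mpre
 (h := fun p : seq T * X => s ++ (h p.2 :: (t ++ p.1))) (m_jan rk mw iw)).
apply: (mpre (h := fun p : seq T * X => h p.2 :: (t ++ p.1)) (m_cat_section s)).
apply: m_seq_consf; first exact: (mpre).
exact: (mpre (m_cat_section t)).
Qed.

Let Bd := EWbound V kap (fun x => - w x).

Let jan_dom s t y x : a x * jan w (s ++ h x :: t ++ y) <=
 (M * a x) * (Bd * wprod kap s * wprod kap t * wprod kap y).
case: sw => mw wW iw _; have := jan_le rk mw iw (s ++ h x :: t ++ y).
rewrite ger0_norm ?(sub_jan_ge0 rk)// !(wprod_cat, wprod_cons) => jl.
apply: le_trans (ler_wpM2l (a0 x) jl) _.
rewrite [leLHS](_ : _ = (a x * kap (h x)) * (Bd * wprod kap s * wprod kap t * wprod kap y)).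
 by rewrite ler_wpM2r ?akap// !mulr_ge0 ?wprod_ge0 ?EWbound_ge0.
by rewrite -/Bd; ring.
Qed.

Let mjan1 s y : measT (fun x => a x * jan w (s ++ h x :: y)).
apply: mfM => //.
exact: (m_section (g := fun y x => jan w (s ++ h x :: y)) (mjan s [::])).
Qed.

Let ijan s y : L1 nu (fun x => a x * jan w (s ++ h x :: y)).
apply: (@le_L1 _ _ _ _ _ (fun x => (Bd * wprod kap s * wprod kap [::] * wprod kap y) * (M * a x))).
- by [].
- by move=> x; rewrite ger0_norm ?mulr_ge0 ?(sub_jan_ge0 rk)// [leRHS]mulrC; exact: (jan_dom s [::]).
- by apply: L1Z; exact: L1Z.
Qed.

(** The submean value inequality for the element [Fw] at [q], with [Fw_sq_le], trades [q] for nearby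
    points [h x]; then [jan_insert] puts [q] back beside each of them. The density with [q] is thus
    bounded by a geometric mean of the density without [q] and one with an additional point, and the
    latter has bounded total mass. *)
Lemma jan_delete y : jan w (q :: y) ^+ 2 <=
 C / c * jan w y * (\int[nu]_x (a x * jan w (q :: h x :: y)))%R.
case: sw => mw wW iw j0.
set J := jan w (q :: y); have J0 : 0 <= J by exact: (sub_jan_ge0 rk).
have y0 := sub_jan_ge0 rk y sw.
have I0 : 0 <= (\int[nu]_x (a x * jan w (q :: h x :: y)))%R.
 by apply: Rint_ge0 => x; rewrite mulr_ge0// (sub_jan_ge0 rk).
have [HF rep Fs Fq] := Fw_rep rk mw wW iw q y.
have i1 := ijan [::] y; have i2 := ijan [:: q] y.
have le1 : J ^+ 2 <= J * (C * (\int[nu]_x (a x * jan w (h x :: y)))%R).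
 have := fq HF; rewrite Fq normcR real_normK ?num_real// -/J => le.
 apply: le_trans le _; rewrite mulrCA; apply: ler_wpM2l => //.
 rewrite -RintZ//; apply: le_Rint; last 1 first.
 - move=> x; rewrite [leRHS]mulrCA [X in _ <= _ * X]mulrC; apply: ler_wpM2l => //.
  exact: (Fw_sq_le rk mw wW).
 - apply: (@le_L1 _ _ _ _ _ (fun x => J * (a x * jan w (h x :: y)))).
  + apply: mfM => //; have [m1 m2] := cmeas_Fw rk mw iw q y.
   have -> : (fun x => normc (Fw V K w q y (h x)) ^+ 2) = (fun x =>
     Re (Fw V K w q y (h x)) ^+ 2 + Im (Fw V K w q y (h x)) ^+ 2).
    by apply/funext => x; rewrite normc_sq.
   by apply: measurable_funD; apply: measurable_funX;
    [exact: mpre m1 mh|exact: mpre m2 mh].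
  + move=> x; rewrite ger0_norm; last by rewrite mulr_ge0 ?sqr_ge0.
   rewrite [leRHS]mulrCA [X in _ <= _ * X]mulrC; apply: ler_wpM2l => //.
   exact: (Fw_sq_le rk mw wW).
  + exact: L1Z.
 - exact: L1Z.
have le2 : c * (J * (\int[nu]_x (a x * jan w (h x :: y)))%R) <=
  jan w y * (\int[nu]_x (a x * jan w (q :: h x :: y)))%R.
 rewrite -!RintZ//; last exact: L1Z.
 apply: le_Rint; [by do 2 apply: L1Z|exact: L1Z|move=> x].
 have [->|n0] := eqVneq (a x) 0; first by rewrite !(mul0r, mulr0).
 have [b [[bH b1] bx bq]] := mult n0.
 have ww z : 0 <= w z <= w z by rewrite lexx andbT; exact: (subw_ge0 z sw).
 have bx' z : z \in [:: h x] -> b z = 0 by rewrite inE => /eqP ->.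
 have := jan_insert rk q y mw wW iw j0 mw ww j0 bH b1 bx'.
 rewrite /= -/J => le; rewrite [leLHS](_ : _ = a x * (c * (J * jan w (h x :: y)))); last by ring.
 rewrite [leRHS](_ : _ = a x * (jan w (q :: h x :: y) * jan w y)); last by ring.
 apply: ler_wpM2l => //; apply: le_trans le; apply: ler_wpM2r => //.
 exact: (mulr_ge0 J0 (sub_jan_ge0 rk _ sw)).
apply: le_trans le1 _; rewrite -mulrA mulrCA -[leRHS]mulrA ler_wpM2l//.
by rewrite ler_pdivlMl.
Qed.

(** [am_gm_le] linearises [jan_delete]. The term with an additional point is integrated without
    [phi], so that its total mass no longer depends on the window. *)
Lemma deletion_bound (phi : seq T -> R) s (lam : R) : 0 < lam -> measT phi ->
 (forall v, 0 <= phi v <= 1) ->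
 EW w (fun v => phi v * jan w (q :: s ++ v)) <=
 lam * EW w (fun v => phi v * jan w (s ++ v)) +
 C / c / (4 * lam) * ((\int[nu]_x a x)%R * (M * kap q * wprod kap s)).
move=> lam0 mphi phi01; have gw := subw_good sw.
case: sw => mw wW iw j0.
have phi0 v : 0 <= phi v by have /andP[] := phi01 v.
have phi1 v : phi v <= 1 by have /andP[] := phi01 v.
pose Hv v := (\int[nu]_x (a x * jan w (q :: h x :: s ++ v)))%R.
have H0 v : 0 <= Hv v by apply: Rint_ge0 => x; rewrite mulr_ge0// (sub_jan_ge0 rk).
have mG : measT (fun p : seq T * X => a p.2 * jan w ([:: q] ++ h p.2 :: s ++ p.1)).
 by apply: mfM; [exact: (mpre ma measurable_snd)|by []].
have mHv : measT Hv.
 exact: (@m_Rint_param _ _ _ _ _ nu).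
set c1 := Bd * wprod kap [:: q] * wprod kap s.
have c10 : 0 <= c1 by rewrite !mulr_ge0 ?wprod_ge0 ?EWbound_ge0.
have kH : kdom kap Hv.
 exists (c1 * (M * (\int[nu]_x a x)%R)).
  apply: mulr_ge0 => //; apply: mulr_ge0 => //; exact: Rint_ge0.
 move=> v; rewrite ger0_norm// [leRHS](_ : _ = (c1 * wprod kap v * M) * (\int[nu]_x a x)%R); last by ring.
 rewrite -RintZ//; apply: le_Rint; [exact: (ijan [:: q])|exact: L1Z|move=> x].
 by have := jan_dom [:: q] s v x; rewrite -/c1; congr (_ <= _); ring.
have k1 t : kdom kap (fun v => jan w (t ++ v)) := kdom_jan_cat rk t sw.
have m1 t : measT (fun v => jan w (t ++ v)) := m_jan_cat rk t sw.
have kphi f : kdom kap f -> kdom kap (fun v => phi v * f v).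
 move=> [D D0 fD]; exists D => // v; rewrite normrM -[leRHS]mul1r.
 by apply: ler_pM => //; rewrite ger0_norm.
set D := C / c / (4 * lam).
have D0 : 0 <= D by rewrite !divr_ge0 ?mulr_ge0// ltW.
have kZ b f : kdom kap f -> kdom kap (fun v => b * f v).
 move=> [E E0 fE]; exists (`|b| * E); first by rewrite mulr_ge0.
 by move=> v; rewrite normrM -mulrA ler_wpM2l.
have mj : measT (fun v => phi v * jan w (s ++ v)).
 exact: mfM .
(* After interchanging the integrals, [jan_total] replaces the integral over configurations by a
   correlation function; Hadamard's inequality then bounds it. *)
have EH : EW w Hv = (\int[nu]_x (a x * rho (q :: h x :: s)))%R.
 rewrite /EW (_ : (\int[lp V]_v (Hv v * wprod w v))%R =
   (\int[lp V]_v \int[nu]_x (wprod w v * (a x * jan w (q :: h x :: s ++ v))))%R); last first.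
  by apply: eq_rint => v; rewrite RintZ 1?mulrC//; exact: (ijan [:: q]).
 rewrite (@Rint_swap _ _ _ _ _ (lp V) nu _ (fun v => c1 * wprod (fun x => kap x * w x) v) (fun x => M * a x)).
 - apply: eq_rint => x; rewrite -(jan_total rk (q :: h x :: s) sw) -(EWZ mkap kap0 (a x) gw (m1 _) (k1 _)).
  by apply: eq_rint => v; rewrite mulrC.
 - apply: mfM => //.
  exact: (mpre (m_wprod mw)).
 - move=> v x; rewrite !mulr_ge0 ?(sub_jan_ge0 rk)// wprod_ge0// => z.
  exact: (subw_ge0 z sw).
 - apply: L1Z; apply: L1_wprod => //.
   exact: mfM.
  by move=> z; rewrite mulr_ge0//; exact: (subw_ge0 z sw).
 - exact: L1Z.
 - move=> v x; have w0 : 0 <= wprod w v by apply: wprod_ge0 => z; exact: (subw_ge0 z sw).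
  have := ler_wpM2l w0 (jan_dom [:: q] s v x) => /le_trans; apply.
  by rewrite -/c1 wprodM; apply: eq_ler; ring.
have EHle : EW w Hv <= (\int[nu]_x a x)%R * (M * kap q * wprod kap s).
 have rk_le x : a x * rho (q :: h x :: s) <= (M * kap q * wprod kap s) * a x.
  have rl := rho_le rk (q :: h x :: s); rewrite !wprod_cons in rl.
  apply: le_trans (ler_wpM2l (a0 x) rl) _.
  rewrite [leLHS](_ : _ = (a x * kap (h x)) * (kap q * wprod kap s)); last by ring.
  rewrite [leRHS](_ : _ = (M * a x) * (kap q * wprod kap s)); last by ring.
  by rewrite ler_wpM2r ?akap// mulr_ge0// wprod_ge0.
 rewrite EH mulrC -RintZ//; apply: le_Rint => //; last exact: L1Z.
 apply: le_L1 (L1Z (M * kap q * wprod kap s) ai).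
 - apply: mfM => //; apply: (mpre (m_rho rk)).
  by apply: m_seq_consf => //; apply: m_seq_consf.
 - by move=> x; rewrite ger0_norm// mulr_ge0// (rho_ge0 rk).
apply: (@le_trans _ _ (EW w (fun v => lam * (phi v * jan w (s ++ v)) + D * Hv v))).
 apply: (le_EW mkap kap0 (fun z => subw_ge0 z sw) gw).
 - by apply: mfM => //; exact: (m1 (q :: s)).
 - by apply: kphi; exact: (k1 (q :: s)).
 - by apply: measurable_funD; apply: mfM.
 - have [E1 E10 fE1] := kZ lam _ (kphi _ (k1 s)); have [E2 E20 fE2] := kZ D _ kH.
  exists (E1 + E2); first exact: addr_ge0.
  by move=> v; rewrite mulrDl (le_trans (ler_normD _ _))// lerD.
 move=> v; have Cc : 0 <= C / c by rewrite divr_ge0// ltW.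
 have := am_gm_le lam0 (sub_jan_ge0 rk (s ++ v) sw) (H0 v) Cc (jan_delete (s ++ v)).
 rewrite -/D => le; have := ler_wpM2l (phi0 v) le => /le_trans; apply.
 rewrite mulrDr mulrCA lerD2l ler_piMl// mulr_ge0//.
rewrite (EWD mkap kap0 gw); last 4 first.
- exact: mfM.
- by apply: kZ; apply: kphi.
- exact: mfM.
- exact: kZ.
rewrite (EWZ mkap kap0 _ gw mj (kphi _ (k1 s))) (EWZ mkap kap0 _ gw mHv kH) lerD2l.
exact: ler_wpM2l.
Qed.

End deletion.

(** * Continuity of complex-valued functions *)

Section complex_continuity.
Variables (R : realType) (T : topologicalType).
Implicit Types (u v : T -> R[i]).

Definition ccts u t := Re (u s) @[s --> t] --> Re (u t) /\
 Im (u s) @[s --> t] --> Im (u t).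

Lemma cctsC (z : R[i]) t : ccts (fun=> z) t.
by split; exact: cvg_cst. Qed.

Lemma cctsD u v t : ccts u t -> ccts v t -> ccts (fun t => u t + v t) t.
move=> [u1 u2] [v1 v2]; split.
- by rewrite cReD; under eq_fun do rewrite cReD; exact: cvgD.
- by rewrite cImD; under eq_fun do rewrite cImD; exact: cvgD.
Qed.

Lemma cctsM u v t : ccts u t -> ccts v t -> ccts (fun t => u t * v t) t.
move=> [u1 u2] [v1 v2]; split.
- by rewrite cReM; under eq_fun do rewrite cReM; apply: cvgB; exact: cvgM.
- by rewrite cImM; under eq_fun do rewrite cImM; apply: cvgD; exact: cvgM.
Qed.

Lemma cctsN u t : ccts u t -> ccts (fun t => - u t) t.
move=> [u1 u2]; split.
- by rewrite cReN; under eq_fun do rewrite cReN; exact: cvgN.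
- by rewrite cImN; under eq_fun do rewrite cImN; exact: cvgN.
Qed.

Lemma cctsB u v t : ccts u t -> ccts v t -> ccts (fun t => u t - v t) t.
by move=> cu cv; apply: cctsD => //; exact: cctsN. Qed.

Lemma cReV (z : R[i]) : Re z^-1 = Re z / (Re z ^+ 2 + Im z ^+ 2).
by case: z. Qed.

Lemma cImV (z : R[i]) : Im z^-1 = - Im z / (Re z ^+ 2 + Im z ^+ 2).
by case: z => x y; rewrite mulNr. Qed.

Lemma cctsV u t : ccts u t -> u t != 0 -> ccts (fun t => (u t)^-1) t.
move=> [u1 u2] u0.
have n2 : (Re (u t) ^+ 2 + Im (u t) ^+ 2) != 0.
 by rewrite -normc_sq expf_neq0// normc_eq0.
have cn : Re (u s) ^+ 2 + Im (u s) ^+ 2 @[s --> t] -->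
  Re (u t) ^+ 2 + Im (u t) ^+ 2.
 by rewrite !expr2; apply: cvgD; exact: cvgM.
split.
- rewrite cReV; under eq_fun do rewrite cReV; apply: cvgM => //; exact: cvgV.
- rewrite cImV; under eq_fun do rewrite cImV; apply: cvgM; [exact: cvgN|exact: cvgV].
Qed.

Lemma cctsX u n t : ccts u t -> ccts (fun t => u t ^+ n) t.
move=> cu; elim: n => [|n IH]; first by under eq_fun do rewrite expr0; exact: cctsC.
by under eq_fun do rewrite exprS; exact: cctsM.
Qed.

Lemma near_ccts u v t : (\forall s \near t, u s = v s) -> ccts u t -> ccts v t.
move=> uv [u1 u2]; have ut : u t = v t by exact: nbhs_singleton uv.
split; rewrite -ut; apply: cvg_trans u1 || apply: cvg_trans u2; apply: near_eq_cvg;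
 by apply: filterS uv => s ->.
Qed.

End complex_continuity.

Lemma ccts_comp (R : realType) (S T : topologicalType) (g : S -> T) (u : T -> R[i]) s :
 g r @[r --> s] --> g s -> ccts u (g s) -> ccts (u \o g) s.
by move=> gs [u1 u2]; split; [exact: cvg_comp u1|exact: cvg_comp u2]. Qed.

Section complex_neighbourhoods.
Variable R : realType.
Implicit Types (z : R[i]) (T : topologicalType).

Lemma nbhs_ncP z (P : set R[i]) :
 nbhs z P <-> exists2 d : R, 0 < d & forall w, normc (w - z) < d -> P w.
split=> [/nbhs_ballP[e /= e0 eP]|[d d0 dP]].
 have [r r0 re] : exists2 r : R, 0 < r & e = r%:C.
  move: e0; case: e {eP} => a b; rewrite /= => /andP[/eqP -> a0].
  by exists a.
 exists r => // w wr; apply: eP; rewrite re -ball_normE /= ltcR.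
 by rewrite normcB_sym.
apply/nbhs_ballP; exists d%:C => /=; first by rewrite ltcR.
move=> w; rewrite -ball_normE /= ltcR => wd; apply: dP.
by rewrite normcB_sym.
Qed.

Lemma nc_ReIm z : normc z <= `|Re z| + `|Im z|.
rewrite -(@ler_pXn2r _ 2) ?nnegrE ?nc_ge0// normc_sq.
rewrite -[Re z ^+ 2]real_normK ?num_real// -[Im z ^+ 2]real_normK ?num_real//.
have := normr_ge0 (Re z); have := normr_ge0 (Im z).
move: `|_| => b; nra.
Qed.

Lemma ccts_near T (u : T -> R[i]) t : ccts u t <->
 forall e : R, 0 < e -> \forall s \near t, normc (u s - u t) <= e.
split=> [[u1 u2] e e0|H]; last first.
 split; apply/cvgrPdist_le => e e0; apply: filterS (H e e0) => s; apply: le_trans;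
  rewrite -normcN_eq opprB.
  by rewrite -cReN -cReD normc_Re.
 by rewrite -cImN -cImD normc_Im.
have e2 : 0 < e / 2 by rewrite divr_gt0.
have /cvgrPdist_le/(_ _ e2) := u1; have /cvgrPdist_le/(_ _ e2) := u2.
apply: filterS2 => s h2 h1; apply: le_trans (nc_ReIm _) _.
by rewrite cReD cReN cImD cImN distrC [X in _ + X]distrC [leRHS]splitr lerD.
Qed.

Lemma ccts_normcP (u : R[i] -> R[i]) z : ccts u z <-> forall e : R, 0 < e ->
 exists2 d : R, 0 < d & forall w, normc (w - z) < d -> normc (u w - u z) <= e.
split=> [/ccts_near H e /H/nbhs_ncP//|H].
by apply/ccts_near => e /H/nbhs_ncP.
Qed.

Lemma ccts_id z : ccts id z.
by apply/ccts_normcP => e; exists e => // w /ltW. Qed.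

Lemma cvg_normcP T (g : T -> R[i]) t : g s @[s --> t] --> g t <-> ccts g t.
rewrite ccts_near; split=> [H e e0|H P].
 have := H (fun w => normc (w - g t) <= e); apply.
 by apply/nbhs_ncP; exists e => // w /ltW.
move=> /nbhs_ncP[d d0 dP]; have d2 : 0 < d / 2 by rewrite divr_gt0.
apply: filterS (H _ d2) => s sd; apply: dP; lra.
Qed.

End complex_neighbourhoods.

(** * Complex integrals over segments *)

Section segments.
Variable R : realType.
Implicit Types (u v : R -> R[i]) (a b c t : R).
Local Notation leb := (@lebesgue_measure R).

Definition curve u := forall t, ccts u t.

(** The interval is half-open so that consecutive segments add up pointwise in [seg_split]. *)
Definition seg a b u : R[i] := cint leb (fun t => (\1_`[a, b[ t)%:C * u t).

Lemma L1_seg a b (v : R -> R) : continuous v ->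
 L1 leb (fun t => v t * \1_`[a, b[ t).
move=> cv; have i1 : leb.-integrable `[a, b] (EFin \o v).
 by apply: continuous_compact_integrable; [exact: segment_compact|exact: continuous_subspaceT].
have i2 : leb.-integrable `[a, b[ (EFin \o v).
 by apply: integrableS i1 => //; exact: subset_itv_co_cc.
have := (@integrable_mkcond _ _ R leb _ (EFin \o v) (measurable_itv `[a, b[)).1 i2.
congr (leb.-integrable _ _); apply/funext => t.
rewrite patchE /= indicE; case: ifPn => _; first by rewrite mulr1.
by rewrite mulr0.
Qed.

Lemma curve_continuous u : curve u ->
 continuous (fun t => Re (u t)) /\ continuous (fun t => Im (u t)).
by move=> cu; split => t; have [] := cu t. Qed.

Lemma cL1_seg a b u : curve u ->
 cL1 leb (fun t => (\1_`[a, b[ t)%:C * u t).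
move=> /curve_continuous[c1 c2]; split.
- by apply: eq_L1 (L1_seg a b c1) => t; rewrite [_%:C * _]mulrC cReMr.
- by apply: eq_L1 (L1_seg a b c2) => t; rewrite [_%:C * _]mulrC cImMr.
Qed.

Lemma eq_seg a b u v : (forall t, a <= t <= b -> u t = v t) -> seg a b u = seg a b v.
move=> uv; apply: eq_cint => t; rewrite indicE.
case: (boolP (t \in _)) ; last by rewrite !mul0r.
by rewrite inE /= in_itv /= => /andP[at_ tb]; rewrite uv// at_ ltW.
Qed.

Lemma segD a b u v : curve u -> curve v -> seg a b (fun t => u t + v t) = seg a b u + seg a b v.
move=> cu cv; rewrite /seg -cintD; try exact: cL1_seg.
by apply: eq_cint => t; rewrite mulrDr.
Qed.

Lemma segZ a b (z : R[i]) u : curve u -> seg a b (fun t => z * u t) = z * seg a b u.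
move=> cu; rewrite /seg -cintZ; last exact: cL1_seg.
by apply: eq_cint => t; rewrite mulrCA.
Qed.

Lemma seg_split a b c u : a <= b <= c -> curve u -> seg a c u = seg a b u + seg b c u.
move=> /andP[ab bc] cu; rewrite /seg -cintD; try exact: cL1_seg.
apply: eq_cint => t; rewrite -mulrDl; congr (_ * _).
rewrite -rmorphD !indicE !mem_setE !in_itv /=; congr (_%:C).
have [ta|at_] := ltP t a.
 by rewrite leNgt (lt_le_trans ta ab) addr0.
have [tb|bt] := ltP t b; first by rewrite (lt_le_trans tb bc) addr0.
by rewrite add0r.
Qed.

Lemma Rint_itvco a b (k : R) : a <= b -> L1 leb (fun t => k * \1_`[a, b[ t) /\
 (\int[leb]_t (k * \1_`[a, b[ t))%R = k * (b - a).
move=> ab; have i1 : L1 leb (fun t => 1 * \1_`[a, b[ t).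
 by apply: L1_seg => t; exact: cvg_cst.
have i2 : L1 leb (\1_`[a, b[ : R -> R) by apply: eq_L1 i1 => t; rewrite mul1r.
split; first exact: L1Z.
rewrite RintZ//; congr (_ * _); apply: EFin_inj; rewrite EFin_Rint//.
have -> : (\int[leb]_x (\1_`[a, b[ x)%:E = leb `[a, b[)%E.
 by rewrite integral_indic// setIT.
by rewrite lebesgue_measure_itv lte_fin EFinB; case: ltgtP ab => // -> _; rewrite subee.
Qed.

Lemma seg_le a b u (k : R) : a <= b -> curve u ->
 (forall t, a <= t <= b -> normc (u t) <= k) -> normc (seg a b u) <= k * (b - a).
move=> ab cu uk; have ci := cL1_seg a b cu.
apply: le_trans (normc_cint ci) _; have [ki <-] := Rint_itvco k ab.
apply: le_Rint => //; first exact: cL1_normc.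
move=> t; rewrite normcM normcR ger0_norm// mulrC !indicE.
case: (boolP (t \in _)) ; last by rewrite !mulr0.
by rewrite inE /= in_itv /= => /andP[at_ tb]; rewrite !mulr1 uk// at_ ltW.
Qed.

Lemma seg_cst a b (z : R[i]) : a <= b -> seg a b (fun=> z) = z * (b - a)%:C.
move=> ab; rewrite (_ : (fun=> z) = (fun=> z * 1)); last by rewrite mulr1.
rewrite segZ; last by exact: cctsC.
congr (_ * _); rewrite /seg -[b - a]mul1r.
have [_ <-] := Rint_itvco 1 ab; rewrite -cint_real; apply: eq_cint => t.
by rewrite mulr1 mul1r.
Qed.

Lemma seg_Re_ge a b u (k : R) : a <= b -> curve u ->
 (forall t, a <= t <= b -> k <= Re (u t)) -> k * (b - a) <= Re (seg a b u).
move=> ab cu uk; have [ki <-] := Rint_itvco k ab; have [c1 c2] := cL1_seg a b cu.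
apply: le_Rint => // t; rewrite [_%:C * _]mulrC cReMr !indicE.
case: (boolP (t \in _)) ; last by rewrite !mulr0.
by rewrite inE /= in_itv /= => /andP[at_ tb]; rewrite !mulr1 uk// at_ ltW.
Qed.

End segments.

(** * Contour integrals over rectangles and Goursat's theorem *)

Section rectangles.
Variable R : realType.
Implicit Types (f g : R[i] -> R[i]) (x y w h : R).

(* Caratheodory's form of complex differentiability *)
Definition cdiff f z := exists q, ccts q z /\ forall u, f u - f z = q u * (u - z).

Lemma cdiff_ccts f z : cdiff f z -> ccts f z.
move=> [q [qc qE]].
have : ccts (fun u => f z + q u * (u - z)) z.
 apply: cctsD; first exact: cctsC.
 by apply: cctsM => //; apply: cctsB; [exact: ccts_id|exact: cctsC].
by congr ccts; apply/funext => u; rewrite -qE subrKC.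
Qed.

Lemma cvg_Re_line (c t : R) : (s +i* c) @[s --> t] --> t +i* c.
by apply/cvg_normcP; split; [by []|exact: cvg_cst]. Qed.

Lemma cvg_Im_line (c t : R) : (c +i* s) @[s --> t] --> c +i* t.
by apply/cvg_normcP; split; [exact: cvg_cst|by []]. Qed.

Definition hside f y t := f (t +i* y).
Definition vside f x t := f (x +i* t).

Lemma curve_hside f y : (forall z, ccts f z) -> curve (hside f y).
by move=> cf t; exact: (ccts_comp (@cvg_Re_line y t)). Qed.

Lemma curve_vside f x : (forall z, ccts f z) -> curve (vside f x).
by move=> cf t; exact: (ccts_comp (@cvg_Im_line x t)). Qed.

(** The counterclockwise contour integral: dz is dt on horizontal sides and i dt on vertical
    ones. *)
Definition rect f x y w h : R[i] :=
 (seg x (x + w) (hside f y) - seg x (x + w) (hside f (y + h))) +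
 'i * (seg y (y + h) (vside f (x + w)) - seg y (y + h) (vside f x)).

(** Continuity is asked along the four sides only, since the Cauchy kernel is singular inside. *)
Definition sides f x y w h := [/\ curve (hside f y), curve (hside f (y + h)),
 curve (vside f x) & curve (vside f (x + w))].

Lemma sides_ccts f x y w h : (forall z, ccts f z) -> sides f x y w h.
by split; (exact: curve_hside || exact: curve_vside). Qed.

Lemma rectD f g x y w h : sides f x y w h -> sides g x y w h ->
 rect (fun z => f z + g z) x y w h = rect f x y w h + rect g x y w h.
by move=> [f1 f2 f3 f4] [g1 g2 g3 g4]; rewrite /rect /vside !segD//; ring.
Qed.

Lemma rectZ (c : R[i]) f x y w h : sides f x y w h ->
 rect (fun z => c * f z) x y w h = c * rect f x y w h.
by move=> [f1 f2 f3 f4]; rewrite /rect !segZ//; ring. Qed.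

Lemma sidesM f g x y w h : sides f x y w h -> sides g x y w h ->
 sides (fun z => f z * g z) x y w h.
by move=> [? ? ? ?] [? ? ? ?]; split=> t; exact: cctsM. Qed.

Definition boundary x y w h z :=
 [/\ x <= Re z <= x + w, y <= Im z <= y + h &
  [|| Im z == y, Im z == y + h, Re z == x | Re z == x + w]].

Lemma eq_rect f g x y w h : 0 <= w -> 0 <= h ->
 (forall z, boundary x y w h z -> f z = g z) -> rect f x y w h = rect g x y w h.
move=> w0 h0 fg; have xw : x <= x + w by rewrite lerDl.
have yh : y <= y + h by rewrite lerDl.
rewrite /rect; congr ((_ - _) + 'i * (_ - _)); apply: eq_seg => t tt;
 by apply: fg; split; rewrite ?lexx ?eqxx ?orbT ?xw ?yh.
Qed.

Lemma rect_le f x y w h M : 0 <= w -> 0 <= h -> sides f x y w h ->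
 (forall z, boundary x y w h z -> normc (f z) <= M) ->
 normc (rect f x y w h) <= 2 * (w + h) * M.
move=> w0 h0 [f1 f2 f3 f4] fM; have xw : x <= x + w by rewrite lerDl.
have yh : y <= y + h by rewrite lerDl.
have B1 : normc (seg x (x + w) (hside f y)) <= M * (x + w - x).
 by apply: seg_le => // t tt; apply: fM; split; rewrite ?lexx ?eqxx.
have B2 : normc (seg x (x + w) (hside f (y + h))) <= M * (x + w - x).
 by apply: seg_le => // t tt; apply: fM; split; rewrite //= ?lexx ?eqxx ?orbT ?xw ?yh.
have B3 : normc (seg y (y + h) (vside f (x + w))) <= M * (y + h - y).
 by apply: seg_le => // t tt; apply: fM; split; rewrite ?lexx ?eqxx ?orbT ?xw.
have B4 : normc (seg y (y + h) (vside f x)) <= M * (y + h - y).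
 by apply: seg_le => // t tt; apply: fM; split; rewrite //= ?lexx ?eqxx ?orbT ?xw ?yh.
rewrite /rect; apply: le_trans (normcD_le _ _) _.
have i1 : normc ('i : R[i]) = 1 by rewrite /= expr0n expr1n add0r sqrtr1.
rewrite normcM i1 mul1r.
have := normcB_le (seg x (x + w) (hside f y)) (seg x (x + w) (hside f (y + h))).
have := normcB_le (seg y (y + h) (vside f (x + w))) (seg y (y + h) (vside f x)).
move: B1 B2 B3 B4; move: (normc _) (normc _) (normc _) (normc _) (normc _) (normc _) => *.
lra.
Qed.

Lemma rect_splitx f x y w1 w2 h : 0 <= w1 -> 0 <= w2 -> (forall z, ccts f z) ->
 rect f x y (w1 + w2) h = rect f x y w1 h + rect f (x + w1) y w2 h.
move=> w10 w20 cf; rewrite /rect addrA.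
have s12 : x <= x + w1 <= x + w1 + w2 by rewrite !lerDl w10.
rewrite !(seg_split s12 (curve_hside _ cf)).
by do 7 (move: (seg _ _ _) => ?); ring.
Qed.

Lemma rect_splity f x y w h1 h2 : 0 <= h1 -> 0 <= h2 -> (forall z, ccts f z) ->
 rect f x y w (h1 + h2) = rect f x y w h1 + rect f x (y + h1) w h2.
move=> h10 h20 cf; rewrite /rect addrA.
have s12 : y <= y + h1 <= y + h1 + h2 by rewrite !lerDl h10.
rewrite !(seg_split s12 (curve_vside _ cf)).
by do 7 (move: (seg _ _ _) => ?); ring.
Qed.

Lemma rect_affine (c l : R[i]) x y w h : 0 <= w -> 0 <= h ->
 rect (fun z => c + l * z) x y w h = 0.
move=> w0 h0; pose A z := c + l * z.
have cA z : ccts A z.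
 by apply: cctsD; [exact: cctsC|apply: cctsM; [exact: cctsC|exact: ccts_id]].
have [s1 s2 s3 s4] := sides_ccts x y w h cA.
have xw : x <= x + w by rewrite lerDl.
have yh : y <= y + h by rewrite lerDl.
have E1 : seg x (x + w) (hside A y) =
  seg x (x + w) (hside A (y + h)) + seg x (x + w) (fun=> - (l * 'i * h%:C)).
 rewrite -segD//; last by exact: cctsC.
 apply: eq_seg => t _; rewrite /hside /A.
 have -> : t +i* (y + h) = (t +i* y) + 'i * h%:C by apply: cext => /=; ring.
 by ring.
have E2 : seg y (y + h) (vside A (x + w)) =
  seg y (y + h) (vside A x) + seg y (y + h) (fun=> l * w%:C).
 rewrite -segD//; last by exact: cctsC.
 apply: eq_seg => t _; rewrite /vside /A.
 have -> : (x + w) +i* t = (x +i* t) + w%:C by apply: cext => /=; ring.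
 by ring.
rewrite -/A /rect E1 E2 !seg_cst//.
have -> : x + w - x = w by ring.
have -> : y + h - y = h by ring.
by ring.
Qed.

End rectangles.

Lemma four_quarters (R : realType) (A B C D : R[i]) (N := normc (A + B + (C + D))) :
 4 * normc D < N -> 4 * normc C < N -> 4 * normc B < N -> 4 * normc A < N -> False.
have := normcD_le (A + B) (C + D); have := normcD_le A B; have := normcD_le C D.
rewrite -/N; lra.
Qed.

Section goursat.
Variables (R : realType) (f : R[i] -> R[i]) (x y w h : R).
Hypotheses (w0 : 0 <= w) (h0 : 0 <= h) (cf : forall z, ccts f z)
 (df : forall z, x <= Re z <= x + w -> y <= Im z <= y + h -> cdiff f z).

Lemma nested_limit (a : nat -> R) (l : R) : 0 <= l ->
 (forall n, a n <= a n.+1 <= a n + l / 2 ^+ n.+1) ->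
 exists X, forall n, a n <= X <= a n + l / 2 ^+ n.
move=> l0 aP; have up n k : a n <= a (n + k)%N /\ a (n + k)%N + l / 2 ^+ (n + k) <= a n + l / 2 ^+ n.
 elim: k => [|k [IH1 IH2]]; first by rewrite addn0.
 rewrite addnS; have /andP[h1 h2] := aP (n + k)%N; split; first exact: le_trans h1.
 apply: le_trans IH2; have -> : l / 2 ^+ (n + k) = l / 2 ^+ (n + k).+1 + l / 2 ^+ (n + k).+1.
  by rewrite exprS; field.
 by rewrite addrA lerD2r.
have lp n : 0 <= l / 2 ^+ n by rewrite divr_ge0.
have ub n : ubound (range a) (a n + l / 2 ^+ n).
 move=> _ [m _ <-]; have [nm|/ltnW mn] := leqP n m.
  by have [_] := up n (m - n)%N; rewrite subnKC//; apply: le_trans; rewrite lerDl.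
 have [+ _] := up m (n - m)%N; rewrite subnKC// => /le_trans; apply.
 by rewrite lerDl.
exists (sup (range a)) => n; apply/andP; split.
 by apply: ub_le_sup; [exists (a 0%N + l / 2 ^+ 0)|exists n].
by apply: ge_sup => //; exists (a 0%N), 0%N.
Qed.

Let W n := w / 2 ^+ n.
Let H n := h / 2 ^+ n.
Let W0 n : 0 <= W n. Proof. by rewrite divr_ge0. Qed.
Let H0 n : 0 <= H n. Proof. by rewrite divr_ge0. Qed.
Let WS n : W n = W n.+1 + W n.+1. Proof. by rewrite /W exprS; field. Qed.
Let HS n : H n = H n.+1 + H n.+1. Proof. by rewrite /H exprS; field. Qed.

(** Otherwise each of the four quarters would carry less than a quarter of the integral, against
    [four_quarters]. *)
Let quarter n (p : R * R) : exists p' : R * R,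
 [/\ p.1 <= p'.1 <= p.1 + W n.+1, p.2 <= p'.2 <= p.2 + H n.+1 &
  normc (rect f p.1 p.2 (W n) (H n)) <= 4 * normc (rect f p'.1 p'.2 (W n.+1) (H n.+1))].
pose w' := W n.+1; pose h' := H n.+1.
apply: contrapT => no.
have small x' y' : p.1 <= x' <= p.1 + w' -> p.2 <= y' <= p.2 + h' ->
  4 * normc (rect f x' y' w' h') < normc (rect f p.1 p.2 (W n) (H n)).
 by move=> hx hy; rewrite ltNge; apply/negP => le; apply: no; exists (x', y').
have w'0 : 0 <= w' by exact: W0.
have h'0 : 0 <= h' by exact: H0.
have X1 : p.1 <= p.1 <= p.1 + w' by rewrite lexx lerDl.
have X2 : p.1 <= p.1 + w' <= p.1 + w' by rewrite lexx lerDl w'0.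
have Y1 : p.2 <= p.2 <= p.2 + h' by rewrite lexx lerDl.
have Y2 : p.2 <= p.2 + h' <= p.2 + h' by rewrite lexx lerDl h'0.
have := small _ _ X1 Y1; have := small _ _ X1 Y2.
have := small _ _ X2 Y1; have := small _ _ X2 Y2.
rewrite WS HS rect_splitx// !rect_splity// -/w' -/h'.
set A := rect f p.1 _ _ _; set B := rect f p.1 _ _ _.
set C := rect f (p.1 + w') _ _ _; set D := rect f (p.1 + w') _ _ _.
exact: four_quarters.
Qed.

(** Bisection. Near the limit point Z the function is affine up to e |z - Z|, and affine functions
    have null integral. Perimeter and distance to Z both shrink like 2^-n, which compensates the
    factor 4^n. *)
Lemma goursat : rect f x y w h = 0.
have /choice[nx nxP] : forall n, exists g : R * R -> R * R, forall p,
 [/\ p.1 <= (g p).1 <= p.1 + W n.+1, p.2 <= (g p).2 <= p.2 + H n.+1 &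
  normc (rect f p.1 p.2 (W n) (H n)) <= 4 * normc (rect f (g p).1 (g p).2 (W n.+1) (H n.+1))].
 by move=> n; have /choice[g] := quarter n; exists g.
pose fix s n : R * R := if n is m.+1 then nx m (s m) else (x, y).
have sS n : s n.+1 = nx n (s n) by [].
have [X XP] := @nested_limit (fun n => (s n).1) w w0 (fun n =>
 let: And3 a _ _ := nxP n (s n) in a).
have [Y YP] := @nested_limit (fun n => (s n).2) h h0 (fun n =>
 let: And3 _ a _ := nxP n (s n) in a).
have le4 n : normc (rect f x y w h) <= 4 ^+ n * normc (rect f (s n).1 (s n).2 (W n) (H n)).
 elim: n => [|n IH]; first by rewrite /W /H expr0 !divr1 mul1r.
 apply: le_trans IH _; rewrite exprSr -mulrA ler_wpM2l ?exprn_ge0//.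
 by have [] := nxP n (s n).
pose Z := X +i* Y.
have [q [cq qE]] : cdiff f Z.
 by apply: df ; [have := XP 0%N|have := YP 0%N]; rewrite divr1.
have small e : 0 < e -> normc (rect f x y w h) <= 2 * (w + h) ^+ 2 * e.
 move=> e0; have [dl dl0 dlP] := (ccts_normcP q Z).1 cq e e0.
 have [n nd] : exists n, (w + h) / 2 ^+ n < dl.
  exists (Num.bound ((w + h) / dl)).
  rewrite ltr_pdivrMr ?exprn_gt0// mulrC -ltr_pdivrMr//.
  apply: lt_le_trans (Num.Theory.archi_boundP (divr_ge0 (addr_ge0 w0 h0) (ltW dl0))) _.
  by rewrite -natrX ler_nat ltnW// ltn_expl.
 apply: le_trans (le4 n) _.
 set a := (s n).1; set b := (s n).2.
 have near z : a <= Re z <= a + W n -> b <= Im z <= b + H n ->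
   normc (z - Z) <= (w + h) / 2 ^+ n.
  move=> zx zy; apply: le_trans (nc_ReIm _) _.
  rewrite cReD cReN cImD cImN mulrDl; apply: lerD.
   by move: zx (XP n); rewrite -/(W n) /= ler_norml ; lra.
  by move: zy (YP n); rewrite -/(H n) /= ler_norml ; lra.
 pose g z := (q z - q Z) * (z - Z).
 have fE z : f z = (f Z - q Z * Z + q Z * z) + g z.
  have := qE z; rewrite /g => /eqP; rewrite subr_eq => /eqP ->; ring.
 have cA z : ccts (fun z => f Z - q Z * Z + q Z * z) z.
  by apply: cctsD; [exact: cctsC|apply: cctsM; [exact: cctsC|exact: ccts_id]].
 have cg z : ccts g z.
  have : ccts (fun z => f z - (f Z - q Z * Z + q Z * z)) z by exact: cctsB.
  by congr ccts; apply/funext => u; rewrite fE; ring.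
 have -> : rect f a b (W n) (H n) = rect g a b (W n) (H n).
  rewrite (_ : f = (fun z => (f Z - q Z * Z + q Z * z) + g z)); last exact/funext.
  rewrite rectD; [|exact: sides_ccts|exact: sides_ccts].
  by rewrite rect_affine// add0r.
 have k0 : 0 <= (w + h) / 2 ^+ n by rewrite divr_ge0 ?addr_ge0.
 have := @rect_le _ g a b (W n) (H n) (e * ((w + h) / 2 ^+ n)) (W0 n) (H0 n)
  (sides_ccts _ _ _ _ cg).
 have gle z : boundary a b (W n) (H n) z -> normc (g z) <= e * ((w + h) / 2 ^+ n).
  move=> [zx zy _]; have zn := near z zx zy.
  rewrite normcM; apply: ler_pM; rewrite ?nc_ge0//.
  by apply: dlP; exact: le_lt_trans nd.
 move=> /(_ gle) le; apply: le_trans (ler_wpM2l (exprn_ge0 n (ler0n _ 4)) le) _.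
 rewrite -mulrDl; apply: eq_ler.
 have -> : 4 ^+ n = 2 ^+ n * 2 ^+ n :> R by rewrite -exprMn; congr (_ ^+ n); ring.
 by field.
apply/eqP; rewrite -normc_eq0 eq_le nc_ge0 andbT; apply/ler_addgt0Pl => e e0.
rewrite addr0; pose k := 2 * (w + h) ^+ 2.
have k0 : 0 <= k by rewrite mulr_ge0// sqr_ge0.
have k1 : 0 < k + 1 by lra.
apply: le_trans (small (e / (k + 1)) (divr_gt0 e0 k1)) _.
rewrite -/k mulrA ler_pdivrMr//; lra.
Qed.

End goursat.

Lemma Im_sum_ge (R : realType) (S1 S2 S3 S4 : R[i]) : 2 / 9 <= Re (- 'i * S1) ->
 2 / 9 <= Re ('i * S2) -> 2 / 9 <= Re S3 -> 2 / 9 <= Re (-1 * S4) ->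
 1 / 2 <= Im (S1 - S2 + 'i * (S3 - S4)).
rewrite !(cReM, cImM, cReD, cReN, cImD, cImN) /=.
case: S1 S2 S3 S4 => [a1 b1] [a2 b2] [a3 b3] [a4 b4]; lra.
Qed.

Section removable_point.
Variables (R : realType) (f : R[i] -> R[i]) (x y w h : R) (p : R[i]).
Hypotheses (cf : forall z, ccts f z)
 (px : x < Re p < x + w) (py : y < Im p < y + h)
 (df : forall z, z != p -> x <= Re z <= x + w -> y <= Im z <= y + h -> cdiff f z).

(** A small square of half-side e around [p] is cut out; Goursat applies to the four rectangles
    around it. The square contributes at most its perimeter 8 e times [M], a bound that continuity
    at [p] provides. *)
Lemma goursat_removable : rect f x y w h = 0.
have /andP[px1 px2] := px; have /andP[py1 py2] := py.
have [dl dl0 dlP] := (ccts_normcP f p).1 (cf p) 1 ltr01.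
pose M := normc (f p) + 1.
have M0 : 0 < M by rewrite ltr_wpDl// nc_ge0.
have small e : 0 < e -> e <= Re p - x -> e <= x + w - Re p ->
  e <= Im p - y -> e <= y + h - Im p -> 4 * e <= dl ->
  normc (rect f x y w h) <= 8 * e * M.
 move=> e0 e1 e2 e3 e4 ed.
 have -> : w = (Re p - e - x) + (2 * e + (x + w - Re p - e)) by ring.
 have -> : h = (Im p - e - y) + (2 * e + (y + h - Im p - e)) by ring.
 set w1 := Re p - e - x; set w3 := x + w - Re p - e.
 set h1 := Im p - e - y; set h3 := y + h - Im p - e.
 have w10 : 0 <= w1 by rewrite /w1; lra.
 have w30 : 0 <= w3 by rewrite /w3; lra.
 have h10 : 0 <= h1 by rewrite /h1; lra.
 have h30 : 0 <= h3 by rewrite /h3; lra.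
 have e20 : 0 <= 2 * e by lra.
 rewrite (rect_splitx x y _ w10 (addr_ge0 e20 w30) cf) (rect_splitx (x + w1) y _ e20 w30 cf).
 rewrite (rect_splity (x + w1) y (2 * e) h10 (addr_ge0 e20 h30) cf).
 rewrite (rect_splity (x + w1) (y + h1) (2 * e) e20 h30 cf).
 have G x' y' w' h' : 0 <= w' -> 0 <= h' -> x <= x' -> x' + w' <= x + w -> y <= y' ->
   y' + h' <= y + h -> [|| Re p < x', x' + w' < Re p,
    Im p < y' | y' + h' < Im p] -> rect f x' y' w' h' = 0.
  move=> w'0 h'0 a1 a2 b1 b2 out; apply: goursat => // z zx zy; apply: df.
  - apply/eqP => zE; move: zx zy out; rewrite zE => /andP[z1 z2] /andP[z3 z4].
   by rewrite !ltNge z1 z2 z3 z4.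
  - by move: zx => /andP[? ?]; apply/andP; lra.
  - by move: zy => /andP[? ?]; apply/andP; lra.
 have xe : x + w1 + 2 * e = Re p + e by rewrite /w1; ring.
 have ye : y + h1 + 2 * e = Im p + e by rewrite /h1; ring.
 have hE : h1 + (2 * e + h3) = h by rewrite /h1 /h3; ring.
 have w1E : w1 = Re p - e - x by [].
 have w3E : w3 = x + w - Re p - e by [].
 have h1E : h1 = Im p - e - y by [].
 have h3E : h3 = y + h - Im p - e by [].
 rewrite hE.
 have -> : rect f x y w1 h = 0 by apply: G; lra.
 have -> : rect f (x + w1 + 2 * e) y w3 h = 0.
  by apply: G; lra.
 have -> : rect f (x + w1) y (2 * e) h1 = 0.
  by apply: G; lra.
 have -> : rect f (x + w1) (y + h1 + 2 * e) (2 * e) h3 = 0.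
  by apply: G; lra.
 rewrite add0r addr0 add0r addr0.
 have : forall z, boundary (x + w1) (y + h1) (2 * e) (2 * e) z -> normc (f z) <= M.
  move=> z [zx zy _]; have zp : normc (z - p) < dl.
   apply: le_lt_trans (nc_ReIm _) _; rewrite cReD cReN cImD cImN.
   have : `|Re z - Re p| <= e.
    by move: zx => /andP[? ?]; rewrite ler_norml; apply/andP; lra.
   have : `|Im z - Im p| <= e.
    by move: zy => /andP[? ?]; rewrite ler_norml; apply/andP; lra.
   lra.
  have := normcD_le (f z - f p) (f p); rewrite subrK => /le_trans; apply.
  by rewrite addrC lerD2l; exact: dlP.
 move=> /(rect_le e20 e20 (sides_ccts _ _ _ _ cf)) /le_trans; apply.
 by apply: eq_ler; ring.
apply/eqP; rewrite -normc_eq0 eq_le nc_ge0 andbT; apply/ler_addgt0Pl => e e0.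
rewrite addr0.
pose e' := Num.min (Num.min (Re p - x) (x + w - Re p))
 (Num.min (Num.min (Im p - y) (y + h - Im p))
  (Num.min (dl / 4) (e / (8 * M)))).
have e'0 : 0 < e'.
 by rewrite !lt_min !subr_gt0 px1 px2 py1 py2 !divr_gt0//= mulr_gt0.
have := lexx e'; rewrite !le_min.
move=> /andP[/andP[b1 b2] /andP[/andP[b3 b4] /andP[b5 b6]]].
apply: le_trans (small e' e'0 b1 b2 b3 b4 _) _; first by rewrite mulrC -ler_pdivlMr.
rewrite mulrAC mulrC -ler_pdivlMr ?mulr_gt0//.
Qed.

End removable_point.

(** * Cauchy's formula and Taylor remainders on a square *)

Section cauchy_formula.
Variables (R : realType) (f : R[i] -> R[i]) (c : R[i]) (rho : R).
Definition insquare s z := `|Re (z - c)| < s /\ `|Im (z - c)| < s.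
Hypotheses (cf : forall z, ccts f z) (df : forall z, insquare rho z -> cdiff f z).

Definition sqrect g s := rect g (Re c - s) (Im c - s) (2 * s) (2 * s).
Definition sqboundary s := boundary (Re c - s) (Im c - s) (2 * s) (2 * s).
Definition ker h z : R[i] := (z - h)^-1.

Lemma sqboundaryE s z : 0 < s -> sqboundary s z -> [/\ `|Re (z - c)| <= s,
 `|Im (z - c)| <= s &
 [|| Im (z - c) == - s, Im (z - c) == s, Re (z - c) == - s |
  Re (z - c) == s]].
move=> s0 [z1 z2 z3]; rewrite !(cReD, cReN, cImD, cImN) !ler_norml; split.
- by move: z1 => /andP[? ?]; apply/andP; lra.
- by move: z2 => /andP[? ?]; apply/andP; lra.
- by case/or4P: z3 => E; apply/or4P; [apply: Or41|apply: Or42|apply: Or43|apply: Or44]; lra.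
Qed.

Section one_square.
Variable s : R.
Hypotheses (s0 : 0 < s) (sr : s < rho).

Lemma sq_ne h z : insquare s h -> sqboundary s z -> z - h != 0.
move=> [h1 h2] /(sqboundaryE s0)[_ _ zb]; rewrite subr_eq0; apply/eqP => zh; subst.
move: h1 h2; rewrite !ltr_norml; lra.
Qed.

Lemma sides_ker h : insquare s h ->
 sides (ker h) (Re c - s) (Im c - s) (2 * s) (2 * s).
move=> [h1 h2]; rewrite !(cReD, cReN, cImD, cImN) !ltr_norml in h1 h2.
have H y t : Im h != y -> ccts (hside (ker h) y) t.
 move=> hy; apply: cctsV; last first.
  by rewrite subr_eq0; apply: contraNneq hy => <-.
 apply: cctsB; last exact: cctsC.
 exact: (ccts_comp (g := fun s => s +i* y) (@cvg_Re_line R y t) (ccts_id _)).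
have Vv x t : Re h != x -> ccts (vside (ker h) x) t.
 move=> hx; apply: cctsV; last first.
  by rewrite subr_eq0; apply: contraNneq hx => <-.
 apply: cctsB; last exact: cctsC.
 exact: (ccts_comp (g := fun s => x +i* s) (@cvg_Im_line R x t) (ccts_id _)).
by split=> t; [apply: H|apply: H|apply: Vv|apply: Vv]; apply/eqP; lra.
Qed.

(** The difference quotient at [h], completed by continuity, is differentiable off [h] and has null
    integral. The factor [sqrect (ker h) s], classically 2 i pi, is never computed: the bounds
    [ker_rect_lb] and [ker_rect_ub] are all that is used. *)
Lemma cauchy_formula h : insquare s h ->
 sqrect (fun z => f z * ker h z) s = f h * sqrect (ker h) s.
move=> hs; have [h1 h2] := hs.
have hr : insquare rho h by split; [exact: lt_trans h1 sr|exact: lt_trans h2 sr].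
have [q [cq qE]] := df hr.
have qker u : u != h -> q u = (f u - f h) * (u - h)^-1.
 by move=> uh; rewrite qE mulfK// subr_eq0.
have cqall z : ccts q z.
 have [->//|zh] := eqVneq z h.
 apply: (@near_ccts _ _ (fun u => (f u - f h) * (u - h)^-1)).
  apply/nbhs_ncP; exists (normc (z - h)); first by rewrite normc_gt0 subr_eq0.
  move=> u uz; rewrite qker//; apply: contraTneq uz => ->.
  by rewrite -leNgt normcB_sym.
 apply: cctsM; first by apply: cctsB => //; exact: cctsC.
 by apply: cctsV; [apply: cctsB; [exact: ccts_id|exact: cctsC]|rewrite subr_eq0].
have dq z : z != h -> insquare rho z -> cdiff q z.
 move=> zh /df[r [cr rE]]; exists (fun u => (r u - q u) * (z - h)^-1); split.
  by apply: cctsM; [exact: cctsB|exact: cctsC].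
 move=> u; have zh0 : z - h != 0 by rewrite subr_eq0.
 apply: (mulfI zh0); rewrite [RHS](_ : _ = (r u - q u) * (u - z)); last by field.
 rewrite (mulrBl _ (r u)) -rE; have := qE u; have := qE z => qz qu.
 have -> : f u - f z = q u * (u - h) - q z * (z - h) by rewrite -qu -qz; ring.
 by ring.
have Q0 : sqrect q s = 0.
 rewrite !(cReD, cReN, cImD, cImN) !ltr_norml in h1 h2.
 apply: (@goursat_removable _ _ _ _ _ _ h) => //; [lra|lra|].
 move=> z zh zx zy; apply: dq => //.
 by have srp := sr; split; rewrite !(cReD, cReN, cImD, cImN) ltr_norml; lra.
have sk := sides_ker hs; have sq := sides_ccts (Re c - s) (Im c - s) (2 * s) (2 * s) cqall.
have s20 : 0 <= 2 * s by have sp := s0; lra.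
rewrite /sqrect (@eq_rect _ _ (fun z => q z + f h * ker h z)) //.
 rewrite rectD//; last by apply: sidesM => //; apply: sides_ccts => z; exact: cctsC.
 by rewrite rectZ// -/(sqrect q s) Q0 add0r.
move=> z /(sq_ne hs); rewrite subr_eq0 => zh; rewrite (qker _ zh) /ker; ring.
Qed.

Definition half h := `|Re (h - c)| <= s / 2 /\ `|Im (h - c)| <= s / 2.

Lemma hinsq h : half h -> insquare s h.
by have sp := s0; move=> [h1 h2]; split; [apply: le_lt_trans h1 _|apply: le_lt_trans h2 _]; lra. Qed.

Lemma half_c : half c.
by have sp := s0; split; rewrite subrr normr0; lra. Qed.

Lemma ker_c_le z : sqboundary s z -> normc (ker c z) <= s^-1.
move=> /(sqboundaryE s0)[_ _ zb]; rewrite /ker normcV.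
have le : s <= normc (z - c).
 case/or4P: zb => /eqP E; [apply: le_trans (normc_Im _)|apply: le_trans (normc_Im _)|
  apply: le_trans (normc_Re _)|apply: le_trans (normc_Re _)]; rewrite E ?normrN gtr0_norm//.
by rewrite lef_pV2// posrE (lt_le_trans s0).
Qed.

Lemma ker_h_le h z : half h -> sqboundary s z -> normc (ker h z) <= 2 / s.
move=> [h1 h2] /(sqboundaryE s0)[_ _ zb]; rewrite /ker normcV.
have le : s / 2 <= normc (z - h).
 rewrite !(cReD, cReN, cImD, cImN) !ler_norml in h1 h2 zb *.
 case/or4P: zb => /eqP E; [apply: le_trans (normc_Im _)|apply: le_trans (normc_Im _)|
  apply: le_trans (normc_Re _)|apply: le_trans (normc_Re _)];
  rewrite !(cReD, cReN, cImD, cImN) ler_normr; apply/orP.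
 - by right; lra.
 - by left; lra.
 - by right; lra.
 - by left; lra.
have s2 : 0 < s / 2 by rewrite divr_gt0.
by rewrite -[2 / s]invf_div lef_pV2// posrE (lt_le_trans s2).
Qed.

Let i1 : normc ('i : R[i]) = 1.
by rewrite /= expr0n /= expr1n add0r sqrtr1. Qed.

(** The four sides contribute with the same sign to the imaginary part. On each, the relevant
    component of 1 / (z - h) is a / (a^2 + b^2) with a >= s / 2 and a, |b| <= 3 s / 2, hence at
    least 1 / (9 s); over the length 2 s this gives 2 / 9, and 8 / 9 exceeds 1 / 2. *)
Lemma ker_rect_lb h : half h -> 1 / 2 <= normc (sqrect (ker h) s).
move=> hh; have sp := s0; have [h1 h2] := hh; apply: le_trans (normc_Im _); rewrite ler_normr; apply/orP; left.
have [s1 s2 s3 s4] := sides_ker (hinsq hh).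
rewrite !(cReD, cReN, cImD, cImN) !ler_norml in h1 h2.
pose k := (9 * s)^-1.
have k0 : 0 < k by rewrite invr_gt0; lra.
have low (a b : R) : a ^+ 2 + b ^+ 2 <= 9 / 2 * s ^+ 2 -> s / 2 <= a -> k <= a / (a ^+ 2 + b ^+ 2).
 move=> ab sa; have a0 : 0 < a by lra.
 have n0 : 0 < a ^+ 2 + b ^+ 2 by rewrite ltr_wpDr ?sqr_ge0// exprn_gt0.
 rewrite ler_pdivlMr// /k mulrC ler_pdivrMr; last by lra.
 by apply: le_trans ab _; rewrite expr2; nra.
have sq (a b : R) : - (3 / 2 * s) <= a <= 3 / 2 * s -> - (3 / 2 * s) <= b <= 3 / 2 * s ->
  a ^+ 2 + b ^+ 2 <= 9 / 2 * s ^+ 2.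
 by move=> /andP[? ?] /andP[? ?]; rewrite !expr2; nra.
have ReI (u : R[i]) : Re (- 'i * u) = Im u.
 by rewrite cReM /=; case: u => ? ? /=; ring.
have ImV (u : R[i]) : Im u^-1 = - Im u / (Re u ^+ 2 + Im u ^+ 2).
 exact: cImV.
have x2s : Re c - s <= Re c - s + 2 * s by lra.
have y2s : Im c - s <= Im c - s + 2 * s by lra.
have w2 (x : R) : x + 2 * s - x = 2 * s by ring.
have B1 : k * (2 * s) <= Re (- 'i * seg (Re c - s) (Re c - s + 2 * s) (hside (ker h) (Im c - s))).
 rewrite -segZ// -[X in _ * X <= _](w2 (Re c - s)); apply: seg_Re_ge => //.
  by move=> t; apply: cctsM => //; exact: cctsC.
 move=> t tt; rewrite ReI /hside /ker cImV addrC.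
 rewrite !(cReD, cReN, cImD, cImN) /= addrC.
 rewrite [X in k <= _ / X]addrC -[X in k <= _ / (X + _)]sqrrN.
 apply: low; [apply: sq|]; lra.
have B2 : k * (2 * s) <= Re ('i * seg (Re c - s) (Re c - s + 2 * s) (hside (ker h) (Im c - s + 2 * s))).
 rewrite -segZ// -[X in _ * X <= _](w2 (Re c - s)); apply: seg_Re_ge => //.
  by move=> t; apply: cctsM => //; exact: cctsC.
 move=> t tt; rewrite -[X in Re X]opprK -mulNr cReN ReI /hside /ker cImV mulNr opprK.
 rewrite !(cReD, cReN, cImD, cImN) /=.
 rewrite [X in k <= _ / X]addrC.
 apply: low; [apply: sq|]; lra.
have B3 : k * (2 * s) <= Re (seg (Im c - s) (Im c - s + 2 * s) (vside (ker h) (Re c - s + 2 * s))).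
 rewrite -[X in _ * X <= _](w2 (Im c - s)); apply: seg_Re_ge => //.
 move=> t tt; rewrite /vside /ker cReV.
 rewrite !(cReD, cReN, cImD, cImN) /=.
 apply: low; [apply: sq|]; lra.
have B4 : k * (2 * s) <= Re (-1 * seg (Im c - s) (Im c - s + 2 * s) (vside (ker h) (Re c - s))).
 rewrite -segZ// -[X in _ * X <= _](w2 (Im c - s)); apply: seg_Re_ge => //.
  by move=> t; apply: cctsM => //; exact: cctsC.
 move=> t tt; rewrite mulN1r cReN /vside /ker cReV -mulNr.
 rewrite !(cReD, cReN, cImD, cImN) /= -[X in k <= _ / (X + _)]sqrrN.
 apply: low; [apply: sq|]; lra.
rewrite /sqrect /rect; set S1 := seg _ _ _ in B1 *; set S2 := seg _ _ (hside _ (_ + _)) in B2 *.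
set S3 := seg _ _ _ in B3 *; set S4 := seg _ _ (vside _ (Re c - s)) in B4 *.
have ks : k * (2 * s) = 2 / 9 by rewrite /k; field; lra.
rewrite ks in B1 B2 B3 B4.
exact: Im_sum_ge B1 B2 B3 B4.
Qed.

(** The perimeter 8 s times the bound 2 / s of the kernel. *)
Lemma ker_rect_ub h : half h -> normc (sqrect (ker h) s) <= 16.
move=> hh; have s20 : 0 <= 2 * s by have sp := s0; lra.
apply: le_trans (rect_le s20 s20 (sides_ker (hinsq hh)) (fun z => @ker_h_le h z hh)) _.
by apply: eq_ler; field; rewrite gt_eqF.
Qed.

(* [remt n h]: up to the factor [ker_rect], the [n]-th Taylor remainder at [c] divided
  by [(h - c) ^+ n]. *)
Definition remt n h := sqrect (fun z => f z * ker c z ^+ n * ker h z) s.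

Let sides_pow n : sides (fun z => f z * ker c z ^+ n) (Re c - s) (Im c - s) (2 * s) (2 * s).
apply: sidesM; first exact: sides_ccts.
have [s1 s2 s3 s4] := sides_ker (hinsq half_c).
by split=> t; exact: cctsX.
Qed.

Lemma remt0 h : half h -> remt 0 h = f h * sqrect (ker h) s.
move=> /hinsq hh; rewrite -(cauchy_formula hh).
apply: (congr1 (fun g => sqrect g s)); apply/funext => z; by rewrite expr0 mulr1.
Qed.

(** The identity 1 / (z - h) = 1 / (z - c) + (h - c) / ((z - c) (z - h)) under the integral. *)
Lemma remtS n h : half h -> remt n h = remt n c + (h - c) * remt n.+1 h.
move=> hh; have hi := hinsq hh; have ci := hinsq half_c.
have s20 : 0 <= 2 * s by have sp := s0; lra.
rewrite /remt /sqrect -rectZ; last by apply: sidesM => //; exact: sides_ker.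
rewrite -rectD; last 2 first.
- by apply: sidesM => //; exact: sides_ker.
- apply: sidesM; first by apply: sides_ccts => z; exact: cctsC.
 by apply: sidesM => //; exact: sides_ker.
apply: eq_rect => // z zb; have zh := sq_ne hi zb; have zc := sq_ne ci zb.
by rewrite exprS /ker; field; rewrite zh zc.
Qed.

Lemma remt_expand n h : half h ->
 f h * sqrect (ker h) s = \sum_(k < n) (h - c) ^+ k * remt k c + (h - c) ^+ n * remt n h.
move=> hh; rewrite -remt0//; elim: n => [|n IH].
 by rewrite big_ord0 add0r expr0 mul1r.
by rewrite IH big_ord_recr /= (remtS n hh) exprSr; ring.
Qed.

Variable M : R.
Hypothesis fM : forall z, sqboundary s z -> normc (f z) <= M.

Lemma remt_le n h : half h -> normc (remt n h) <= 16 * M / s ^+ n.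
move=> hh; have s20 : 0 <= 2 * s by have sp := s0; lra.
have sd : sides (fun z => f z * ker c z ^+ n * ker h z) (Re c - s) (Im c - s) (2 * s) (2 * s).
 by apply: sidesM => //; exact: sides_ker (hinsq hh).
have le z : sqboundary s z -> normc (f z * ker c z ^+ n * ker h z) <= M * s^-1 ^+ n * (2 / s).
 move=> zb; rewrite !normcM normcX; apply: ler_pM; rewrite ?mulr_ge0 ?exprn_ge0 ?nc_ge0//.
  apply: ler_pM; rewrite ?exprn_ge0 ?nc_ge0//; first exact: fM.
  by apply: lerXn2r; [rewrite nnegrE nc_ge0|rewrite nnegrE invr_ge0 ltW|exact: ker_c_le].
 exact: ker_h_le.
apply: le_trans (rect_le s20 s20 sd le) _; rewrite exprVn.
by apply: eq_ler; field; rewrite expf_neq0 gt_eqF.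
Qed.

End one_square.

End cauchy_formula.

(** * Zeros, Lipschitz bounds and second-order Taylor bounds *)

Section local_behaviour.
Variables (R : realType) (f : R[i] -> R[i]) (c : R[i]) (rho s : R).
Hypotheses (cf : forall z, ccts f z) (df : forall z, insquare c rho z -> cdiff f z)
 (s0 : 0 < s) (sr : s < rho).
Local Notation remf := (remt f c s).
Local Notation half := (half c s).
Local Notation kerR h := (sqrect c (ker h) s).

Definition csq z := `|Re (z - c)| <= s /\ `|Im (z - c)| <= s.

Lemma half_near h : normc (h - c) <= s / 2 -> half h.
by move=> hc; split; [apply: le_trans (normc_Re _) hc|apply: le_trans (normc_Im _) hc]. Qed.

Let bound_ex : exists2 M, 0 <= M & forall z, sqboundary c s z -> normc (f z) <= M.
have H (u : R -> R[i]) : curve u -> forall a b, exists2 M, 0 <= M & forall t, a <= t <= b -> normc (u t) <= M.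
 move=> /curve_continuous[c1 c2] a b.
 have E (v : R -> R) : continuous v -> exists2 M, 0 <= M & forall t, a <= t <= b -> `|v t| <= M.
  move=> cv; have [ab|ba] := leP a b; last first.
   exists 0 => // t /andP[at_ tb]; have := le_trans at_ tb; by rewrite leNgt ba.
  have cn : {within `[a, b], continuous (fun t => `|v t|)}.
   apply: continuous_subspaceT => t; apply: cvg_norm; exact: cv.
  have [m _ mP] := EVT_max ab cn.
  by exists `|v m| .
 have [M1 M10 h1] := E _ c1; have [M2 M20 h2] := E _ c2.
 exists (M1 + M2); first exact: addr_ge0.
 by move=> t tt; apply: le_trans (nc_ReIm _) _; rewrite lerD ?h1 ?h2.
have Hh y := H _ (curve_hside y cf) (Re c - s) (Re c - s + 2 * s).
have Hv x := H _ (curve_vside x cf) (Im c - s) (Im c - s + 2 * s).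
have [M1 M10 h1] := Hh (Im c - s).
have [M2 M20 h2] := Hh (Im c - s + 2 * s).
have [M3 M30 h3] := Hv (Re c - s).
have [M4 M40 h4] := Hv (Re c - s + 2 * s).
exists (M1 + M2 + M3 + M4); first by rewrite !addr_ge0.
case=> a b [/= ta tb /or4P[] /eqP E].
- by move: (h1 a); rewrite -E; lra.
- by move: (h2 a); rewrite -E; lra.
- by move: (h3 b); rewrite -E; lra.
- by move: (h4 b); rewrite -E; lra.
Qed.

(** If all the coefficients [remf n c] vanish, |f(h)| is at most a constant times (|h - c| / s)^n
    for every n, with a ratio below 1 on the half square. Otherwise the first nonzero coefficient
    dominates near [c]; the conclusion is a uniform lower bound on annuli, because the deletion of
    points needs it quantitatively. *)
Lemma zero_dichotomy : (forall h, half h -> f h = 0) \/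
 exists2 e, 0 < e & forall t, 0 < t -> exists2 dl, 0 < dl &
  forall h, t <= normc (h - c) < e -> dl <= normc (f h).
have [M M0 fM] := bound_ex.
have [all0|/existsNP[m0 /eqP nz]] := pselect (forall n, remf n c = 0).
 left=> h hh; apply/eqP; rewrite -normc_eq0 eq_le nc_ge0 andbT.
 have E n : f h * kerR h = (h - c) ^+ n * remf n h.
  by rewrite (remt_expand cf df s0 sr n hh) big1 ?add0r// => k _; rewrite all0 mulr0.
 pose k := normc (h - c) / s.
 have k0 : 0 <= k by rewrite divr_ge0 ?nc_ge0// ltW.
 have k1 : k < 1.
  rewrite ltr_pdivrMr// mul1r -(@ltr_pXn2r _ 2)// ?nnegrE ?nc_ge0 ?(ltW s0)// normc_sq.
  have [h1 h2] := hh; have sp := s0; move: h1 h2; rewrite !ler_norml => /andP[? ?] /andP[? ?].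
  nra.
 have le n : normc (f h) <= 32 * M * k ^+ n.
  have := congr1 (@normc R) (E n); rewrite !normcM normcX => En.
  have lb := ker_rect_lb s0 hh.
  have : normc (f h) * (1 / 2) <= normc (h - c) ^+ n * (16 * M / s ^+ n).
   apply: le_trans (ler_wpM2l (nc_ge0 _) lb) _; rewrite En.
   by rewrite ler_wpM2l ?exprn_ge0 ?nc_ge0//; exact: remt_le.
  have -> : normc (h - c) ^+ n * (16 * M / s ^+ n) = 16 * M * k ^+ n.
   by rewrite /k expr_div_n; ring.
  have -> : 32 * M * k ^+ n = 2 * (16 * M * k ^+ n) by ring.
  move: (_ * k ^+ n) => *; lra.
 apply: (@le_cvg _ (fun=> normc (f h)) (fun n => 32 * M * k ^+ n)) le; first exact: cvg_cst.
 rewrite -[X in _ --> X](mulr0 (32 * M)); apply: cvgM; first exact: cvg_cst.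
 by apply: cvg_expr; rewrite ger0_norm.
right.
have /ex_minnP[m mn mmin] : exists n, remf n c != 0 by exists m0.
have ex0 k : (k < m)%N -> remf k c = 0.
 by move=> km; apply/eqP; apply: contraTT km => /mmin; rewrite -leqNgt.
pose C := 16 * M / s ^+ m.+1.
have C0 : 0 <= C by rewrite divr_ge0 ?exprn_ge0 ?(ltW s0)// mulr_ge0.
pose a := normc (remf m c); have a0 : 0 < a by rewrite normc_gt0.
have C1 : 0 < 2 * (C + 1) by lra.
(* Within this radius the remainder is at most half of the leading coefficient [a], and the points
   remain in the half square. *)
exists (Num.min (s / 2) (a / (2 * (C + 1)))).
 by rewrite lt_min !divr_gt0.
move=> t t0; exists (t ^+ m * (a / 2) / 16); first by rewrite divr_gt0// mulr_gt0 ?exprn_gt0 ?divr_gt0.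
move=> h /andP[hc]; rewrite lt_min => /andP[hs ha].
have hh := half_near (ltW hs).
have E := remt_expand cf df s0 sr m.+1 hh.
rewrite big_ord_recr /= big1 in E; last by move=> k _; rewrite ex0 ?mulr0.
rewrite add0r exprSr -mulrA -mulrDr in E.
have := congr1 (@normc R) E; rewrite !normcM normcX => En.
have ub := ker_rect_ub s0 hh.
have le := remt_le cf s0 fM m.+1 hh; rewrite -/C in le.
have lb : a / 2 <= normc (remf m c + (h - c) * remf m.+1 h).
 have := normcB_le (remf m c + (h - c) * remf m.+1 h) ((h - c) * remf m.+1 h).
 rewrite addrK -/a normcM.
 have : normc (h - c) * normc (remf m.+1 h) <= a / (2 * (C + 1)) * C.
  by apply: ler_pM; rewrite ?nc_ge0//; exact: ltW.
 have : a / (2 * (C + 1)) * C <= a / 2 by rewrite mulrAC ler_pdivrMr//; nra.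
 move: (normc (_ + _)) (_ * C) (_ * normc _) => *; lra.
have : t ^+ m * (a / 2) <= normc (f h) * 16.
 apply: le_trans (ler_wpM2l (nc_ge0 _) ub); rewrite En.
 apply: ler_pM => //; [by rewrite exprn_ge0// ltW|by rewrite divr_ge0// ltW|].
 by apply: lerXn2r => //; rewrite nnegrE ?nc_ge0// ltW.
by rewrite ler_pdivrMr.
Qed.

Variable M : R.
Hypothesis fM : forall z, csq z -> normc (f z) <= M.

Let M0 : 0 <= M.
apply: le_trans (nc_ge0 (f c)) (fM _).
by rewrite /csq subrr normr0; split; exact: ltW.
Qed.

Let closed_boundary z : sqboundary c s z -> csq z.
by move=> /(sqboundaryE s0)[h1 h2 _]. Qed.

Let half_closed h : half h -> csq h.
by have sp := s0; move=> []; split; lra. Qed.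

(** Expansion of order 1 of f - f(c), which is at most 2 M on the boundary: 64 is 16 for the
    remainder, times 2 for this bound, times 2 for the lower bound of the kernel integral. *)
Lemma lipschitz_center h : half h -> normc (f h - f c) <= 64 * M / s * normc (h - c).
move=> hh; pose g z := f z + (- f c).
have cg z : ccts g z by apply: cctsD => //; exact: cctsC.
have dg z : insquare c rho z -> cdiff g z.
 move=> /df[q [cq qE]]; exists q; split=> // u; rewrite /g -qE; ring.
have gM z : sqboundary c s z -> normc (g z) <= 2 * M.
 move=> zb; apply: le_trans (normcB_le _ _) _.
 have := fM (closed_boundary zb); have := fM (half_closed (half_c c s0)); lra.
have E := remt_expand cg dg s0 sr 1 hh.
have E0 := remt_expand cg dg s0 sr 0 (half_c c s0).
move: E0; rewrite big_ord0 mul1r add0r /g subrr mul0r -/g => E0.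
move: E; rewrite big_ord_recr big_ord0 /= -E0 mulr0 !add0r expr1 => E.
have := congr1 (@normc R) E; rewrite !normcM => En.
have lb := ker_rect_lb s0 hh; have ub := remt_le cg s0 gM 1 hh; rewrite expr1 in ub.
have : normc (f h - f c) * (1 / 2) <= normc (h - c) * (16 * (2 * M) / s).
 apply: le_trans (ler_wpM2l (nc_ge0 _) lb) _; rewrite En.
 by rewrite ler_wpM2l// nc_ge0.
have -> : normc (h - c) * (16 * (2 * M) / s) = 32 * M / s * normc (h - c) by ring.
have -> : 64 * M / s * normc (h - c) = 2 * (32 * M / s * normc (h - c)) by ring.
move: (_ * normc (h - c)) => *; lra.
Qed.

(** The function [g], f minus its affine part at [c], has its first two coefficients null and is at
    most M + M + 128 M on the boundary, since |z - c| <= 2 s there. With the factor 16 of the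
    remainder and 2 for the kernel, 130 M becomes 4160 M. *)
Lemma taylor1 q : ccts q c -> (forall u, f u - f c = q u * (u - c)) ->
 normc (q c) <= 64 * M / s /\
 forall h, half h -> normc (f h - f c - q c * (h - c)) <= 4160 * M / s ^+ 2 * normc (h - c) ^+ 2.
move=> cq qE; have sp := s0.
have near_pt (e : R) : 0 < e -> exists h, [/\ half h, h != c & normc (h - c) <= e].
 move=> e0; pose t := Num.min e (s / 2); have t0 : 0 < t by rewrite lt_min e0 divr_gt0.
 have tc : normc (c + t%:C - c) = t by rewrite addrC addKr normcR gtr0_norm.
 exists (c + t%:C); split.
 - by apply: half_near; rewrite tc ge_min lexx orbT.
 - by rewrite -subr_eq0 -normc_eq0 tc gt_eqF.
 - by rewrite tc ge_min lexx.
have qc : normc (q c) <= 64 * M / s.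
 apply/ler_addgt0Pr => e e0; have [dl dl0 dlP] := (ccts_normcP q c).1 cq e e0.
 have [|h [hh hc hd]] := near_pt (dl / 2); first by rewrite divr_gt0.
 have := dlP h; have -> : normc (h - c) < dl by apply: le_lt_trans hd _; lra.
 move=> /(_ isT) qd; have := lipschitz_center hh; rewrite qE normcM.
 rewrite ler_pM2r; last by rewrite normc_gt0 subr_eq0.
 have := normcB_le (q h) (q h - q c); rewrite opprB addrCA subrr addr0; lra.
split=> // h hh.
pose g z := (q z - q c) * (z - c).
have gE z : g z = f z + (- f c + (- q c) * (z - c)) by rewrite /g mulrBl -qE; ring.
have cg z : ccts g z.
 have : ccts (fun z => f z + (- f c + (- q c) * (z - c))) z.
  apply: cctsD => //; apply: cctsD; first exact: cctsC.
  by apply: cctsM; [exact: cctsC|apply: cctsB; [exact: ccts_id|exact: cctsC]].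
 by congr ccts; apply/funext .
have dg z : insquare c rho z -> cdiff g z.
 move=> /df[r [cr rE]]; exists (fun u => r u - q c); split.
  exact: cctsB (cctsC _ _).
 move=> u; rewrite /g (mulrBl _ (r u)) -rE mulrBl -qE mulrBl -qE.
 by move: c => *; ring.
have gM z : sqboundary c s z -> normc (g z) <= 130 * M.
 move=> zb; rewrite gE; apply: le_trans (normcD_le _ _) _.
 have f1 := fM (closed_boundary zb); have f2 := fM (half_closed (half_c c s0)).
 have := normcD_le (- f c) (- q c * (z - c)); rewrite normcN_eq normcM normcN_eq.
 have zc : normc (z - c) <= 2 * s.
  have [z1 z2] := closed_boundary zb; apply: le_trans (nc_ReIm _) _; lra.
 have : normc (q c) * normc (z - c) <= 64 * M / s * (2 * s) by apply: ler_pM; rewrite ?nc_ge0.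
 have -> : 64 * M / s * (2 * s) = 128 * M by field; rewrite gt_eqF.
 move: (_ * _) => *; lra.
have gc : g c = 0 by rewrite /g !subrr mulr0.
have r0 : sqrect c (fun z => g z * ker c z ^+ 0 * ker c z) s = 0.
 by have := remt0 cg dg s0 sr (half_c c s0); rewrite gc mul0r.
pose r := remt g c s.
have ex u : half u -> g u * kerR u = (u - c) * (r 1%N c + (u - c) * r 2%N u).
 move=> hu; have := remt_expand cg dg s0 sr 2 hu.
 rewrite !big_ord_recr big_ord0 /= -/r (r0 : r 0%N c = 0).
 by move=> ->; ring.
have rle u : half u -> normc (r 2%N u) <= 16 * (130 * M) / s ^+ 2.
 exact: remt_le.
have r1 : r 1%N c = 0.
 apply/eqP; rewrite -normc_eq0 eq_le nc_ge0 andbT; apply/ler_addgt0Pr => e e0; rewrite add0r.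
 pose C := 16 * (130 * M) / s ^+ 2.
 have C0 : 0 <= C by rewrite divr_ge0 ?sqr_ge0// !mulr_ge0.
 have e1 : 0 < e / 32 by rewrite divr_gt0.
 have [dl dl0 dlP] := (ccts_normcP q c).1 cq _ e1.
 have C1 : 0 < 2 * (C + 1) by lra.
 have [|u [hu uc ud]] := near_pt (Num.min (dl / 2) (e / (2 * (C + 1)))).
  by rewrite lt_min !divr_gt0.
 move: ud; rewrite le_min => /andP[ud ue].
 have qd : normc (q u - q c) <= e / 32 by apply: dlP; lra.
 have u0 : u - c != 0 by rewrite subr_eq0.
 have : (q u - q c) * kerR u = r 1%N c + (u - c) * r 2%N u.
  by apply: (mulfI u0); rewrite -ex// /g; ring.
 move=> /eqP; rewrite -subr_eq => /eqP <-.
 apply: le_trans (normcB_le _ _) _; rewrite !normcM.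
 have a1 : normc (q u - q c) * normc (kerR u) <= e / 32 * 16.
  by apply: ler_pM; rewrite ?nc_ge0//; exact: ker_rect_ub.
 have a2 : normc (u - c) * normc (r 2%N u) <= e / (2 * (C + 1)) * C.
  by apply: ler_pM; rewrite ?nc_ge0//; exact: rle.
 have a3 : e / (2 * (C + 1)) * C <= e / 2.
  rewrite mulrAC ler_pdivrMr//; nra.
 lra.
have E := ex h hh; rewrite r1 add0r in E.
have En : normc (g h) * normc (kerR h) = normc (h - c) * (normc (h - c) * normc (r 2%N h)).
 by rewrite -normcM E !normcM.
have -> : f h - f c - q c * (h - c) = g h by rewrite gE; ring.
have lb := ker_rect_lb s0 hh; have ub := rle h hh.
have : normc (g h) * (1 / 2) <= normc (h - c) * (normc (h - c) * (16 * (130 * M) / s ^+ 2)).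
 apply: le_trans (ler_wpM2l (nc_ge0 _) lb) _; rewrite En.
 by rewrite !ler_wpM2l// nc_ge0.
have -> : 4160 * M / s ^+ 2 * normc (h - c) ^+ 2 =
  2 * (normc (h - c) * (normc (h - c) * (16 * (130 * M) / s ^+ 2))) by ring.
move: (normc (h - c) * (normc (h - c) * _)) => *; lra.
Qed.

End local_behaviour.

(* A function measurable in [x] and continuous in [y] is the limit of the functions
  obtained by rounding [y] to the first point of a dense sequence that is close. *)
Lemma caratheodory d1 d2 (X : measurableType d1) (Y : measurableType d2) (R : realType)
  (f : X -> Y -> R) (D : nat -> Y) (E : nat -> nat -> set Y) :
 (forall n k, measurable (E n k)) -> (forall n y, exists k, E n k y) ->
 (forall k, measT (f^~ (D k))) ->
 (forall x y (k : nat -> nat), (forall n, E n (k n) y) -> f x (D (k n)) @[n --> \oo] --> f x y) ->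
 measT (fun p : X * Y => f p.1 p.2).
move=> mE covE mf cf.
pose F n k := E n k `\` \bigcup_(j in [set j | (j < k)%N]) E n j.
have mF n k : measurable (F n k).
 by apply: measurableD => //; apply: bigcup_measurable _.
have exq n y : exists k, `[< E n k y >] by have [k] := covE n y; exists k; apply/asboolP.
pose q n y := ex_minn (exq n y).
have qE n y : E n (q n y) y by rewrite /q; case: ex_minnP => k /asboolP.
have qF n y k : F n k y <-> q n y = k.
 rewrite /F /q; case: ex_minnP => m /asboolP Em mmin; split=> [[Ek nk]|<-].
  apply/eqP; rewrite eqn_leq mmin /=; last exact/asboolP.
  by rewrite leqNgt; apply/negP => mk; apply: nk; exists m.
 by split=> // -[j jm Ej]; have := mmin j (introT (asboolP _) Ej); rewrite leqNgt jm.
apply: (@measurable_fun_cvg _ _ _ _ (fun n (p : X * Y) => f p.1 (D (q n p.2)))); last first.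
 by move=> [x y] _; apply: cf .
move=> n _ A mA; rewrite setTI.
rewrite (_ : _ _ = \bigcup_k ((f^~ (D k) @^-1` A) `*` F n k)).
 apply: bigcup_measurable => k _; apply: measurableX => //.
 by rewrite -[X in measurable X]setTI; exact: mf.
apply/seteqP; split=> [[x y] /= Axy|[x y] [k _ [ Ax /qF qk]]]; last by rewrite /= qk.
by exists (q n y) ; split=> //; apply/qF.
Qed.

(** * Rounding to rational points *)

Section real_rounding.
Variable R : realType.

Definition ratpoint (k : nat) : R := ratr (odflt 0 (unpickle k)).

Definition ratball n k : set R := [set y | `|y - ratpoint k| < n.+1%:R^-1].

Lemma m_ratball n k : measurable (ratball n k).
have -> : ratball n k = `]ratpoint k - n.+1%:R^-1, ratpoint k + n.+1%:R^-1[%classic.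
 by apply/seteqP; split=> y; rewrite /ratball /= ltr_distl.
by [].
Qed.

Lemma ratball_cover n y : exists k, ratball n k y.
have e0 : 0 < n.+1%:R^-1 :> R by [].
have [q] := @rat_in_itvoo R (y - n.+1%:R^-1) (y + n.+1%:R^-1) (ltac:(by rewrite ltrD2l gtrN)).
rewrite in_itv /= => /andP[q1 q2]; exists (pickle q); rewrite /ratball.
have -> : ratpoint (pickle q) = ratr q by rewrite /ratpoint pickleK.
by rewrite /= ltr_distlC; apply/andP.
Qed.

Lemma ratball_cvg (y : R) (k : nat -> nat) : (forall n, ratball n (k n) y) ->
 ratpoint (k n) @[n --> \oo] --> y.
move=> kP; apply/cvgrPdist_le => e e0.
have /cvgrPdist_le/(_ _ e0) := @cvg_harmonic R.
apply: filterS => n; rewrite sub0r normrN ger0_norm ?invr_ge0//.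
by move=> le; apply: ltW; apply: lt_le_trans le; exact: kP.
Qed.

End real_rounding.

(** * Translations and reflections of the line *)

Section lebesgue_isometries.
Variable R : realType.
Local Notation leb := (@lebesgue_measure R).
Local Notation RT := (measurableTypeR R).

(** Lebesgue measure is determined by its values on half-open intervals, so checking the preimages
    of these suffices. *)
Lemma leb_isometry (phi : RT -> RT) : measT phi ->
 (forall a b, leb (phi @^-1` `]a, b]) = leb `]a, b]%classic) ->
 forall H : RT -> \bar R, measT H -> (forall x, 0 <= H x)%E ->
 (\int[leb]_x H (phi x) = \int[leb]_x H x)%E.
move=> mphi phiE H mH H0.
have := @ge0_integral_pushforward _ _ _ _ R phi mphi leb setT H measurableT mH (fun x _ => H0 x).
rewrite preimage_setT => <-; apply: eq_measure_integral => A mA _; apply/esym.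
apply: (@lebesgue_measure_unique) => //.
by move=> _ [[a b] _ <-]; apply/esym; exact: phiE.
Qed.

Lemma ge0_integral_leb_add (a : R) (H : RT -> \bar R) : measT H ->
 (forall x, 0 <= H x)%E -> (\int[leb]_x H (a + x)%R = \int[leb]_x H x)%E.
move=> mH H0; apply: (leb_isometry (phi := fun x => a + x)) => //.
 exact: measurable_funD.
move=> u v; rewrite (_ : _ _ = `]u - a, v - a]%classic); last first.
 by apply/seteqP; split=> x /=; rewrite !in_itv /= ; lra.
by rewrite !lebesgue_measure_itv !lte_fin ltrD2r; case: ifP => _; congr (_%:E); ring.
Qed.

Lemma ge0_integral_leb_sub (a : R) (H : RT -> \bar R) : measT H ->
 (forall x, 0 <= H x)%E -> (\int[leb]_x H (a - x)%R = \int[leb]_x H x)%E.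
move=> mH H0; apply: (leb_isometry (phi := fun x => a - x)) => //.
 exact: measurable_funB.
move=> u v; rewrite (_ : _ @^-1` _ = `[a - v, a - u[%classic); last first.
 by apply/seteqP; split=> x /=; rewrite !in_itv /= ; lra.
rewrite !lebesgue_measure_itv !lte_fin -!EFinB.
have -> : (a - v < a - u) = (u < v) by rewrite ltrD2l ltrN2.
by case: ifP => _; congr (_%:E); ring.
Qed.

End lebesgue_isometries.

(** * The submean value inequality over a square annulus *)

Lemma strip_arith (R : realType) (a s : R) (I : \bar R) : 0 < s -> (0 <= I)%E ->
 ((a * (s / 2))%:E <= (2 / s)%:E * (I + I + (I + I)))%E -> (a%:E <= (16 / s ^+ 2)%:E * I)%E.
move=> s0; case: I => [r| |]//; last first.
 have K0 : 0 < 16 / s ^+ 2 by rewrite divr_gt0// exprn_gt0.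
 by move=> _ _; rewrite mulry gtr0_sg// mul1e leey.
rewrite !lee_fin => r0; have -> : 2 / s * (r + r + (r + r)) = (16 / s ^+ 2 * r) * (s / 2).
 by field; rewrite gt_eqF.
by rewrite ler_pM2r// divr_gt0.
Qed.

(** The value 144 / a makes the constant term 16 / s^2 * 9 s^2 / (2 t) equal to a / 2, which the
    left side absorbs. *)
Lemma area_arith (R : realType) (a s : R) (I J : \bar R) (t := 144 / a) : 0 < s -> 0 < a ->
 (0 <= J)%E -> (a%:E <= (16 / s ^+ 2)%:E * I)%E ->
 (I <= (t / 2)%:E * J + ((2 * t)^-1 * (9 * s ^+ 2))%:E)%E ->
 ((a ^+ 2)%:E <= ((48 / s) ^+ 2)%:E * J)%E.
move=> s0 a0 J0 am le.
have K0 : 0 < 16 / s ^+ 2 by rewrite divr_gt0// exprn_gt0.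
have K0' : (0 <= (16 / s ^+ 2)%:E :> \bar R)%E by rewrite ltW.
have := le_trans am (lee_wpmul2l K0' le).
case: J J0 {le} => [r| |]//; last first.
 have K1 : 0 < (48 / s) ^+ 2 by rewrite exprn_gt0// divr_gt0.
 by move=> _ _; rewrite mulry gtr0_sg// mul1e leey.
rewrite lee_fin => r0; rewrite !lee_fin.
have -> : 16 / s ^+ 2 * (t / 2 * r + (2 * t)^-1 * (9 * s ^+ 2)) =
  ((48 / s) ^+ 2 * r / 2) / a + a / 2.
 by rewrite /t; field; rewrite gt_eqF// gt_eqF.
move: (_ * r) => u H; have : a / 2 <= u / 2 / a by lra.
by rewrite ler_pdivlMr// ; lra.
Qed.

Section area_bound.
Variables (R : realType) (f : R[i] -> R[i]) (c : R[i]) (rho s : R).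
Hypotheses (cf : forall z, ccts f z) (df : forall z, insquare c rho z -> cdiff f z)
 (s0 : 0 < s) (sr : 3 / 2 * s < rho).
Local Notation leb := (@lebesgue_measure R).
Local Notation RT := (measurableTypeR R).
Local Notation cx := (Re c).
Local Notation cy := (Im c).
Local Notation big := (3 / 2 * s).

Let g (x y : RT) : R := normc (f (x +i* y)).

Let g0 x y : 0 <= g x y. Proof. exact: nc_ge0. Qed.

Lemma m_plane : cmeas (fun p : RT * RT => f (p.1 +i* p.2)).
have H (p : R[i] -> R) : (forall z, p (f w) @[w --> z] --> p (f z)) ->
  measT (fun q : RT * RT => p (f (q.1 +i* q.2))).
 move=> cp; apply: (@caratheodory _ _ _ _ R (fun x y => p (f (x +i* y))) (@ratpoint R) (@ratball R)).
 - exact: m_ratball.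
 - exact: ratball_cover.
 - move=> k; apply: continuous_measurable_fun => t.
  exact: cvg_comp (@cvg_Re_line R (ratpoint R k) t) (cp _).
 - move=> x y k /ratball_cvg ky.
  have c2 : p (f (x +i* t)) @[t --> y] --> p (f (x +i* y)).
   exact: cvg_comp (@cvg_Im_line R x y) (cp _).
  exact: (@cvg_comp _ _ _ (fun n => ratpoint R (k n)) (fun t => p (f (x +i* t))) _ _ _ ky).
by split; apply: H => z; have [] := cf z.
Qed.

Let mg : measT (fun p : RT * RT => g p.1 p.2).
exact: m_normc m_plane. Qed.

(** An annulus rather than a full square, so that the mean runs over points at a definite distance
    from the centre: a multiplier vanishing at such a point has to stay away from 0 at the
    centre. *)
Definition annulus : set (RT * RT) := [set p | [/\ `|p.1 - cx| <= big, `|p.2 - cy| <= big &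
 (s <= `|p.1 - cx|) \/ (s <= `|p.2 - cy|)]].

Lemma m_annulus : measurable annulus.
have m1 : measT (fun p : RT * RT => `|p.1 - cx|).
 by apply: mfcomp => //; apply: measurable_funB.
have m2 : measT (fun p : RT * RT => `|p.2 - cy|).
 by apply: mfcomp => //; apply: measurable_funB.
have ml (h : RT * RT -> R) (t) : measT h -> measurable [set p | h p <= t].
 move=> mh; rewrite (_ : [set p | _] = setT `&` h @^-1` `]-oo, t]); first exact: mh.
 by apply/seteqP; split=> p /=; rewrite in_itv => -[].
have mr (h : RT * RT -> R) (t) : measT h -> measurable [set p | t <= h p].
 move=> mh; rewrite (_ : [set p | _] = setT `&` h @^-1` `[t, +oo[); first exact: mh.
 by apply/seteqP; split=> p /=; rewrite in_itv andbT => -[].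
have -> : annulus = [set p | `|p.1 - cx| <= big] `&` [set p | `|p.2 - cy| <= big] `&`
  ([set p | s <= `|p.1 - cx|] `|` [set p | s <= `|p.2 - cy|]).
 by apply/seteqP; split=> p [] => [ ?|[]].
by apply: measurableI; [apply: measurableI; exact: ml|apply: measurableU; exact: mr].
Qed.

Let Ix : set RT := `[cx - big, cx + big[%classic.
Let Iy : set RT := `[cy - big, cy + big[%classic.
Let J : set RT := `[s, big[%classic.

Let Sh (y : RT) : R := (\int[leb]_t (\1_Ix t * g t y))%R.
Let Sv (x : RT) : R := (\int[leb]_t (\1_Iy t * g x t))%R.

Let side_integrable (a b : R) u : curve u -> L1 leb (fun t => \1_`[a, b[ t * normc (u t)).
move=> cu; have := cL1_normc (cL1_seg a b cu).
by apply: eq_L1 => t; rewrite normcM normcR ger0_norm.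
Qed.

Let seg_le_side (a b a' b' : R) (u v : R -> R[i]) : a' <= a -> b <= b' -> curve u -> curve v ->
 (forall t, a <= t <= b -> normc (u t) <= s^-1 * normc (v t)) ->
 normc (seg a b u) <= s^-1 * (\int[leb]_t (\1_`[a', b'[ t * normc (v t)))%R.
move=> aa bb cu cv uv; have ci := cL1_seg a b cu.
apply: le_trans (normc_cint ci) _; rewrite -RintZ; last exact: side_integrable.
apply: le_Rint; [exact: cL1_normc|apply: L1Z; exact: side_integrable|].
move=> t; rewrite normcM normcR ger0_norm//.
have s1 : 0 <= s^-1 by rewrite invr_ge0 ltW.
rewrite !indicE; case: (boolP (t \in `[a, b[%classic)) => [|_]; last first.
 by rewrite mul0r mulr_ge0// mulr_ge0 ?nc_ge0.
rewrite inE /= in_itv /= => /andP[at_ tb].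
have -> : t \in `[a', b'[%classic.
 by rewrite inE /= in_itv /= (le_trans aa at_) (lt_le_trans tb).
by rewrite !mul1r uv// at_ ltW.
Qed.

(** Cauchy's formula at the centre on the square of half-side [sg]. Its sides are lengthened to the
    full width of the annulus, so that the right side depends on [sg] only through the positions of
    the four lines. *)
Lemma mean_bound sg : s <= sg < big ->
 normc (f c) <= 2 / s * (Sh (cy - sg) + Sh (cy + sg) + (Sv (cx - sg) + Sv (cx + sg))).
move=> /andP[ssg sgb]; have sg0 : 0 < sg by exact: lt_le_trans ssg.
have sgr : sg < rho by exact: lt_trans sr.
have ch := half_c c sg0; have ci := hinsq sg0 ch.
have lb := ker_rect_lb sg0 ch.
have E := cauchy_formula cf df sg0 sgr ci.
have sk := sides_ker ci.
have sf := sides_ccts (cx - sg) (cy - sg) (2 * sg) (2 * sg) cf.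
have [f1 f2 f3 f4] := sf; have [k1 k2 k3 k4] := sidesM sf sk.
have le z : sqboundary c sg z -> normc (f z * ker c z) <= s^-1 * normc (f z).
 move=> zb; rewrite normcM mulrC ler_wpM2r ?nc_ge0//.
 by apply: le_trans (ker_c_le sg0 zb) _; rewrite lef_pV2.
have sgs : 0 <= 2 * sg by rewrite mulr_ge0// ltW.
have xw : cx - sg <= cx - sg + 2 * sg by rewrite lerDl.
have yh : cy - sg <= cy - sg + 2 * sg by rewrite lerDl.
have ex : cx - sg + 2 * sg = cx + sg by ring.
have ey : cy - sg + 2 * sg = cy + sg by ring.
have b1 : cx - big <= cx - sg by rewrite lerB// ltW.
have b2 : cy - big <= cy - sg by rewrite lerB// ltW.
have b3 : cx - sg + 2 * sg <= cx + big by rewrite ex lerD2l ltW.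
have b4 : cy - sg + 2 * sg <= cy + big by rewrite ey lerD2l ltW.
have A1 := seg_le_side b1 b3 k1 f1 (fun t tt => le (t +i* _) (And3 tt (introT andP (conj (lexx _) yh)) (introT or4P (Or41 _ _ _ (eqxx _))))).
have A2 := seg_le_side b1 b3 k2 f2 (fun t tt => le (t +i* _) (And3 tt (introT andP (conj yh (lexx _))) (introT or4P (Or42 _ _ _ (eqxx _))))).
have A3 := seg_le_side b2 b4 k3 f3 (fun t tt => le (_ +i* t) (And3 (introT andP (conj (lexx _) xw)) tt (introT or4P (Or43 _ _ _ (eqxx _))))).
have A4 := seg_le_side b2 b4 k4 f4 (fun t tt => le (_ +i* t) (And3 (introT andP (conj xw (lexx _))) tt (introT or4P (Or44 _ _ _ (eqxx _))))).
rewrite -/(Sh (cy - sg)) in A1; rewrite -/(Sh (cy - sg + 2 * sg)) ey in A2.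
rewrite -/(Sv (cx - sg)) in A3; rewrite -/(Sv (cx - sg + 2 * sg)) ex in A4.
have : normc (f c) * (1 / 2) <= s^-1 * Sh (cy - sg) + s^-1 * Sh (cy + sg) + (s^-1 * Sv (cx + sg) + s^-1 * Sv (cx - sg)).
 apply: le_trans (ler_wpM2l (nc_ge0 _) lb) _; rewrite -normcM -E /sqrect /rect.
 apply: le_trans (normcD_le _ _) _; rewrite normcM.
 have -> : normc ('i : R[i]) = 1 by rewrite /= expr0n expr1n add0r sqrtr1.
 rewrite mul1r ey ex; rewrite ?ey ?ex in A1 A2 A3 A4.
 apply: lerD; apply: le_trans (normcB_le _ _) _; exact: lerD.
have -> : 2 / s * (Sh (cy - sg) + Sh (cy + sg) + (Sv (cx - sg) + Sv (cx + sg))) =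
 2 * (s^-1 * Sh (cy - sg) + s^-1 * Sh (cy + sg) + (s^-1 * Sv (cx + sg) + s^-1 * Sv (cx - sg))) by ring.
by rewrite mul1r ler_pdivrMr// mulrC.
Qed.

Definition ann (p : RT * RT) : R := \1_annulus p.

Lemma m_ann : measT ann.
exact: mindic m_annulus. Qed.

Let Iarea : \bar R := (\int[@lebm2 R]_p (ann p * g p.1 p.2)%:E)%E.

Let mIg : measT (fun p : RT * RT => ann p * g p.1 p.2).
by apply: mfM => //; exact: m_ann. Qed.

Let ind_ge0 d (T : measurableType d) (A : set T) t : 0 <= \1_A t :> R.
by []. Qed.

Let hcurve y : L1 leb (fun t : RT => \1_Ix t * g t y).
exact: (side_integrable _ _ (curve_hside y cf)). Qed.

Let vcurve x : L1 leb (fun t : RT => \1_Iy t * g x t).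
exact: (side_integrable _ _ (curve_vside x cf)). Qed.

Let mSh : measT Sh.
apply: (@m_Rint_param _ _ _ _ R leb).
apply: mfM; last exact: (mpre mg (@measurable_swap _ _ RT RT)).
by apply: (mpre) => //; exact: mindic (measurable_itv _).
Qed.

Let mSv : measT Sv.
apply: (@m_Rint_param _ _ _ _ R leb).
apply: mfM => //.
by apply: (mpre (h := snd)) => //; exact: mindic (measurable_itv _).
Qed.

Let Sh0 y : 0 <= Sh y. Proof. by apply: Rint_ge0 => t; rewrite mulr_ge0. Qed.
Let Sv0 x : 0 <= Sv x. Proof. by apply: Rint_ge0 => t; rewrite mulr_ge0. Qed.

Let in_annulus (x y : RT) : (\1_Ix x : R) != 0 -> s <= `|y - cy| -> `|y - cy| <= big ->
 ann (x, y) = 1.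
rewrite indicE; case: (boolP (x \in Ix)) ; last by rewrite eqxx.
rewrite inE /Ix /= in_itv /= => /andP[x1 x2] _ y1 y2; rewrite /ann indicE mem_set//.
by split=> //; [rewrite ler_distl x1 ltW|right].
Qed.

Let in_annulus' (x y : RT) : (\1_Iy y : R) != 0 -> s <= `|x - cx| -> `|x - cx| <= big ->
 ann (x, y) = 1.
rewrite indicE; case: (boolP (y \in Iy)) ; last by rewrite eqxx.
rewrite inE /Iy /= in_itv /= => /andP[y1 y2] _ x1 x2; rewrite /ann indicE mem_set//.
by split=> //; [rewrite ler_distl y1 ltW|left].
Qed.

(** Common to horizontal and vertical sides: when its offset runs over [J], a lengthened side sweeps
    a strip of the annulus. *)
Let strip_le (k : RT -> R) (S : RT -> R) (H : RT -> RT -> R) :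
 measT k -> (forall t, 0 <= k t <= 1) -> (forall y, 0 <= S y) -> measT S ->
 (forall y, (S y)%:E = \int[leb]_t (H y t)%:E)%E ->
 measT (fun p : RT * RT => H p.1 p.2) -> (forall y t, 0 <= H y t) ->
 forall G : RT -> RT -> R, measT (fun p : RT * RT => G p.1 p.2) ->
 (forall y t, 0 <= G y t) -> (forall y t, k y * H y t <= G y t) ->
 (\int[leb]_y \int[leb]_t (G y t)%:E = Iarea)%E ->
 (\int[leb]_y (k y * S y)%:E <= Iarea)%E.
move=> mk k01 S0 mS SE mH H0 G mG G0 kG <-; apply: ge0_le_integral => //.
- by move=> y _; rewrite lee_fin mulr_ge0; have /andP[] := k01 y.
- by apply/mEFinP; exact: mfM.
- apply: (@mfubF _ _ _ _ _ leb (fun p => (G p.1 p.2)%:E)).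
  exact/mEFinP.
 by move=> p; rewrite lee_fin.
move=> y _; have k0 : 0 <= k y by have /andP[] := k01 y.
have mHy : measT (H y) by exact: m_section.
rewrite EFinM SE -ge0_integralZl_EFin//; last 2 first.
- by move=> t _; rewrite lee_fin.
- exact/mEFinP.
apply: ge0_le_integral => //.
- by move=> t _; rewrite lee_fin mulr_ge0.
- by apply/mEFinP; exact: mfM.
- by apply/mEFinP; exact: m_section.
by move=> t _; rewrite lee_fin.
Qed.

Let mswap (h : RT -> RT -> R) : measT (fun p : RT * RT => h p.1 p.2) ->
 measT (fun p : RT * RT => h p.2 p.1).
by move=> mh; exact: (mpre mh (@measurable_swap _ _ RT RT)).
Qed.

Let hstrip (k : RT -> R) : measT k -> (forall t, 0 <= k t <= 1) ->
 (forall y, k y != 0 -> s <= `|y - cy| <= big) -> (\int[leb]_y (k y * Sh y)%:E <= Iarea)%E.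
move=> mk k01 kJ.
apply: (@strip_le k Sh (fun y t => \1_Ix t * g t y) mk k01 Sh0 mSh _ _ _ (fun y t => ann (t, y) * g t y)).
- by move=> y; rewrite EFin_Rint.
- apply: mfM; last exact: mswap.
 by apply: (mpre) => //; exact: mindic (measurable_itv _).
- by move=> y t; rewrite mulr_ge0.
- exact: (mswap (h := fun x y => ann (x, y) * g x y)).
- by move=> y t; rewrite mulr_ge0.
- move=> y t; rewrite mulrA ler_wpM2r//.
 have [->|k0] := eqVneq (k y) 0; first by rewrite mul0r.
 have [->|i0] := eqVneq (\1_Ix t : R) 0; first by rewrite mulr0.
 have /andP[y1 y2] := kJ y k0; rewrite in_annulus//.
 by have /andP[h1 h2] := k01 y; apply: mulr_ile1.
- rewrite /Iarea fubini_tonelli2//.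
  exact/mEFinP.
 by move=> p; rewrite lee_fin mulr_ge0.
Qed.

Let vstrip (k : RT -> R) : measT k -> (forall t, 0 <= k t <= 1) ->
 (forall x, k x != 0 -> s <= `|x - cx| <= big) -> (\int[leb]_x (k x * Sv x)%:E <= Iarea)%E.
move=> mk k01 kJ.
apply: (@strip_le k Sv (fun x t => \1_Iy t * g x t) mk k01 Sv0 mSv _ _ _ (fun x t => ann (x, t) * g x t)).
- by move=> x; rewrite EFin_Rint.
- apply: mfM => //.
 by apply: (mpre) => //; exact: mindic (measurable_itv _).
- by move=> x t; rewrite mulr_ge0.
- by [].
- by move=> x t; rewrite mulr_ge0.
- move=> x t; rewrite mulrA ler_wpM2r//.
 have [->|k0] := eqVneq (k x) 0; first by rewrite mul0r.
 have [->|i0] := eqVneq (\1_Iy t : R) 0; first by rewrite mulr0.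
 have /andP[x1 x2] := kJ x k0; rewrite in_annulus'//.
 by have /andP[h1 h2] := k01 x; apply: mulr_ile1.
- rewrite /Iarea fubini_tonelli1//.
  exact/mEFinP.
 by move=> p; rewrite lee_fin mulr_ge0.
Qed.

Let J01 t : 0 <= (\1_J t : R) <= 1.
by rewrite ler0n lern1 leq_b1. Qed.

Let inJ (t : RT) : (\1_J t : R) != 0 -> s <= t <= big.
rewrite indicE; case: (boolP (t \in J)) ; last by rewrite eqxx.
by rewrite inE /J /= in_itv /= => /andP[-> /ltW ->].
Qed.

Let Jabs (t : RT) : (\1_J t : R) != 0 -> s <= `|t| <= big.
by move=> /inJ/andP[t1]; rewrite ger0_norm (le_trans _ t1)// ltW.
Qed.

Let mJ : measT (\1_J : RT -> R).
exact: mindic (measurable_itv _). Qed.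

Let Jsub (a : R) (S : RT -> R) : measT S -> (forall y, 0 <= S y) ->
 (\int[leb]_t (\1_J t * S (a - t)%R)%:E = \int[leb]_y (\1_J (a - y)%R * S y)%:E)%E.
move=> mS S0; rewrite -(@ge0_integral_leb_sub _ a (fun y => (\1_J (a - y) * S y)%:E)).
- by apply: eq_integral => t _; rewrite subKr.
- apply/mEFinP; apply: mfM => //.
 by apply: mpre => //; exact: measurable_funB.
- by move=> y; rewrite lee_fin mulr_ge0.
Qed.

Let Jadd (a : R) (S : RT -> R) : measT S -> (forall y, 0 <= S y) ->
 (\int[leb]_t (\1_J t * S (a + t)%R)%:E = \int[leb]_y (\1_J (y - a)%R * S y)%:E)%E.
move=> mS S0; rewrite -(@ge0_integral_leb_add _ a (fun y => (\1_J (y - a) * S y)%:E)).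
- by apply: eq_integral => t _; rewrite addrC addrK.
- apply/mEFinP; apply: mfM => //.
 by apply: mpre => //; exact: measurable_funB.
- by move=> y; rewrite lee_fin mulr_ge0.
Qed.

(** [mean_bound] is integrated over [sg] in [J], an interval of length s / 2; each of the four
    strips costs at most [Iarea]. *)
Lemma area_mean : ((normc (f c))%:E <= (16 / s ^+ 2)%:E * Iarea)%E.
have mJS (S : RT -> R) (h : RT -> RT) : measT h -> measT S ->
  measT (fun t => (\1_J t * S (h t))%:E).
 move=> mh mS; apply/mEFinP; apply: mfM => //.
 exact: mpre.
have m1 := mJS Sh (fun t => cy - t) (measurable_funB (measurable_cst _) (@measurable_id _ _ _)) mSh.
have m2 := mJS Sh (fun t => cy + t) (measurable_funD (measurable_cst _) (@measurable_id _ _ _)) mSh.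
have m3 := mJS Sv (fun t => cx - t) (measurable_funB (measurable_cst _) (@measurable_id _ _ _)) mSv.
have m4 := mJS Sv (fun t => cx + t) (measurable_funD (measurable_cst _) (@measurable_id _ _ _)) mSv.
have p1 t : (0 <= (\1_J t * Sh (cy - t)%R)%:E)%E by rewrite lee_fin mulr_ge0.
have p2 t : (0 <= (\1_J t * Sh (cy + t)%R)%:E)%E by rewrite lee_fin mulr_ge0.
have p3 t : (0 <= (\1_J t * Sv (cx - t)%R)%:E)%E by rewrite lee_fin mulr_ge0.
have p4 t : (0 <= (\1_J t * Sv (cx + t)%R)%:E)%E by rewrite lee_fin mulr_ge0.
have mk (a : R) : measT (fun y : RT => \1_J (a - y) : R).
 by apply: (mpre) => //; exact: measurable_funB.
have mk' (a : R) : measT (fun y : RT => \1_J (y - a) : R).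
 by apply: (mpre) => //; exact: measurable_funB.
have I1 : (\int[leb]_t (\1_J t * Sh (cy - t)%R)%:E <= Iarea)%E.
 by rewrite (Jsub cy mSh Sh0); apply: (hstrip (mk cy) (fun => J01 _)) => y /Jabs; rewrite distrC.
have I2 : (\int[leb]_t (\1_J t * Sh (cy + t)%R)%:E <= Iarea)%E.
 by rewrite (Jadd cy mSh Sh0); apply: (hstrip (mk' cy) (fun y => J01 _)) => y /Jabs.
have I3 : (\int[leb]_t (\1_J t * Sv (cx - t)%R)%:E <= Iarea)%E.
 by rewrite (Jsub cx mSv Sv0); apply: (vstrip (mk cx) (fun y => J01 _)) => y /Jabs; rewrite distrC.
have I4 : (\int[leb]_t (\1_J t * Sv (cx + t)%R)%:E <= Iarea)%E.
 by rewrite (Jadd cx mSv Sv0); apply: (vstrip (mk' cx) (fun y => J01 _)) => y /Jabs.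
have m12 := emeasurable_funD m1 m2; have m34 := emeasurable_funD m3 m4.
have m1234 := emeasurable_funD m12 m34.
have Ileft : (\int[leb]_t (normc (f c) * \1_J t)%:E = (normc (f c) * (s / 2))%:E)%E.
 have sb : s <= big by rewrite ler_peMl ?(ltW)//; lra.
 have [ki kE] := Rint_itvco (normc (f c)) sb; rewrite -EFin_Rint// kE.
 by congr ((_ * _)%:E); field.
have : ((normc (f c) * (s / 2))%:E <= (2 / s)%:E * (Iarea + Iarea + (Iarea + Iarea)))%E.
 rewrite -Ileft.
 apply: (@le_trans _ _ (\int[leb]_t ((2 / s)%:E * ((\1_J t * Sh (cy - t)%R)%:E +
   (\1_J t * Sh (cy + t)%R)%:E + ((\1_J t * Sv (cx - t)%R)%:E + (\1_J t * Sv (cx + t)%R)%:E))))%E).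
  apply: ge0_le_integral => //.
  - by move=> t _; rewrite lee_fin mulr_ge0 ?nc_ge0.
  - by apply/mEFinP; apply: mfM.
  - exact: emeasurable_funM.
  move=> t _; rewrite lee_fin -!mulrDr [leRHS]mulrCA [leLHS]mulrC.
  have [->|j0] := eqVneq (\1_J t : R) 0; first by rewrite !mul0r.
  apply: ler_wpM2l => //; apply: mean_bound.
  move: j0; rewrite indicE; case: (boolP (t \in J)) ; last by rewrite eqxx.
  by rewrite inE /J /= /=.
 have k0 : 0 <= 2 / s by rewrite divr_ge0// ltW.
 have E := @ge0_integralZl_EFin _ _ R leb setT measurableT _ (fun t _ =>
  adde_ge0 (adde_ge0 (p1 t) (p2 t)) (adde_ge0 (p3 t) (p4 t))) m1234 _ k0.
 have E0 := @ge0_integralD _ _ R leb setT measurableT _ _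
  (fun t _ => adde_ge0 (p1 t) (p2 t)) m12 (fun t _ => adde_ge0 (p3 t) (p4 t)) m34.
 have E1 := @ge0_integralD _ _ R leb setT measurableT _ _ (fun t _ => p1 t) m1 (fun t _ => p2 t) m2.
 have E2 := @ge0_integralD _ _ R leb setT measurableT _ _ (fun t _ => p3 t) m3 (fun t _ => p4 t) m4.
 rewrite E; apply: lee_wpmul2l; first by [].
 by rewrite E0 E1 E2; exact: leeD (leeD I1 I2) (leeD I3 I4).
have I0 : (0 <= Iarea)%E by apply: integral_ge0 => p _; rewrite lee_fin mulr_ge0.
exact: strip_arith I0.
Qed.

(** Second moments come from x <= t x^2 / 2 + 1 / (2 t), integrated over the annulus, whose
    enclosing box has area 9 s^2. *)
Lemma area_mean2 : ((normc (f c) ^+ 2)%:E <= ((48 / s) ^+ 2)%:E *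
 \int[@lebm2 R]_p (ann p * normc (f (p.1 +i* p.2)) ^+ 2)%:E)%E.
set I2 := (\int[_]_p _)%E; set a := normc (f c).
have I20 : (0 <= I2)%E.
 by apply: integral_ge0 => p _; rewrite lee_fin mulr_ge0 ?sqr_ge0.
have [a0|a0] := eqVneq a 0.
 by rewrite a0 expr0n mule_ge0// lee_fin sqr_ge0.
have ap : 0 < a by rewrite lt_neqAle eq_sym a0 nc_ge0.
pose box : set (RT * RT) := `[cx - big, cx + big]%classic `*` `[cy - big, cy + big]%classic.
have mbox : measurable box by apply: measurableX.
have boxE : (@lebm2 R box = (9 * s ^+ 2)%:E)%E.
 rewrite /lebm2 product_measure1E; [|by []|by []].
 have L (u : R) : leb `[u - big, u + big]%classic = (3 * s)%:E.
  rewrite lebesgue_measure_itv /= lte_fin ltrD2l.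
  have -> : - big < big by have := s0; lra.
  by rewrite -EFinB; congr (_%:E); field.
 transitivity ((3 * s)%:E * (3 * s)%:E)%E; first exact: (f_equal2 _ (L cx) (L cy)).
 by rewrite -EFinM; congr (_%:E); ring.
pose t := 144 / a.
have t0 : 0 < t by rewrite divr_gt0.
have m2 : measT (fun p : RT * RT => ann p * g p.1 p.2 ^+ 2).
 by apply: mfM; [exact: m_ann|exact: measurable_funX].
have mb : measT (\1_box : RT * RT -> R) by [].
have le : (Iarea <= (t / 2)%:E * I2 + ((2 * t)^-1 * (9 * s ^+ 2))%:E)%E.
 have t1 : 0 <= (2 * t)^-1 by rewrite invr_ge0 mulr_ge0// ltW.
 have t2 : 0 <= t / 2 by rewrite divr_ge0// ltW.
 have pb p : (0 <= (\1_box p : R)%:E)%E by [].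
 have pa p : (0 <= (ann p * g p.1 p.2 ^+ 2)%:E)%E.
  by rewrite lee_fin mulr_ge0 ?sqr_ge0.
 have mbE : measT (fun p => (\1_box p : R)%:E) by exact/mEFinP.
 have maE : measT (fun p : RT * RT => (ann p * g p.1 p.2 ^+ 2)%:E).
  exact/mEFinP.
 have mA : measT (fun p : RT * RT => ((t / 2)%:E * (ann p * g p.1 p.2 ^+ 2)%:E)%E).
  exact: emeasurable_funM .
 have mB : measT (fun p => ((2 * t)^-1%:E * (\1_box p : R)%:E)%E).
  exact: emeasurable_funM .
 have E1 := @ge0_integralZl_EFin _ _ R (@lebm2 R) setT measurableT _ (fun p _ => pb p) mbE _ t1.
 have E2 := @ge0_integralZl_EFin _ _ R (@lebm2 R) setT measurableT _ (fun p _ => pa p) maE _ t2.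
 have E3 := @ge0_integralD _ _ R (@lebm2 R) setT measurableT _ _
  (fun p _ => mule_ge0 (t2 : (0 <= (t / 2)%:E)%E) (pa p)) mA
  (fun p _ => mule_ge0 (t1 : (0 <= (2 * t)^-1%:E)%E) (pb p)) mB.
 have E4 : (\int[@lebm2 R]_p (\1_box p)%:E = (9 * s ^+ 2)%:E)%E.
  by rewrite integral_indic// setIT.
 rewrite E4 -EFinM in E1; rewrite -E1 -E2 -E3.
 apply: ge0_le_integral => //.
 - by move=> p _; rewrite lee_fin mulr_ge0.
 - exact/mEFinP.
 - exact: emeasurable_funD.
 move=> p _; rewrite lee_fin /ann indicE.
 case: (boolP (p \in annulus)) => [|_]; last first.
  by rewrite !mul0r mulr0 add0r mulr_ge0//.
 rewrite inE => -[p1 p2 _]; rewrite !mul1r.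
 have -> : \1_box p = 1 :> R.
  rewrite indicE mem_set; split; rewrite /= in_itv; by rewrite -ler_distl.
 rewrite mulr1; move: (g p.1 p.2) => x.
 have -> : (2 * t)^-1 = t / 2 * (t^-1) ^+ 2 by field; rewrite gt_eqF.
 have := sqr_ge0 (x - t^-1); rewrite sqrrB => xt.
 have E : t / 2 * (x * t^-1 *+ 2) = x by rewrite mulr2n; field; rewrite gt_eqF.
 have := mulr_ge0 (divr_ge0 (ltW t0) (ler0n R 2)) xt.
 rewrite mulrDr mulrBr; lra.
exact: area_arith area_mean le.
Qed.

End area_bound.

(** * From functions on a square to functions on the plane *)

Section local_functions.
Variable R : realType.
Implicit Types (f g : R[i] -> R[i]) (c z l : R[i]) (r : R).

Lemma cdiff_eps f z l : (forall e, 0 < e -> exists2 d, 0 < d &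
  forall u, normc (u - z) < d -> normc (f u - f z - l * (u - z)) <= e * normc (u - z)) ->
 exists q, [/\ q z = l, ccts q z & forall u, f u - f z = q u * (u - z)].
move=> fl; exists (fun u => if u == z then l else (f u - f z) / (u - z)); split.
- by rewrite eqxx.
- apply/ccts_normcP => e e0; have [d d0 dP] := fl e e0; exists d => // u ud.
 rewrite eqxx; have [_|uz] := eqVneq; first by rewrite subrr normc0 ltW.
 have n0 : 0 < normc (u - z) by rewrite normc_gt0 subr_eq0.
 rewrite -(ler_pM2r n0) -normcM; apply: le_trans (dP u ud).
 by rewrite mulrBl divfK// subr_eq0.
- by move=> u; have [->|uz] := eqVneq; rewrite ?subrr ?mulr0// divfK// subr_eq0.
Qed.

Lemma caratheodory_eps f z q : ccts q z -> (forall u, f u - f z = q u * (u - z)) ->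
 forall e, 0 < e -> exists2 d, 0 < d &
  forall u, normc (u - z) < d -> normc (f u - f z - q z * (u - z)) <= e * normc (u - z).
move=> /ccts_normcP cq qE e /cq[d d0 dP]; exists d => // u ud.
by rewrite qE -mulrBl normcM ler_wpM2r ?nc_ge0// dP.
Qed.

Lemma near_cdiff f g z : (\forall u \near z, f u = g u) -> cdiff f z -> cdiff g z.
move=> fg [q [cq qE]]; have fz : f z = g z by exact: nbhs_singleton fg.
have /nbhs_ncP[d1 d10 d1P] := fg.
have [q' [_ c' E']] : exists q', [/\ q' z = q z, ccts q' z & forall u, g u - g z = q' u * (u - z)].
 apply: cdiff_eps => e e0; have [d d0 dP] := caratheodory_eps cq qE e0.
 exists (Num.min d d1); first by rewrite lt_min d0.
 by move=> u; rewrite lt_min => /andP[u1 u2]; rewrite -fz -d1P//; exact: dP.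
by exists q'.
Qed.

Lemma max_lip (a t u : R) : `|Num.max a t - Num.max a u| <= `|t - u|.
have := ler_norm (t - u); have := lerNnormlW (lexx `|t - u|); have := normr_ge0 (t - u).
move: `|t - u| => k k0 k1 k2; rewrite ler_norml /Num.max.
by case: ltP => h1; case: ltP ; lra.
Qed.

Lemma min_lip (a t u : R) : `|Num.min a t - Num.min a u| <= `|t - u|.
have := ler_norm (t - u); have := lerNnormlW (lexx `|t - u|); have := normr_ge0 (t - u).
move: `|t - u| => k k0 k1 k2; rewrite ler_norml /Num.min.
by case: ltP => h1; case: ltP ; lra.
Qed.

Section clamp.
Variables (c : R[i]) (r : R).
Hypothesis r0 : 0 < r.

Definition clamp1 (a t : R) : R := Num.max (a - r) (Num.min (a + r) t).
(** The retraction onto the closed square. Composing with it extends a function differentiable on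
    the square to a continuous function on the plane, unchanged inside, as the preceding results on
    squares require. *)
Definition clamp z : R[i] := clamp1 (Re c) (Re z) +i* clamp1 (Im c) (Im z).

Lemma clamp1_id a t : `|t - a| <= r -> clamp1 a t = t.
by rewrite ler_distl => /andP[h1 h2]; rewrite /clamp1 (min_idPr h2); apply/max_idPr. Qed.

Lemma clamp1_in a t : `|clamp1 a t - a| <= r.
have rp := r0; rewrite ler_distl le_max lexx ge_max ge_min lexx/=.
by have -> : a - r <= a + r by lra.
Qed.

Lemma clamp1_lip a t u : `|clamp1 a t - clamp1 a u| <= `|t - u|.
exact: le_trans (max_lip _ _ _) (min_lip _ _ _).
Qed.

Lemma clamp_id z : csq c r z -> clamp z = z.
by case: z => a b [h1 h2]; move: h1 h2; rewrite !(cReD, cReN, cImD, cImN) => h1 h2;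
 rewrite /clamp !clamp1_id.
Qed.

Lemma clamp_in z : csq c r (clamp z).
by split; rewrite !(cReD, cReN, cImD, cImN); exact: clamp1_in. Qed.

Lemma cvg_clamp z : clamp u @[u --> z] --> clamp z.
apply/cvg_normcP/ccts_near => e e0; apply/nbhs_ncP; exists (e / 2); first by rewrite divr_gt0.
move=> u uz; apply: le_trans (nc_ReIm _) _; rewrite /=.
have a1 := clamp1_lip (Re c) (Re u) (Re z).
have a2 := clamp1_lip (Im c) (Im u) (Im z).
have := normc_Re (u - z); have := normc_Im (u - z); rewrite !(cReD, cReN, cImD, cImN).
move: a2; move: `|_| => *; lra.
Qed.

Lemma insq_closed z : insquare c r z -> csq c r z.
by move=> []; split; exact: ltW. Qed.

Lemma insq_near z : insquare c r z -> \forall u \near z, insquare c r u.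
move=> [h1 h2]; apply/nbhs_ncP.
exists (Num.min (r - `|Re (z - c)|) (r - `|Im (z - c)|)).
 by rewrite lt_min !subr_gt0 h1.
move=> u; rewrite lt_min => /andP[u1 u2].
have n1 := le_lt_trans (normc_Re _) u1; have n2 := le_lt_trans (normc_Im _) u2.
have a1 : Re (u - c) = Re (u - z) + Re (z - c).
 by rewrite -cReD; ring.
have a2 : Im (u - c) = Im (u - z) + Im (z - c).
 by rewrite -cImD; ring.
by split; rewrite ?a1 ?a2 (le_lt_trans (ler_normD _ _))// -ltrBrDr.
Qed.

Variable f : R[i] -> R[i].
Hypothesis df : forall z, csq c r z -> cdiff f z.

Lemma clamp_ccts z : ccts (f \o clamp) z.
by apply: ccts_comp (@cvg_clamp z) _; apply: cdiff_ccts; apply: df; exact: clamp_in. Qed.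

Lemma clamp_cdiff z : insquare c r z -> cdiff (f \o clamp) z.
move=> zr; apply: @near_cdiff; last by apply: df; exact: insq_closed.
by apply: filterS (insq_near zr) => u ur; rewrite /= clamp_id//; exact: insq_closed.
Qed.

Let r2 : 0 < r / 2. Proof. exact: divr_gt0. Qed.
Let r2r : r / 2 < r. Proof. by have := r0; lra. Qed.

Lemma half_csq h : half c (r / 2) h -> csq c r h.
by have rp := r0; move=> []; split; lra. Qed.

Lemma normc_csq h : normc (h - c) <= r -> csq c r h.
by move=> hr; split; [exact: le_trans (normc_Re _) hr|exact: le_trans (normc_Im _) hr]. Qed.

Lemma isolated_or_null : (forall h, half c (r / 2) h -> f h = 0) \/
 exists2 e, 0 < e & forall t, 0 < t -> exists2 dl, 0 < dl &
  forall h, t <= normc (h - c) < e -> dl <= normc (f h).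
have [H|[e e0 eP]] := zero_dichotomy clamp_ccts clamp_cdiff r2 r2r.
 by left=> h hh; rewrite -(H h hh) /= clamp_id//; exact: half_csq.
right; exists (Num.min e r); first by rewrite lt_min e0.
move=> t /eP[dl dl0 dlP]; exists dl => // h; rewrite lt_min => /and3P[h1 h2 h3].
have := dlP h; rewrite h1 h2 => /(_ isT); rewrite /= clamp_id//.
by apply: normc_csq; exact: ltW.
Qed.

Lemma local_taylor1 M q : (forall z, csq c r z -> normc (f z) <= M) ->
 ccts q c -> (forall u, f u - f c = q u * (u - c)) ->
 normc (q c) <= 128 * M / r /\
 forall h, half c (r / 2) h ->
  normc (f h - f c - q c * (h - c)) <= 4160 * 4 * M / r ^+ 2 * normc (h - c) ^+ 2.
move=> fM cq qE.
have cc : csq c r c by apply: normc_csq; rewrite subrr normc0 ltW.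
have fM' z : csq c (r / 2) z -> normc ((f \o clamp) z) <= M.
 by move=> _; apply: fM; exact: clamp_in.
have [q' [q'c cq' q'E]] : exists q', [/\ q' c = q c, ccts q' c &
  forall u, (f \o clamp) u - (f \o clamp) c = q' u * (u - c)].
 apply: cdiff_eps => e e0; have [d d0 dP] := caratheodory_eps cq qE e0.
 exists (Num.min d r); first by rewrite lt_min d0.
 move=> u; rewrite lt_min => /andP[u1 u2] /=.
 rewrite clamp_id; last by apply: normc_csq; exact: ltW.
 by rewrite clamp_id//; exact: dP.
have [] := taylor1 clamp_ccts clamp_cdiff r2 r2r fM' cq' q'E.
rewrite q'c => A1 A2; split.
 by apply: le_trans A1 _; apply: eq_ler; field; rewrite gt_eqF.
move=> h hh; have := A2 h hh; rewrite /= clamp_id; last exact: half_csq.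
rewrite clamp_id// => /le_trans; apply.
by apply: eq_ler; field; rewrite gt_eqF.
Qed.

Lemma local_area : ((normc (f c) ^+ 2)%:E <= ((96 / r) ^+ 2)%:E *
 \int[@lebm2 R]_p (ann c (r / 2) p * normc (f (p.1 +i* p.2)) ^+ 2)%:E)%E.
have r3 : 3 / 2 * (r / 2) < r by have := r0; lra.
have := area_mean2 clamp_ccts clamp_cdiff r2 r3.
have -> : 48 / (r / 2) = 96 / r by field; rewrite gt_eqF.
rewrite /= clamp_id; last by apply: normc_csq; rewrite subrr normc0 ltW.
move=> /le_trans; apply; apply: eq_ler; congr (_ * _)%E.
apply: eq_integral => p _; rewrite /ann indicE.
case: (boolP (p \in annulus c (r / 2))) ; last by rewrite !mul0r.
rewrite inE => -[p1 p2 _]; rewrite clamp_id//; have rp := r0.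
by split; rewrite !(cReD, cReN, cImD, cImN); lra.
Qed.

End clamp.

End local_functions.

(** * Identity principle on segments and countability of zeros *)

Lemma open_curve_preimage (R : realType) (gm : R -> R[i]) (Q : set R[i]) :
 (forall t, gm s @[s --> t] --> gm t) -> (forall z, Q z -> \forall u \near z, Q u) ->
 open (gm @^-1` Q).
by move=> cg oQ; rewrite openE => t Qt; exact: cg (oQ _ Qt). Qed.

Section segment_identity.
Variables (R : realType) (O : set R[i]) (f : R[i] -> R[i]).
Hypotheses (oO : forall z, O z -> \forall u \near z, O u) (df : forall z, O z -> cdiff f z).

Lemma csq_in z : O z -> exists2 r : R, 0 < r & forall u, csq z r u -> O u.
move=> /oO/nbhs_ncP[d d0 dP]; exists (d / 4); first by rewrite divr_gt0.
move=> u [h1 h2]; apply: dP; apply: le_lt_trans (nc_ReIm _) _; lra.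
Qed.

Lemma isolated_or_near_null z : O z -> (\forall u \near z, f u = 0) \/
 exists2 e, 0 < e & forall t, 0 < t -> exists2 dl, 0 < dl &
  forall h, t <= normc (h - z) < e -> dl <= normc (f h).
move=> Oz; have [r r0 rO] := csq_in Oz.
have [H|H] := isolated_or_null r0 (fun u ur => df (rO u ur)); last by right.
left; apply/nbhs_ncP; exists (r / 4); first by rewrite divr_gt0.
by move=> u ur; apply: H; apply: half_near; apply: ltW; lra.
Qed.

(** The parameters near whose point [f] vanishes form an open set; it is also closed, because near
    any other point the zeros are isolated. Connectedness of the segment concludes. *)
Lemma segment_identity a b : (forall t : R, 0 <= t <= 1 -> O (a + t%:C * (b - a))) ->
 (\forall u \near a, f u = 0) -> \forall u \near b, f u = 0.
move=> seg fa; pose gm (t : R) := a + t%:C * (b - a).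
have cgm t : gm s @[s --> t] --> gm t.
 apply/cvg_normcP; apply: cctsD; first exact: cctsC.
 by apply: cctsM; [split ; [by []|exact: cvg_cst]|exact: cctsC].
pose P (z : R[i]) : Prop := \forall u \near z, f u = 0.
have oP z : P z -> \forall u \near z, P u by move=> /nbhs_interior.
pose A : set R := `[0, 1]%classic.
pose B : set R := A `&` [set t | P (gm t)].
suff : B = A.
 move=> BA; have : B 1 by rewrite BA /A /= in_itv /= ler01 lexx.
 by move=> [_]; rewrite /= /gm rmorph1 mul1r subrKC.
apply: (@segment_connected R 0).
- exists 0; split; first by rewrite /A /= in_itv /= lexx ler01.
 by rewrite /= /gm mul0r addr0.
- by exists (gm @^-1` P); first exact: open_curve_preimage.
- pose Q : set R[i] := [set z | O z /\ ~ P z].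
 have oQ z : Q z -> \forall u \near z, Q u.
  move=> [Oz nP]; have := isolated_or_near_null Oz => -[//|[e e0 eP]].
  apply: filterI; first exact: oO.
  apply/nbhs_ncP; exists e; [by []|move=> u ue Pu].
  have [uz|uz] := eqVneq u z; first by apply: nP; rewrite -uz.
  have n0 : 0 < normc (u - z) by rewrite normc_gt0 subr_eq0.
  have [dl dl0 dlP] := eP _ n0.
  have := dlP u; rewrite lexx ue => /(_ isT).
  have -> : f u = 0 by exact: nbhs_singleton Pu.
  by rewrite normc0 leNgt dl0.
 exists (~` (gm @^-1` Q)); first by apply: open_closedC; exact: open_curve_preimage.
 apply/seteqP; split=> t [At] /=; first by move=> Pt; split=> // -[].
 move=> nC; split; [by []|apply: contrapT => nP; apply: nC; split; [|by []]].
 by apply: seg; move: At.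
Qed.

End segment_identity.

Section countable_zeros.
Variables (R : realType) (O : set R[i]) (f : R[i] -> R[i]) (z0 : R[i]).
Hypotheses (oO : forall z, O z -> \forall u \near z, O u) (df : forall z, O z -> cdiff f z)
 (cvxO : forall a b (t : R), O a -> O b -> 0 <= t <= 1 -> O (a + t%:C * (b - a)))
 (Oz0 : O z0) (fz0 : f z0 != 0).
Local Notation RT := (measurableTypeR R).

Lemma zero_isolated z : O z -> exists2 e, 0 < e &
 forall h, 0 < normc (h - z) < e -> f h != 0.
move=> Oz; have [H|[e e0 eP]] := isolated_or_near_null oO df Oz.
 have := segment_identity oO df (fun => cvxO Oz Oz0) H.
 by move=> /nbhs_singleton fz; have := fz0; rewrite fz eqxx.
exists e => // h /andP[h0 he]; have [dl dl0 dlP] := eP _ h0.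
have := dlP h; rewrite lexx he => /(_ isT) le.
by rewrite -normc_gt0; exact: lt_le_trans le.
Qed.

Lemma plane_point_null (p : RT * RT) : @lebm2 R [set p] = 0%E.
have -> : [set p] = [set p.1] `*` [set p.2].
 by apply/seteqP; split=> [q ->//|[a b] [/= -> ->]]; case: p.
rewrite /lebm2 product_measure1E; [|by []|by []].
apply: (@etrans _ _ ((lebesgue_measure [set p.1]) * 0)%E); last by rewrite mule0.
by congr (_ * _)%E; exact: lebesgue_measure_set1.
Qed.

(** Each zero is the only one in some ball with rational centre and radius 2 / (n + 1), so [pt]
    enumerates all the zeros; indices that code no pair give 0, and for balls that isolate no zero
    the value of [get] is immaterial. *)
Lemma zeros_negligible : (@lebm2 R).-negligible
 [set p : RT * RT | O (p.1 +i* p.2) /\ f (p.1 +i* p.2) = 0].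
pose D (k : nat * nat) : R[i] := ratpoint R k.1 +i* ratpoint R k.2.
pose Z z := O z /\ f z = 0.
pose only (i : nat * (nat * nat)) z := Z z /\ forall u, Z u ->
 normc (u - D i.2) < 2 / i.1.+1%:R -> u = z.
pose pt (i : nat) : R[i] := if unpickle i is Some j then get (only j) else 0.
pose S i : set (RT * RT) := [set (Re (pt i), Im (pt i))].
apply: (@negligibleS _ _ _ _ (\bigcup_i S i)); last first.
 apply: (@negligible_bigcup _ _ _ (@lebm2 R)) => i.
 apply/negligibleP; last exact: plane_point_null.
 rewrite (_ : S i = [set Re (pt i)] `*` [set Im (pt i)]).
  exact: measurableX.
 by apply/seteqP; split=> [q ->//|[a b] [/= -> ->]].
move=> [x y] [Oz fz]; set z := x +i* y in Oz fz.
have [e e0 eP] := zero_isolated Oz.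
have [n ne] : exists n : nat, 4 / n.+1%:R < e.
 exists (Num.bound (4 / e)); rewrite ltr_pdivrMr// mulrC -ltr_pdivrMr//.
 by apply: (lt_le_trans (archi_boundP _)); rewrite ?divr_ge0 ?(ltW e0)// ler_nat.
have [k1 k1P] := ratball_cover n x; have [k2 k2P] := ratball_cover n y.
have zD : normc (z - D (k1, k2)) < 2 / n.+1%:R.
 apply: le_lt_trans (nc_ReIm _) _; rewrite /=.
 by rewrite mulr_natl ltrD.
exists (pickle (n, (k1, k2))) => //; rewrite /S /pt pickleK.
have onl : only (n, (k1, k2)) z.
 split=> // u [Ou fu] uD; apply/eqP; rewrite -subr_eq0 -normc_eq0; apply: contraT => uz.
 have : 0 < normc (u - z) < e; last by move=> /(eP); rewrite fu eqxx.
 rewrite lt_neqAle eq_sym uz nc_ge0; apply: lt_trans ne.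
 have := normcB_le (u - D (k1, k2)) (z - D (k1, k2)).
 rewrite opprB addrA subrK => /le_lt_trans; apply.
 rewrite (_ : 4 / _ = 2 / n.+1%:R + 2 / n.+1%:R); last by rewrite -mulrDl; ring.
 exact: ltrD.
have /= [Zg gP] := getI onl.
have -> : get (only (n, (k1, k2))) = z by rewrite -(gP z).
by [].
Qed.

End countable_zeros.

(** * Polysquares: square means and zeros in several variables *)

Section polysquare.
Variables (R : realType) (d : nat) (A : nat -> R[i]) (r r1 : R).
Local Notation RR := (measurableTypeR R * measurableTypeR R)%type.
Local Notation leb2 := (@lebm2 R).
Hypotheses (r0 : 0 < r) (rr1 : r < r1).

Definition sqb (k : nat) (x : RR) := (`|x.1 - Re (A k)| <= r) && (`|x.2 - Im (A k)| <= r).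
Definition osqb (k : nat) (x : RR) := (`|x.1 - Re (A k)| < r1) && (`|x.2 - Im (A k)| < r1).

Fixpoint boxb (S : nat -> RR -> bool) (k : nat) (s : seq RR) :=
 if s is x :: s' then S k x && boxb S k.+1 s' else true.

Lemma boxb_cat S k u v : boxb S k (u ++ v) = boxb S k u && boxb S (k + size u) v.
by elim: u k => [|x u IH] k /=; rewrite ?addn0// IH -andbA addSnnS. Qed.

Lemma boxb_open k s : boxb sqb k s -> boxb osqb k s.
elim: s k => [//|x s IH] k /= /andP[/andP[x1 x2] /IH ->]; rewrite andbT.
by apply/andP; split; [exact: le_lt_trans rr1|exact: le_lt_trans rr1].
Qed.

Variable G : seq RR -> R[i].
Hypotheses (mG : forall u n, (size u + n)%N = d -> cmeas (fun t : n.-tuple RR => G (u ++ t)))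
 (dG : forall u (x : RR) t, (size u + (size t).+1)%N = d -> boxb osqb 0 (u ++ x :: t) ->
   cdiff (fun z => G (u ++ (Re z, Im z) :: t)) (x.1 +i* x.2)).

Fixpoint centers k n : n.-tuple RR :=
 if n is m.+1 then [tuple of (Re (A k), Im (A k)) :: centers k.+1 m] else [tuple].

Lemma boxb_centers k n : boxb sqb k (centers k n).
elim: n k => [//|n IH] k /=.
rewrite IH /sqb !subrr normr0 (ltW)//.
Qed.

Lemma m_sqb k : measT (fun x : RR => (sqb k x)%:R : R).
have -> : (fun x : RR => (sqb k x)%:R : R) = \1_(`[Re (A k) - r, Re (A k) + r]%classic
  `*` `[Im (A k) - r, Im (A k) + r]%classic).
 apply/funext => x; rewrite indicE /sqb !ler_distl; congr (_%:R); congr nat_of_bool.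
 apply/idP/idP => [/andP[h1 h2]|]; first by rewrite inE; split; rewrite /= in_itv.
 by rewrite inE => -[]; rewrite /= !in_itv /= => -> ->.
apply: mindic; apply: measurableX; exact: measurable_itv.
Qed.

Lemma m_boxb k n : measT (fun t : n.-tuple RR => (boxb sqb k t)%:R : R).
elim: n k => [|n IH] k.
 rewrite (_ : (fun _ => _) = cst 1)//.
 by apply/funext => t; rewrite tuple0.
rewrite (_ : (fun _ => _) = (fun t : n.+1.-tuple RR => (sqb k (thead t))%:R * (boxb sqb k.+1 [tuple of behead t])%:R)).
 apply: mfM.
  by apply: (mpre (m_sqb k)); exact: measurable_tnth.
 by apply: (mpre (IH k.+1)); exact: measurable_behead.
by apply/funext => t; rewrite {}(tuple_eta t) -natrM mulnb.
Qed.

Let insq k (z : R[i]) : insquare (A k) r1 z = osqb k (Re z, Im z) :> Prop.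
rewrite /insquare /osqb !(cReD, cReN, cImD, cImN) /=.
by apply/propext; split=> [[-> ->]//|/andP[]].
Qed.

(** Induction on the number of free coordinates: those in [u] are already chosen, the others sit at
    the centre, and each step applies [local_area] to one coordinate. *)
Lemma polysquare_area n u : (size u + n)%N = d -> boxb sqb 0 u ->
 ((normc (G (u ++ centers (size u) n)) ^+ 2)%:E <= (((96 / r) ^+ 2) ^+ n)%:E *
  \int[tuple_measure leb2 n]_t ((boxb sqb (size u) t)%:R * normc (G (u ++ t)) ^+ 2)%:E)%E.
elim: n u => [|n IH] u un bu.
 rewrite mul1e integral_dirac//=.
  by rewrite diracT mul1e mul1r.
 by apply/mEFinP; apply: mfM; [exact: m_boxb|apply: m_normc2; exact: mG].
set C := (96 / r) ^+ 2.
have C0 : 0 <= C by exact: sqr_ge0.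
set k := size u; set cs := centers k.+1 n.
have ucs (p : RR) : u ++ p :: cs = rcons u p ++ cs by rewrite cat_rcons.
have szr (p : RR) : (size (rcons u p) + n)%N = d by rewrite size_rcons addSnnS.
have bo : forall z, csq (A k) r z -> cdiff (fun z => G (u ++ (Re z, Im z) :: cs)) z.
 move=> [a b] [ z1 z2]; apply: (dG (x := (a, b))); first by rewrite size_tuple.
 apply: boxb_open; rewrite boxb_cat bu /= add0n boxb_centers andbT /sqb.
 by move: z1 z2; rewrite !(cReD, cReN, cImD, cImN) => -> ->.
have := local_area r0 bo; rewrite -/C => /le_trans; apply.
have mF : measT (fun t : n.+1.-tuple RR => (boxb sqb k t)%:R * normc (G (u ++ t)) ^+ 2).
 by apply: mfM; [exact: m_boxb|apply: m_normc2; exact: mG].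
rewrite int_tupleS; last 2 first.
- exact/mEFinP.
- by move=> t; rewrite lee_fin mulr_ge0 ?sqr_ge0.
rewrite (exprS C) (EFinM C) -muleA; apply: lee_wpmul2l; first by [].
have mcons : measT (fun q : RR * n.-tuple RR => [tuple of q.1 :: q.2]).
 exact: measurable_cons.
have mI : measT (fun p : RR => \int[tuple_measure leb2 n]_t
  ((boxb sqb k [tuple of p :: t])%:R * normc (G (u ++ [tuple of p :: t])) ^+ 2)%:E)%E.
 apply: (@mfubF _ _ _ _ _ (tuple_measure leb2 n)
  (fun q => ((boxb sqb k [tuple of q.1 :: q.2])%:R * normc (G (u ++ [tuple of q.1 :: q.2])) ^+ 2)%:E)).
  by apply/mEFinP; exact: (mpre mF mcons).
 by move=> q; rewrite lee_fin mulr_ge0 ?sqr_ge0.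
have I0 p : (0 <= \int[tuple_measure leb2 n]_t
  ((boxb sqb k [tuple of p :: t])%:R * normc (G (u ++ [tuple of p :: t])) ^+ 2)%:E)%E.
 by apply: integral_ge0 => t _; rewrite lee_fin mulr_ge0 ?sqr_ge0.
have Cn0 : 0 <= C ^+ n by exact: exprn_ge0.
rewrite -ge0_integralZl_EFin//.
have mline : measT (fun p : RR => normc (G (u ++ p :: cs)) ^+ 2).
 have m1 := m_normc2 (mG un).
 apply: (mpre (h := fun p : RR => [tuple of p :: cs]) m1).
 exact: (mpre mcons (mfpair (@measurable_id _ _ _) (measurable_cst _))).
apply: ge0_le_integral => //.
- by move=> p _; rewrite lee_fin mulr_ge0 ?sqr_ge0//.
- apply/mEFinP; apply: mfM; first exact: m_ann.
 by apply: eq_measurable_fun mline => -[a b] _.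
- by apply: emeasurable_funM => //.
move=> [a b] _; rewrite /=.
case: (boolP (sqb k (a, b))) => [sp|nsp]; last first.
 rewrite /ann indicE memNset ?mul0r ?mule_ge0//; last first.
  move=> [/= p1 p2 _]; move: nsp; rewrite /sqb /=; have rp := r0.
  by rewrite ?(p2); lra.
 by apply: integral_ge0 => t _; rewrite lee_fin mulr_ge0 ?sqr_ge0.
apply: (@le_trans _ _ ((normc (G (rcons u (a, b) ++ cs)) ^+ 2)%:E)).
 rewrite ucs lee_fin ler_piMl ?sqr_ge0// /ann lern1 leq_b1//.
have := IH (rcons u (a, b)) (szr _); rewrite size_rcons -/k -/cs -/C.
have -> : boxb sqb 0 (rcons u (a, b)) by rewrite -cats1 boxb_cat bu /= sp.
move=> /(_ isT) /le_trans; apply; apply: lee_wpmul2l; first by [].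
apply: eq_ler.
by apply: eq_integral => t _; rewrite cat_rcons.
Qed.

Let zer n u (t : n.-tuple RR) : R := (boxb sqb (size u) t && (G (u ++ t) == 0))%:R.

Let mzer n u : (size u + n)%N = d -> measT (@zer n u).
move=> un; rewrite /zer.
have m2 := m_normc2 (mG un).
rewrite (_ : (fun _ => _) = (fun t : n.-tuple RR => (boxb sqb (size u) t)%:R *
  \1_([set y : R | y = 0]) (normc (G (u ++ t)) ^+ 2))).
 apply: mfM; first exact: m_boxb.
 by apply: (mpre _ m2); apply: mindic; exact: measurable_set1.
apply/funext => t; rewrite -natrM mulnb; congr ((_ && _)%:R).
apply/idP/idP => [Gt|]; first by rewrite inE; apply/eqP; rewrite sqrf_eq0 normc_eq0.
by rewrite inE => /eqP; rewrite sqrf_eq0 normc_eq0.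
Qed.

(** Fubini. With the last coordinates fixed at those of a point where [G] is nonzero, the zeros in
    the first free coordinate are negligible; off them the slice still contains a point where [G] is
    nonzero, and induction applies to it. *)
Lemma polysquare_zeros n u : (size u + n)%N = d -> boxb sqb 0 u ->
 (exists t0 : n.-tuple RR, boxb sqb (size u) t0 && (G (u ++ t0) != 0)) ->
 (\int[tuple_measure leb2 n]_t (boxb sqb (size u) t && (G (u ++ t) == 0))%:R%:E = 0)%E.
elim: n u => [|n IH] u un bu [t0 /andP[bt0 Gt0]].
 rewrite integral_dirac//=; last by apply/mEFinP; exact: mzer.
 by rewrite diracT mul1e; move: Gt0; rewrite (tuple0) => /negbTE ->.
set k := size u; case/tupleP: t0 bt0 Gt0 => x0 t0 /= /andP[sx0 bt0] Gx0.
rewrite int_tupleS; last 2 first.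
- by apply/mEFinP; exact: mzer.
- by [].
pose f z := G (u ++ (Re z, Im z) :: t0).
pose O z := insquare (A k) r1 z.
have oO z : O z -> \forall u \near z, O u by exact: insq_near.
have df z : O z -> cdiff f z.
 case: z => a b; rewrite /O insq /= => ab; apply: (dG (x := (a, b))); first by rewrite size_tuple.
 by rewrite boxb_cat boxb_open//= ab boxb_open.
have cvx a b (t : R) : O a -> O b -> 0 <= t <= 1 -> O (a + t%:C * (b - a)).
 move=> [a1 a2] [b1 b2] /andP[t0' t1'].
 have conv (x y : R) : `|x| < r1 -> `|y| < r1 -> `|x + t * (y - x)| < r1.
  rewrite !ltr_norml => /andP[x1 x2] /andP[y1 y2].
  have u1 : 0 <= (1 - t) * (r1 - x) by apply: mulr_ge0; lra.
  have u2 : 0 <= (1 - t) * (r1 + x) by apply: mulr_ge0; lra.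
  have [->|tn] := eqVneq t 0; first by apply/andP; lra.
  have tp : 0 < t by rewrite lt_neqAle eq_sym tn.
  have u3 : 0 < t * (r1 - y) by rewrite mulr_gt0// subr_gt0.
  have u4 : 0 < t * (r1 + y) by rewrite mulr_gt0//; lra.
  by apply/andP; nra.
 have e1 : Re (a + t%:C * (b - a) - A k) = Re (a - A k) + t * (Re (b - A k) - Re (a - A k)).
  by rewrite !(cReD, cReM) /=; ring.
 have e2 : Im (a + t%:C * (b - a) - A k) = Im (a - A k) + t * (Im (b - A k) - Im (a - A k)).
  by rewrite !(cImD, cImM) /=; ring.
 by split; rewrite ?e1 ?e2; exact: conv.
have Oz0 : O (x0.1 +i* x0.2).
 rewrite /O insq; move: sx0 => /andP[p1 p2]; rewrite -surjective_pairing.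
 by apply/andP; split; [exact: le_lt_trans rr1|exact: le_lt_trans rr1].
have fz0 : f (x0.1 +i* x0.2) != 0 by rewrite /f -surjective_pairing.
have [N [mN N0 ZN]] := zeros_negligible oO df cvx Oz0 fz0.
transitivity (\int[leb2]_p cst 0 p)%E; last by rewrite integral0.
have mF := mzer un.
have mcons : measT (fun q : RR * n.-tuple RR => [tuple of q.1 :: q.2]).
 exact: measurable_cons.
apply: ae_eq_integral => //.
 apply: (@mfubF _ _ _ _ _ (tuple_measure leb2 n)
  (fun q => (zer u [tuple of q.1 :: q.2])%:E)).
  by apply/mEFinP; exact: (mpre mF mcons).
 by move=> q; rewrite lee_fin.
exists N; split=> // p /= nI; apply: ZN; apply: contrapT => nZ; apply: nI => _.
case: (boolP (sqb k p)) => [sp|nsp]; last first.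
 by rewrite ?integral0// => _.
have := IH (rcons u p); rewrite size_rcons addSnnS -/k => /(_ un).
have -> : boxb sqb 0 (rcons u p) by rewrite -cats1 boxb_cat bu /= sp.
move=> /(_ isT) IHp; rewrite -[RHS]IHp.
 by apply: eq_integral => t _; rewrite cat_rcons.
exists t0; rewrite bt0 cat_rcons; apply: contra_notN nZ => /eqP Gp; split.
 rewrite /O insq; move: sp => /andP[p1 p2]; rewrite -surjective_pairing.
 by apply/andP; split; [exact: le_lt_trans rr1|exact: le_lt_trans rr1].
by rewrite /f -surjective_pairing.
Qed.

End polysquare.

(** * Differentiability in several complex variables *)

Section complex_space.
Variables (R : realType) (d : nat).
Local Notation Cd := 'rV[R[i]]_d.
Implicit Types (x z h : Cd) (f g : Cd -> R[i]).

(** The sup norm as a real number; the norm of the space takes its values in [R[i]]. *)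
Definition tn h : R := Re `|h|.

Lemma normE_tn h : `|h| = (tn h)%:C.
by apply: cext => //; have := normr_ge0 h; case: `|h| => a b; rewrite /= => /andP[/eqP]. Qed.

Lemma tn_ge0 h : 0 <= tn h.
by have := normr_ge0 h; rewrite normE_tn lecR. Qed.

Lemma tnP h e : 0 < e -> (tn h < e) <-> (forall j, normc (h 0 j) < e).
move=> e0; have e0' : 0 < e%:C by rewrite ltcR.
have -> : (tn h < e) = ball (0 : Cd) e%:C h :> Prop.
 by rewrite -ball_normE /= sub0r normrN normE_tn ltcR.
split=> [[_ hb] j|hj].
 by have := hb 0 j; rewrite -ball_normE /= mxE sub0r normrN ltcR.
split=> // i j; rewrite ord1 -ball_normE /= mxE sub0r normrN ltcR; by [].
Qed.

Lemma normc_le_tn h j : normc (h 0 j) <= tn h.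
apply/ler_addgt0Pr => e e0; apply: ltW; have te : 0 < tn h + e by rewrite ltr_wpDl ?tn_ge0.
by have [H _] := tnP h te; apply: H; rewrite ltrDl.
Qed.

Lemma tn_le h e : 0 <= e -> (forall j, normc (h 0 j) <= e) -> tn h <= e.
move=> e0 he; apply/ler_addgt0Pr => t t0; apply: ltW.
have te : 0 < e + t by rewrite ltr_wpDl.
by apply/(tnP h te) => j; apply: le_lt_trans (he j) _; rewrite ltrDl.
Qed.

Lemma tnD h h' : tn (h + h') <= tn h + tn h'.
by rewrite -lecR rmorphD /= -!normE_tn ler_normD. Qed.

Lemma tnZ (c : R[i]) h : tn (c *: h) = normc c * tn h.
by apply: @complexI; rewrite -normE_tn normrZ normE_tn -rmorphM. Qed.

Lemma tnN h : tn (- h) = tn h.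
by rewrite /tn normrN. Qed.

Lemma nbhs_tnP z (P : set Cd) :
 nbhs z P <-> exists2 e : R, 0 < e & forall w, tn (w - z) < e -> P w.
split=> [/nbhs_ballP[e /= e0 eP]|[e e0 eP]].
 have [r r0 re] : exists2 r : R, 0 < r & e = r%:C.
  move: e0; case: e {eP} => a b; rewrite /= => /andP[/eqP -> a0].
  by exists a.
 exists r => // w wr; apply: eP; rewrite re -ball_normE /= normE_tn ltcR.
 by rewrite -tnN opprB.
apply/nbhs_ballP; exists e%:C => /=; first by rewrite ltcR.
by move=> w; rewrite -ball_normE /= normE_tn ltcR -tnN opprB; exact: eP.
Qed.

Lemma ccts_tnP f z : ccts f z <-> forall e : R, 0 < e ->
 exists2 r : R, 0 < r & forall w, tn (w - z) < r -> normc (f w - f z) <= e.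
split=> [/ccts_near H e /H/nbhs_tnP//|H].
by apply/ccts_near => e /H/nbhs_tnP.
Qed.

Lemma ccts_coord j z : ccts (fun h : Cd => h 0 j) z.
apply/ccts_tnP => e e0; exists e => // w we.
have := normc_le_tn (w - z) j; rewrite !mxE => /le_trans; apply; exact: ltW.
Qed.

Definition lform (B : 'I_d -> R[i]) (h : Cd) : R[i] := \sum_j h 0 j * B j.

Lemma lform_linear B : linear (lform B).
move=> a u v; rewrite /lform scaler_sumr -big_split /=; apply: eq_bigr => j _.
by rewrite !mxE mulrDl -mulrA.
Qed.

HB.instance Definition _ B := GRing.isLinear.Build R[i] Cd R[i] *:%R (lform B) (lform_linear B).

Lemma ccts_sum (S : topologicalType) (I : Type) (r : seq I) (F : I -> S -> R[i]) s :
 (forall i, ccts (F i) s) -> ccts (fun t => \sum_(i <- r) F i t) s.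
move=> cF; elim: r => [|i r IH].
 by under eq_fun do rewrite big_nil; exact: cctsC.
by under eq_fun do rewrite big_cons; exact: cctsD.
Qed.

Lemma ccts_lform B z : ccts (lform B) z.
by apply: ccts_sum => j; apply: cctsM; [exact: ccts_coord|exact: cctsC]. Qed.

Lemma diff_tnP f x : differentiable f x <-> exists B, forall e, 0 < e ->
 exists2 r : R, 0 < r & forall h, tn h < r -> normc (f (x + h) - f x - lform B h) <= e * tn h.
split=> [/diff_locallyP[_ df]|[B H]].
 exists (fun j => 'd f x (delta_mx 0 j)) => e e0.
 have /eqaddoP /(_ e%:C) := df; rewrite ltcR => /(_ e0) /nbhs_tnP[r r0 rP].
 exists r => // h hr; have := rP h; rewrite subr0 => /(_ hr).
 rewrite /= !fctE normE_tn -rmorphM lecR opprD addrA.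
 rewrite (addrC x); congr (normc (_ - _) <= _).
 rewrite [in LHS](matrix_sum_delta h) big_ord1 linear_sum.
 by apply: eq_bigr => j _; rewrite linearZ.
have cB : continuous (lform B) by move=> z; apply/cvg_normcP; exact: ccts_lform.
pose P (df : {linear Cd -> R[i]}) := continuous df /\ forall y,
 f y = f (lim (nbhs x)) + df (y - lim (nbhs x)) +o_(y \near x) (y - lim (nbhs x)).
suff PB : P (lform B).
 by apply/diffP; exact: (@getPex _ P (ex_intro _ _ PB)).
split=> //.
have E : f = (fun y => f (lim (nbhs x)) + lform B (y - lim (nbhs x))) +o_x
  (fun y => y - lim (nbhs x)).
 apply/eqaddoP => e; case: e => a b; rewrite /= => /andP[/eqP -> a0].
 have [r r0 rP] := H a a0; apply/nbhs_tnP; exists r => // w wr.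
 rewrite lim_id// !fctE normE_tn -[a +i* 0]/(a%:C) -rmorphM lecR.
 by have := rP _ wr; rewrite subrKC opprD addrA.
by move: E; rewrite funeqE.
Qed.

Lemma diff_ccts f x : differentiable f x -> ccts f x.
by move=> /differentiable_continuous fx; apply/cvg_normcP. Qed.

Lemma diff_lin (c : R[i]) f g x : differentiable f x -> differentiable g x ->
 differentiable (fun z => c * f z + g z) x.
by move=> df dg; apply: differentiableD dg; apply: differentiableM. Qed.

Lemma near_diff f g x : (\forall y \near x, f y = g y) ->
 differentiable f x -> differentiable g x.
move=> fg /diff_tnP[B H]; apply/diff_tnP; exists B => e /H[r r0 rP].
have fx : f x = g x by exact: nbhs_singleton fg.
have /nbhs_tnP[s s0 sP] := fg; exists (Num.min r s); first by rewrite lt_min r0.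
move=> h; rewrite lt_min => /andP[h1 h2]; rewrite -fx -sP; first exact: rP.
by rewrite addrC addKr.
Qed.

Lemma line_derivative f B x h : (forall e, 0 < e -> exists2 r : R, 0 < r &
  forall k, tn k < r -> normc (f (x + k) - f x - lform B k) <= e * tn k) ->
 exists q, [/\ q 0 = lform B h, ccts q 0 & forall u, f (x + u *: h) - f (x + 0 *: h) = q u * (u - 0)].
move=> H; apply: cdiff_eps => e e0; have t0 := tn_ge0 h.
have k0 : 0 < tn h + 1 by lra.
have [r r0 rP] := H (e / (tn h + 1)) (divr_gt0 e0 k0).
exists (r / (tn h + 1)); first by rewrite divr_gt0.
move=> u; rewrite subr0 => ur.
have hr : tn (u *: h) < r.
 rewrite tnZ; apply: (@le_lt_trans _ _ (normc u * (tn h + 1))).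
  by rewrite ler_wpM2l ?nc_ge0// lerDl.
 by rewrite -ltr_pdivlMr.
have := rP _ hr; rewrite scale0r addr0 linearZ [lform B h * u]mulrC => /le_trans; apply.
rewrite tnZ mulrCA [leRHS]mulrC ler_wpM2l ?nc_ge0// mulrAC ler_pdivrMr// ler_wpM2l ?(ltW e0)//.
by rewrite lerDl.
Qed.

Lemma cdiff_line f x h (u0 : R[i]) : differentiable f (x + u0 *: h) ->
 cdiff (fun u => f (x + u *: h)) u0.
move=> /diff_tnP[B /(line_derivative h)[q [q0 cq qE]]].
exists (fun u => q (u - u0)); split.
 have := @ccts_comp R _ _ (fun u => u - u0) q u0; rewrite subrr; apply=> //.
 have /cvg_normcP : ccts (fun u => u - u0) u0 by apply: cctsB; [exact: ccts_id|exact: cctsC].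
 by rewrite subrr.
by move=> u; have := qE (u - u0); rewrite scale0r addr0 subr0 -addrA -scalerDl subrKC.
Qed.

End complex_space.

(** * Holomorphic functions on polysquares and the identity theorem *)

Section holomorphic_local.
Variables (R : realType) (d : nat).
Local Notation Cd := 'rV[R[i]]_d.
Local Notation RR := (measurableTypeR R * measurableTypeR R)%type.
Local Notation V := (@lebesgue_Cn R d).
Implicit Types (a z h : Cd) (f : Cd -> R[i]) (r : R).

Definition vec (s : seq RR) : Cd := \row_j ((nth (0, 0) s j).1 +i* (nth (0, 0) s j).2).

Lemma vec_tuple (t : d.-tuple RR) : vec t = Cn_of_tuple t.
by apply/rowP => j; rewrite !mxE -!tnth_nth. Qed.

Lemma vec_line u (z : R[i]) (t : seq RR) (k : 'I_d) : size u = k ->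
 vec (u ++ (Re z, Im z) :: t) = vec (u ++ (0, 0) :: t) + z *: delta_mx 0 k.
move=> uk; apply/rowP => j; rewrite !mxE /= !nth_cat uk.
case: ltngtP => [jk|kj|/val_inj ->].
- by rewrite (negbTE (contraTneq _ jk)) ?mulr0 ?addr0// => ->; rewrite ltnn.
- rewrite -(subnSK kj) (_ : (j == k) = false) ?mulr0 ?addr0//.
 by apply/eqP => jk; rewrite jk ltnn in kj.
- by rewrite subnn eqxx mulr1; apply: cext; rewrite add0r.
Qed.

Definition psq a r z := forall j, csq (a 0 j) r (z 0 j).
Definition opsq a r z := forall j, insquare (a 0 j) r (z 0 j).

Definition coordn a (k : nat) : R[i] := if insub k is Some j then a 0 j else 0.

Lemma coordn_ord a (j : 'I_d) : coordn a j = a 0 j.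
by rewrite /coordn valK. Qed.

Lemma boxb_nth (S : nat -> RR -> bool) k s :
 boxb S k s <-> forall i, (i < size s)%N -> S (k + i)%N (nth (0, 0) s i).
elim: s k => [|x s IH] //=; split=> [/andP[Sx /IH bs] [|i] si|H].
- by rewrite addn0.
- by rewrite addnS; exact: bs.
- rewrite -{1}(addn0 k) (H)//; apply/IH => i si.
 by rewrite addSn -addnS; exact: H.
Qed.

Section box.
Variables (a : Cd) (r r1 : R) (f : Cd -> R[i]).
Hypotheses (r0 : 0 < r) (rr1 : r < r1) (mf : cmeas f)
 (df : forall z, opsq a r1 z -> differentiable f z).
Local Notation A := (coordn a).
Local Notation G := (fun s => f (vec s)).

Lemma boxb_psq (t : seq RR) : size t = d -> boxb (sqb A r) 0 t <-> psq a r (vec t).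
move=> td; rewrite boxb_nth td; split=> [H j|H i id_].
 have := H j (ltn_ord j); rewrite /sqb coordn_ord /csq !mxE.
 by rewrite !(cReD, cReN, cImD, cImN) => /andP[].
have := H (Ordinal id_); rewrite /csq !mxE !(cReD, cReN, cImD, cImN) /= => -[h1 h2].
by rewrite /sqb (coordn_ord a (Ordinal id_)) h1.
Qed.

Lemma boxb_opsq (t : seq RR) : size t = d -> boxb (osqb A r1) 0 t -> opsq a r1 (vec t).
move=> td /boxb_nth H j; have := H j; rewrite td => /(_ (ltn_ord j)).
rewrite /osqb coordn_ord /insquare !mxE !(cReD, cReN, cImD, cImN) /= => /andP[].
by [].
Qed.

Let mG u n : (size u + n)%N = d -> cmeas (fun t : n.-tuple RR => G (u ++ t)).
move=> un; have E (t : n.-tuple RR) : vec (u ++ t) = Cn_of_tuple (tuple_of_seq d (u ++ t)).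
 by rewrite -vec_tuple tuple_of_seqK// size_cat size_tuple.
have H : measT (fun t : n.-tuple RR => Cn_of_tuple (tuple_of_seq d (u ++ t))).
 apply: (mpre (h := fun t : n.-tuple RR => tuple_of_seq d (u ++ t)) (@measurable_Cn_of_tuple R d)).
 apply: (mpre (h := fun t : n.-tuple RR => u ++ t) (@m_tuple_of_seq _ _ d)).
 exact: (mpre (m_cat_section u) (@m_tval _ _ n)).
by apply: eq_cmeas (cmpre H mf) => t; rewrite E.
Qed.

Let dG u (x : RR) t : (size u + (size t).+1)%N = d -> boxb (osqb A r1) 0 (u ++ x :: t) ->
 cdiff (fun y : R[i] => G (u ++ (Re y, Im y) :: t)) (x.1 +i* x.2).
move=> ut bx; have kd : (size u < d)%N by rewrite -ut addnS leq_addr.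
pose k := Ordinal kd; have uk : size u = k by [].
rewrite (_ : (fun _ => _) = (fun y => f (vec (u ++ (0, 0) :: t) + y *: delta_mx 0 k))); last first.
 by apply/funext => y; rewrite (vec_line y t uk).
apply: cdiff_line; rewrite -(vec_line _ t uk) -surjective_pairing.
by apply: df; apply: boxb_opsq => //; rewrite size_cat /= ut.
Qed.

Let integral_box (F : Cd -> R) (g : seq RR -> R) : measT F -> (forall z, 0 <= F z) ->
 (forall t : d.-tuple RR, F (vec t) = g t) ->
 (\int[V]_z (F z)%:E = \int[tuple_measure (@lebm2 R) d]_t (g t)%:E)%E.
move=> mF F0 Fg; rewrite ge0_integral_pushforward//.
- by rewrite preimage_setT; apply: eq_integral => t _ /=; rewrite -vec_tuple Fg.
- exact: measurable_Cn_of_tuple.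
- exact/mEFinP.
- by move=> z _; rewrite lee_fin.
Qed.

Definition psqi z : R := `[< psq a r z >]%:R.

Lemma m_coord (p : R[i] -> R) j : (forall u, p v @[v --> u] --> p u) ->
 measT (fun z : Cd => p (z 0 j)).
move=> cp; apply: (measurability _ (RGenOpens.measurableE R)).
move=> _ [_ [x [y ->] <-]]; rewrite setTI; apply: sub_sigma_algebra.
suff : open [set z : Cd | `]x, y[%classic (p (z 0 j))] by [].
rewrite openE => z /= pz.
have H : p ((w : Cd) 0 j) @[w --> (z : Cd)] --> p (z 0 j).
 have /cvg_normcP cj := @ccts_coord R d j z; exact: cvg_comp (cp _).
have N : nbhs (p (z 0 j)) `]x, y[%classic.
 exact: open_nbhs_nbhs.
exact: (H _ N).
Qed.

Lemma m_psqi : measT psqi.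
have -> : psqi = \1_(\bigcap_(j in [set: 'I_d]) ([set z : Cd | `|Re (z 0 j) - Re (a 0 j)| <= r] `&`
  [set z : Cd | `|Im (z 0 j) - Im (a 0 j)| <= r])).
 apply/funext => z; rewrite indicE /psqi; congr ((nat_of_bool _)%:R).
 apply/asboolP/idP => [H|]; first rewrite inE => j _.
  by have := H j; rewrite /csq !(cReD, cReN, cImD, cImN).
 rewrite inE => H j; have := H j I.
 by rewrite /csq !(cReD, cReN, cImD, cImN).
have ml (h : Cd -> R) (t : R) : measT h -> measurable [set p | h p <= t].
 move=> mh; rewrite (_ : [set p | _] = setT `&` h @^-1` `]-oo, t]); first exact: mh.
 by apply/seteqP; split=> p /=; rewrite in_itv => // -[].
have mab (h : Cd -> R) (c : R) : measT h -> measT (fun z => `|h z - c|).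
 by move=> mh; apply: mfcomp => //; apply: measurable_funB.
apply: mindic; apply: fin_bigcap_measurable => // j _.
by apply: measurableI; apply: ml; apply: mab; apply: m_coord => u; have [] := ccts_id u.
Qed.

Lemma polysquare_bound : ((normc (f a) ^+ 2)%:E <= (((96 / r) ^+ 2) ^+ d)%:E *
 \int[V]_z (psqi z * normc (f z) ^+ 2)%:E)%E.
have := polysquare_area r0 rr1 mG dG (u := [::]) (add0n d) isT.
have -> : vec ([::] ++ centers A (size (Nil RR)) d) = a.
 apply/rowP => j; rewrite mxE /=.
 have E : forall n k i, (i < n)%N -> nth (0, 0) (centers A k n) i =
   (Re (A (k + i)%N), Im (A (k + i)%N)).
  by elim=> [//|n IH] k [|i] /= ni; rewrite ?addn0// IH// addnS addSn.
 rewrite E// add0n /= coordn_ord; by case: (a 0 j).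
move=> /le_trans; apply; apply: eq_ler; congr (_ * _)%E.
rewrite (@integral_box _ (fun s => (boxb (sqb A r) 0 s)%:R * normc (G s) ^+ 2))//.
- apply: mfM; [exact: m_psqi|exact: m_normc2].
- by move=> z; rewrite mulr_ge0 ?sqr_ge0// /psqi.
- move=> t; congr (_%:R * _); congr nat_of_bool.
 by apply/asboolP/idP => H; [apply/(boxb_psq (size_tuple t))|apply/(boxb_psq (size_tuple t))].
Qed.

Lemma polysquare_null : (exists2 z, psq a r z & f z != 0) ->
 (\int[V]_z (psqi z * (f z == 0)%:R)%:E = 0)%E.
move=> [z0 z0a fz0].
have mz : measT (fun z => (f z == 0)%:R : R).
 rewrite (_ : (fun _ => _) = (fun z => \1_([set y : R | y = 0]) (normc (f z) ^+ 2))).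
  apply: (mpre _ (m_normc2 mf)); apply: mindic.
  exact: measurable_set1.
 apply/funext => z; rewrite indicE; congr ((nat_of_bool _)%:R).
 apply/idP/idP => [Gt|]; first by rewrite inE; apply/eqP; rewrite sqrf_eq0 normc_eq0.
 by rewrite inE /= => /eqP; rewrite sqrf_eq0 normc_eq0.
rewrite (@integral_box _ (fun s => (boxb (sqb A r) 0 s && (G s == 0))%:R)).
- apply: (polysquare_zeros rr1 mG dG (u := [::]) (add0n d) isT).
 exists (tuple_of_Cn z0); have E : vec (tuple_of_Cn z0) = z0.
  by apply/rowP => j; rewrite mxE -!tnth_nth !tnth_mktuple; case: (z0 0 j).
 have Bz : boxb (sqb A r) 0 (tuple_of_Cn z0) by apply/(boxb_psq (size_tuple _)); rewrite E.
 by rewrite cat0s Bz E fz0.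
- apply: mfM => //; exact: m_psqi.
- by move=> z; rewrite mulr_ge0// /psqi.
- move=> t; rewrite -natrM mulnb; congr ((_ && _)%:R).
 by apply/asboolP/idP => H; [apply/(boxb_psq (size_tuple t))|apply/(boxb_psq (size_tuple t))].
Qed.

End box.

Section identity_theorem.
Variables (U : set Cd) (f : Cd -> R[i]).
Hypotheses (oU : open U) (cU : connected U) (hf : holomorphic_on U f).

Lemma open_ball z : U z -> exists2 r : R, 0 < r & forall w, tn (w - z) < r -> U w.
by move=> Uz; apply/nbhs_tnP; exact: open_nbhs_nbhs. Qed.

Lemma line_domain z r w h : (forall y, tn (y - z) < r -> U y) ->
 let O := [set u : R[i] | tn (w + u *: h - z) < r] in
 (forall u, O u -> \forall u' \near u, O u') /\
 (forall u, O u -> cdiff (fun u => f (w + u *: h)) u).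
move=> zU O; split=> [u|u Ou]; last by apply: cdiff_line; apply: hf; exact: zU.
rewrite /O /= => Ou; apply/nbhs_ncP.
exists ((r - tn (w + u *: h - z)) / (tn h + 1)); first by rewrite divr_gt0 ?subr_gt0// ltr_wpDl ?tn_ge0.
move=> u' uu; rewrite /=; have -> : w + u' *: h - z = (w + u *: h - z) + (u' - u) *: h.
 by rewrite scalerBl; apply/rowP => j; rewrite !mxE; ring.
apply: le_lt_trans (tnD _ _) _; rewrite tnZ addrC -ltrBrDr.
apply: (@le_lt_trans _ _ (normc (u' - u) * (tn h + 1))).
 by rewrite ler_wpM2l ?nc_ge0// lerDl.
by rewrite -ltr_pdivlMr// ltr_wpDl ?tn_ge0.
Qed.

Lemma line_null z r w v : (forall y, tn (y - z) < r -> U y) -> tn (w - z) < r ->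
 tn (v - z) < r -> (\forall u \near (0 : R[i]), f (w + u *: (v - w)) = 0) -> f v = 0.
move=> zU wr vr g0; have [oO dg] := line_domain w (v - w) zU.
have seg (t : R) : 0 <= t <= 1 -> tn (w + (0 + t%:C * (1 - 0)) *: (v - w) - z) < r.
 move=> /andP[t0 t1]; rewrite add0r subr0 mulr1.
 have -> : w + t%:C *: (v - w) - z = (1 - t)%:C *: (w - z) + t%:C *: (v - z).
  by rewrite rmorphB; apply/rowP => j; rewrite !mxE; ring.
 apply: le_lt_trans (tnD _ _) _; rewrite !tnZ !normcR ger0_norm ?subr_ge0// ger0_norm//.
 have [->|tn0] := eqVneq t 0; first by rewrite subr0 mul1r mul0r addr0.
 have tp : 0 < t by rewrite lt_neqAle eq_sym tn0.
 have q1 : (1 - t) * tn (w - z) <= (1 - t) * r by rewrite ler_wpM2l ?subr_ge0// ltW.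
 have q2 : t * tn (v - z) < t * r by rewrite ltr_pM2l.
 have e : (1 - t) * r + t * r = r by ring.
 by rewrite -[ltRHS]e; exact: ler_ltD.
have := nbhs_singleton (segment_identity oO dg seg g0).
by rewrite scale1r subrKC.
Qed.

Lemma line_identity z r w v : (forall y, tn (y - z) < r -> U y) -> tn (w - z) < r ->
 tn (v - z) < r -> (\forall y \near w, f y = 0) -> f v = 0.
move=> zU wr vr fw; apply: line_null zU wr vr _.
have k0 : 0 < tn (v - w) + 1 by rewrite ltr_wpDl ?tn_ge0.
have /nbhs_tnP[e e0 eP] := fw; apply/nbhs_ncP.
exists (e / (tn (v - w) + 1)); first by rewrite divr_gt0.
move=> u; rewrite subr0 => ue; apply: eP; rewrite addrC addKr tnZ.
apply: (@le_lt_trans _ _ (normc u * (tn (v - w) + 1))).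
 by rewrite ler_wpM2l ?nc_ge0// lerDl.
by rewrite -ltr_pdivlMr.
Qed.

(** The points near which [f] vanishes form an open subset of [U]. If a ball inside [U] contains one
    of them, vanishing spreads along segments to the whole ball, so the subset is closed in [U];
    connectedness concludes. *)
Lemma identity_theorem z : U z -> (exists2 w, U w & f w != 0) -> ~ (\forall y \near z, f y = 0).
move=> Uz [w0 Uw0 fw0] fz.
pose P (y : Cd) : Prop := \forall x \near y, f x = 0.
pose B : set Cd := [set y | U y /\ P y].
suff : B = U by move=> BU; have : B w0 by [rewrite BU]; move=> [_ /nbhs_singleton fw]; rewrite fw eqxx in fw0.
apply: cU.
- by exists z.
- exists B; last by apply/seteqP; split=> [y []|y [_ By]].
 rewrite openE => y [Uy Py]; apply: filterI; first exact: open_nbhs_nbhs.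
 exact: nbhs_interior.
- exists (~` [set y | U y /\ ~ P y]); last first.
  apply/seteqP; split=> [y [Uy Py]|y [Uy nP]]; first by split=> // -[].
  by split; [exact: Uy|apply: contrapT => nPy; exact: nP (conj Uy nPy)].
 apply: open_closedC; rewrite openE => y [Uy nP].
 have [r r0 rU] := open_ball Uy.
 suff : nbhs y [set y | U y /\ ~ P y] by [].
 apply/nbhs_tnP; exists r; first by [].
 move=> w wr; split; first exact: rU.
 move=> Pw; apply: nP; apply/nbhs_tnP; exists r; first by [].
 by move=> v vr; exact: (line_identity rU wr vr).
Qed.

End identity_theorem.

End holomorphic_local.

(** * Weierstrass's theorem on locally uniform limits *)

Section weierstrass.
Variables (R : realType) (d : nat).
Local Notation Cd := 'rV[R[i]]_d.
Implicit Types (z h : Cd) (f g : Cd -> R[i]).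

Lemma real_cauchy (u : nat -> R) : (forall e, 0 < e -> exists N, forall n m, (N <= n)%N ->
 (N <= m)%N -> `|u n - u m| <= e) -> exists l : R, u n @[n --> \oo] --> l.
exists (lim (u n @[n --> \oo])).
apply/cauchy_cvgP; apply: cauchy_exP => e e0.
have [N NP] := H (e / 2) ltac:(by rewrite divr_gt0).
exists (u N); exists N => // n /= Nn; rewrite -ball_normE /=.
by apply: le_lt_trans (NP N n (leqnn _) Nn) _; rewrite ltr_pdivrMr// ltr_pMr// ltr1n.
Qed.

Lemma complex_cauchy (u : nat -> R[i]) : (forall e, 0 < e -> exists N, forall n m, (N <= n)%N ->
 (N <= m)%N -> normc (u n - u m) <= e) ->
 exists l, forall e, 0 < e -> exists N, forall n, (N <= n)%N -> normc (u n - l) <= e.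
move=> H.
have [a ua] : exists a : R, (fun => Re (u n)) n @[n --> \oo] --> a.
 apply: real_cauchy => e /H[N NP]; exists N => n m Nn Nm.
 by rewrite -cReN -cReD; exact: le_trans (normc_Re _) (NP n m Nn Nm).
have [b ub] : exists b : R, (fun => Im (u n)) n @[n --> \oo] --> b.
 apply: real_cauchy => e /H[N NP]; exists N => n m Nn Nm.
 by rewrite -cImN -cImD; exact: le_trans (normc_Im _) (NP n m Nn Nm).
exists (a +i* b) => e e0; have e2 : 0 < e / 2 by rewrite divr_gt0.
have [N _ NP] : \forall n \near \oo, `|Re (u n) - a| <= e / 2 /\ `|Im (u n) - b| <= e / 2.
 by apply: filterI; [have /cvgrPdist_le/(_ _ e2) := ua|have /cvgrPdist_le/(_ _ e2) := ub];
   apply: filterS => n; rewrite distrC.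
exists N => n /NP[h1 h2]; apply: le_trans (nc_ReIm _) _.
by rewrite !(cReD, cImD, cImN) [leRHS]splitr lerD.
Qed.

Lemma lformB B B' h : lform (fun j => B j - B' j) h = lform B h - lform B' h.
by rewrite -sumrB; apply: eq_bigr => j _; rewrite mulrBr. Qed.

Lemma lform_delta (B : 'I_d -> R[i]) j : lform B (delta_mx 0 j) = B j.
rewrite /lform (bigD1 j)//= mxE !eqxx mul1r big1 ?addr0// => k kj.
by rewrite mxE (negbTE kj) mul0r.
Qed.

Definition partials f z (B : 'I_d -> R[i]) := forall e, 0 < e ->
 exists2 r : R, 0 < r & forall h, tn h < r -> normc (f (z + h) - f z - lform B h) <= e * tn h.

Lemma partialsB f g z B B' : partials f z B -> partials g z B' ->
 partials (fun w => f w - g w) z (fun j => B j - B' j).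
move=> H H' e e0; have e2 : 0 < e / 2 by rewrite divr_gt0.
have [r r0 rP] := H _ e2; have [s s0 sP] := H' _ e2.
exists (Num.min r s); first by rewrite lt_min r0.
move=> h; rewrite lt_min => /andP[/rP h1 /sP h2]; rewrite lformB.
have -> : f (z + h) - g (z + h) - (f z - g z) - (lform B h - lform B' h) =
 (f (z + h) - f z - lform B h) - (g (z + h) - g z - lform B' h) by ring.
apply: le_trans (normcB_le _ _) _; apply: le_trans (lerD h1 h2) _.
by rewrite -mulrDl -splitr.
Qed.

Section bound.
Variables (z0 : Cd) (s : R).
Hypothesis s0 : 0 < s.
Local Notation near_z0 z := (tn (z - z0) < s).
Let r := s / 4.
Let r0 : 0 < r. Proof. by rewrite divr_gt0. Qed.

(** The one-variable bounds are applied on the complex lines through [z0] in directions of norm at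
    most 1. The radius s / 4 keeps the square of parameters, whose points have modulus at most 2 r,
    inside the ball. *)
Lemma taylor_tn g M B : (forall z, near_z0 z -> differentiable g z) ->
 (forall z, near_z0 z -> normc (g z) <= M) -> partials g z0 B ->
 (forall j, normc (B j) <= 128 * M / r) /\
 forall k, tn k <= r / 4 -> normc (g (z0 + k) - g z0 - lform B k) <= 4160 * 4 * M / r ^+ 2 * tn k ^+ 2.
move=> dg gM gB.
have L h : tn h <= 1 -> normc (lform B h) <= 128 * M / r /\
  forall t : R, 0 <= t <= r / 4 -> normc (g (z0 + t%:C *: h) - g z0 - t%:C * lform B h) <= 4160 * 4 * M / r ^+ 2 * t ^+ 2.
 move=> h1; pose f (u : R[i]) := g (z0 + u *: h).
 have near_sq u : csq 0 r u -> near_z0 (z0 + u *: h).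
  rewrite /csq subr0 => -[u1 u2]; rewrite addrC addKr tnZ.
  apply: le_lt_trans (_ : _ <= 2 * r) _; last by rewrite /r; have sp := s0; lra.
  apply: le_trans (_ : normc u * 1 <= _); first by rewrite ler_wpM2l ?nc_ge0.
  by rewrite mulr1; apply: le_trans (nc_ReIm _) _; rewrite mulrDl mul1r lerD.
 have [q [q0 cq qE]] := line_derivative h gB.
 have [b1 b2] := local_taylor1 r0 (f := f) (c := 0) (fun u us => cdiff_line (dg _ (near_sq u us)))
  (fun u us => gM _ (near_sq u us)) cq qE.
 rewrite q0 in b1 b2; split=> // t /andP[t0 tr].
 have := b2 t%:C; rewrite !subr0 normcR (ger0_norm t0) /half subr0 /= normr0 (ger0_norm t0).
 rewrite /f scale0r addr0 [lform B h * _]mulrC; apply; split; first by apply: le_trans tr _; lra.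
 by apply: divr_ge0 => //; apply: divr_ge0 => //; exact: ltW.
split=> [j|k kr].
 rewrite -lform_delta; apply: (L _ _).1; apply: tn_le => // i.
 by rewrite mxE; case: (_ && _); rewrite ?normc1 ?normc0.
have [k0|k0] := eqVneq (tn k) 0.
 have -> : k = 0.
  apply/rowP => j; rewrite mxE; apply/eqP; rewrite -normc_eq0 eq_le nc_ge0 andbT -k0.
  exact: normc_le_tn.
 by rewrite addr0 linear0 !subrr normc0 /tn normr0 /= expr0n mulr0.
have kk : k = (tn k)%:C *: ((tn k)^-1%:C *: k).
 by rewrite scalerA -rmorphM divff// rmorph1 scale1r.
have := (L ((tn k)^-1%:C *: k) _).2 (tn k); rewrite -kk.
have -> : (tn k)%:C * lform B ((tn k)^-1%:C *: k) = lform B k.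
 by rewrite linearZ /= mulrA -rmorphM divff// rmorph1 mul1r.
apply; last by rewrite tn_ge0.
by rewrite tnZ normcR ger0_norm ?invr_ge0 ?tn_ge0// mulVf.
Qed.

(** Cauchy's estimates make the partial derivatives [B n] converge. The quadratic Taylor bound for
    [g_ n - g_ N], whose constant does not depend on n, survives the limit, so [g - g_ N] is
    differentiable at [z0]. *)
Lemma weierstrass (g_ : nat -> Cd -> R[i]) g :
 (forall n z, near_z0 z -> differentiable (g_ n) z) ->
 (forall e, 0 < e -> exists N, forall n m z, (N <= n)%N -> (N <= m)%N -> near_z0 z ->
   normc (g_ n z - g_ m z) <= e) ->
 (forall z, near_z0 z -> normc (g_ n z - g z) @[n --> \oo] --> (0 : R)) ->
 differentiable g z0.
move=> dg cg gl; have z00 : near_z0 z0 by rewrite subrr /tn normr0.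
have exB n : exists B, partials (g_ n) z0 B by apply/diff_tnP; exact: dg.
pose B n := projT1 (cid (exB n)); have BP n : partials (g_ n) z0 (B n) := projT2 (cid (exB n)).
have T n m M C := @taylor_tn (fun w => g_ n w - g_ m w) M C
 (fun z zs => differentiableB (dg n z zs) (dg m z zs)).
have exl j : exists l, forall e, 0 < e -> exists N, forall n, (N <= n)%N -> normc (B n j - l) <= e.
 apply: complex_cauchy => e e0; have [N NP] := cg (e * r / 128) ltac:(by rewrite divr_gt0// mulr_gt0).
 exists N => n m Nn Nm; have [H _] := T n m _ _ (fun z zs => NP n m z Nn Nm zs) (partialsB (BP n) (BP m)).
 apply: le_trans (H j) _; apply: eq_ler.
 by field; rewrite lt0r_neq0.
pose L j := projT1 (cid (exl j)).
have LP j : forall e, 0 < e -> exists N, forall n, (N <= n)%N -> normc (B n j - L j) <= e.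
 exact: projT2 (cid (exl j)).
have [N NP] := cg 1 ltr01.
pose C := 4160 * 4 * 1 / r ^+ 2 : R.
have C0 : 0 <= C.
 apply: divr_ge0; first by apply: mulr_ge0; [apply: mulr_ge0; exact: ler0n|exact: ler01].
 by apply: exprn_ge0; exact: ltW.
have key k : tn k <= r / 4 -> normc (g (z0 + k) - g_ N (z0 + k) - (g z0 - g_ N z0) - lform (fun j => L j - B N j) k) <= C * tn k ^+ 2.
 move=> kr; have zk : near_z0 (z0 + k).
  by rewrite addrC addKr; apply: le_lt_trans kr _; rewrite /r; have := s0; lra.
 apply/ler_addgt0Pr => e e0.
 have e1 : 0 < e / 3 by rewrite divr_gt0.
 have e2 : 0 < e / 3 / (d%:R * tn k + 1) by rewrite divr_gt0// ltr_wpDl// mulr_ge0// tn_ge0.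
 have [N1 _ N1P] : \forall n \near \oo, normc (g_ n (z0 + k) - g (z0 + k)) <= e / 3 /\ normc (g_ n z0 - g z0) <= e / 3.
  by apply: filterI; [have /cvgr_le := gl _ zk|have /cvgr_le := gl _ z00]; apply.
 have exN j := LP j _ e2.
 pose N2 j := projT1 (cid (exN j)).
 have N2P j n : (N2 j <= n)%N -> normc (B n j - L j) <= e / 3 / (d%:R * tn k + 1).
  exact: (projT2 (cid (exN j))).
 pose n := maxn N (maxn N1 (\max_j N2 j)).
 have Nn : (N <= n)%N by rewrite leq_maxl.
 have [a1 a2] : normc (g_ n (z0 + k) - g (z0 + k)) <= e / 3 /\ normc (g_ n z0 - g z0) <= e / 3.
  by apply: N1P; rewrite /= /n maxnCA leq_maxl.
 have [_ /(_ k kr) a3] := T n N _ _ (fun z zs => NP n N z Nn (leqnn _) zs) (partialsB (BP n) (BP N)).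
 have a4 : normc (lform (fun j => B n j - L j) k) <= e / 3.
  apply: le_trans (_ : \sum_(j < d) tn k * (e / 3 / (d%:R * tn k + 1)) <= _).
   rewrite /lform; elim/big_rec2 : _ => [|j u v _ IH]; first by rewrite normc0.
   apply: le_trans (normcD_le _ _) _; apply: lerD => //; rewrite normcM.
   apply: ler_pM; rewrite ?nc_ge0 ?normc_le_tn//; apply: N2P.
   by rewrite !leq_max (leq_bigmax) !orbT.
  have E (x y c a : R) : x * (y * (c * a)) = c * (x * y * a) by ring.
  rewrite sumr_const card_ord -[leLHS]mulr_natl E ler_piMr ?(ltW e1)//.
  by rewrite ler_pdivrMr ?mul1r ?lerDl// ltr_wpDl// mulr_ge0// tn_ge0.
 have -> : g (z0 + k) - g_ N (z0 + k) - (g z0 - g_ N z0) - lform (fun j => L j - B N j) k =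
  (g_ n (z0 + k) - g_ N (z0 + k) - (g_ n z0 - g_ N z0) - lform (fun j => B n j - B N j) k)
  - (g_ n (z0 + k) - g (z0 + k)) + (g_ n z0 - g z0) + lform (fun j => B n j - L j) k.
  by rewrite !lformB; ring.
 apply: le_trans (normcD_le _ _) _; apply: le_trans (lerD (normcD_le _ _) (lexx _)) _.
 apply: le_trans (lerD (lerD (normcB_le _ _) (lexx _)) (lexx _)) _.
 rewrite -/C in a3; move: a2 a3 a4; lra.
have dgN : differentiable (fun w => g w - g_ N w) z0.
 apply/diff_tnP; exists (fun j => L j - B N j) => e e0.
 exists (Num.min (r / 4) (e / (C + 1))); first by rewrite lt_min !divr_gt0// ltr_wpDl.
 move=> h; rewrite lt_min => /andP[h1 h2]; apply: le_trans (key _ (ltW h1)) _.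
 rewrite mulrA ler_wpM2r ?tn_ge0//.
 apply: le_trans (_ : (C + 1) * tn h <= _); first by rewrite ler_wpM2r ?tn_ge0// lerDl.
 by rewrite mulrC -ler_pdivlMr ?ltr_wpDl// ltW.
have := diff_lin 1 dgN (dg N z0 z00).
rewrite (_ : (fun _ => _) = g)//; apply/funext => w; by rewrite mul1r subrK.
Qed.

End bound.
End weierstrass.

(** * Rational cells and the exhaustion of the domain *)

Section cells.
Variables (R : realType) (d : nat).
Local Notation Cd := 'rV[R[i]]_d.
Local Notation V := (@lebesgue_Cn R d).
Implicit Types (z w a : Cd) (f : Cd -> R[i]) (r : R).

Lemma m_open_Cn (A : set Cd) : open A -> measurable A.
exact: sub_sigma_algebra. Qed.

Definition ratC (k : nat) : Cd :=
 let t := odflt [ffun=> (0%N, 0%N)] (unpickle k : option {ffun 'I_d -> nat * nat}) in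
 \row_j (ratpoint R (t j).1 +i* ratpoint R (t j).2).

Lemma ratC_near z e : 0 < e -> exists k, tn (ratC k - z) < e.
move=> e0; have [n _ /(_ n (leqnn _)) ne] : \forall n \near \oo, n.+1%:R^-1 <= e / 4.
 have /cvgr_le H := @cvg_harmonic R; apply: H; exact: divr_gt0.
pose k1 j := projT1 (cid (ratball_cover n (Re (z 0 j)))).
have k1P j : ratball n (k1 j) (Re (z 0 j)) := projT2 (cid (ratball_cover n (Re (z 0 j)))).
pose k2 j := projT1 (cid (ratball_cover n (Im (z 0 j)))).
have k2P j : ratball n (k2 j) (Im (z 0 j)) := projT2 (cid (ratball_cover n (Im (z 0 j)))).
exists (pickle [ffun j : 'I_d => (k1 j, k2 j)]); rewrite /ratC pickleK /=.
apply: le_lt_trans (_ : _ <= e / 2) _; last by rewrite ltr_pdivrMr// ltr_pMr// ltr1n.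
apply: tn_le => [|j]; first by rewrite divr_ge0// ltW.
rewrite !mxE ffunE; apply: le_trans (nc_ReIm _) _.
rewrite !(cReD, cReN, cImD, cImN) /=.
have := ltW (lt_le_trans (k1P j) ne); have := ltW (lt_le_trans (k2P j) ne).
rewrite distrC => h1; rewrite distrC => h2; apply: le_trans (lerD h2 h1) _.
by rewrite -mulrDr -[X in _ * X]mulr2n -mulr_natl; lra.
Qed.

Lemma psq_tn a r z : tn (z - a) <= r -> psq a r z.
move=> h j; have := normc_le_tn (z - a) j; rewrite !mxE => h'.
by split; [exact: le_trans (normc_Re _) (le_trans h' h)|exact: le_trans (normc_Im _) (le_trans h' h)].
Qed.

Lemma tn_psq a r z : 0 <= r -> psq a r z -> tn (z - a) <= 2 * r.
move=> r0 h; apply: tn_le => [|j]; first by rewrite mulr_ge0.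
have [h1 h2] := h j; rewrite !mxE; apply: le_trans (nc_ReIm _) _.
by rewrite mulrDl mul1r lerD.
Qed.

Lemma psq_trans a r b r' z : psq a r b -> psq b r' z -> psq a (r + r') z.
move=> h h' j; have [h1 h2] := h j; have [h3 h4] := h' j.
have E : z 0 j - a 0 j = (b 0 j - a 0 j) + (z 0 j - b 0 j) by ring.
split; rewrite E (cReD (b 0 j - a 0 j), cImD).
 by apply: le_trans (ler_normD _ _) _; apply: lerD.
by apply: le_trans (ler_normD _ _) _; apply: lerD.
Qed.

Lemma opsq_psq a r z : opsq a r z -> psq a r z.
by move=> h j; exact: insq_closed. Qed.

Lemma psq_opsq a r r' z : r < r' -> psq a r z -> opsq a r' z.
by move=> rr h j; have [] := h j; split; exact: le_lt_trans rr. Qed.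

Lemma psqiE a r z : psqi a r z = \1_(psq a r) z.
by []. Qed.

Lemma m_psq a r : measurable (psq a r : set Cd).
rewrite (_ : psq a r = setT `&` psqi a r @^-1` [set 1]).
 exact: m_psqi .
rewrite setTI; apply/seteqP; split=> z /=; rewrite /psqi; case: asboolP => //= _ /esym/eqP.
by rewrite oner_eq0.
Qed.

Lemma compact_psq a r : compact (psq a r : set Cd).
apply: (@rV_compact _ _ (fun j => csq (a 0 j) r)) => j.
pose c := a 0 j; pose phi (p : R * R) := p.1 +i* p.2 : R[i].
have -> : csq c r = [set phi p | p in
 `[Re c - r, Re c + r]%classic `*` `[Im c - r, Im c + r]%classic].
 apply/seteqP; split=> [[x y]|_ [[x y] /= [+ +] <-]].
  rewrite /csq !(cReD, cReN, cImD, cImN) /= !ler_distl => -[h1 h2].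
  by exists (x, y) .
 by rewrite /csq !(cReD, cReN, cImD, cImN) !ler_distl.
apply: continuous_compact; last by apply: compact_setX; exact: segment_compact.
apply: continuous_subspaceT => p; apply/cvg_normcP; split.
 exact: @cvg_fst.
exact: @cvg_snd.
Qed.

Variable U : set Cd.
Hypothesis oU : open U.

(** An index codes a rational centre and an n giving the half-side 1 / (n + 1); indices that code no
    pair stand for (0, 0). *)
Definition rad (i : nat) : R := (odflt (0%N, 0%N) (unpickle i)).2.+1%:R^-1.
Definition ctr (i : nat) : Cd := ratC (odflt (0%N, 0%N) (unpickle i)).1.
(** Three concentric polysquares are at work: values are estimated on that of half-side [rad i],
    means are taken over the double, and holomorphy is used on the triple. *)
Definition good_cell i := `[< opsq (ctr i) (3 * rad i) `<=` U >].
Definition exh (M : nat) : set Cd :=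
 \bigcup_(i < M) (if good_cell i then psq (ctr i) (2 * rad i) else set0).

Lemma rad_gt0 i : 0 < rad i. Proof. by rewrite invr_gt0. Qed.

Lemma good_cell_cover z : U z -> exists2 i, good_cell i &
 forall w, tn (w - z) < rad i / 2 -> psq (ctr i) (rad i) w.
move=> Uz; have [e e0 eU] := open_ball oU Uz.
have [n _ /(_ n (leqnn _)) ne] : \forall n \near \oo, n.+1%:R^-1 <= e / 7.
 have /cvgr_le H := @cvg_harmonic R; apply: H; exact: divr_gt0.
have n0 : 0 < n.+1%:R^-1 :> R by rewrite invr_gt0.
have [k kz] := @ratC_near z (n.+1%:R^-1 / 2) ltac:(by rewrite divr_gt0).
have D w x y : tn (w - y) <= tn (w - x) + tn (x - y).
 by apply: le_trans (tnD _ _); rewrite addrA subrK.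
have E w x : tn (w - x) = tn (x - w) by rewrite -tnN opprB.
have ni : rad (pickle (k, n)) = n.+1%:R^-1 by rewrite /rad pickleK.
have ci : ctr (pickle (k, n)) = ratC k by rewrite /ctr pickleK.
exists (pickle (k, n)); rewrite ?/good_cell ni ci.
 apply/asboolP => w /opsq_psq/tn_psq h; apply: eU.
 apply: le_lt_trans (D _ (ratC k) _) _.
 have := h ltac:(by rewrite mulr_ge0// ltW).
 by move: ne n0 kz; move: (_^-1) (tn _) (tn _) => *; lra.
move=> w wz; apply: psq_tn; apply: le_trans (D _ z _) _; rewrite [X in _ + X]E [leRHS]splitr.
by rewrite lerD// ltW.
Qed.

Lemma exh_good i M : (i < M)%N -> good_cell i -> psq (ctr i) (2 * rad i) `<=` exh M.
by move=> iM gi; exists i => //; rewrite gi. Qed.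

Lemma exh_nd n m : (n <= m)%N -> exh n `<=` exh m.
by move=> nm z [i iN]; exists i => //; exact: leq_trans nm. Qed.

Lemma exh_cover z : U z -> exists M, exh M z.
move=> /good_cell_cover[i gi H]; exists i.+1; apply: (exh_good _ gi) => //.
have : psq (ctr i) (rad i) z by apply: H; rewrite subrr /tn normr0 divr_gt0// rad_gt0.
move=> h; apply: opsq_psq; apply: psq_opsq h; by rewrite ltr_pMl ?rad_gt0// ltr1n.
Qed.

Lemma good_cell_sub i : good_cell i -> psq (ctr i) (2 * rad i) `<=` U.
move=> /asboolP gi z zi; apply: gi; apply: psq_opsq zi.
by rewrite ltr_pM2r ?rad_gt0// ltr_nat.
Qed.

Lemma exh_sub M : exh M `<=` U.
by move=> z [i _]; case: ifP => // gi; exact: good_cell_sub. Qed.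

Lemma m_exh M : measurable (exh M).
by apply: bigcup_measurable => i _; case: ifP => // _; exact: m_psq. Qed.

Lemma rc_closed (A : set Cd) : compact A -> A `<=` U -> rcpt U A.
move=> cA AU; have E := (closure_id A).1 (compact_closed (@norm_hausdorff _ _) cA).
by rewrite /rcpt -E.
Qed.

Lemma rc_exh M : rcpt U (exh M).
apply: rc_closed; last exact: exh_sub.
rewrite /exh bigcup_mkord; apply: bigsetU_compact => i _.
by case: ifP => _; [exact: compact_psq|exact: compact0].
Qed.

Lemma m_continuous_on (h : Cd -> R) : (forall z, U z -> h w @[w --> z] --> h z) ->
 measurable_fun U h.
move=> ch; apply: (measurability _ (RGenOpens.measurableE R)).
move=> _ [_ [x [y ->] <-]]; apply: m_open_Cn.
suff : open [set z : Cd | U z /\ `]x, y[%classic (h z)] by [].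
rewrite openE => z [Uz /= hz]; apply: filterI; first exact: open_nbhs_nbhs.
have N : nbhs (h z) `]x, y[%classic.
 exact: open_nbhs_nbhs.
exact: (ch _ Uz _ N).
Qed.

Lemma m_zero_ext (h : Cd -> R) : measurable_fun U h -> (forall z, ~ U z -> h z = 0) ->
 measT h.
move=> mh h0; have mU := m_open_Cn oU.
rewrite -(setUv U); apply/measurable_funU => //; first exact: measurableC.
split=> // _ Y mY; rewrite (_ : _ _ = ~` U `&` (cst 0 : Cd -> R) @^-1` Y).
 exact: (@measurable_cst _ _ Cd R (~` U) 0 (measurableC mU)).
by apply/seteqP; split=> z [nU /=]; rewrite h0.
Qed.

(** The value 0 outside [U] gives each holomorphic function on [U] exactly one representative,
    measurable on the whole space. *)
Definition Hol : set (Cd -> R[i]) := [set f | (forall z, ~ U z -> f z = 0) /\ holomorphic_on U f].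

Lemma Hol_cmeas f : Hol f -> cmeas f.
move=> [f0 hf]; split; (apply: m_zero_ext; last by move=> z /f0 ->);
 by apply: m_continuous_on => z Uz; have [] := diff_ccts (hf z Uz).
Qed.

Lemma normc2_eq0 (u : R[i]) : normc u ^+ 2 = 0 -> u = 0.
by move/eqP; rewrite sqrf_eq0 normc_eq0 => /eqP. Qed.

Section zeros.
Hypothesis cU : connected U.
Variable f : Cd -> R[i].
Hypotheses (hf : Hol f) (f0 : exists2 z, U z & f z != 0).

Lemma m_zeros : measurable [set z | U z /\ f z = 0].
have mU := m_open_Cn oU; have mf := m_normc2 (Hol_cmeas hf).
rewrite (_ : [set z | _] = U `&` (setT `&` (fun z => normc (f z) ^+ 2) @^-1` [set 0])).
 by apply: measurableI => //; apply: mf .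
rewrite setTI; apply/seteqP; split=> z [Uz fz]; split=> //.
 by rewrite /= fz normc0 expr0n.
exact: normc2_eq0.
Qed.

(** The good cells are countably many, and by the identity theorem [f] is not identically 0 on any
    of them, so that [polysquare_null] applies. *)
Lemma zeros_null : V [set z | U z /\ f z = 0] = 0.
have mf := Hol_cmeas hf; apply/negligibleP; first exact: m_zeros.
pose C i := (if good_cell i then psq (ctr i) (2 * rad i) else set0) `&` [set z | f z = 0].
suff H : V.-negligible (\bigcup_i C i).
 apply: negligibleS H => z [Uz]; have [M [i _]] := exh_cover Uz; by exists i.
apply: negligible_bigcup => i; rewrite /C; case: ifP => gi; last by rewrite set0I; exact: negligible_set0.
have gU : opsq (ctr i) (3 * rad i) `<=` U by apply/asboolP.
have r2 : 0 < 2 * rad i by rewrite mulr_gt0// rad_gt0.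
have r23 : 2 * rad i < 3 * rad i by rewrite ltr_pM2r ?rad_gt0// ltr_nat.
have ex : exists2 z, psq (ctr i) (2 * rad i) z & f z != 0.
 apply: contrapT => nex; apply: (identity_theorem oU cU hf.2 (z := ctr i)) => //.
  by apply: (good_cell_sub gi); apply: psq_tn; rewrite subrr /tn normr0 ltW.
 apply/nbhs_tnP; exists (2 * rad i) => // w wr; apply/eqP/negP => /negP fw; apply: nex.
 by exists w => //; apply: psq_tn; exact: ltW.
have := polysquare_null r23 mf (fun z zi => hf.2 z (gU z zi)) ex.
have mz : measurable ([set z | f z = 0] : set Cd).
 rewrite (_ : [set z | _] = setT `&` (fun z => normc (f z) ^+ 2) @^-1` [set 0]).
  exact: m_normc2 .
 rewrite setTI; apply/seteqP; split=> z /=; first by move=> ->; rewrite normc0 expr0n.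
 exact: normc2_eq0.
have mI : measurable (psq (ctr i) (2 * rad i) `&` [set z | f z = 0]).
 by apply: measurableI => //; exact: m_psq.
rewrite (_ : (fun z => _) = (fun z => (\1_(psq (ctr i) (2 * rad i) `&` [set z | f z = 0]) z)%:E)).
 by rewrite integral_indic// setIT => H; apply/negligibleP.
apply/funext => z; congr EFin.
by rewrite !indicE in_setI -mulnb natrM; congr (_ * (nat_of_bool _)%:R); apply/idP/idP; rewrite inE => /eqP.
Qed.

End zeros.

End cells.

(** * The weighted Bergman space as an instance of the abstract setting *)

Section bergman_rkhs.
Variables (R : realType) (d : nat).
Local Notation Cd := 'rV[R[i]]_d.
Local Notation V := (@lebesgue_Cn R d).
Variables (U : set Cd) (omega : Cd -> R).
Hypotheses (oU : open U) (momega : measurable_fun U omega)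
 (omega0 : forall z, U z -> 0 < omega z)
 (omega_inf : forall (B : set Cd) (mB : measurable B),
   rcpt U B -> (0 < V B)%E ->
   (0 < ess_inf (mrestr V mB) (EFin \o omega))%E).
Variable K : Cd -> Cd -> R[i].
Hypothesis Kr : reproducing_kernel U omega K.
Implicit Types (z w a : Cd) (f : Cd -> R[i]) (r : R).
Local Notation rad := (@rad R).
Local Notation ctr := (@ctr R d).

Definition zext f z := if `[< U z >] then f z else 0.
Definition omegaU z := if `[< U z >] then omega z else 0.
Definition kernelU z w := if `[< U z >] && `[< U w >] then K z w else 0.

Let mU : measurable U. Proof. exact: m_open_Cn. Qed.

Lemma omegaU_ge0 z : 0 <= omegaU z.
by rewrite /omegaU; case: asboolP => // /omega0/ltW. Qed.

Lemma m_omegaU : measT omegaU.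
apply: (@m_zero_ext R d U oU); last by move=> z; rewrite /omegaU; case: asboolP.
move=> mY Y mYY; rewrite (_ : _ _ = U `&` omega @^-1` Y); first exact: momega.
by apply/seteqP; split=> z [Uz]; rewrite /= /omegaU asboolT.
Qed.

Lemma Hol_zext f : holomorphic_on U f -> Hol U (zext f).
move=> hf; split=> [z|z Uz]; first by rewrite /zext; case: asboolP.
apply: near_diff (hf z Uz).
have : nbhs z U by exact: open_nbhs_nbhs.
by apply: filterS => w Uw; rewrite /zext asboolT.
Qed.

Lemma integral_omegaU (h : Cd -> R) (g : Cd -> R) : (forall z, U z -> h z = g z * omega z) ->
 (\int[V]_(z in U) (h z)%:E = \int[V]_z (g z * omegaU z)%:E)%E.
move=> hg; rewrite integral_mkcond; apply: eq_integral => z _.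
rewrite /patch /omegaU; case: asboolP => Uz; first by rewrite mem_set// hg.
by rewrite memNset// mulr0.
Qed.

Lemma L2_zext f : bergman_space U omega f -> L2 V omegaU (zext f).
move=> [hf fi]; have mf := Hol_cmeas oU (Hol_zext hf); split=> //.
apply: ge0_L1P.
- by apply: mfM; [exact: m_normc2|exact: m_omegaU].
- by move=> z; rewrite mulr_ge0 ?sqr_ge0 ?omegaU_ge0.
- rewrite -(integral_omegaU (h := fun z => normc (f z) ^+ 2 * omega z))//.
 by move=> z Uz; rewrite /zext asboolT.
Qed.

Lemma bergman_Hol f : Hol U f -> L2 V omegaU f -> bergman_space U omega f.
move=> hf [mf fi]; split; first exact: hf.2.
rewrite (integral_omegaU (g := fun z => normc (f z) ^+ 2))//.
by apply: L1_lty fi _ => z; rewrite mulr_ge0 ?sqr_ge0 ?omegaU_ge0.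
Qed.

Lemma kernelU_zext w : kernelU^~ w = if `[< U w >] then zext (K^~ w) else fun=> 0.
apply/funext => z; rewrite /kernelU /zext.
by case: (asboolP (U w)) => _; rewrite ?andbT ?andbF.
Qed.

Lemma L2_0 : L2 V omegaU (fun=> 0).
split; first by [].
apply: (@eq_L1 _ _ _ _) => [z|]; first by rewrite normc0 expr0n mul0r.
exact: integrable0.
Qed.

Lemma Hol_0 : Hol U (fun=> 0).
by split=> z _. Qed.

Lemma kernelU_H w : Hol U (kernelU^~ w) /\ L2 V omegaU (kernelU^~ w).
rewrite kernelU_zext; case: asboolP => Uw; last by split; [exact: Hol_0|exact: L2_0].
by have bK := Kr.1 w Uw; split; [exact: Hol_zext bK.1|exact: L2_zext].
Qed.

Lemma kernelU_rep f w : Hol U f -> L2 V omegaU f -> f w = dotw V omegaU f (kernelU^~ w).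
move=> hf fi; have [Uw|nUw] := pselect (U w); last first.
 rewrite (hf.1 w nUw) -(cint0 V); apply: eq_cint => z.
 by rewrite /kernelU (asboolF nUw) andbF cj0 mulr0 mul0r.
rewrite (Kr.2 f w (bergman_Hol hf fi) Uw) /bergman_dot /dotw /cint.
have E (p : R[i] -> R) : (forall u (t : R), p (u * t%:C) = p u * t) -> p 0 = 0 ->
  (\int[V]_(z in U) (p (f z * (K z w)^*) * omega z) =
  \int[V]_z p (f z * conjc (kernelU z w) * (omegaU z)%:C))%R.
 move=> pZ p0; congr fine.
 rewrite (integral_omegaU (g := fun z => p (f z * conjc (kernelU z w)))).
  by apply: eq_integral => z _; rewrite pZ.
 by move=> z Uz; rewrite /kernelU !asboolT.
by congr (_ +i* _); apply: E => // u t; rewrite ?cReMr ?cImMr.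
Qed.

Lemma kernelU_conj z w : kernelU z w = conjc (kernelU w z).
have [H1 L1'] := kernelU_H w; have [H2 L2'] := kernelU_H z.
have := kernelU_rep z H1 L1'; have := kernelU_rep w H2 L2' => -> ->.
rewrite /dotw -cint_conj.
 by apply: eq_cint => u; rewrite !cjM cjK cj_real [conjc _ * _]mulrC.
exact: dotw_integrable m_omegaU omegaU_ge0 _ _ L2' L1'.
Qed.

(** The kernel is holomorphic in its first variable, hence by Hermitian symmetry continuous in the
    second one, and [caratheodory] applies. Index 0 of the dense sequence stands for a point outside
    [U], where the kernel vanishes. *)
Lemma kernelU_cmeas : cmeas (fun p : Cd * Cd => kernelU p.1 p.2).
pose D (k : nat) : Cd := if k is k'.+1 then ratC R d k' else get (~` U).
pose E (n k : nat) : set Cd := if k is k'.+1 then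
 (if `[< U (ratC R d k') >] then [set y | U y /\ tn (y - ratC R d k') < n.+1%:R^-1] else set0) else ~` U.
have mE n k : measurable (E n k).
 case: k => [|k]; first exact: measurableC.
 rewrite /E; case: asboolP => // _; apply: m_open_Cn; rewrite openE => y [Uy yk].
 suff : nbhs y [set y | U y /\ tn (y - ratC R d k) < n.+1%:R^-1] by [].
 apply: filterI; first exact: open_nbhs_nbhs.
 apply/nbhs_tnP; exists (n.+1%:R^-1 - tn (y - ratC R d k)); first by rewrite subr_gt0.
 move=> w wy; rewrite -(subrK y w) -addrA; apply: le_lt_trans (tnD _ _) _.
 by rewrite -ltrBrDr.
have covE n y : exists k, E n k y.
 have [Uy|nUy] := pselect (U y); last by exists 0%N.
 have [e e0 eU] := open_ball oU Uy.
 have m0 : 0 < Num.min e n.+1%:R^-1 by rewrite lt_min e0 invr_gt0 ltr0n.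
 have [k] := ratC_near y m0.
 rewrite lt_min => /andP[k1 k2]; exists k.+1; rewrite /E asboolT; last exact: eU.
 by split=> //; rewrite -tnN opprB.
have key (p : R[i] -> R) : (forall u, p v @[v --> u] --> p u) -> (forall w, measT (fun z => p (kernelU z w))) ->
  measT (fun q : Cd * Cd => p (kernelU q.1 q.2)).
 move=> cp mp; apply: (@caratheodory _ _ Cd Cd R (fun x y => p (kernelU x y)) D E mE covE).
  by [].
 move=> x y k kE; have [Uy|nUy] := pselect (U y); last first.
  have Z n : kernelU x (D (k n)) = kernelU x y.
   have := kE n; rewrite /E /D; case: (k) => [_|j]; last by case: asboolP => _ [].
   have ex : exists u, (~` U) u by exists y.
   by rewrite /kernelU [in LHS](asboolF (getPex ex)) (asboolF nUy) !andbF.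
  by under eq_fun do rewrite Z; exact: cvg_cst.
 have cK : ccts (kernelU x) y.
  have [[_ hK] _] := kernelU_H x; have := diff_ccts (hK y Uy) => -[c1 c2].
  have EK : kernelU x = fun w => conjc (kernelU w x) by apply/funext => w; rewrite kernelU_conj.
  rewrite EK; split.
   by under eq_fun do rewrite cRe_conj; rewrite cRe_conj.
  by under eq_fun do rewrite cIm_conj; rewrite cIm_conj; exact: (cvgN c2).
 have Dy : D (k n) @[n --> \oo] --> y.
  move=> P /nbhs_tnP[e e0 eP]; have /cvgr_lt/(_ e e0) := @cvg_harmonic R.
  apply: filterS => n /= ne; apply: eP; apply: lt_trans ne.
  have := kE n; rewrite /E /D; case: (k) => [/(_)//|j]; case: asboolP => // _ [_].
  by rewrite -tnN opprB.
 have /cvg_normcP cK' := cK.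
 exact: (cvg_comp _ _ (cvg_comp _ _ Dy cK') (cp _)).
have mK w := Hol_cmeas oU (kernelU_H w).1.
split; apply: key => [u|w]; [by have [] := ccts_id u|exact: (mK w).1|by have [] := ccts_id u|exact: (mK w).2].
Qed.

(** The unweighted square mean over the doubled cell is bounded by the weighted one, because [omega]
    has a positive essential infimum there. This is where the hypothesis on [omega] enters. *)
Lemma cell_bound i : good_cell U i -> exists2 C, 0 <= C & forall f a, Hol U f ->
 psq (ctr i) (rad i) a ->
 ((normc (f a) ^+ 2)%:E <= C%:E * \int[V]_z (normc (f z) ^+ 2 * (omegaU z * \1_(psq (ctr i) (2 * rad i)) z))%:E)%E.
move=> gi; have gU : opsq (ctr i) (3 * rad i) `<=` U by apply/asboolP.
have r0 : 0 < rad i := rad_gt0 R i.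
have gi' := good_cell_sub gi; set A := psq (ctr i) (2 * rad i).
have mA : measurable A by exact: m_psq.
have bd f a : cmeas f -> (forall z, U z -> differentiable f z) -> psq (ctr i) (rad i) a ->
  ((normc (f a) ^+ 2)%:E <= (((96 / rad i) ^+ 2) ^+ d)%:E *
   \int[V]_z (\1_A z * normc (f z) ^+ 2)%:E)%E.
 move=> mf df ai; have sub z : opsq a (2 * rad i) z -> U z.
  move=> az; apply: gU => j; have [h1 h2] := ai j; have [h3 h4] := az j.
  have E : z 0 j - ctr i 0 j = (a 0 j - ctr i 0 j) + (z 0 j - a 0 j) by ring.
  have e3 : 3 * rad i = rad i + 2 * rad i by ring.
  split; rewrite E e3 (cReD (a 0 j - ctr i 0 j), cImD).
   by apply: le_lt_trans (ler_normD _ _) _; apply: ler_ltD.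
  by apply: le_lt_trans (ler_normD _ _) _; apply: ler_ltD.
 have r2 : rad i < 2 * rad i by rewrite ltr_pMl// ltr1n.
 apply: le_trans (polysquare_bound r0 r2 mf (fun z za => df z (sub z za))) _.
 apply: lee_wpmul2l; first by rewrite lee_fin exprn_ge0// sqr_ge0.
 apply: ge0_le_integral => //.
 - by move=> z _; rewrite lee_fin mulr_ge0 ?sqr_ge0.
 - by apply/mEFinP; apply: mfM; [exact: m_psqi|exact: m_normc2].
 - by apply/mEFinP; apply: mfM; [by []|exact: m_normc2].
 - move=> z _; rewrite lee_fin ler_wpM2r ?sqr_ge0// psqiE ler_nat.
  have [/set_mem za|//] := boolP (z \in (psq a (rad i) : set Cd)); rewrite mem_set//.
  by rewrite /A mulrDl mul1r; exact: psq_trans.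
(* The square mean inequality for the constant function 1 shows that the cell is not a null set. *)
have VA : (0 < V A)%E.
 have cc : psq (ctr i) (rad i) (ctr i) by apply: psq_tn; rewrite subrr /tn normr0 ltW.
 have m1 : cmeas ((fun=> 1) : Cd -> R[i]) by [].
 have := bd (fun=> 1) (ctr i) m1 (fun z _ => differentiable_cst _ _) cc.
 rewrite normc1 expr1n; under eq_integral do rewrite mulr1.
 rewrite integral_indic// setIT; apply: contraTT; rewrite -!leNgt => V0.
 have VA0 : V A = 0 by apply/eqP; rewrite eq_le V0 measure_ge0.
 change (~~ (1 <= (((96 / rad i) ^+ 2) ^+ d)%:E * V A)%E); rewrite VA0.
 by rewrite mule0 lee_fin ler10.
have rcA : rcpt U A by apply: rc_closed gi'; exact: compact_psq.
have O := omega_inf mA rcA VA.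
(* An essential infimum equal to +oo is replaced by the bound 1. *)
have [dl dl0 dlO] : exists2 dl : R, 0 < dl & (dl%:E <= ess_inf (mrestr V mA) (EFin \o omega))%E.
 move: O; case: (ess_inf _ _) => [x x0|_|//]; first by exists x.
 by exists 1 => //; rewrite leey.
have ae : {ae V, forall z, setT z -> ((\1_A z)%:E <= (dl^-1 * (omegaU z * \1_A z))%:E)%E}.
 have [N [mN VN NP]] := ess_inf_le (mrestr V mA) (EFin \o omega).
 exists (N `&` A); split; [exact: measurableI|by []|] => z nz.
 have Az : A z by apply: contrapT => nA; apply: nz => _; rewrite indicE memNset// !mulr0.
 split=> //; apply: NP => h; apply: nz => _.
 rewrite indicE mem_set// mulr1 lee_fin /omegaU asboolT; last exact: gi'.
 rewrite -(@ler_pM2l _ dl)// mulr1 mulrA divff ?lt0r_neq0// mul1r -lee_fin.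
 exact: le_trans h.
exists (((96 / rad i) ^+ 2) ^+ d * dl^-1); first by apply: mulr_ge0; [apply: exprn_ge0; exact: sqr_ge0|rewrite invr_ge0; exact: ltW].
move=> f a hf ai; have mf := Hol_cmeas oU hf.
apply: le_trans (bd f a mf hf.2 ai) _; rewrite EFinM -muleA.
apply: lee_wpmul2l; first by rewrite lee_fin exprn_ge0// sqr_ge0.
have mg : measT (fun z => normc (f z) ^+ 2 * (omegaU z * \1_A z)).
 apply: mfM; first exact: m_normc2.
 by apply: mfM; [exact: m_omegaU|by []].
have g0 z : 0 <= normc (f z) ^+ 2 * (omegaU z * \1_A z).
 by rewrite mulr_ge0 ?sqr_ge0// mulr_ge0 ?omegaU_ge0.
rewrite -ge0_integralZl//; last 3 first.
- exact/mEFinP.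
- by move=> z _; rewrite lee_fin.
- by rewrite lee_fin invr_ge0 ltW.
apply: ae_ge0_le_integral => //.
- by move=> z _; rewrite lee_fin mulr_ge0 ?sqr_ge0.
- by apply/mEFinP; apply: mfM; [by []|exact: m_normc2].
- by move=> z _; rewrite lee_fin mulr_ge0 ?invr_ge0 ?(ltW dl0).
- by apply/mEFinP; apply: mfM.
apply: filterS ae => z /(_ I); rewrite !lee_fin => h _.
by rewrite mulrC mulrCA; apply: ler_wpM2l => //; exact: sqr_ge0.
Qed.

Lemma cell_nrm2 i M : good_cell U i -> (i < M)%N -> exists2 C, 0 <= C & forall f a, Hol U f ->
 L2 V omegaU f -> psq (ctr i) (rad i) a ->
 normc (f a) ^+ 2 <= C * nrm2 V (fun z => omegaU z * \1_(exh U M) z) f.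
move=> gi iM; have [C C0 CP] := cell_bound gi; exists C => // f a hf [mf fi] ai.
have mE := m_exh U M; have mO := m_omegaU.
have mn := m_normc2 mf; have mA := m_psq (ctr i) (2 * rad i).
have fi' : L1 V (fun z => normc (f z) ^+ 2 * (omegaU z * \1_(exh U M) z)).
 apply: le_L1 fi.
  by apply: mfM => //; apply: mfM .
 move=> z; rewrite ger0_norm; last by rewrite mulr_ge0 ?sqr_ge0// mulr_ge0 ?omegaU_ge0.
 rewrite ler_wpM2l ?sqr_ge0// ler_piMr ?omegaU_ge0//.
rewrite -lee_fin [X in (_ <= X)%E]EFinM.
have -> : (nrm2 V (fun z => omegaU z * \1_(exh U M) z) f)%:E = (\int[V]_z (normc (f z) ^+ 2 * (omegaU z * \1_(exh U M) z))%:E)%E.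
 exact: EFin_Rint.
apply: le_trans (CP f a hf ai) _.
apply: lee_wpmul2l; first by [].
apply: ge0_le_integral => //.
- by move=> z _; rewrite lee_fin mulr_ge0 ?sqr_ge0// mulr_ge0 ?omegaU_ge0.
- by apply/mEFinP; apply: mfM => //; apply: mfM .
- by apply/mEFinP; apply: mfM => //; apply: mfM .
- move=> z _; rewrite lee_fin ler_wpM2l ?sqr_ge0// ler_wpM2l ?omegaU_ge0// ler_nat.
 have [/set_mem za|//] := boolP (z \in (psq (ctr i) (2 * rad i) : set Cd)); rewrite mem_set//.
 exact: exh_good za.
Qed.

(** [cell_nrm2] turns the Cauchy property in local norms into a uniform one on each good cell;
    Weierstrass's theorem then makes the pointwise limit holomorphic. *)
Lemma bergman_complete (f_ : nat -> Cd -> R[i]) :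
 (forall n, Hol U (f_ n) /\ L2 V omegaU (f_ n)) ->
 (forall M e, 0 < e -> exists N, forall n m, (N <= n)%N -> (N <= m)%N ->
   nrm2 V (fun z => omegaU z * \1_(exh U M) z) (fun z => f_ n z - f_ m z) <= e) ->
 exists2 f, Hol U f & forall z, normc (f_ n z - f z) @[n --> \oo] --> (0 : R).
move=> fH fC.
have HB n m : Hol U (fun z => f_ n z - f_ m z) /\ L2 V omegaU (fun z => f_ n z - f_ m z).
 have [[a1 a2] a3] := fH n; have [[b1 b2] b3] := fH m; split; last first.
  by apply: L2B a3 b3 => //; [exact: m_omegaU|exact: omegaU_ge0].
 split=> [z nU|z Uz]; first by rewrite a1// b1// subrr.
 exact: differentiableB (a2 z Uz) (b2 z Uz).
have unif i : good_cell U i -> forall e, 0 < e -> exists N, forall n m z, (N <= n)%N -> (N <= m)%N ->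
  psq (ctr i) (rad i) z -> normc (f_ n z - f_ m z) <= e.
 move=> gi e e0; have [C C0 CP] := cell_nrm2 gi (ltnSn i).
 have [N NP] := fC i.+1 (e ^+ 2 / (C + 1)) ltac:(by rewrite divr_gt0 ?exprn_gt0// ltr_wpDl).
 exists N => n m z Nn Nm zi; have [h1 h2] := HB n m.
 rewrite -(ler_pXn2r (n := 2)) ?nnegrE ?nc_ge0 ?(ltW e0)//.
 apply: le_trans (CP _ z h1 h2 zi) _; apply: le_trans (ler_wpM2l C0 (NP n m Nn Nm)) _.
 by rewrite mulrCA ler_piMr ?sqr_ge0// ler_pdivrMr ?ltr_wpDl// mul1r lerDl.
have exl z : exists l, forall e, 0 < e -> exists N, forall n, (N <= n)%N -> normc (f_ n z - l) <= e.
 have [Uz|nUz] := pselect (U z); last first.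
  by exists 0 ; exists 0%N => n _; rewrite (fH n).1.1// subrr normc0 ltW.
 apply: complex_cauchy => e e0; have [i gi iP] := good_cell_cover oU Uz.
 have [N NP] := unif i gi e e0; exists N => n m Nn Nm; apply: NP => //; apply: iP.
 by rewrite subrr /tn normr0 divr_gt0 ?rad_gt0.
pose f z := projT1 (cid (exl z)).
have fl z : normc (f_ n z - f z) @[n --> \oo] --> (0 : R).
 apply/cvgrPdist_le => e e0; have [N NP] := projT2 (cid (exl z)) e e0.
 by exists N => // Nn; rewrite sub0r normrN ger0_norm ?nc_ge0//; exact: NP.
exists f => //; split=> [z nUz|z Uz].
 apply/eqP; rewrite -normc_eq0; apply/eqP.
 have : (fun n => normc (f_ n z - f z)) = fun=> normc (f z).
  by apply/funext => n; rewrite (fH n).1.1// sub0r normcN_eq.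
 have := fl z => /[swap] ->; exact: (cvg_unique (@Rhausdorff R) (cvg_cst _)).
have [i gi iP] := good_cell_cover oU Uz.
apply: (@weierstrass R d z (rad i / 2) _ f_); first by rewrite divr_gt0 ?rad_gt0.
- by move=> n w wz; apply: (fH n).1.2; apply: (good_cell_sub gi); apply: opsq_psq; apply: psq_opsq (iP w wz); rewrite ltr_pMl ?rad_gt0 ?ltr1n.
- move=> e e0; have [N NP] := unif i gi e e0; exists N => n m w Nn Nm wz.
 by apply: NP => //; exact: iP.
- by [].
Qed.

Lemma bergman_rkhs : rkhs V omegaU (Hol U) (exh U) kernelU.
split.
- exact: m_omegaU.
- exact: omegaU_ge0.
- by exact: Hol_cmeas.
- move=> c f g [f0 hf] [g0 hg]; split=> [z nU|z Uz]; first by rewrite f0// g0// mulr0 addr0.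
 by apply: diff_lin; [exact: hf|exact: hg].
- exact: Hol_0.
- by exact: m_exh.
- by exact: exh_nd.
- move=> z; rewrite /omegaU; case: asboolP => [Uz _|_]; last by rewrite eqxx.
 exact: exh_cover.
- exact: bergman_complete.
- exact: kernelU_cmeas.
- exact: kernelU_H.
- exact: kernelU_rep.
Qed.

End bergman_rkhs.

(** * Multipliers built from a bounded function *)

Section bounded_function.
Variables (R : realType) (d : nat) (U : set 'rV[R[i]]_d) (omega : 'rV[R[i]]_d -> R).
Local Notation Cd := 'rV[R[i]]_d.
Local Notation V := (@lebesgue_Cn R d).
Hypotheses (oU : open U) (cU : connected U) (momega : measurable_fun U omega)
 (omega0 : forall z, U z -> 0 < omega z)
 (omega_inf : forall (B : set Cd) (mB : measurable B),
   rcpt U B -> (0 < V B)%E ->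
   (0 < ess_inf (mrestr V mB) (EFin \o omega))%E).
Variable K : Cd -> Cd -> R[i].
Hypothesis Kr : reproducing_kernel U omega K.
Variables (g : Cd -> R[i]) (M : R).
Hypotheses (hg : holomorphic_on U g) (M0 : 0 < M) (gM : forall z, U z -> normc (g z) <= M)
 (g_nc : exists z w, [/\ U z, U w & g z != g w]).
Local Notation W0 := (omegaU U omega).
Local Notation KU := (kernelU U K).
Local Notation rk := (bergman_rkhs oU momega omega0 omega_inf Kr).
Local Notation mult := (multiplier V W0 (Hol U)).

Lemma hol_multiplier b : Hol U b -> (forall z, normc (b z) <= 1) -> mult b.
move=> hb b1; split=> // f [[f0 hf] [mf fi]]; split.
 split=> [z nU|z Uz]; first by rewrite f0// mulr0.
 exact: differentiableM (hb.2 z Uz) (hf z Uz).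
have mb := cmeasM (Hol_cmeas oU hb) mf; split=> //.
have mO : measT W0 := m_omegaU oU momega.
have O0 z : 0 <= W0 z := omegaU_ge0 omega0 z.
apply: le_L1 fi; first by apply: mfM => //; exact: m_normc2.
move=> z; rewrite ger0_norm; last by rewrite mulr_ge0 ?sqr_ge0.
apply: ler_wpM2r => //; rewrite normcM exprMn ler_piMl ?sqr_ge0//.
by rewrite exprn_ile1 ?nc_ge0.
Qed.

Definition diffb x := zext U (fun z => (2 * M)^-1%:C * (g z - g x)).

Lemma diffb_multiplier x : U x -> mult (diffb x).
move=> Ux; apply: hol_multiplier => [|z].
 apply: (Hol_zext oU) => z Uz; apply: differentiableM; first by [].
 by apply: differentiableB; [exact: hg|by []].
rewrite /diffb /zext; case: asboolP => [Uz|_]; last by rewrite normc0.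
rewrite normcM normcR ger0_norm ?invr_ge0 ?mulr_ge0 ?(ltW M0)//.
rewrite ler_pdivrMl ?mulr_gt0// mulr1 mulrDl mul1r; apply: le_trans (normcB_le _ _) _.
by apply: lerD; exact: gM.
Qed.

Lemma normc_diffb x q : U q -> normc (diffb x q) = normc (g q - g x) / (2 * M).
move=> Uq; rewrite /diffb /zext asboolT// normcM normcR mulrC ger0_norm//.
by rewrite invr_ge0 mulr_ge0// ltW.
Qed.

Lemma product_multiplier (x : seq Cd) : (forall z, z \in x -> U z) ->
 mult (fun z => \prod_(u <- x) diffb u z).
elim: x => [|u x IH] xU.
 split=> [f hf|z]; last by rewrite big_nil normc1.
 by under eq_fun do rewrite big_nil mul1r.
have [m1 n1] : mult (fun z => \prod_(u <- x) diffb u z).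
 by apply: IH => z zx; apply: xU; rewrite in_cons zx orbT.
have [m2 n2] := diffb_multiplier (xU u (mem_head _ _)).
split=> [f hf|z]; last by rewrite big_cons normcM mulr_ile1 ?nc_ge0.
by under eq_fun do rewrite big_cons -mulrA; apply: m2; exact: m1.
Qed.

(** The bound [eta <= 2 * M] keeps the base at most 1, so that fewer than n factors only help; the
    factor 2 in the exponent comes from the square. *)
Lemma product_bound (x : seq Cd) (q : Cd) (eta : R) (n : nat) : U q -> 0 < eta <= 2 * M ->
 (forall z, z \in x -> eta <= normc (g q - g z)) -> (size x <= n)%N ->
 (eta / (2 * M)) ^+ (2 * n) <= normc (\prod_(u <- x) diffb u q) ^+ 2.
move=> Uq /andP[e0 eM] xe xn; have M2 : 0 < 2 * M by rewrite mulr_gt0.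
have b01 : 0 <= eta / (2 * M) <= 1 by rewrite divr_ge0 ?(ltW e0) ?(ltW M2)// ler_pdivrMr ?mul1r.
have /andP[b0 b1] := b01.
rewrite mulnC exprM ler_pXn2r ?nnegrE ?exprn_ge0 ?nc_ge0//.
apply: le_trans (_ : _ <= (eta / (2 * M)) ^+ size x) _; first by rewrite ler_wiXn2l.
elim: x xe {xn} => [|u x IH] xe; first by rewrite big_nil normc1.
rewrite big_cons normcM exprS; apply: ler_pM; rewrite ?exprn_ge0//.
 by rewrite normc_diffb// ler_pM2r ?invr_gt0// xe ?mem_head.
by apply: IH => z zx; apply: xe; rewrite in_cons zx orbT.
Qed.

(** The data that [deletion_bound] requires at [q]: a weighted family of points [h x] with a submean
    value inequality at [q], a bound for the kernel on the family, and multipliers vanishing at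
    [h x] but bounded below at [q]. *)
Definition deletable q := exists (a : measurableTypeR R * measurableTypeR R -> R)
  (h : measurableTypeR R * measurableTypeR R -> Cd) (C c N : R),
 [/\ (forall x, 0 <= a x), L1 (@lebm2 R) a, measT h, 0 <= C &
  (0 < c /\ 0 <= N) /\ [/\ measT a, (forall x, a x != 0 -> kap KU (h x) <= N),
  (forall f, inH V W0 (Hol U) f ->
   normc (f q) ^+ 2 <= C * (\int[@lebm2 R]_x (a x * normc (f (h x)) ^+ 2))%R) &
  forall x, a x != 0 -> exists b, [/\ mult b, b (h x) = 0 & c <= normc (b q) ^+ 2]]].

(** The cell bound for the kernel at [z], evaluated at [z] itself, reads kap^2 <= C kap. *)
Lemma kap_bounded q : U q -> exists r C, [/\ 0 < r, 0 <= C,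
 (forall z, tn (z - q) < r -> U z) & forall z, tn (z - q) < r -> kap KU z <= C].
move=> Uq; have [i gi iP] := good_cell_cover oU Uq.
have [C C0 CP] := cell_nrm2 oU momega omega0 omega_inf gi (ltnSn i).
have cellU z : psq (ctr R d i) (rad R i) z -> U z.
 by move=> zi; apply: (good_cell_sub gi); apply: opsq_psq; apply: psq_opsq zi; rewrite ltr_pMl ?rad_gt0 ?ltr1n.
exists (rad R i / 2), C; split=> //; first by rewrite divr_gt0 ?rad_gt0.
 by move=> z /iP/cellU.
move=> z /iP zi; have [hK LK] := kernelU_H oU momega omega0 Kr z.
have := CP _ z hK LK zi; rewrite (K_diag rk) normcR ger0_norm ?(kap_ge0 rk)//.
have mv : measT (fun u => W0 u * \1_(exh U i.+1) u).
 apply: mfM; first exact: m_omegaU.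
 by apply: mindic; exact: m_exh.
have H : nrm2 V (fun u => W0 u * \1_(exh U i.+1) u) (KU^~ z) <= kap KU z.
 rewrite (kap_nrm2 rk); apply: (nrm2_le mv _ LK) => u; have := omegaU_ge0 omega0 u => O0.
 by rewrite indicE; case: (_ \in _); rewrite ?mulr1 ?mulr0 ?lexx ?O0.
move=> /le_trans/(_ (ler_wpM2l C0 H)); have [->|k0] := eqVneq (kap KU z) 0; first by [].
by rewrite ler_pM2r// lt_neqAle eq_sym k0 (kap_ge0 rk).
Qed.

Lemma m_line q (e : Cd) : measT
 (fun p : measurableTypeR R * measurableTypeR R => q + (p.1 +i* p.2) *: e).
pose t (p : measurableTypeR R * measurableTypeR R) := mktuple (fun j : 'I_d =>
 (Re (q 0 j) + (p.1 * Re (e 0 j) - p.2 * Im (e 0 j)),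
  Im (q 0 j) + (p.1 * Im (e 0 j) + p.2 * Re (e 0 j))) : measurableTypeR R * measurableTypeR R).
rewrite (_ : (fun _ => _) = fun p => Cn_of_tuple (t p)).
 apply: mpre (@measurable_Cn_of_tuple R d) _; apply/measurable_fun_tnthP => j.
 rewrite (_ : _ _ = fun p : measurableTypeR R * measurableTypeR R =>
 (Re (q 0 j) + (p.1 * Re (e 0 j) - p.2 * Im (e 0 j)),
  Im (q 0 j) + (p.1 * Im (e 0 j) + p.2 * Re (e 0 j)))).
  apply: mfpair; apply: measurable_funD; try by [];
   [apply: measurable_funB|apply: measurable_funD]; apply: mfM => //.
 by apply/funext => p; rewrite /= tnth_mktuple.
apply/funext => p; apply/rowP => j; rewrite !mxE tnth_mktuple /=.
by case: (q 0) (e 0) => a b [].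
Qed.

Lemma L1_annulus (s : R) : L1 (@lebm2 R) (ann 0 s).
have mA := m_annulus (0 : R[i]) s; apply: ge0_L1P; first exact: m_ann.
 by [].
rewrite integral_indic// setIT.
pose b := 3 / 2 * s; have mb : measurable (`[(- b), b]%classic : set (measurableTypeR R)) by [].
have mbb := measurableX mb mb.
apply: (@le_lt_trans _ _ (lebm2 (`[(- b), b]%classic `*` `[(- b), b]%classic))).
 apply: le_measure; rewrite ?inE// => p [h1 h2 _]; move: h1 h2; rewrite /= !subr0 !in_itv /= !ler_norml.
 by [].
rewrite /lebm2 product_measure1E//= lebesgue_measure_itv /=.
by case: ifP => _; rewrite ltry.
Qed.

(** One complex line through [q] suffices, chosen by the identity theorem so that [g] is not
    constant on it near [q]. There [g - g q] has an isolated zero at [q], and the mean is taken over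
    an annulus of the line on which it is bounded below. *)
Lemma bounded_deletable q : U q -> deletable q.
move=> Uq; have [r [N [r0 N0 rU rN]]] := kap_bounded Uq.
pose f z := g z - g q.
have hf : holomorphic_on U f by move=> z Uz; apply: differentiableB; [exact: hg|exact: differentiable_cst].
have [w wr fw] : exists2 w, tn (w - q) < r & f w != 0.
 have ex : exists2 w, U w & f w != 0.
  have [z [w [Uz Uw zw]]] := g_nc; have [E|zq] := eqVneq (g z) (g q); last by exists z; rewrite ?subr_eq0.
  by exists w => //; rewrite subr_eq0 -E eq_sym.
 apply: contrapT => nw; apply: (identity_theorem oU cU hf Uq ex); apply/nbhs_tnP; exists r => // w wr.
 by apply/eqP/negPn/negP => fw; apply: nw; exists w.
pose e := w - q; pose F u := f (q + u *: e).
have qr : tn (q - q) < r by rewrite subrr /tn normr0.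
have [oO dO] := line_domain hf q e rU.
have O0 : [set u : R[i] | tn (q + u *: e - q) < r] 0 by rewrite /= scale0r addr0.
have [F0|[e0 e0p eP]] := isolated_or_near_null oO dO O0.
 by exfalso; move: fw; rewrite (line_null hf rU qr wr F0) eqxx.
have T0 : 0 < 4 * (tn e + 1) by rewrite mulr_gt0// ltr_wpDl ?tn_ge0.
pose s := Num.min (e0 / 4) (r / (4 * (tn e + 1))).
have s0 : 0 < s by rewrite lt_min !divr_gt0.
have se : s <= e0 / 4 by rewrite ge_min lexx.
have sr : s <= r / (4 * (tn e + 1)) by rewrite ge_min lexx orbT.
have sq (u : R[i]) : normc u <= 2 * s -> tn (q + u *: e - q) < r.
 move=> us; rewrite addrC addKr tnZ; apply: (@le_lt_trans _ _ (2 * s * (tn e + 1))).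
  by apply: ler_pM; rewrite ?nc_ge0 ?tn_ge0// lerDl.
 apply: (@le_lt_trans _ _ (2 * (r / (4 * (tn e + 1))) * (tn e + 1))).
  by rewrite ler_wpM2r ?addr_ge0 ?tn_ge0// ler_wpM2l.
 have t0 : tn e + 1 != 0 by rewrite gt_eqF// ltr_wpDl ?tn_ge0.
 have -> : 2 * (r / (4 * (tn e + 1))) * (tn e + 1) = r / 2 by field.
 by rewrite ltr_pdivrMr// ltr_pMr// ltr1n.
have cs u : csq 0 s u -> normc u <= 2 * s.
 move=> [h1 h2]; apply: le_trans (nc_ReIm _) _; move: h1 h2; rewrite !subr0 mulrDl mul1r.
 exact: lerD.
have [dl dl0 dlP] := eP (s / 2) ltac:(by rewrite divr_gt0).
pose a := ann (0 : R[i]) (s / 2).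
pose h (p : measurableTypeR R * measurableTypeR R) : Cd := q + (p.1 +i* p.2) *: e.
have aP p : a p != 0 -> s / 2 <= normc (p.1 +i* p.2) <= 2 * s.
 rewrite /a /ann indicE; case: (boolP (p \in _)) => [/set_mem[h1 h2 h3] _|_]; last by rewrite eqxx.
 rewrite !subr0 in h1 h2 h3.
 have bs : 3 / 2 * (s / 2) <= s by move: s0; lra.
 apply/andP; split; last by apply: cs; split; rewrite subr0; [exact: le_trans bs|exact: le_trans bs].
 have n1 : `|p.1| <= normc (p.1 +i* p.2) := normc_Re (p.1 +i* p.2).
 have n2 : `|p.2| <= normc (p.1 +i* p.2) := normc_Im (p.1 +i* p.2).
 by case: h3 => h3; [exact: le_trans n1|exact: le_trans n2].
have ah p : a p != 0 -> tn (h p - q) < r by move=> /aP/andP[_]; exact: sq.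
have M2 : 0 < 2 * M by rewrite mulr_gt0.
exists a, h, ((96 / s) ^+ 2), ((dl / (2 * M)) ^+ 2), N; split.
- by [].
- exact: L1_annulus.
- exact: m_line.
- exact: sqr_ge0.
split; first by split=> //; rewrite exprn_gt0// divr_gt0.
split; first exact: m_ann.
- by move=> p /ah; exact: rN.
- move=> f1 f1H.
 have dF u : csq 0 s u -> cdiff (fun u => f1 (q + u *: e)) u.
  by move=> us; apply: cdiff_line; apply: f1H.1.2; apply: rU; apply: sq; exact: cs.
 have := local_area s0 dF; rewrite scale0r addr0 => A.
 have mf : measT (fun p => normc (f1 (h p)) ^+ 2).
  exact: mpre (m_normc2 f1H.2.1) (m_line q e).
 have I1 : L1 (@lebm2 R) (fun p => a p * normc (f1 (h p)) ^+ 2).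
  apply: le_L1 (L1Z (N * nrm2 V W0 f1) (L1_annulus (s / 2))).
   by apply: mfM => //; exact: m_ann.
  move=> p; have a0 : 0 <= a p by [].
  rewrite ger0_norm; last by rewrite mulr_ge0 ?sqr_ge0.
  have [->|ap] := eqVneq (a p) 0; first by rewrite mul0r !mulr_ge0// nrm2_ge0//; exact: omegaU_ge0.
  rewrite mulrC ler_wpM2r//; apply: le_trans (eval_bound rk (h p) f1H) _.
  by rewrite ler_wpM2r ?nrm2_ge0//; [exact: omegaU_ge0|apply: rN; exact: ah].
 by rewrite -lee_fin [X in (_ <= X)%E]EFinM EFin_Rint.
- move=> p ap; have Uh := rU _ (ah p ap); exists (diffb (h p)); split.
 + exact: diffb_multiplier.
 + by rewrite /diffb /zext asboolT// subrr mulr0.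
 + rewrite ler_pXn2r ?nnegrE ?nc_ge0 ?divr_ge0 ?(ltW dl0) ?(ltW M2)// normc_diffb//.
  rewrite ler_pM2r ?invr_gt0// normcB_sym; apply: dlP; rewrite subr0.
  have /andP[h1] := aP p ap; rewrite h1; lra.
Qed.

End bounded_function.

(** * Factorial moments and Moebius inversion over finite words *)

Section factorial_words.

Fixpoint fm (T : eqType) (m : T -> nat) (t : seq T) : nat :=
 if t is a :: t' then (m a * fm (fun z => m z - (z == a)) t')%N else 1%N.

Lemma eq_fm (T : eqType) (m m' : T -> nat) t : m =1 m' -> fm m t = fm m' t.
by elim: t m m' => [//|a t IH] m m' mm /=; rewrite mm (IH _ (fun z => m' z - (z == a))%N)// => z; rewrite mm. Qed.

Lemma fmD1 (T : eqType) (m : T -> nat) a t :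
 fm (fun z => m z + (z == a))%N t = (fm m t + remsum (fun b r => (b == a) * fm m r)%N t)%N.
have nD (x y : nat) : (x + y)%R = (x + y)%N by [].
elim: t m => [//|b t IH] m /=; rewrite nD.
have [->|ba] := eqVneq.
 rewrite mul1n (@eq_fm _ (fun z => m z + (z == a) - (z == a))%N m); last first.
  by move=> z; rewrite addnK.
 have [m0|mp] := posnP (m a).
  rewrite m0 mul1n add0n (@eq_remsum _ _ _ (fun _ _ => 0%N)).
   suff -> : remsum (fun _ _ => 0%N) t = 0%N by rewrite addn0.
   by elim: t {IH} .
  by move=> z r; rewrite muln0.
 have E : fm m t = (fm (fun z => m z - (z == a)) t + remsum (fun b r => (b == a) * fm (fun z => m z - (z == a)) r) t)%N.
  rewrite -IH; apply: eq_fm => z; have [->|_] := eqVneq; first by rewrite subnK.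
  by rewrite subn0 addn0.
 have -> : remsum (fun z r => (z == a) * (m a * fm (fun z0 => m z0 - (z0 == a)) r))%N t =
   (m a * remsum (fun b r => (b == a) * fm (fun z => m z - (z == a)) r) t)%N.
  rewrite remsum_morph ?muln0//; last by move=> *; rewrite mulnDr.
  by apply: eq_remsum => z r; rewrite mulnCA.
 by rewrite mulnDl mul1n {1}E mulnDr addnAC addnA.
rewrite add0n addn0 (@eq_fm _ (fun z => m z + (z == a) - (z == b))%N (fun z => m z - (z == b) + (z == a))%N).
 rewrite IH mulnDr; congr (_ + _)%N.
 rewrite remsum_morph ?muln0//; last by move=> *; rewrite mulnDr.
 by apply: eq_remsum => z r; rewrite mulnCA.
move=> z; have [->|] := eqVneq; last by rewrite !addn0.
by rewrite eq_sym (negbTE ba) !subn0.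
Qed.

Variable R : realType.

Lemma big_tupleS (Z : nmodType) (I : finType) n (F : seq I -> Z) :
 \sum_(w : n.+1.-tuple I) F w = \sum_(b : I) \sum_(w : n.-tuple I) F (b :: w).
rewrite pair_big (reindex (fun q : I * n.-tuple I => [tuple of q.1 :: q.2])) //=.
exists (fun w => (thead w, [tuple of behead w])) => [[b w]|w] _.
 by rewrite theadE; congr pair; exact: val_inj.
by rewrite -tuple_eta.
Qed.

Lemma sum_remsum (I : finType) n (g : I -> seq I -> R) :
 \sum_(w : n.+1.-tuple I) remsum g w = n.+1%:R * \sum_b \sum_(w : n.-tuple I) g b w.
elim: n g => [|n IH] g; rewrite big_tupleS mulr_sumr.
 by apply: eq_bigr => b _; rewrite mul1r; apply: eq_bigr => w _; rewrite tuple0 /= addr0.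
under eq_bigr do rewrite big_split /= IH.
rewrite big_split /= -mulr_sumr -mulr_sumr -[n.+2%:R]natr1 mulrDl mul1r addrC; congr (_ * _ + _).
by rewrite exchange_big; apply: eq_bigr => b _; rewrite big_tupleS.
Qed.

Definition symm (T : eqType) (f : seq T -> R) := forall s t, perm_eq s t -> f s = f t.

Lemma mul_remsum (T : eqType) (f : seq T -> R) (g : T -> seq T -> R) s : symm f ->
 f s * remsum g s = remsum (fun b r => f (b :: r) * g b r) s.
elim: s f g => [|a s IH] f g sf /=; first by rewrite mulr0.
rewrite mulrDr (IH (fun r => f (a :: r))); last by move=> u v uv; apply: sf; rewrite perm_cons.
congr (_ + _); apply: eq_remsum => b r; congr (_ * _); apply: sf.
exact/permPl/(perm_catCA [:: a] [:: b]).
Qed.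

Lemma ssum0 (T : Type) (Z : nmodType) (g : seq T -> seq T -> Z) s :
 (forall x y, g x y = 0) -> ssum g s = 0.
by elim: s g => [|a s IH] g g0 /=; rewrite ?g0// !IH ?addr0. Qed.

(* Both sides count the [n]-element subfamilies of [y], weighted by [f]. *)
Lemma sum_fm (I : finType) n (f : seq I -> R) y : symm f ->
 \sum_(w : n.-tuple I) f w * (fm (fun z => count_mem z y) w)%:R =
 n`!%:R * ssum (fun s _ => (size s == n)%:R * f s) y.
elim: y n f => [|a y IH] n f sf.
 case: n => [|n]; first by rewrite (big_pred1 [tuple]) ?mulr1 ?mul1r//= ?mul1r// => w; rewrite (tuple0 w).
 by rewrite /= mul0r mulr0 big1// => w _; case/tupleP: w => b w; rewrite mulr0.
have sa : symm (fun s => f (a :: s)) by move=> u v uv; apply: sf; rewrite perm_cons.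
have E (w : seq I) : f w * (fm (fun z => count_mem z (a :: y)) w)%:R =
  f w * (fm (fun z => count_mem z y) w)%:R +
  remsum (fun b r => (b == a)%:R * (f (a :: r) * (fm (fun z => count_mem z y) r)%:R)) w.
 rewrite (eq_fm (m' := fun z => count_mem z y + (z == a))%N); last by move=> z; rewrite addnC eq_sym.
 rewrite fmD1 natrD mulrDr; congr (_ + _).
 rewrite remsum_morph ?mulr0n//; last by move=> x z; rewrite natrD.
 rewrite mul_remsum//; apply: eq_remsum => b r; rewrite natrM.
 by have [->|] := eqVneq; rewrite ?mul1r ?mul0r ?mulr0.
under eq_bigr do rewrite E; rewrite big_split /= IH// mulrDr addrC; congr (_ + _).
case: n => [|n].
 by rewrite (big_pred1 [tuple]) => [|w]; rewrite ?(tuple0 w)// ssum0 ?mulr0// => *; rewrite mul0r.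
rewrite sum_remsum natrM -mulrA; congr (_ * _); rewrite -(IH)//.
rewrite (bigD1 a)//= [X in _ + X]big1 ?addr0.
 by apply: eq_bigr => w _; rewrite eqxx mul1r.
by move=> b /negbTE ba; rewrite big1// => w _; rewrite ba mul0r.
Qed.

Lemma ssum_size (T : Type) (g : seq T -> R) N y : (size y < N)%N ->
 ssum (fun s _ => (size s < N)%:R * g s) y = ssum (fun s _ => g s) y.
elim: y N g => [|a y IH] [//|N] g /= yN; first by rewrite mul1r.
rewrite -(IH N.+1 g); last exact: ltnW.
by rewrite -(IH N).
Qed.

Lemma sum_ssum_size (T : Type) (g : seq T -> R) N y :
 \sum_(0 <= n < N) ssum (fun s _ => (size s == n)%:R * g s) y =
 ssum (fun s _ => (size s < N)%:R * g s) y.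
elim: N => [|N IH]; first by rewrite big_nil ssum0// => t; rewrite mul0r.
rewrite big_nat_recr//= IH -ssum_add; apply: eq_ssum => s t.
rewrite ltnS; case: ltngtP; by rewrite !(mul0r, addr0, add0r).
Qed.

(** The Moebius transform over subfamilies. Through its inversion an indicator becomes a sum over
    subfamilies, whose expectation is governed by the correlation functions. *)
Definition mob (T : Type) (h : seq T -> R) s : R := ssum (fun x y => h x * (-1) ^+ size y) s.

Lemma mob_cons (T : Type) (h : seq T -> R) a s :
 mob h (a :: s) = mob (fun x => h (a :: x)) s - mob h s.
congr (_ + _); rewrite ssum_morph => [|x z]; last by rewrite opprD.
by apply: eq_ssum => x y; rewrite exprS mulN1r mulrN.
Qed.

Lemma eq_mob (T : Type) (h k : seq T -> R) s : h =1 k -> mob h s = mob k s.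
by move=> hk; apply: eq_ssum => y; rewrite hk. Qed.

Lemma moebius (T : Type) (h : seq T -> R) y : ssum (fun s _ => mob h s) y = h y.
elim: y h => [|a y IH] h; first by rewrite /mob /= mulr1.
rewrite /= -ssum_add -[RHS](IH (fun s => h (a :: s))); apply: eq_ssum => s _.
by rewrite mob_cons subrK.
Qed.

Lemma mob_symm (T : eqType) (h : seq T -> R) : symm h -> symm (mob h).
have cs (k : seq T -> R) a : symm k -> symm (fun s => k (a :: s)).
 by move=> sk u v uv; apply: sk; rewrite perm_cons.
have C (t1 t2 : seq T) a k : symm k -> mob k (t1 ++ a :: t2) = mob k (a :: t1 ++ t2).
 elim: t1 k => [//|b t1 IH] k sk; rewrite cat_cons mob_cons !IH//; last exact: cs.
 rewrite !mob_cons (eq_mob (k := fun x => k [:: a, b & x])); first by ring.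
 by move=> x; apply: sk; exact/permPl/(perm_catCA [:: b] [:: a]).
move=> sh s; elim: s h sh => [|a s IH] h sh t st; first by move: st; rewrite perm_sym => /perm_nilP ->.
have ta : a \in t by rewrite -(perm_mem st) mem_head.
case/path.splitPr: ta st => t1 t2 st; rewrite C// !mob_cons.
have st' : perm_eq s (t1 ++ t2).
 by rewrite -(perm_cons a) (perm_trans st)//; exact/permPl/(perm_catCA t1 [:: a]).
by rewrite (IH _ (cs _ a sh) _ st') (IH _ sh _ st').
Qed.

Lemma mob_le (T : Type) (h : seq T -> R) s : (forall x, `|h x| <= 1) -> `|mob h s| <= 2 ^+ size s.
elim: s h => [|a s IH] h h1; first by rewrite /mob /= mulr1.
rewrite mob_cons exprS mulrDl mul1r; apply: le_trans (ler_normB _ _) _.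
by apply: lerD; apply: IH .
Qed.

(** Binomial theorem. The right side is the probability that no entry survives when each is kept
    independently with probability t. *)
Lemma ssum_pow (T : Type) (t : R) (y : seq T) :
 ssum (fun s _ => (- t) ^+ size s) y = (1 - t) ^+ size y.
elim: y => [//|a y IH] /=; rewrite exprS mulrDl mul1r -IH addrC; congr (_ + _).
rewrite ssum_morph; last by move=> x z; rewrite mulrDr.
by apply: eq_ssum => s _; rewrite exprS.
Qed.

End factorial_words.

(** * Coloured points and their counts *)

Section tuples_over.
Variables (T : eqType) (I : eqType) (c : T -> option I).

Fixpoint tuples_over (u : seq T) n : seq (n.-tuple T) :=
 match n with
 | 0 => [:: [tuple]]
 | n'.+1 => [seq cons_tuple a t | a <- u, t <- tuples_over u n']
 end.

Lemma mem_tuples_over u n (t : n.-tuple T) : (t \in tuples_over u n) = all [in u] t.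
elim: n t => [|n IH] t; first by rewrite tuple0.
case/tupleP: t => a t /=; apply/allpairsP/andP => [[[b s] /= [bu su [-> ts]]]|[au tu]].
 by split=> //; rewrite ts -IH.
by exists (a, t); rewrite IH.
Qed.

Lemma uniq_tuples_over u n : uniq u -> uniq (tuples_over u n).
move=> uu; elim: n => [//|n IH] /=; apply: allpairs_uniq => //.
by move=> [a t] [b s] _ _ [-> /val_inj ->].
Qed.

(** The image of the multiplicities under the colouring [c], the uncoloured points being
    discarded. *)
Definition pushc (u : seq T) (m : T -> nat) i := (\sum_(a <- u) (c a == Some i) * m a)%N.

Lemma pushc_sub u m a b : uniq u -> a \in u -> c a = Some b -> (0 < m a)%N ->
 pushc u (fun z => m z - (z == a))%N =1 (fun i => pushc u m i - (i == b))%N.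
move=> uu au cab ma i.
have -> : pushc u m i = (pushc u (fun z => m z - (z == a)) i + (i == b))%N.
 have -> : (i == b : nat) = (\sum_(z <- u) (c z == Some i) * (z == a))%N.
  rewrite (bigD1_seq a)//= eqxx muln1 cab big1 ?addn0 => [|z /negbTE ->]; last by rewrite muln0.
  by congr nat_of_bool; apply/eqP/eqP => [->|[]].
 rewrite -big_split; apply: eq_bigr => z _; rewrite /= -mulnDr; congr (_ * _)%N.
 by have [->|_] := eqVneq; rewrite ?subnK.
by rewrite addnK.
Qed.

(** Choosing points without replacement and then reading their colours, or choosing the colours
    directly, gives the same count. *)
Lemma sum_tuples_over u m (w : seq I) n : uniq u -> size w = n ->
 (\sum_(t <- tuples_over u n) (map c t == map Some w) * fm m t = fm (pushc u m) w)%N.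
move=> uu; elim: n w m => [|n IH] [|b w] m //= => [_|/succn_inj wn]; first by rewrite big_seq1.
rewrite big_allpairs_dep /=.
transitivity (\sum_(a <- u) ((c a == Some b) * m a) * fm (fun i => pushc u m i - (i == b)) w)%N; last first.
 by rewrite -big_distrl.
apply: eq_big_seq => a au.
under eq_bigr do rewrite eqseq_cons -mulnb mulnCA -mulnA mulnCA mulnC -mulnA.
have [cab|_] := eqVneq; last first.
 by rewrite big1// => t _; rewrite !(muln0).
have [m0|mp] := posnP (m a); first by rewrite m0 big1//.
rewrite mul1n -(eq_fm _ (pushc_sub uu au cab mp)) -IH// big_distrr /=; apply: eq_bigr => t _.
ring.
Qed.

End tuples_over.

Section counts.
Variables (R : realType) (d : nat) (U : set 'rV[R[i]]_d) (I : finType).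
Local Notation Cd := 'rV[R[i]]_d.
Variables (c : Cd -> option I) (L0 : set Cd).
Hypotheses (mc : forall i, measurable (c @^-1` [set Some i])) (rc : rcpt U L0)
 (cL : forall z, c z != None -> L0 z).
Implicit Type X : configuration U.

Lemma rcS (A B : set Cd) : A `<=` B -> rcpt U B -> rcpt U A.
move=> AB [cB BU]; split; last by apply: subset_trans BU; exact: closure_subset.
by apply: subclosed_compact cB _; [exact: closed_closure|exact: closure_subset].
Qed.

Definition npts X i := npoints X (c @^-1` [set Some i]).

Lemma m_npts i n : measurable [set X | npts X i = n].
apply: sub_sigma_algebra; exists (c @^-1` [set Some i]), n; split=> //.
by apply: rcS rc => z cz; apply: cL; rewrite cz.
Qed.

Lemma support_list X (B : set Cd) : rcpt U B ->
 exists2 u : seq Cd, uniq u & forall z, B z -> X z != 0%N -> z \in u.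
move=> rB; have /finite_seqP[s sE] := mult_locally_finite X rB; exists (undup s).
 exact: undup_uniq.
move=> z Lz Xz; rewrite mem_undup; have : [set` s] z by rewrite -sE.
by [].
Qed.

Lemma npoints_sum X (B : set Cd) u : uniq u -> (forall z, B z -> X z != 0%N -> z \in u) ->
 npoints X B = (\sum_(a <- u) `[< B a >] * X a)%N.
move=> uu Bu; rewrite /npoints.
rewrite -(@fsbig_widen _ _ _ _ [set` [seq a <- u | `[< B a >]]]).
- rewrite -fsbig_seq ?filter_uniq// big_filter big_mkcond; apply: eq_bigr => a _.
 by case: asboolP; rewrite ?mul1n.
- by move=> z /=; rewrite mem_filter => /andP[/asboolP].
- move=> z [Bz] /=; rewrite mem_filter (asboolT Bz) /= => /negP zu.
 by apply/eqP; apply: contraNT zu ; exact: Bu.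
Qed.

Lemma factorial_multE X n (t : n.-tuple Cd) : factorial_mult X t = fm X t.
rewrite /factorial_mult; elim: n t (mult X) => [|n IH] t m; first by rewrite big_ord0 tuple0.
case/tupleP: t => a t; rewrite big_ord_recl /= -(IH); congr (_ * _)%N.
 by rewrite -sum1_card big_pred0 ?subn0 .
apply: eq_bigr => i _; rewrite tnthS -subnDA; congr (_ _)%N.
rewrite -!sum1_card big_mkcond big_ord_recl !inE /= eq_sym; congr (_ + _)%N.
rewrite [RHS]big_mkcond; apply: eq_bigr => j _.
by rewrite !inE !tnthS.
Qed.

Lemma esum_factorial_mult X n (w : n.-tuple I) :
 \esum_(t in [set t : n.-tuple Cd | map c t = map Some w]) (factorial_mult X t)%:R%:E =
 (fm (npts X) w)%:R%:E :> \bar R.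
have [u uu uP] := support_list X rc.
have cu z : c z != None -> X z != 0%N -> z \in u by move=> /cL; exact: uP.
have -> : fm (npts X) w = fm (pushc c u X) w.
 apply: eq_fm => i; rewrite /npts (npoints_sum uu) => [|z cz]; last by apply: cu; rewrite cz.
 by apply: eq_bigr => a _; congr (nat_of_bool _ * _)%N; apply/asboolP/eqP.
rewrite -(sum_tuples_over c X uu (size_tuple w)) natr_sum -sumEFin.
pose S := [seq t : n.-tuple Cd <- tuples_over u n | map c t == map Some w].
have fm_u (t : seq Cd) : all (fun z => c z != None) t -> fm X t != 0%N -> all [in u] t.
 elim: t (mult X) cu => [//|a t IH] m mu /= /andP[ca ct]; rewrite muln_eq0 negb_or => /andP[ma mt].
 rewrite mu//; apply: (IH _ _ ct mt) => z cz mz; apply: mu => //.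
 by apply: contraNneq mz => ->.
transitivity (\esum_(t in [set` S]) ((factorial_mult X t)%:R%:E : \bar R)).
 rewrite esum_mkcond [RHS]esum_mkcond; apply: eq_esum => t _.
 have [/set_mem/= ct|nct] := boolP (t \in [set t : n.-tuple Cd | map c t = map Some w]).
  have [] := boolP (t \in [set` S]); first by [].
  rewrite notin_setE /= mem_filter ct eqxx /= mem_tuples_over factorial_multE => /negP ntu.
  have [->//|ft] := eqVneq (fm X t) 0%N.
  have ca : all (fun z => c z != None) t.
   by rewrite -(all_map c (fun o => o != None)) ct all_map; apply/allP.
  by move: ntu; rewrite (fm_u _).
 rewrite memNset//= mem_filter => /andP[/eqP]; move: nct; rewrite notin_setE; exact.
rewrite esum_fset; [|exact: finite_seq|by []].
rewrite -fsbig_seq ?filter_uniq ?uniq_tuples_over// big_filter big_mkcond; apply: eq_bigr => t _.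
by case: eqP; rewrite ?mul1n ?mul0n// factorial_multE.
Qed.

(** The coloured points as a word sorted by colour. The order is immaterial for symmetric functions,
    and the word takes countably many values, each fixed by finitely many counts, whence
    [m_ptsword]. *)
Definition ptsword X : seq I := flatten [seq nseq (npts X i) i | i <- enum I].

Lemma count_ptsword X i : count_mem i (ptsword X) = npts X i.
rewrite count_flatten -map_comp sumnE big_map big_enum (bigD1 i)//= count_nseq /= eqxx mul1n.
by rewrite big1 ?addn0// => j /negbTE ji; rewrite count_nseq /= ji.
Qed.

Lemma m_ptsword d' (Y : measurableType d') (g : seq I -> Y) :
 measT (fun X => g (ptsword X)).
move=> _ B mB; rewrite setTI.
have -> : (fun X => g (ptsword X)) @^-1` B = \bigcup_(v : seq I)
  (if `[< B (g v) >] then [set X | ptsword X = v] else set0).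
 apply/seteqP; split=> [X BX|X [v _]]; first by exists (ptsword X) => //; rewrite asboolT.
 by case: asboolP => // Bv; rewrite /= => ->.
apply: countable_bigcupT_measurable; first by [].
move=> v; case: asboolP => // _.
pose cn := flatten [seq nseq (count_mem i v) i | i <- enum I].
have [vE|nv] := eqVneq v cn.
 rewrite (_ : [set X | _] = \bigcap_(i in [set: I]) [set X | npts X i = count_mem i v]).
  by apply: fin_bigcap_measurable => // i _; exact: m_npts.
 apply/seteqP; split=> [X <- i _|X H]; first by rewrite count_ptsword.
 rewrite vE; congr flatten; apply: eq_map => i; by rewrite H.
rewrite (_ : [set X | _] = set0)//; apply/seteqP; split=> // X /= Xv.
case/eqP: nv; rewrite /cn -Xv; congr flatten; apply: eq_map => i.
by rewrite count_ptsword.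
Qed.

End counts.

(** * Campbell's formula *)

Section campbell.
Variables (R : realType) (d : nat) (U : set 'rV[R[i]]_d) (I : finType).
Local Notation Cd := 'rV[R[i]]_d.
Local Notation V := (@lebesgue_Cn R d).
Variables (c : Cd -> option I) (L0 : set Cd).
Hypotheses (mc : forall i, measurable (c @^-1` [set Some i])) (rc : rcpt U L0)
 (cL : forall z, c z != None -> L0 z).
Variables (P : probability (configuration U) R) (r : seq Cd -> R) (W0 : Cd -> R).
Hypotheses (r0 : forall s, 0 <= r s) (mr : measT r) (W00 : forall z, 0 <= W0 z)
 (mW0 : measT W0).
Hypothesis corr : forall l (A : set (l.-tuple Cd)), measurable A ->
 A `<=` [set t | forall i, U (tnth t i)] ->
 correlation_measure P A = (\int[tuple_measure V l]_(t in A) (r t * wprod W0 t)%:E)%E.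
Local Notation N := (npts (U := U) c).
Local Notation word := (ptsword (U := U) c).
Implicit Type f : seq I -> R.

Definition cweight z := W0 z * (c z != None)%:R.

Definition pull f (s : seq Cd) := if all (fun z => c z != None) s then f (pmap c s) else 0.

Lemma all_pmap (s : seq Cd) (w : seq I) : map c s = map Some w ->
 all (fun z => c z != None) s /\ pmap c s = w.
by elim: s w => [|a s IH] [|b w] //= [-> /IH[-> ->]]. Qed.

Lemma pmap_all (s : seq Cd) : all (fun z => c z != None) s -> map c s = map Some (pmap c s).
by elim: s => //= a s IH; case: c => // i /IH ->. Qed.

Lemma pull_sum f n (t : n.-tuple Cd) :
 pull f t = \sum_(w : n.-tuple I) f w * (map c t == map Some w)%:R.
rewrite /pull; case: ifP => [ct|nct].
 have pn : size (pmap c t) == n by have /(congr1 size) := pmap_all ct; rewrite !size_map size_tuple => <-.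
 rewrite (bigD1 (Tuple pn))//= -(pmap_all ct) eqxx mulr1 big1 ?addr0// => w wn.
 case: eqP => [/all_pmap[_ E]|]; last by rewrite mulr0.
 by case/eqP: wn; apply: val_inj.
rewrite big1// => w _; case: eqP => [/all_pmap[E _]|]; last by rewrite mulr0.
by rewrite E in nct.
Qed.

Lemma wprod_cweight (s : seq Cd) : wprod cweight s = if all (fun z => c z != None) s then wprod W0 s else 0.
elim: s => [|a s IH] /=; first by rewrite !wprod_nil.
rewrite !wprod_cons IH /cweight; case: (c a != None); rewrite /= ?mulr1 ?mulr0 ?mul0r//.
by case: ifP; rewrite ?mulr0.
Qed.

Let word_set n (w : n.-tuple I) : set (n.-tuple Cd) := [set t : n.-tuple Cd | map c t = map Some w].

Let m_word_set n (w : n.-tuple I) : measurable (word_set w).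
rewrite (_ : word_set w = \bigcap_(k in [set: 'I_n]) (setT `&` (fun t => tnth t k) @^-1` (c @^-1` [set Some (tnth w k)]))).
 by apply: fin_bigcap_measurable => // k _; exact: measurable_tnth.
apply/seteqP; split=> [t tw k _|t tw].
 have E : map_tuple c t = map_tuple Some w by exact: val_inj.
 by split; have := congr1 (fun s => tnth s k) E; rewrite !tnth_map.
have : map_tuple c t = map_tuple Some w.
 by apply: eq_from_tnth => k; rewrite !tnth_map; have [_] := tw k Logic.I.
by move/(congr1 val).
Qed.

Let m_word_ind n (w : n.-tuple I) : measT (fun t : n.-tuple Cd => (map c t == map Some w)%:R : R).
rewrite (_ : (fun _ => _) = \1_(word_set w)).
 by apply: mindic; exact: m_word_set.
by apply/funext => t; congr (nat_of_bool _)%:R; apply/eqP/idP; rewrite inE.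
Qed.

Lemma m_pull f : measT (pull f).
apply/m_fun_seqP => n.
rewrite (_ : (fun t => _) = fun t : n.-tuple Cd => \sum_(w : n.-tuple I) f w * (map c t == map Some w)%:R).
 by apply: measurable_sum => w; apply: mfM; [by []|exact: m_word_ind].
by apply/funext ; exact: pull_sum.
Qed.

Lemma m_cweight : measT cweight.
apply: mfM => //.
rewrite (_ : (fun z => _) = \1_(\bigcup_(i : I) c @^-1` [set Some i])).
 by apply: mindic; apply: countable_bigcupT_measurable; first exact: countableP.
apply/funext => z; rewrite indicE; congr (nat_of_bool _)%:R.
apply/idP/idP; rewrite inE /=; last by move=> [i _ /= ->].
by case E : (c z) => [i|//] _; exists i.
Qed.

Lemma cweight_ge0 z : 0 <= cweight z. Proof. exact: mulr_ge0. Qed.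

Let integral_word n (w : n.-tuple I) :
 (\int[P]_X (fm (N X) w)%:R%:E = \int[tuple_measure V n]_t ((map c t == map Some w)%:R * (r t * wprod cweight t))%:E)%E.
transitivity (correlation_measure P (word_set w)).
 by apply: eq_integral => X _; rewrite (esum_factorial_mult rc).
rewrite corr; [|by []|]; last first.
 move=> t tw i; apply: rc.2; apply: subset_closure; apply: cL.
 have [/allP ct _] := all_pmap tw; apply: ct; exact: mem_tnth.
rewrite integral_mkcond; apply: eq_integral => t _; rewrite /patch wprod_cweight.
case: ifPn => [/set_mem tw|]; last by rewrite notin_setE => /eqP/negbTE ->; rewrite mul0r.
by have [ct _] := all_pmap tw; rewrite ct tw eqxx mul1r.
Qed.

Lemma campbell_series f : (forall s, 0 <= f s) ->
 (\int[P]_X \sum_(0 <= n <oo) (n`!%:R^-1 * \sum_(w : n.-tuple I) f w * (fm (N X) w)%:R)%:E =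
  \int[lp V]_s (pull f s * (r s * wprod cweight s))%:E)%E.
move=> f0; have mfm w : measT (fun X => (fm (N X) w)%:R : R).
 rewrite (_ : (fun X => _) = fun X => (fun v => (fm (fun z => count_mem z v) w)%:R) (word X)); last first.
  by apply/funext => X; congr (_%:R); apply: eq_fm => i; rewrite count_ptsword.
 exact: (m_ptsword mc rc cL (fun v => (fm (fun z => count_mem z v) w)%:R : R)).
have mpw : measT (fun s => r s * wprod cweight s).
 by apply: mfM => //; apply: m_wprod; exact: m_cweight.
have pw0 s : 0 <= r s * wprod cweight s by rewrite mulr_ge0// wprod_ge0//; exact: cweight_ge0.
rewrite integral_nneseries//; last 2 first.
- move=> n; apply/mEFinP; apply: mfM; first by [].
 by apply: measurable_sum => w; apply: mfM.
- move=> n X _; rewrite lee_fin mulr_ge0 ?invr_ge0// sumr_ge0// => w _; exact: mulr_ge0.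
rewrite ge0_integral_lp; last 2 first.
- by apply/mEFinP; apply: mfM => //; exact: m_pull.
- by move=> s; rewrite lee_fin mulr_ge0// /pull; case: ifP.
apply: eq_eseriesr => n _.
have mt : measT (fun t : n.-tuple Cd => r t * wprod cweight t).
 exact: (mpre mpw (@m_tval _ _ n)).
under eq_integral do rewrite EFinM.
have mS : measT (fun X : configuration U => (\sum_(w : n.-tuple I) f w * (fm (N X) w)%:R)%:E).
 by apply/mEFinP; apply: measurable_sum => w; apply: mfM.
rewrite (@ge0_integralZl _ _ R P setT measurableT _ mS); last 2 first.
- by move=> X _; rewrite lee_fin sumr_ge0// => w _; exact: mulr_ge0.
- by [].
congr (_ * _)%E; under eq_integral do rewrite -sumEFin.
rewrite ge0_integral_sum//; last 2 first.
- by move=> w; apply/mEFinP; apply: mfM .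
- by move=> w X _; rewrite lee_fin mulr_ge0.
under eq_integral do rewrite pull_sum mulr_suml -sumEFin.
rewrite ge0_integral_sum//; last 2 first.
- move=> w; apply/mEFinP; apply: mfM => //.
 by apply: mfM; [by []|exact: m_word_ind].
- by move=> w t _; apply: mulr_ge0; [exact: mulr_ge0|by []].
apply: eq_bigr => w _; under eq_integral do rewrite EFinM.
under [RHS]eq_integral do rewrite -mulrA EFinM.
rewrite !ge0_integralZl ?lee_fin//; first by rewrite integral_word.
- by apply/mEFinP; apply: mfM; [exact: m_word_ind|exact: mt].
- by move=> t _; apply: mulr_ge0 .
- by apply/mEFinP.
Qed.

(** Sorted by size, the subfamilies of the word give factorial moments divided by n!, by [sum_fm].
    Each moment is an integral of a correlation function, and the factorials assemble them into one
    integral against [lp]. *)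
Lemma campbell f : (forall s, 0 <= f s) -> symm f ->
 (\int[P]_X (ssum (fun s _ => f s) (word X))%:E =
  \int[lp V]_s (pull f s * (r s * wprod cweight s))%:E)%E.
move=> f0 sf; rewrite -campbell_series//; apply: eq_integral => X _.
have E n : n`!%:R^-1 * (\sum_(w : n.-tuple I) f w * (fm (N X) w)%:R) =
  ssum (fun s _ => (size s == n)%:R * f s) (word X).
 under eq_bigr => w _ do rewrite (@eq_fm _ (N X) (fun z => count_mem z (word X)) w (fun i => esym (count_ptsword c X i))).
 by rewrite sum_fm// mulKf.
under eq_eseriesr do rewrite E.
apply/esym/cvg_lim => //; apply: cvg_near_cst; exists (size (word X)).+1 => // n /= nw.
by rewrite sumEFin sum_ssum_size ssum_size.
Qed.

Variables (kap : Cd -> R) (C0 : R).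
Hypotheses (kap0 : forall z, 0 <= kap z) (mkap : measT kap) (C00 : 0 <= C0)
 (gw : L1 V (fun z => kap z * cweight z)) (rk : forall s, r s <= C0 * wprod kap s).

(** A geometric bound in the size is absorbed by [L1_wprod], so positive and negative parts have
    finite integrals. The bound cannot be uniform in the size: Moebius transforms grow like powers
    of 2. *)
Lemma campbell_real f (C : R) : symm f -> 0 <= C -> (forall s, `|f s| <= C ^+ size s) ->
 (\int[P]_X ssum (fun s _ => f s) (word X) = EW V cweight (fun s => pull f s * r s))%R.
move=> sf C1 fC.
have mpw : measT (fun s => r s * wprod cweight s).
 by apply: mfM => //; apply: m_wprod; exact: m_cweight.
have pw0 s : 0 <= r s * wprod cweight s by rewrite mulr_ge0// wprod_ge0//; exact: cweight_ge0.
have key g : symm g -> (forall s, 0 <= g s) -> (forall s, g s <= C ^+ size s) ->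
  [/\ L1 P (fun X => ssum (fun s _ => g s) (word X)),
   L1 (lp V) (fun s => pull g s * (r s * wprod cweight s)) &
  (\int[P]_X ssum (fun s _ => g s) (word X) = \int[lp V]_s (pull g s * (r s * wprod cweight s)))%R].
 move=> sg g0 gC; have mg := m_pull g.
 have ig : L1 (lp V) (fun s => pull g s * (r s * wprod cweight s)).
  have mC : measT (fun z => C * (kap z * cweight z)).
   by apply: mfM; [by []|apply: mfM => //; exact: m_cweight].
  apply: le_L1 (L1Z C0 (L1_wprod mC _ (L1Z C gw))).
  - exact: mfM.
  - move=> s; have wp := wprod_ge0 s cweight_ge0; have kp := wprod_ge0 s kap0.
   have -> : wprod (fun z => C * (kap z * cweight z)) s = C ^+ size s * (wprod kap s * wprod cweight s).
    rewrite !wprodM; congr (_ * _); elim: s {wp kp} => [|a s IH]; first by rewrite wprod_nil.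
    by rewrite wprod_cons IH exprS.
   have pg : 0 <= pull g s <= C ^+ size s.
    by rewrite /pull; case: ifP => [ct|_]; rewrite ?lexx ?exprn_ge0// g0 (le_trans (gC _))// -(size_map Some) -pmap_all// size_map.
   have /andP[pg0 pgC] := pg; rewrite ger0_norm ?mulr_ge0//.
   have A (a b u v : R) : a * (b * (u * v)) = b * ((a * u) * v) by ring.
   rewrite A.
   apply: ler_pM; [by []|by []|by []|by rewrite ler_wpM2r].
  - by move=> z; rewrite !mulr_ge0.
 have E := campbell g0 sg.
 have ip : L1 P (fun X => ssum (fun s _ => g s) (word X)).
  apply: ge0_L1P.
  - exact: (m_ptsword mc rc).
  - by move=> X; rewrite -(ssum0 (word X) (fun _ _ => erefl)); apply: ssum_le.
  - rewrite E; apply: L1_lty ig _ => s; rewrite mulr_ge0// /pull; by case: ifP.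
 by split=> //; rewrite /Rintegral E.
pose p s := Num.max (f s) 0; pose n s := Num.max (- f s) 0.
have pn s : f s = p s - n s.
 by rewrite /p /n /Num.max oppr_lt0; case: (ltgtP) => [h|h|->]; rewrite ?sub0r ?opprK ?subr0.
have [sp sn] : symm p /\ symm n by split=> u v uv; rewrite /p /n (sf _ _ uv).
have p0 s : 0 <= p s by rewrite le_max lexx orbT.
have n0 s : 0 <= n s by rewrite le_max lexx orbT.
have fC' s : - C ^+ size s <= f s <= C ^+ size s by rewrite -ler_norml.
have pC s : p s <= C ^+ size s by rewrite ge_max exprn_ge0// andbT; have /andP[] := fC' s.
have nC s : n s <= C ^+ size s by rewrite ge_max exprn_ge0// andbT lerNl; have /andP[] := fC' s.
have [i1 j1 E1] := key p sp p0 pC; have [i2 j2 E2] := key n sn n0 nC.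
transitivity (\int[P]_X (ssum (fun s _ => p s) (word X) - ssum (fun s _ => n s) (word X)))%R.
 apply: eq_rint => X; rewrite (@eq_ssum _ _ _ (fun s _ => p s + - n s)) => []//.
 rewrite ssum_add; congr (_ + _).
 by rewrite -(ssum_morph)// => x z; rewrite opprD.
rewrite (RintB i1 i2) E1 E2 -(RintB j1 j2); apply: eq_rint => s.
by rewrite -mulrBl -mulrA; rewrite /pull; case: ifP; rewrite ?subrr// -pn.
Qed.

End campbell.

Lemma eq_ssum_perm (T : eqType) (Z : nmodType) (s : seq T) (g h : seq T -> seq T -> Z) :
 (forall x y, perm_eq (x ++ y) s -> g x y = h x y) -> ssum g s = ssum h s.
elim: s g h => [|a s IH] g h gh /=; first exact: gh.
congr (_ + _); apply: IH => x y xy; apply: gh; first by rewrite perm_cons.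
by rewrite - cat1s perm_catCA perm_cons.
Qed.

(** * Probabilities as integrals of Janossy densities *)

Section law.
Variables (R : realType) (d : nat) (U : set 'rV[R[i]]_d).
Local Notation Cd := 'rV[R[i]]_d.
Local Notation V := (@lebesgue_Cn R d).
Variables (W0 : Cd -> R) (Hol : set (Cd -> R[i])) (B : nat -> set Cd) (K : Cd -> Cd -> R[i]).
Hypothesis rk : rkhs V W0 Hol B K.
Local Notation kap := (kap K).
Local Notation rho := (rho K).
Local Notation jan := (jan V K).

(** The process itself is the case [p = [::]]. Length 0 is included, where the formula says that the
    total mass is 1. *)
Definition palm_law (p : seq Cd) (P : probability (configuration U) R) :=
 forall l (A : set (l.-tuple Cd)), measurable A -> A `<=` [set t | forall i, U (tnth t i)] ->
 correlation_measure P A = (\int[tuple_measure V l]_(t in A) (rho (p ++ t) / rho p * wprod W0 t)%:E)%E.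

Variables (I : finType) (c : Cd -> option I) (L0 : set Cd).
Hypotheses (mc : forall i, measurable (c @^-1` [set Some i])) (rc : rcpt U L0)
 (cL : forall z, c z != None -> L0 z).
Local Notation w := (cweight c W0).
Local Notation word := (ptsword (U := U) c).
Hypothesis gw : L1 V (fun z => kap z * w z).
Let mw : measT w := m_cweight mc (rkhs_mW rk).
Let w0 z : 0 <= w z := cweight_ge0 c (rkhs_W0 rk) z.
Let kap0 := kap_ge0 rk.
Let mkap := m_kap rk.

Section palm.
Variables (p : seq Cd) (P : probability (configuration U) R).
Hypotheses (rp : 0 < rho p) (Pp : palm_law p P).

Lemma palm_campbell (f : seq I -> R) (C : R) : symm f -> 0 <= C -> (forall s, `|f s| <= C ^+ size s) ->
 (\int[P]_X ssum (fun s _ => f s) (word X) = EW V w (fun s => pull c f s * (rho (p ++ s) / rho p)))%R.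
have rhop s : 0 <= rho (p ++ s) / rho p by rewrite divr_ge0 ?(rho_ge0 rk).
have mr : measT (fun s => rho (p ++ s) / rho p).
 by apply: mfM; [exact: m_rho_cat rk p|exact: measurable_cst].
apply: (@campbell_real R d U I c L0 mc rc cL P (fun s => rho (p ++ s) / rho p) W0 rhop mr
 (rkhs_W0 rk) (rkhs_mW rk) Pp kap (wprod kap p / rho p) kap0 mkap gw).
move=> s; rewrite mulrAC ler_pM2r ?invr_gt0//; exact: le_trans (ler_norm _) (rho_dom rk p s).
Qed.

Lemma pull_mob (h : seq I -> R) (s : seq Cd) : all (fun z => c z != None) s ->
 pull c (mob h) s = mob (pull c h) s.
rewrite {1}/pull => cs; rewrite cs; elim: s h cs => [|a s IH] h //=.
case E : (c a) => [i|]//= cs; rewrite !mob_cons !IH//; congr (_ - _).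
by apply: eq_mob ; rewrite /pull /= E.
Qed.

Lemma pull_le (h : seq I -> R) s : (forall x, 0 <= h x <= 1) -> 0 <= pull c h s <= 1.
by rewrite /pull; case: ifP; rewrite ?lexx ?ler01. Qed.

(** Moebius inversion writes the indicator as a sum over subfamilies, whose expectation is given by
    Campbell's formula. The signs (-1)^|y| of the transform join the weights of [y], and summing
    over [y] rebuilds the series of [jan]. *)
Lemma palm_probability (h : seq I -> bool) : symm (fun s => (h s)%:R : R) ->
 P [set X | h (word X)] = ((EW V w (fun s => pull c (fun t => (h t)%:R) s * jan w (p ++ s))) / rho p)%:E.
move=> sh; pose H s : R := (h s)%:R; have H01 x : 0 <= H x <= 1 by rewrite ler0n lern1 leq_b1.
have mD : measurable [set X | h (word X)].
 rewrite (_ : [set X | _] = setT `&` (fun X => H (word X)) @^-1` [set 1]).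
  exact: (m_ptsword mc rc).
 rewrite setTI; apply/seteqP; split=> X /=; rewrite /H; first by move=> ->.
 by case: (h _) => // /esym/eqP; rewrite oner_eq0.
have mH : measT (fun x => pull c H x) := m_pull mc H.
have gw' : gweight V kap w by [].
have gN : gweight V kap (fun x => - w x) := gweight_opp mw gw.
have mf : measT (fun q : seq Cd * seq Cd => pull c H q.1 * rho (p ++ (q.1 ++ q.2))).
 apply: mfM; first exact: mpre.
 exact: mpre (m_rho_cat rk p) (@m_seq_cat _ _).
have kf : kdom2 kap (fun x y => pull c H x * rho (p ++ (x ++ y))).
 exists (wprod kap p) => [|x y]; first exact: wprod_ge0.
 rewrite normrM -wprod_cat -[leRHS]mul1r; apply: ler_pM => //; last exact: (rho_dom rk).
 by have /andP[ ?] := pull_le x H01; rewrite ger0_norm.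
have [iE E] := EW_ssum mkap kap0 gw' gN mf kf.
have -> : EW V w (fun s => pull c H s * jan w (p ++ s)) =
  EW V w (fun x => EW V (fun z => - w z) (fun y => pull c H x * rho (p ++ (x ++ y)))).
 apply: EW_ext => x; rewrite (EWZ mkap)//.
 - by congr (_ * _); apply: EW_ext => y; rewrite catA.
 - exact: mpre (m_rho_cat rk p) (m_cat_section x).
 - exists (wprod kap p * wprod kap x) => [|y]; first by rewrite mulr_ge0 ?wprod_ge0.
  by rewrite -mulrA -wprod_cat; exact: (rho_dom rk).
rewrite -(fineK (fin_num_measure P _ mD)); congr EFin.
transitivity (\int[P]_X ssum (fun s _ => mob H s) (word X))%R.
 rewrite /Rintegral; congr fine; have := @integral_indic _ _ R P setT measurableT _ mD.
 rewrite setIT => <-; apply: eq_integral => X _.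
 by rewrite moebius; congr (nat_of_bool _)%:R%:E; apply/idP/idP; rewrite inE.
rewrite (palm_campbell (mob_symm sh) (C := 2))//; last first.
 by move=> s; apply: mob_le => x; have /andP[] := H01 x; rewrite ger0_norm.
rewrite -E mulrC -(RintZ _ iE); apply: eq_rint => s.
rewrite (@eq_ssum_perm _ _ _ _ (fun x y => rho (p ++ s) * (pull c H x * (-1) ^+ size y * (wprod w x * wprod w y)))).
 rewrite ssumZ ssum_wprod_same wprod_cweight.
 by case: ifP => cs; rewrite ?mulr0// pull_mob// /mob; ring.
move=> x y xy; have -> : wprod (fun z => - w z) y = (-1) ^+ size y * wprod w y.
 by rewrite -wprod_scale; apply: eq_bigr => z _; rewrite mulN1r.
have -> : rho (p ++ (x ++ y)) = rho (p ++ s) by apply: rho_perm; rewrite perm_cat2l.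
ring.
Qed.

End palm.

(** Campbell's formula for s => (- t)^|s|: by [ssum_pow] the sum over subfamilies is (1 - t)^N,
    which is nonnegative. *)
Lemma law_subw (P : probability (configuration U) R) : palm_law [::] P -> subw V W0 K w.
move=> PP; split=> // [z|t /andP[t0 t1]].
 rewrite w0 /cweight; have := rkhs_W0 rk z.
 by case: (c z != None) ; rewrite ?mulr1 ?mulr0 ?lexx.
have r1 : 0 < rho [::] by rewrite rho_nil.
have S : symm (fun s : seq I => (- t) ^+ size s) by move=> u v /perm_size ->.
have B1 (s : seq I) : `|(- t) ^+ size s| <= 1 ^+ size s.
 by rewrite normrX normrN ger0_norm// expr1n exprn_ile1// ltW.
suff -> : jan (fun x => t * w x) [::] = (\int[P]_X ssum (fun s _ => (- t) ^+ size s) (word X))%R.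
 by apply: Rint_ge0 => X; rewrite ssum_pow exprn_ge0// subr_ge0 ltW.
rewrite (palm_campbell r1 PP S ler01 B1); apply: eq_rint => s.
have -> : wprod (fun x => - (t * w x)) s = (- t) ^+ size s * wprod w s.
 by rewrite -wprod_scale; apply: eq_bigr => z _; rewrite mulNr.
rewrite wprod_cweight rho_nil divr1 /pull; case: ifP => cs; last by rewrite !mulr0.
have -> : size (pmap c s) = size s by rewrite -(size_map Some) -pmap_all// size_map.
by rewrite mulrCA mulrA.
Qed.

End law.

(** * Local events and approximation of measurable events *)

Section local_events.
Variables (R : realType) (d : nat) (U : set 'rV[R[i]]_d).
Local Notation Cd := 'rV[R[i]]_d.
Local Notation V := (@lebesgue_Cn R d).
Variables (W0 : Cd -> R) (Hol : set (Cd -> R[i])) (K : Cd -> Cd -> R[i]).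
Hypotheses (oU : open U) (rk : rkhs V W0 Hol (exh U) K).
Variable F : nat -> set Cd.
Hypotheses (FT : forall z, exists n, F n z) (ndF : forall n m, (n <= m)%N -> F n `<=` F m)
 (Foo : forall n, measurable (F n) /\ (V (F n) < +oo)%E).
Local Notation kap := (kap K).
Local Notation rho := (rho K).
Local Notation jan := (jan V K).
Local Notation Om := (configuration U).
Implicit Types (X : Om) (D : set Om).

(** Truncating [kap] and [W0] on a set of finite volume makes their product integrable; the windows
    still exhaust [U]. *)
Definition window m := [set z | [/\ exh U m z, F m z, kap z <= m%:R & W0 z <= m%:R]].

Definition restr (A : set Cd) z : R := W0 z * \1_A z.

Lemma le_set (f : Cd -> R) (t : R) : measT f -> measurable [set z | f z <= t].
move=> mf; rewrite (_ : [set z | _] = setT `&` f @^-1` `]-oo, t]); first exact: mf.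
by apply/seteqP.
Qed.

Lemma m_window m : measurable (window m).
rewrite (_ : window m = exh U m `&` F m `&` ([set z | kap z <= m%:R] `&` [set z | W0 z <= m%:R])).
 apply: measurableI; first by apply: measurableI; [exact: m_exh|exact: (Foo m).1].
 by apply: measurableI; apply: le_set; [exact: m_kap rk|exact: rkhs_mW rk].
by apply/seteqP; split=> [z []|z [[? ?] []]].
Qed.

Lemma window_nd n m : (n <= m)%N -> window n `<=` window m.
move=> nm z [h1 h2 h3 h4]; have nmR : n%:R <= m%:R :> R by rewrite ler_nat.
by split; [exact: exh_nd h1|exact: ndF h2|exact: le_trans nmR|exact: le_trans nmR].
Qed.

Lemma window_cover z : U z -> exists m, window m z.
move=> Uz; have [m1 h1] := exh_cover oU Uz; have [m2 h2] := FT z.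
pose m3 := Num.bound (kap z); pose m4 := Num.bound (W0 z).
exists (maxn (maxn m1 m2) (maxn m3 m4)); split.
- by apply: exh_nd h1; rewrite !leq_max leqnn.
- by apply: ndF h2; rewrite !leq_max leqnn orbT.
- apply: le_trans (ltW (archi_boundP (kap_ge0 rk z))) _; by rewrite ler_nat !leq_max leqnn !orbT.
- apply: le_trans (ltW (archi_boundP (rkhs_W0 rk z))) _; by rewrite ler_nat !leq_max leqnn !orbT.
Qed.

Lemma restr_integrable m (A : set Cd) : measurable A -> A `<=` window m ->
 L1 V (fun z => kap z * restr A z).
move=> mA Am; have [mF Fm] := Foo m.
have iF : L1 V (fun z => \1_(F m) z).
 apply: ge0_L1P; [exact: mindic|by []|by rewrite integral_indic// setIT].
apply: le_L1 (L1Z (m%:R * m%:R) iF).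
 apply: mfM; first exact: m_kap rk.
 by apply: mfM; [exact: rkhs_mW rk|by []].
move=> z; have k0 := kap_ge0 rk z; have w0 := rkhs_W0 rk z.
rewrite ger0_norm ?mulr_ge0// /restr !indicE.
have [/set_mem/Am[_ Fz kz wz]|_] := boolP (z \in A); last by rewrite !mulr0.
by rewrite mem_set// !mulr1; exact: ler_pM.
Qed.

Section family.
Variables (J : finType) (Bs : J -> set Cd) (m : nat).
Hypotheses (mB : forall j, measurable (Bs j)) (BA : forall j, Bs j `<=` window m).
Variable G : (J -> nat) -> bool.

Variable A : set Cd.
Hypotheses (mA : measurable A) (Am : A `<=` window m).

(** The colours are the atoms generated by the sets [Bs j] inside [A], so every count in [Bs j] is a
    sum of counts of colours. *)
Definition cell z : option {ffun J -> bool} :=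
 if `[< A z >] then Some [ffun j => `[< Bs j z >]] else None.

Let cell_meas i : measurable (cell @^-1` [set Some i]).
rewrite (_ : _ _ = A `&` \bigcap_(j in [set: J]) (if i j then Bs j else ~` Bs j)).
 apply: measurableI => //; apply: fin_bigcap_measurable => // j _.
 by case: (i j) => //; exact: measurableC.
apply/seteqP; split=> [z|z [Az H]]; rewrite /= /cell.
 case: asboolP => // Az [<-]; split=> // j _; rewrite ffunE; by case: asboolP.
rewrite asboolT//; congr Some; apply/ffunP => j; rewrite ffunE.
by have := H j Logic.I; case: (i j); [move=> Bz; exact/asboolP|move=> nB; exact/asboolP].
Qed.

Let cell_win z : cell z != None -> exh U m z.
by rewrite /cell; case: asboolP => // /Am[]. Qed.

Lemma cweight_cell : cweight cell W0 = restr A.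
apply/funext => z; rewrite /cell; congr (_ * (_)%:R).
by case: asboolP => h; [rewrite mem_set|rewrite memNset].
Qed.

Let gA : L1 V (fun z => kap z * cweight cell W0 z).
by rewrite cweight_cell; exact: restr_integrable Am. Qed.

Lemma restr_subw (P : probability Om R) : palm_law W0 K [::] P -> subw V W0 K (restr A).
move=> PP; rewrite -cweight_cell.
exact: (law_subw rk cell_meas (rc_exh U m) cell_win gA PP).
Qed.

Definition local_fun (s : seq Cd) : R :=
 (all (fun z => `[< A z >]) s && G (fun j => count (fun z => `[< Bs j z >]) s))%:R.

Let h (v : seq {ffun J -> bool}) := G (fun j => count (fun i : {ffun J -> bool} => i j) v).

Lemma local_fun_pull : local_fun = pull cell (fun v => (h v)%:R).
apply/funext => s; rewrite /local_fun /pull.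
have -> : all (fun z => cell z != None) s = all (fun z => `[< A z >]) s.
 by apply: eq_all => z; rewrite /cell; case: asboolP.
case: ifP => // sA; congr (((G _))%:R); apply/funext => j.
elim: s sA => //= z s IH /andP[zA sA]; rewrite /cell zA /= ffunE; congr (_ + _)%N; exact: IH.
Qed.

Lemma m_local_fun : measT local_fun.
rewrite local_fun_pull; exact: m_pull. Qed.

Lemma symf_local_fun : symf local_fun.
move=> s t st; rewrite /local_fun (perm_all _ st); congr (((_ && G _))%:R).
by apply/funext => j; exact: seq.permP.
Qed.

Lemma local_fun01 s : 0 <= local_fun s <= 1.
by rewrite ler0n lern1 leq_b1. Qed.

Lemma npoints_word X j : A = window m -> npoints X (Bs j) = count (fun i : {ffun J -> bool} => i j) (ptsword cell X).
move=> AE; have [u uu uP] := support_list X (rc_exh U m).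
have uB (C : set Cd) : C `<=` window m -> forall z, C z -> X z != 0%N -> z \in u.
 by move=> Cm z /Cm[]; move=> /uP.
rewrite (npoints_sum uu (uB _ (@BA j))) count_flatten -map_comp sumnE big_map big_enum /=.
transitivity (\sum_(i : {ffun J -> bool}) \sum_(a <- u) (i j : nat) * (`[< (cell @^-1` [set Some i]) a >] * X a))%N.
 rewrite exchange_big /=; apply: eq_bigr => a _.
 rewrite (bigD1 [ffun j => `[< Bs j a >]])//= ffunE [X in (_ + X)%N]big1 ?addn0.
  case: asboolP => Ba; rewrite ?mul1n//.
  by rewrite asboolT ?mul1n// /cell asboolT// AE; exact: BA Ba.
 move=> i ia; rewrite asboolF ?muln0// /cell; case: asboolP => // _ [E].
 by rewrite -E eqxx in ia.
apply: eq_bigr => i _; rewrite count_nseq -big_distrr /=; congr (_ * _)%N.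
apply/esym/npoints_sum => // z cz; apply: uB Am _ _.
by move: cz; rewrite /= /cell; case: asboolP.
Qed.

Lemma local_probability p (P : probability Om R) : A = window m -> 0 < rho p -> palm_law W0 K p P ->
 P [set X | G (fun j => npoints X (Bs j))] = (EW V (restr A) (fun s => local_fun s * jan (restr A) (p ++ s)) / rho p)%:E.
move=> AE rp PP; rewrite local_fun_pull -cweight_cell.
rewrite -(palm_probability rk cell_meas (rc_exh U m) cell_win gA rp PP); last first.
 move=> s t st; congr (((G _))%:R); by apply/funext => j; exact: seq.permP.
congr (P _); apply/seteqP; split=> X; congr ((G _));
 by apply/funext => j; rewrite npoints_word.
Qed.

End family.

Definition local m D := exists (J : finType) (Bs : J -> set Cd) (G : (J -> nat) -> bool),
 (forall j, measurable (Bs j) /\ Bs j `<=` window m) /\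
 D = [set X | G (fun j => npoints X (Bs j))].

Lemma localC m D : local m D -> local m (~` D).
move=> [J [Bs [G [H ->]]]]; exists J, Bs, (fun v => ~~ G v); split=> //.
by apply/seteqP; split=> X /negP.
Qed.

Lemma localU m D D' : local m D -> local m D' -> local m (D `|` D').
move=> [J [Bs [G [H ->]]]] [J' [Bs' [G' [H' ->]]]].
exists (J + J')%type, (fun j => match j with inl j => Bs j | inr j => Bs' j end),
 (fun v => G (v \o inl) || G' (v \o inr)); split; first by case.
by apply/seteqP; split=> X /orP.
Qed.

Lemma local_mono m n D : (m <= n)%N -> local m D -> local n D.
move=> mn [J [Bs [G [H ->]]]]; exists J, Bs, G; split=> // j; have [h1 h2] := H j.
by split=> // z /h2; exact: window_nd.
Qed.

Lemma npoints_mono X (B B' : set Cd) : rcpt U B' -> B `<=` B' ->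
 (npoints X B <= npoints X B')%N.
move=> rB BB; have [u uu uP] := support_list X rB.
rewrite (npoints_sum uu uP) (npoints_sum uu (fun z Bz => uP z (@BB z Bz))).
apply: leq_sum => a _; rewrite leq_mul2r; case: asboolP => [Ba|_]; last by rewrite orbT.
by rewrite (asboolT (@BB a Ba)) orbT.
Qed.

Lemma m_npoints (B : set Cd) n : measurable B -> rcpt U B ->
 measurable [set X : Om | npoints X B = n].
by move=> mB rB; apply: sub_sigma_algebra; exists B, n. Qed.

Lemma m_npoints_pred (B : set Cd) (Q : nat -> Prop) : measurable B -> rcpt U B ->
 measurable [set X : Om | Q (npoints X B)].
move=> mB rB; rewrite (_ : [set X | _] = \bigcup_(n in [set n | Q n]) [set X | npoints X B = n]).
 by apply: bigcup_measurable => n _; exact: m_npoints.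
by apply/seteqP; split=> [X QX|X [n Qn /= ->]//]; exists (npoints X B).
Qed.

Lemma npoints_window X (B : set Cd) : rcpt U B ->
 exists m, forall n, (m <= n)%N -> npoints X (B `&` window n) = npoints X B.
move=> rB; have [u uu uP] := support_list X rB.
have BU z : B z -> U z by move=> Bz; apply: rB.2; exact: subset_closure.
have ex (a : Cd) : exists m, B a -> window m a.
 by have [/BU/window_cover[m am]|nB] := pselect (B a); [exists m|exists 0%N].
pose mm a := projT1 (cid (ex a)); exists (\max_(a <- u) mm a) => n un.
rewrite (npoints_sum uu uP) (npoints_sum uu (fun z (Bz : (B `&` window n) z) => uP z Bz.1)).
apply: eq_big_seq => a au; congr (nat_of_bool _ * _)%N.
apply/asboolP/asboolP => [[]//|Ba]; split=> //.
apply: (@window_nd (mm a)); last exact: (projT2 (cid (ex a)) Ba).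
apply: leq_trans un; exact: leq_bigmax_seq.
Qed.

Lemma vanishing_sets (mu : {measure set Om -> \bar R}) (S : nat -> set Om) (e : R) : (mu setT < +oo)%E ->
 (forall n, measurable (S n)) -> (forall n m, (n <= m)%N -> S m `<=` S n) ->
 mu (\bigcap_n S n) = 0 -> 0 < e -> exists n, (mu (S n) <= e%:E)%E.
move=> mu1 mS ndS S0 e0.
have C : mu (S n) @[n --> \oo] --> (0 : \bar R).
 rewrite -S0; apply: nonincreasing_cvg_mu => //.
 - by apply: le_lt_trans mu1; apply: le_measure; rewrite ?inE.
 - exact: bigcapT_measurable.
 - by move=> n m nm; apply/subsetPset; exact: ndS.
apply: contrapT => nex; have : (e%:E <= 0)%E.
 apply: cvge_ge C; apply: nearW => n; apply: ltW; rewrite ltNge; apply/negP => h.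
 by apply: nex; exists n.
by rewrite lee_fin leNgt e0.
Qed.

Section approximation.
Variable mu : {measure set Om -> \bar R}.
Hypothesis mu1 : (mu setT < +oo)%E.
Local Notation "A ^^ B" := ((A `\` B) `|` (B `\` A)) (at level 50).

Definition approx (E : set Om) := measurable E /\ forall e : R, 0 < e ->
 exists m D, [/\ local m D, measurable D & (mu (E ^^ D) <= e%:E)%E].

Lemma m_local m D : local m D -> measurable D.
move=> [J [Bs [G [H ->]]]].
have HM j n : measurable [set X : Om | npoints X (Bs j) = n].
 apply: m_npoints; first exact: (H j).1.
 by apply: rcS (rc_exh U m) => z /(H j).2[].
rewrite (_ : [set X | _] = \bigcup_(v : {ffun J -> nat})
  (if G v then \bigcap_(j in [set: J]) [set X | npoints X (Bs j) = v j] else set0)).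
 apply: countable_bigcupT_measurable => [|v]//.
 by case: G => //; apply: fin_bigcap_measurable.
apply/seteqP; split=> [X /= GX|X [v _]].
 have E : (fun j => npoints X (Bs j)) = [ffun j => npoints X (Bs j)] :> (J -> nat).
  by apply/funext => j; rewrite ffunE.
 exists [ffun j => npoints X (Bs j)] => //.
 rewrite (_ : G _ = true) => [j _|]; [by rewrite ffunE|by rewrite -E].
case: ifP => Gv vX; rewrite /= (_ : (fun => _) = v)//; apply/funext => j; exact: vX.
Qed.

Lemma approx_le (E E' : set Om) : measurable E -> (forall e : R, 0 < e ->
 exists2 E', approx E' & (mu (E ^^ E') <= e%:E)%E) -> approx E.
move=> mE H; split=> // e e0; have e2 : 0 < e / 2 by rewrite divr_gt0.
have [E1 [mE1 aE1] h1] := H _ e2; have [m [D [lD mD h2]]] := aE1 _ e2.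
exists m, D; split=> //; have -> : e%:E = ((e / 2)%:E + (e / 2)%:E)%E by rewrite -EFinD -splitr.
apply: le_trans (leeD h1 h2); apply: le_trans (measureU2 _ _ _); last 2 first.
- by apply: measurableU; apply: measurableD.
- by apply: measurableU; apply: measurableD.
apply: le_measure; rewrite ?inE.
- by apply: measurableU; apply: measurableD.
- by apply: measurableU; apply: measurableU; apply: measurableD.
move=> X [[EX nD]|[DX nE]]; have [E1X|nE1] := pselect (E1 X); by [left; left|left; right|right; left|right; right].
Qed.

Lemma approxC E : approx E -> approx (~` E).
move=> [mE aE]; split=> [|e /aE[m [D [lD mD h]]]]; first exact: measurableC.
exists m, (~` D); split; [exact: localC|exact: measurableC|].
rewrite (_ : ~` E ^^ ~` D = E ^^ D)// !setDE !setCK setUC; congr (_ `|` _); exact: setIC.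
Qed.

Lemma approxU E E' : approx E -> approx E' -> approx (E `|` E').
move=> [mE aE] [mE' aE']; split=> [|e e0]; first exact: measurableU.
have e2 : 0 < e / 2 by rewrite divr_gt0.
have [m [D [lD mD h]]] := aE _ e2; have [m' [D' [lD' mD' h']]] := aE' _ e2.
exists (maxn m m'), (D `|` D'); split; last 2 first.
- exact: measurableU.
- have -> : e%:E = ((e / 2)%:E + (e / 2)%:E)%E by rewrite -EFinD -splitr.
 apply: le_trans (leeD h h'); apply: le_trans (measureU2 _ _ _); last 2 first.
 + by apply: measurableU; apply: measurableD.
 + by apply: measurableU; apply: measurableD.
 apply: le_measure; rewrite ?inE.
 + by apply: measurableU; apply: measurableD; apply: measurableU.
 + by apply: measurableU; apply: measurableU; apply: measurableD.
 move=> X [[[EX|EX] nD]|[[DX|DX] nE]]; [left; left|right; left|left; right|right; right];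
  split=> // h0; by [apply: nD; left|apply: nD; right|apply: nE; left|apply: nE; right].
by apply: localU; apply: local_mono; [exact: leq_maxl|by []|exact: leq_maxr|by []].
Qed.

(** The approximable events form a sigma-algebra. A generating event counts the points of a set [B]
    that need not lie in any window; its count agrees with that of [B] inside window m from some m
    on, depending on the configuration, so the exceptional events decrease to the empty set. *)
Lemma approx_measurable E : measurable E -> approx E.
apply: smallest_sub => [|_ [B [n [mB rB ->]]]].
- have a0 : approx set0.
  split=> // e e0; exists 0%N, set0; split=> //; last by rewrite setDv setU0 measure0 ltW.
  exists unit, (fun=> set0), (fun=> false); split=> //; by apply/seteqP; split.
 split=> // [ aE|S aS]; first by rewrite setTD; exact: approxC.
 pose T n := \big[setU/set0]_(i < n) S i.
 have aT n : approx (T n).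
  by rewrite /T; elim: n => [|n IH]; [rewrite big_ord0|rewrite big_ord_recr; exact: approxU].
 have mS : measurable (\bigcup_i S i) by apply: bigcupT_measurable => i; exact: (aS i).1.
 have TE n : T n = \bigcup_(i in [set i | (i < n)%N]) S i by rewrite /T -bigcup_mkord.
 apply: approx_le => // e e0.
 have [|||||n h] := @vanishing_sets mu (fun n => (\bigcup_i S i) `\` T n) e.
 - by [].
 - by move=> n; apply: measurableD => //; exact: (aT n).1.
 - move=> n k nk X [SX nT]; split=> // TX; apply: nT; move: TX; rewrite !TE => -[i /= ik SiX].
  by exists i => //; exact: leq_trans nk.
 - rewrite (_ : \bigcap_n _ = set0) ?measure0//; apply/seteqP; split=> // X H.
  have [[i _ SiX] _] := H 0%N Logic.I; have [_ nT] := H i.+1 Logic.I.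
  by apply: nT; rewrite TE; exists i => /=.
 - by [].
 exists (T n); first by [].
 rewrite (_ : T n `\` _ = set0) ?setU0//; apply/seteqP; split=> X [].
 by rewrite TE => -[i _ SiX] nS; apply: nS; exists i.
- have mB' : measurable [set X : Om | npoints X B = n] := m_npoints n mB rB.
 pose S m := [set X : Om | exists2 k, (m <= k)%N & npoints X (B `&` window k) <> npoints X B].
 have rBw k : rcpt U (B `&` window k) by apply: rcS rB .
 have mBw k : measurable (B `&` window k) by apply: measurableI => //; exact: m_window.
 have mS m : measurable (S m).
  rewrite (_ : S m = \bigcup_(k in [set k | (m <= k)%N]) \bigcup_i
   ([set X : Om | npoints X (B `&` window k) = i] `&` [set X : Om | npoints X B <> i])).
   apply: bigcup_measurable => k _; apply: bigcupT_measurable => i; apply: measurableI.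
    exact: m_npoints.
   exact: (m_npoints_pred (fun j => j <> i)).
  apply/seteqP; split=> [X [k mk h]|X [k mk [i _ [ h1 h2]]]].
   by exists k => //; exists (npoints X (B `&` window k)) ; split=> // h'; apply: h.
  by exists k => // h'; apply: h2; rewrite -h'.
 apply: approx_le => // e e0.
 have [|||||m h] := @vanishing_sets mu S e => //.
 + by move=> m m' mm X [k mk]; exists k => //; exact: leq_trans mk.
 + rewrite (_ : \bigcap_n _ = set0) ?measure0//; apply/seteqP; split=> // X H.
  by have [m mP] := npoints_window X rB; have [k mk] := H m Logic.I; apply; exact: mP.
 have lm : local m [set X | npoints X (B `&` window m) = n].
  exists unit, (fun=> B `&` window m), (fun v => v tt == n); split; last first.
   by apply/seteqP; split=> X /eqP.
  by [].
 exists [set X | npoints X (B `&` window m) = n].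
  split=> [|e1 e10]; first exact: m_local lm.
  exists m, [set X | npoints X (B `&` window m) = n]; split=> //; first exact: m_local lm.
  by rewrite setDv setU0 measure0 ltW.
 have ml := m_local lm.
 apply: le_trans h; apply: le_measure; rewrite ?inE//.
  by apply: measurableU; apply: measurableD.
 move=> X [[h1 h2]|[h1 h2]]; exists m => // E2; apply: h2; move: h1; by rewrite /= E2.
Qed.

End approximation.

(* The comparison is first made on local events, where the two laws have densities. *)
Lemma dominates_of_local (P Q : probability Om R) :
 (forall e : R, 0 < e -> exists2 lam : R, 0 <= lam & forall m D, local m D ->
   (P D <= lam%:E * Q D + e%:E)%E) -> P `<< Q.
move=> H; apply/null_content_dominatesP => A mA QA.
apply/eqP; rewrite eq_le measure_ge0 andbT; apply/lee_addgt0Pr => e e0; rewrite add0e.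
have e3 : 0 < e / 3 by rewrite divr_gt0.
have [lam lam0 HL] := H _ e3.
(* The approximation error is counted once for [P] and [lam] times for [Q], whence (lam + 1) t <= e
   / 3. *)
pose t := Num.min (e / 3) (e / 3 / (lam + 1)).
have l1 : 0 < lam + 1 by rewrite ltr_wpDl.
have t0 : 0 < t by rewrite lt_min e3 divr_gt0.
(* Approximation with respect to [P + Q] is good for both laws at once. *)
have fPQ : (measure_add P Q setT < +oo)%E.
 by rewrite measure_addE lte_add_pinfty// ltey_eq fin_num_measure.
have [_ /(_ _ t0)[m [D [lD mD h]]]] := approx_measurable fPQ mA.
have mAD : measurable ((A `\` D) `|` (D `\` A)) by apply: measurableU; apply: measurableD.
have [hP hQ] : (P ((A `\` D) `|` (D `\` A)) <= t%:E)%E /\ (Q ((A `\` D) `|` (D `\` A)) <= t%:E)%E.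
 have hs : (P ((A `\` D) `|` (D `\` A)) + Q ((A `\` D) `|` (D `\` A)) <= t%:E)%E.
  by rewrite -measure_addE.
 by split; apply: le_trans hs; [exact: leeDl|exact: leeDr].
have cut (S : probability Om R) E1 E2 : measurable E1 -> measurable E2 -> (S E1 <= S E2 + S ((A `\` D) `|` (D `\` A)))%E \/ ~ (E1 `\` E2 `<=` (A `\` D) `|` (D `\` A)).
 move=> m1 m2; have [sub|] := pselect (E1 `\` E2 `<=` (A `\` D) `|` (D `\` A)); [left|by right].
 apply: le_trans (measureU2 _ m2 mAD); apply: le_measure; rewrite ?inE//; first exact: measurableU.
 by move=> X; have [] := pselect (E2 X); [left|right; apply: sub].
have PA : (P A <= P D + t%:E)%E.
 case: (cut P A D mA mD) => [c1|]; first exact: le_trans (leeD2l _ hP).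
 by [].
have QD : (Q D <= t%:E)%E.
 case: (cut Q D A mD mA) => [c1|]; first by apply: le_trans c1 _; rewrite QA add0e.
 by [].
apply: le_trans PA _; apply: (@le_trans _ _ (lam%:E * t%:E + (e / 3)%:E + t%:E)%E).
 by apply: leeD2r; apply: le_trans (HL _ _ lD) _; apply: leeD2r; apply: lee_wpmul2l.
rewrite lee_fin.
have t1 : t <= e / 3 by rewrite ge_min lexx.
have t2 : (lam + 1) * t <= e / 3 by rewrite mulrC -ler_pdivlMr// ge_min lexx orbT.
by move: t2; lra.
Qed.

End local_events.

(** * Mutual domination of the two laws *)

Section comparison.
Variables (R : realType) (d : nat) (U : set 'rV[R[i]]_d) (omega : 'rV[R[i]]_d -> R).
Local Notation Cd := 'rV[R[i]]_d.
Local Notation V := (@lebesgue_Cn R d).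
Hypotheses (oU : open U) (cU : connected U) (momega : measurable_fun U omega)
 (omega0 : forall z, U z -> 0 < omega z)
 (omega_inf : forall (B : set Cd) (mB : measurable B),
   rcpt U B -> (0 < V B)%E ->
   (0 < ess_inf (mrestr V mB) (EFin \o omega))%E).
Variable K : Cd -> Cd -> R[i].
Hypothesis Kr : reproducing_kernel U omega K.
Variables (g : Cd -> R[i]) (M : R).
Hypotheses (hg : holomorphic_on U g) (M0 : 0 < M) (gM : forall z, U z -> normc (g z) <= M)
 (g_nc : exists z w, [/\ U z, U w & g z != g w]).
Local Notation W0 := (omegaU U omega).
Local Notation KU := (kernelU U K).
Local Notation rk := (bergman_rkhs oU momega omega0 omega_inf Kr).
Local Notation Om := (configuration U).
Local Notation rho := (rho KU).
Local Notation jan := (jan V KU).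
Variable F : nat -> set Cd.
Hypotheses (FT : forall z, exists n, F n z) (ndF : forall n m, (n <= m)%N -> F n `<=` F m)
 (Foo : forall n, measurable (F n) /\ (V (F n) < +oo)%E).
Variables (p : seq Cd) (P Pp : probability Om R).
Hypotheses (pU : forall q, q \in p -> U q) (rp : 0 < rho p)
 (PP : palm_law W0 KU [::] P) (PPp : palm_law W0 KU p Pp).
Local Notation win := (window U W0 KU F).
Local Notation restr := (restr W0).
Local Notation mwin := (m_window rk Foo).
Let sub_w m (A : set Cd) (mA : measurable A) (Am : A `<=` win m) : subw V W0 KU (restr A).
exact: (@restr_subw R d U W0 (Hol U) KU rk F Foo unit (fun=> set0) m (fun=> measurable0) A mA Am P).
Qed.

(** [lam] is chosen before the window and the event: the constants of [deletion_bound] come from the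
    points of [s] and the kernel alone. *)
Lemma deletion_local (s : seq Cd) : (forall q, q \in s -> U q) -> forall e : R, 0 < e ->
 exists2 lam : R, 0 <= lam & forall m (phi : seq Cd -> R), measT phi -> (forall v, 0 <= phi v <= 1) ->
  EW V (restr (win m)) (fun v => phi v * jan (restr (win m)) (s ++ v)) <=
  lam * EW V (restr (win m)) (fun v => phi v * jan (restr (win m)) v) + e.
elim: s => [|q s IH] sU e e0; first by exists 1 => // m phi _ _; rewrite mul1r lerDl ltW.
have [a [h [C [c [N [a0 ia mh C0 [[c0 N0] [ma ka fq mu]]]]]]]] :=
 bounded_deletable oU cU momega omega0 omega_inf Kr hg M0 gM g_nc (sU q (mem_head _ _)).
pose H := ((\int[@lebm2 R]_x a x)%R * (N * kap KU q * wprod (kap KU) s))%R.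
have H0 : 0 <= H.
 by rewrite mulr_ge0 ?Rint_ge0// !mulr_ge0 ?wprod_ge0 ?(rk)// => *; exact: kap_ge0 rk _.
pose k := C / c * H; have k0 : 0 <= k by rewrite mulr_ge0// divr_ge0// ltW.
(* This brings the error k / (4 l1) for the point [q] below e / 2. The remaining points are allowed
   only e / (2 l1), because their error is multiplied by l1. *)
pose l1 := k / e + 1; have l10 : 0 < l1 by rewrite ltr_wpDl// divr_ge0// ltW.
have sU' q' : q' \in s -> U q' by move=> qs; apply: sU; rewrite in_cons qs orbT.
have [lam lam0 IHs] := IH sU' (e / (2 * l1)) ltac:(by rewrite divr_gt0// mulr_gt0).
exists (l1 * lam) => [|m phi mphi phi01]; first by rewrite mulr_ge0// ltW.
have DB := deletion_bound rk a0 ia mh C0 c0 N0 ma ka fq mu (sub_w (mwin m) (@subset_refl _ _)) s l10 mphi phi01.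
apply: le_trans DB _.
have e1 : C / c / (4 * l1) * H <= e / 2.
 have -> : C / c / (4 * l1) * H = k / (4 * l1) by rewrite /k; ring.
 rewrite ler_pdivrMr ?mulr_gt0//.
 have -> : e / 2 * (4 * l1) = 2 * k + 2 * e by rewrite /l1; field; rewrite gt_eqF.
 by move: e0; lra.
apply: le_trans (lerD (ler_wpM2l (ltW l10) (IHs m phi mphi phi01)) e1) _.
have e2 : l1 * (e / (2 * l1)) = e / 2 by field; rewrite gt_eqF.
by rewrite mulrDr mulrA e2 -addrA -splitr.
Qed.

(** [eval_localized] is used with C larger than [rho (q :: s) / rho s] by the factor [kp]. Since [w]
    vanishes on [exh U M2], the weight [W0 - w] equals [W0] there, and the localized bound applies
    to it whatever the window. *)
Lemma jan_localized (s : seq Cd) (kp : R) : 0 < rho s -> 1 < kp -> exists M1, forall M2 m, (M1 <= M2)%N ->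
 let w := restr (win m `\` exh U M2) in
 chain (fun q s' => exists2 C : R, 0 <= C & forall y, jan w (q :: s' ++ y) <= C * jan w (s' ++ y)) s /\
 forall y, jan w (s ++ y) <= kp ^+ size s * rho s * jan w y.
move=> rs kp1; elim: s rs => [|q s IH] rs.
 by exists 0%N => M2 m _; split=> // y; rewrite rho_nil !mul1r.
have rs' : 0 < rho s.
 rewrite lt_neqAle (rho_ge0 rk) andbT.
 apply: contraTneq rs => r0; rewrite -leNgt; apply: le_trans (rho_cons_le rk q s) _.
 by rewrite -r0 mulr0.
have [M1 HM1] := IH rs'; pose C := rho (q :: s) / rho s * kp.
have C0 : 0 <= C by rewrite mulr_ge0 ?divr_ge0 ?ltW// (lt_trans ltr01).
have rC : rho (q :: s) < C * rho s.
 have -> : C * rho s = rho (q :: s) * kp by rewrite /C; field; rewrite gt_eqF.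
 by rewrite ltr_pMr.
have [M3 HM3] := eval_localized rk rs' rC.
exists (maxn M1 M3) => M2 m; rewrite geq_max => /andP[M12 M32] w.
have [chs bs] := HM1 M2 m M12.
have mD : measurable (win m `\` exh U M2) by apply: measurableD; [exact: mwin|exact: m_exh].
have [mw wW iw j0] := sub_w mD (@subDsetl _ (win m) (exh U M2)).
have step y : jan w (q :: s ++ y) <= C * jan w (s ++ y).
 apply: (jan_cons_le rk mw wW iw j0 C0) => f fH fs.
 have fs' x : x \in s -> f x = 0 by move=> xs; apply: fs; rewrite mem_cat xs.
 apply: le_trans (HM3 f fH fs') _; apply: ler_wpM2l => //.
 have mO : measT W0 := m_omegaU oU momega.
 have O0 z : 0 <= W0 z := omegaU_ge0 omega0 z.
 have mv : measT (fun z => W0 z - w z) by apply: measurable_funB.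
 have m3 : measT (fun z => W0 z * \1_(exh U M3) z).
  by apply: mfM => //; apply: mindic; exact: m_exh.
 have v01 z : 0 <= W0 z - w z <= W0 z.
  by have /andP[h1 h2] := wW z; rewrite subr_ge0 h2 gerBl.
 apply: (nrm2_le m3 _ (L2_le mv v01 fH.2)) => z; rewrite /w /restr !indicE.
 have [/set_mem z3|_] := boolP (z \in exh U M3); last by rewrite mulr0 lexx; have /andP[] := v01 z.
 by rewrite mulr1 O0 /= memNset ?mulr0 ?subr0// => -[_]; apply; exact: exh_nd z3.
split; first by split=> //; exists C.
move=> y; apply: le_trans (step y) _; apply: le_trans (ler_wpM2l C0 (bs y)) _.
apply: eq_ler; rewrite /C exprS.
by field; rewrite gt_eqF.
Qed.

(** The expected number of points in [A] is the integral of the first correlation function over a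
    null set. *)
Lemma first_moment0 (A : set Cd) k : measurable A -> A `<=` exh U k -> V A = 0 ->
 P [set X : Om | (0 < npoints X A)%N] = 0.
move=> mA Ak VA; pose c z := if `[< A z >] then Some tt else None.
have cA : c @^-1` [set Some tt] = A.
 by apply/seteqP; split=> z; rewrite /= /c; [case: asboolP|move=> Az; rewrite asboolT].
have rc := rc_exh U k.
have cL z : c z != None -> exh U k z by rewrite /c; case: asboolP => // /Ak.
pose A1 := [set t : 1.-tuple Cd | map c t = map Some [tuple tt]].
have A1E : A1 = (fun t : 1.-tuple Cd => thead t) @^-1` A.
 apply/seteqP; split=> t; case/tupleP: t => x t; rewrite tuple0 /A1 /= theadE /c; first by case: asboolP.
 by move=> Ax; rewrite asboolT.
have mA1 : measurable A1.
 by rewrite A1E -[X in measurable X]setTI; exact: (@measurable_tnth _ _).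
have E : (\int[P]_X (npoints X A)%:R%:E = correlation_measure P A1)%E.
 apply: eq_integral => X _; have := esum_factorial_mult rc cL X [tuple tt].
 by rewrite -/A1 => ->; rewrite /= muln1 /npts cA.
have A1U : A1 `<=` [set t | forall i, U (tnth t i)].
 move=> t; rewrite A1E => At i; apply: (@exh_sub R d); apply: Ak; rewrite ord1; by [].
have mN : measT (fun X : Om => (npoints X A)%:R%:E : \bar R).
 apply/mEFinP; rewrite -cA.
 rewrite (_ : (fun X => _) = fun X => (count_mem tt (ptsword c X))%:R); last first.
  by apply/funext => X; rewrite count_ptsword.
 apply: (m_ptsword _ rc cL (fun v => (count_mem tt v)%:R : R)) => -[]; by rewrite cA.
have V1 : tuple_measure V 1 A1 = 0.
 have := @int_tupleS _ _ R V 0 (fun t => (\1_A1 t)%:E).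
 rewrite integral_indic// setIT => ->//; last by apply/mEFinP.
 transitivity (\int[V]_x (\1_A x)%:E)%E; last by rewrite integral_indic// setIT.
 apply: eq_integral => x _ /=.
 rewrite (@eq_integral _ _ _ _ _ (cst (\1_A x)%:E)) => [|t _].
  by rewrite integral_dirac// diracE in_setT mul1e.
 by rewrite A1E.
have E0 : (\int[P]_X (npoints X A)%:R%:E = 0)%E.
 rewrite E PP//; apply: null_set_integral => //; apply: measurable_funTS; apply/mEFinP.
 apply: mfM; last first.
  exact: mpre (m_wprod (m_omegaU oU momega)) (@m_tval _ _ 1).
 apply: mfM; last by [].
 exact: mpre (m_rho_cat rk [::]) (@m_tval _ _ 1).
apply/eqP; rewrite eq_le measure_ge0 andbT -E0.
have mS : measurable [set X : Om | (0 < npoints X A)%N].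
 by apply: (m_npoints_pred (fun n => 0 < n)%N) => //; exact: rcS rc.
have := @integral_indic _ _ R P setT measurableT _ mS; rewrite setIT => <-.
apply: ge0_le_integral => //.
- by apply/mEFinP.
- move=> X _; rewrite lee_fin ler_nat; case: (boolP (_ \in _)) => //.
 by rewrite inE.
Qed.

Lemma pow_near1 n (e : R) : 0 < e -> exists2 k : R, 1 < k & k ^+ n <= 1 + e.
elim: n e => [|n IH] e e0; first by exists 2; rewrite ?ltr1n// lerDl ltW.
have e2 : 0 < e / 2 by rewrite divr_gt0.
have [k k1 kn] := IH _ e2; have l0 : 0 < 1 + e / 2 by rewrite addr_gt0.
exists (Num.min k (1 + e / 2 / (1 + e / 2))); first by rewrite lt_min k1 ltrDl divr_gt0.
have kk : 0 <= k := le_trans ler01 (ltW k1); set k' := Num.min _ _; have k'0 : 0 <= k'.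
 by rewrite le_min kk addr_ge0// divr_ge0// ltW.
rewrite exprS; apply: (@le_trans _ _ ((1 + e / 2 / (1 + e / 2)) * (1 + e / 2))).
 apply: ler_pM; rewrite ?exprn_ge0//; first by rewrite ge_min lexx orbT.
 by apply: le_trans kn; apply: lerXn2r; rewrite ?ge_min ?lexx.
by rewrite mulrDl mul1r mulfVK ?gt_eqF// -addrA -splitr.
Qed.

Lemma local_comparison m D : local W0 KU F m D -> exists phi : seq Cd -> R, [/\ measT phi, (forall v, 0 <= phi v <= 1),
 P D = (EW V (restr (win m)) (fun v => phi v * jan (restr (win m)) v))%:E &
 Pp D = (EW V (restr (win m)) (fun v => phi v * jan (restr (win m)) (p ++ v)) / rho p)%:E].
move=> [J [Bs [G [H ->]]]]; exists (local_fun Bs G (win m)).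
have mB j := (H j).1; have BA j := (H j).2; have r1 : 0 < rho [::] by rewrite rho_nil.
split.
- exact: (m_local_fun mB G (mwin m)).
- exact: local_fun01.
- by rewrite (local_probability rk Foo mB BA G (mwin m) (@subset_refl _ _) erefl r1 PP) rho_nil divr1.
- by rewrite (local_probability rk Foo mB BA G (mwin m) (@subset_refl _ _) erefl rp).
Qed.

Lemma palm_dominated : Pp `<< P.
apply: (dominates_of_local oU rk FT ndF Foo) => e e0.
have [lam lam0 H] := deletion_local pU (mulr_gt0 e0 rp).
exists (lam / rho p) => [|m D]; first by rewrite divr_ge0// ltW.
move=> /local_comparison[phi [mphi phi01 -> ->]]; rewrite lee_fin ler_pdivrMr//.
apply: le_trans (H m phi mphi phi01) _; apply: eq_ler.
by field; rewrite gt_eqF.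
Qed.

(** A finite union of zero sets of the functions [g - g q], none of them identically 0 since [g] is
    not constant. *)
Lemma fiber_null (s : seq Cd) : let Z := [set z | U z /\ has (fun q => g z == g q) s] in
 measurable Z /\ V Z = 0.
elim: s => [|q s [mZ VZ]] /=.
 by rewrite (_ : [set z | _] = set0) ?measure0//; apply/seteqP; split=> z [].
have hq : Hol U (zext U (fun z => g z - g q)).
 by apply: Hol_zext => // z Uz; apply: differentiableB; [exact: hg|exact: differentiable_cst].
have nz : exists2 z, U z & zext U (fun z => g z - g q) z != 0.
 have [z [w [Uz Uw zw]]] := g_nc; have [E|zq] := eqVneq (g z) (g q).
  by exists w => //; rewrite /zext asboolT// subr_eq0 -E eq_sym.
 by exists z => //; rewrite /zext asboolT// subr_eq0.
have m1 := m_zeros oU hq; have n1 := zeros_null oU cU hq nz.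
rewrite (_ : [set z | _] = [set z | U z /\ zext U (fun z => g z - g q) z = 0] `|` [set z | U z /\ has (fun q => g z == g q) s]).
 split; first exact: measurableU.
 apply/negligibleP; first exact: measurableU.
 by apply: negligibleU; apply/negligibleP.
apply/seteqP; split=> [z [Uz /orP[/eqP E|zs]]|z [[Uz E]|[Uz zs]]]; [left|right| |].
- by split=> //; rewrite /zext asboolT// E subrr.
- by [].
- by split; move: E; rewrite /zext asboolT// => /eqP; rewrite subr_eq0 => ->.
- by split=> //; rewrite zs orbT.
Qed.

Lemma dominated_palm : P `<< Pp.
apply: (dominates_of_local oU rk FT ndF Foo) => e e0; have e3 : 0 < e / 3 by rewrite divr_gt0.
(* The loss [kp ^+ size p - 1] of the insertion bound is one of three errors e / 3; the other two
   are the probabilities of too many points in [BB] and of a point whose value is close to a value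
   on [p]. *)
have [kp kp1 kpn] := pow_near1 (size p) e3; have [M1 HM1] := jan_localized rp kp1.
pose BB := exh U M1; have rB : rcpt U BB := rc_exh U M1.
have mB : measurable BB := m_exh U M1.
have P1 : (P setT < +oo)%E by rewrite ltey_eq fin_num_measure.
have sB (C : set Cd) : rcpt U (BB `&` C) by apply: rcS rB => z [].
have [|||||n0 hn0] := @vanishing_sets R d U P (fun n => [set X : Om | (n < npoints X BB)%N]) (e / 3).
- exact: P1.
- by move=> n; apply: (m_npoints_pred (fun k => n < k)%N).
- by move=> n k nk X; exact: leq_ltn_trans.
- rewrite (_ : \bigcap_n _ = set0) ?measure0//; apply/seteqP; split=> // X H.
 by have := H (npoints X BB) Logic.I; rewrite /= ltnn.
- exact: e3.
(* The minimum with [2 * M] is what [product_bound] asks for. *)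
pose eta k : R := Num.min k.+1%:R^-1 (2 * M).
have eta0 k : 0 < eta k by rewrite lt_min invr_gt0 mulr_gt0//= ltr0n.
pose Z k := [set z | U z /\ has (fun q => normc (g q - g z) < eta k) p].
have mZ k : measurable (Z k).
 apply: m_open_Cn; rewrite openE => z [Uz /hasP[q qp gq]].
 suff : nbhs z [set z | U z /\ has (fun q => normc (g q - g z) < eta k) p] by [].
 apply: filterI; first exact: open_nbhs_nbhs.
 have /ccts_near/(_ ((eta k - normc (g q - g z)) / 2)) := diff_ccts (hg Uz).
 have h0 : 0 < (eta k - normc (g q - g z)) / 2 by rewrite divr_gt0// subr_gt0.
 move=> /(_ h0); apply: filterS => w wz; apply/hasP; exists q => //.
 have -> : g q - g w = (g q - g z) - (g w - g z) by ring.
 by apply: le_lt_trans (normcB_le _ _) _; move: wz h0; move: (normc _) (normc _) => *; lra.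
have e2M k : eta k <= 2 * M by rewrite ge_min lexx orbT.
have etand k k' : (k <= k')%N -> eta k' <= eta k.
 move=> kk; rewrite /eta le_min !ge_min lexx orbT andbT; apply/orP; left.
 by rewrite lef_pV2 ?posrE ?ltr0n// ler_nat.
have Znd k k' : (k <= k')%N -> Z k' `<=` Z k.
 move=> kk z [Uz zp]; split=> //; apply: sub_has zp => q; move=> /lt_le_trans; apply; exact: etand.
have [|||||k hk] := @vanishing_sets R d U P (fun k => [set X : Om | (0 < npoints X (BB `&` Z k))%N]) (e / 3).
- exact: P1.
- by move=> k; apply: (m_npoints_pred (fun j => 0 < j)%N) => //; exact: measurableI.
- move=> k k' kk X /= h; apply: leq_trans h _; apply: npoints_mono => // z [zB zZ].
 by split=> //; exact: Znd zZ.
(* A configuration meeting [BB] in [Z k] for every k has a point in [Z0], the fibres of [g] through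
   [p], and almost surely there is none. *)
- have [mF VF] := fiber_null p; set Z0 := [set z | _] in mF VF.
 have mI : measurable (BB `&` Z0) by exact: measurableI.
 have := @first_moment0 (BB `&` Z0) M1 mI (@subIsetl _ _ _) _.
 rewrite (_ : V _ = 0); last first.
  by apply/eqP; rewrite eq_le measure_ge0 andbT -VF; apply: le_measure; rewrite ?inE// => z [].
 move=> /(_ erefl) n1; apply/eqP; rewrite eq_le measure_ge0 andbT -n1; apply: le_measure; rewrite ?inE.
 + apply: bigcapT_measurable => i; apply: (m_npoints_pred (fun j => 0 < j)%N) => //.
  exact: measurableI.
 + by apply: (m_npoints_pred (fun j => 0 < j)%N).
 move=> X H; rewrite /= lt0n; apply/negP => /eqP N0.
 have [u uu uP] := support_list X rB.
 have sub (C : set Cd) z : (BB `&` C) z -> X z != 0%N -> z \in u by move=> [zB _]; exact: uP.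
 (* A point of [X] lying in every [Z i] would have one of the values of [g] on [p], hence lie in
    [Z0]. As [BB] contains finitely many points of [X], one index excludes them all. *)
 have ex (a : Cd) : exists i, a \in u -> ~ (BB a /\ Z i a /\ X a != 0%N).
  have [Za|nZ] := pselect (BB a /\ Z0 a /\ X a != 0%N).
   have [Ba [Z0a Xa]] := Za; exists 0%N => au _; move/eqP: N0; rewrite (npoints_sum uu (@sub Z0)).
   by rewrite (bigD1_seq a)//= addn_eq0 asboolT// mul1n (negbTE Xa).
  apply: contrapT => nex; apply: nZ.
  have HB i : BB a /\ Z i a /\ X a != 0%N by apply: contrapT => h; apply: nex; exists i.
  have [Ba [[Ua _] Xa]] := HB 0%N; split=> //; split=> //; split=> //.
  have : forall i, has (fun q => normc (g q - g a) < eta i) p by move=> i; have [_ [[]]] := HB i.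
  elim: (p) => [|q s IHs] /= Hs; first by have := Hs 0%N.
  have [->|qa] := eqVneq (g a) (g q); first by [].
  apply: IHs => i; have d0 : 0 < normc (g q - g a) by rewrite normc_gt0 subr_eq0 eq_sym.
  have [j _ /(_ j (leqnn _)) jd] : \forall j \near \oo, j.+1%:R^-1 <= normc (g q - g a).
   by have /cvgr_le := @cvg_harmonic R; apply.
  have /orP[] := Hs (maxn i j); last first.
   by apply: sub_has => q'; move=> /lt_le_trans; apply; apply: etand; exact: leq_maxl.
  rewrite ltNge => /negP[]; apply: le_trans jd; apply: le_trans (etand _ _ (leq_maxr i j)) _.
  by rewrite ge_min lexx.
 pose ii a := projT1 (cid (ex a)); pose i := \max_(a <- u) ii a.
 have := H i Logic.I; rewrite /= (npoints_sum uu (@sub (Z i))) lt0n => /negP[].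
 rewrite sum_nat_seq_eq0; apply/allP => a au; apply/implyP => _; rewrite muln_eq0.
 have [_|Xa] := eqVneq (X a) 0%N; rewrite ?orbT// orbF eqb0; apply/asboolPn => -[Ba Za].
 have li : (ii a <= i)%N by exact: leq_bigmax_seq.
 exact: (projT2 (cid (ex a)) au (conj Ba (conj (Znd _ _ li _ Za) Xa))).
- exact: e3.
(* The lower bound of [product_bound] for the squared modulus of a product of at most [n0]
   multipliers. *)
pose bet := (eta k / (2 * M)) ^+ (2 * n0); have M2 : 0 < 2 * M by rewrite mulr_gt0.
have bet0 : 0 < bet by rewrite exprn_gt0// divr_gt0.
exists ((bet ^+ size p)^-1) => [|m D]; first by rewrite invr_ge0 exprn_ge0// ltW.
move=> lD; have mD := m_local lD; move: lD mD => [J [Bs [G [H ->]]]] mD.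
(* Two more counts are added to those of the local event, so that the restriction to good
   configurations is again a local event. *)
pose C (b : bool) := win m `&` (if b then BB else BB `&` Z k).
have mC b : measurable (C b).
 by apply: measurableI; [exact: mwin|case: b => //; exact: measurableI].
pose Bs' j := match j with inl j => Bs j | inr b => C b end.
pose G' (v : J + bool -> nat) := [&& G (v \o inl), v (inr true) <= n0 & v (inr false) == 0]%N.
have mB' j : measurable (Bs' j) by case: j => [j|b] /=; [exact: (H j).1|exact: mC].
have BW' j : Bs' j `<=` win m by case: j => [j|b] /=; [exact: (H j).2|move=> z []].
pose phi := local_fun Bs' G' (win m); pose w := restr (win m).
have r1 : 0 < rho [::] by rewrite rho_nil.
have mw1 : measurable (win m `&` BB) by apply: measurableI => //; exact: mwin.
have mw2 : measurable (win m `\` BB) by apply: measurableD => //; exact: mwin.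
have [ch bd] := HM1 M1 m (leqnn _).
have := insertion_bound rk (w := w) (w1 := restr (win m `&` BB)) (w2 := restr (win m `\` BB)) (BB := BB)
 (p := p) (bet := bet) (kp := kp ^+ size p) (phi := phi) (sub_w (mwin m) (@subset_refl _ _))
 (sub_w mw1 (@subIsetl _ _ _)) (sub_w mw2 (@subDsetl _ _ _)).
have wE x : w x = restr (win m `&` BB) x + restr (win m `\` BB) x.
 rewrite /w /restr -mulrDr !indicE in_setI in_setD; congr (_ * _).
 by case: (x \in win m); case: (x \in BB); rewrite /= ?addr0 ?add0r.
have wB x : restr (win m `&` BB) x != 0 -> BB x.
 by rewrite /restr indicE; case: (boolP (x \in _)) => [/set_mem[]//|_]; rewrite mulr0 eqxx.
move=> /(_ wE wB rp bet0 (exprn_ege1 _ (ltW kp1)) ch bd).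
move=> /(_ (m_local_fun mB' G' (mwin m)) (local_fun01 _ _ _) (symf_local_fun _ _ _)).
have mult y x : phi (y ++ x) != 0 -> (forall z, z \in x -> BB z) -> exists b : Cd -> R[i],
  [/\ multiplier V W0 (Hol U) b, forall z, z \in x -> b z = 0 & forall q, q \in p -> bet <= normc (b q) ^+ 2].
 rewrite /phi /local_fun => ph xB; have {ph} : all (fun z => `[< win m z >]) (y ++ x) &&
   G' (fun j => count (fun z => `[< Bs' j z >]) (y ++ x)) by case: (_ && _) ph; rewrite ?eqxx.
 rewrite all_cat => /andP[/andP[_ /allP xw] /and3P[_]]; rewrite !count_cat addn_eq0.
 move=> h1 /andP[_ h2]; exists (fun z => \prod_(u <- x) diffb U g M u z); split.
 - by apply: (product_multiplier oU momega omega0 hg M0 gM) => z /xB; exact: exh_sub.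
 - move=> z zx; have Uz : U z by apply: (@exh_sub R d U M1); exact: xB.
  by apply/eqP; rewrite prodf_seq_eq0; apply/hasP; exists z => //; rewrite /diffb /zext asboolT// subrr mulr0 eqxx.
 - move=> q qp; have h0 : 0 < eta k <= 2 * M by rewrite eta0 e2M.
  have h3 z : z \in x -> eta k <= normc (g q - g z).
   move=> zx; rewrite leNgt; apply/negP => lt; move: h2; rewrite -leqn0 leqNgt -has_count => /negP; apply.
   apply/hasP; exists z => //; apply/asboolP; split; first by apply/asboolP; exact: xw.
   split; first exact: xB.
   by split; [apply: (@exh_sub R d U M1); exact: xB|apply/hasP; exists q].
  have h4 : (size x <= n0)%N.
   apply: leq_trans h1; apply: leq_trans (leq_addl _ _).
   rewrite -[leqRHS](_ : size x = _)//; apply/esym/eqP; rewrite -all_count; apply/allP => z zx.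
   by apply/asboolP; split; [apply/asboolP; exact: xw|exact: xB].
  have k1 := product_bound (x := x) (q := q) (eta := eta k) (n := n0) M0 (pU qp).
  have k2 := k1 _ h0.
  have k3 := k2 _ h3.
  have k4 := k3 h4.
  exact: k4.
move=> /(_ mult) main.
pose D' := [set X : Om | G' (fun j => npoints X (Bs' j))].
have PD' : P D' = (EW V w (fun v => phi v * jan w v))%:E.
 by rewrite (local_probability rk Foo mB' BW' G' (mwin m) (@subset_refl _ _) erefl r1 PP) rho_nil divr1.
have PpD' : Pp D' = (EW V w (fun v => phi v * jan w (p ++ v)) / rho p)%:E.
 by rewrite (local_probability rk Foo mB' BW' G' (mwin m) (@subset_refl _ _) erefl rp PPp).
have mD' : measurable D'.
 by apply: (m_local (m := m)); exists (J + bool)%type, Bs', G'; split.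
have mS1 : measurable [set X : Om | (n0 < npoints X BB)%N] by apply: (m_npoints_pred (fun k => n0 < k)%N).
have mS2 : measurable [set X : Om | (0 < npoints X (BB `&` Z k))%N].
 by apply: (m_npoints_pred (fun j => 0 < j)%N) => //; exact: measurableI.
set D0 := [set X | _] in mD *.
(* Outside the two exceptional events [D0] coincides with its restriction [D'] to good
   configurations, the only ones to which the insertion bound applies. *)
have cover : (P D0 <= P D' + (e / 3)%:E + (e / 3)%:E)%E.
 apply: le_trans (leeD (leeD (lexx _) hn0) hk).
 have mU1 := measurableU _ _ mD' mS1.
 have h1 := @measureU2 _ _ R P _ _ mD' mS1.
 have h2 := @measureU2 _ _ R P _ _ mU1 mS2.
 apply: le_trans (leeD h1 (lexx _)); apply: le_trans h2.
 apply: le_measure; rewrite ?inE//; first by apply: measurableU => //; exact: measurableU.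
 move=> X DX; have [h|h] := ltnP n0 (npoints X BB); first by left; right.
 have [h'|h'] := posnP (npoints X (BB `&` Z k)); last by right.
 left; left; apply/and3P; split; first exact: DX.
  by apply: leq_trans h; apply: npoints_mono => // z [].
 by rewrite -leqn0 -h'; apply: npoints_mono => // z [].
have DD : (Pp D' <= Pp D0)%E by apply: le_measure; rewrite ?inE// => X /and3P[].
apply: le_trans cover _; rewrite PD' -!EFinD.
have b0 : (0 <= (bet ^+ size p)^-1%:E)%E by rewrite lee_fin invr_ge0 exprn_ge0// ltW.
apply: le_trans (leeD2r e%:E (lee_wpmul2l b0 DD)).
rewrite PpD' -EFinM -EFinD lee_fin; move: main kpn; rewrite invfM -!mulrA.
rewrite [(rho p)^-1 * _]mulrC; set x := EW V w _; set y := bet ^- size p * _; set t := kp ^+ size p.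
by clearbody x y t; lra.
Qed.

End comparison.

(** * Correlation functions of the determinantal process and of its Palm process *)

Section determinantal.
Variables (R : realType) (d : nat) (U : set 'rV[R[i]]_d) (omega : 'rV[R[i]]_d -> R)
 (K : 'rV[R[i]]_d -> 'rV[R[i]]_d -> R[i]).
Local Notation Cd := 'rV[R[i]]_d.
Local Notation V := (@lebesgue_Cn R d).
Local Notation W0 := (omegaU U omega).
Local Notation KU := (kernelU U K).
Variables (Hol : set (Cd -> R[i])) (B : nat -> set Cd).
Hypothesis rk : rkhs V W0 Hol B KU.

Lemma minor_kernelU n (t : n.-tuple Cd) : (forall i, U (tnth t i)) ->
 minor K (dup t) = minor KU (dup t).
move=> tU; rewrite !minor_dup; congr (\det _); apply/matrixP => i j.
by rewrite !mxE /kernelU !asboolT.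
Qed.

Lemma rho_gt0 n (p : n.-tuple Cd) : (forall i, U (tnth p i)) ->
 \det (\matrix_(i < n, j < n) K (tnth p i) (tnth p j)) != 0 -> 0 < rho KU p.
move=> pU; rewrite -minor_dup minor_kernelU// (minor_real rk) => r0.
by rewrite lt_neqAle (rho_ge0 rk) andbT eq_sym; apply: contraNneq r0 => ->.
Qed.

Lemma palm_kernel_nil : palm_kernel K [tuple] = K.
by apply/funext => z; apply/funext => w; rewrite /palm_kernel det_mx11 det_mx00 divr1 mxE.
Qed.

(** By [minor_palm] the determinants of the Palm kernel are quotients of minors of [K], which on [U]
    agree with those of its extension by zero. The case l = 0, absent from [determinantal_process],
    is the total mass of [P]. *)
Lemma determinantal_palm_law n (p : n.-tuple Cd) (P : probability (configuration U) R) :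
 (forall i, U (tnth p i)) ->
 \det (\matrix_(i < n, j < n) K (tnth p i) (tnth p j)) != 0 ->
 determinantal_process omega (palm_kernel K p) P -> palm_law W0 KU p P.
move=> pU p0 [_ H] l A mA AU; have r0 := rho_gt0 pU p0.
case: l A mA AU => [|l] A mA AU.
 have [A0|/set0P[t At]] := eqVneq A set0.
  by rewrite A0 integral_set0 /correlation_measure; under eq_integral do rewrite esum_set0; rewrite integral0.
 have -> : A = [set: 0.-tuple Cd] by apply/seteqP; split=> u _; rewrite (tuple0) -(tuple0 t).
 rewrite [RHS](@eq_integral _ _ _ _ _ (cst 1%E)) => [|u _]; last first.
  by rewrite (tuple0) cats0 wprod_nil mulr1 divff ?gt_eqF.
 rewrite integral_cst//= diracE in_setT mule1.
 transitivity (\int[P]_X (cst 1%E : configuration U -> \bar R) X)%E; last first.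
  by rewrite integral_cst// mul1e; exact: (@probability_setT _ _ _).
 apply: eq_integral => X _; rewrite (_ : [set: 0.-tuple Cd] = [set [tuple]]); last first.
  by apply/seteqP; split=> u _; rewrite (tuple0 u).
 by rewrite esum_set1 /factorial_mult big_ord0.
rewrite H//; apply: eq_integral => t /set_mem /AU tU; congr (_%:E); congr (_ * _).
 have m0 : minor K (dup p) != 0 by rewrite minor_dup.
 have := minor_palm t m0; rewrite [in X in X = _ -> _]minor_dup => ->.
 have tpU i : U (tnth [tuple of t ++ p] i).
  by case: (split_ordP i) => j ->; rewrite ?tnth_lshift ?tnth_rshift.
 rewrite (minor_kernelU tpU) (minor_kernelU pU) !(minor_real rk) -fmorphV -rmorphM /=.
 have pp : perm_eq (t ++ p) (p ++ t) by rewrite perm_catC.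
 by rewrite (rho_perm KU pp).
rewrite /wprod big_tuple; apply: eq_bigr => i _.
by rewrite /omegaU asboolT.
Qed.

End determinantal.

Unset Implicit Arguments.

Theorem theorem1p1 (R : realType) (d : nat) (U : set 'rV[R[i]]_d)
    (omega : 'rV[R[i]]_d -> R)
    (U_nonempty : U !=set0) (U_connected : connected U) (U_open : open U)
    (omega_borel : measurable_fun U omega)
    (omega_gt0 : forall z, U z -> 0 < omega z)
    (omega_ess_inf : forall (B : set 'rV[R[i]]_d) (mB : measurable B),
      relatively_compact U B -> (0 < lebesgue_Cn B)%E ->
      (0 < ess_inf (mrestr (@lebesgue_Cn R d) mB) (EFin \o omega))%E)
    (bergman_neq0 : exists2 f, bergman_space U omega f &
      exists2 z, U z & f z != 0)
    (K : 'rV[R[i]]_d -> 'rV[R[i]]_d -> R[i])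
    (K_reproducing : reproducing_kernel U omega K)
    (P : probability (configuration U) R)
    (P_determinantal : determinantal_process omega K P)
    (bounded_nonconstant : exists f : 'rV[R[i]]_d -> R[i],
      [/\ holomorphic_on U f,
          exists M : R, forall z, U z -> normc (f z) <= M &
          exists z w, [/\ U z, U w & f z != f w]]) :
  forall (l : nat) (p : l.-tuple 'rV[R[i]]_d)
      (Pp : probability (configuration U) R),
    (0 < l)%N -> uniq p -> (forall i, U (tnth p i)) ->
    \det (\matrix_(i < l, j < l) K (tnth p i) (tnth p j)) != 0 ->
    determinantal_process omega (palm_kernel K p) Pp ->
    P `<< Pp /\ Pp `<< P.
Proof.
move=> l p Pp _ _ pU p0 HPp; have [g [hg [M gM] g_nc]] := bounded_nonconstant.
have M0 : 0 < Num.max M 1 by rewrite lt_max ltr01 orbT.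
have gM' z : U z -> normc (g z) <= Num.max M 1 by move=> Uz; rewrite le_max gM.
have rk := bergman_rkhs U_open omega_borel omega_gt0 omega_ess_inf K_reproducing.
(* The law [P] is its own Palm law for the empty tuple, which lets one lemma serve both measures. *)
have PP : palm_law (omegaU U omega) (kernelU U K) [::] P.
  apply: (determinantal_palm_law rk (p := [tuple])) => [[]//||]; first by rewrite det_mx00 oner_neq0.
  by rewrite palm_kernel_nil.
have PPp := determinantal_palm_law rk pU p0 HPp.
have /sigma_finiteP[F [TF ndF Foo]] := sigma_finiteT (@lebesgue_Cn R d).
have FT z : exists n, F n z by have [n _ Fz] : (\bigcup_n F n) z; [rewrite -TF|exists n].
have ndF' n m : (n <= m)%N -> F n `<=` F m by move=> nm; exact/subsetPset/ndF.
have pU' q : q \in (p : seq _) -> U q by move=> /tnthP[i ->].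
have rp := rho_gt0 rk pU p0.
split.
  exact: (dominated_palm U_open U_connected omega_borel omega_gt0 omega_ess_inf K_reproducing
    hg M0 gM' g_nc FT ndF' Foo pU' rp PP PPp).
exact: (palm_dominated U_open U_connected omega_borel omega_gt0 omega_ess_inf K_reproducing
  hg M0 gM' g_nc FT ndF' Foo pU' rp PP PPp).
Qed.
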